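(* Let $\Gamma$ be a quiver with vertices $1,\dots,n$ and companion matrix $[a_{ij}]$, $\theta:\mathbb{Z}^n\to\mathbb{Z}$ a stability function, $\mu\in\mathbb{Q}$, and let $q$ be a prime power. Then the following identities of formal power series in $X_1,\dots,X_n$ hold: $$\sum_{\alpha\in\Delta_\mu^+}M_\mu^{ss}(\alpha,q)X^\alpha=\prod_{d=1}^\infty\bigl(P_\mu(q^d,X_1^d,\dots,X_n^d)\bigr)^{\phi_d(q)},$$ $$\sum_{\alpha\in\Delta_\mu^+}M_\mu^{ss}(\alpha,q)X^\alpha=\prod_{\alpha\in\Delta_\mu^+\setminus\{0\}}(1-X^\alpha)^{-I_\mu^{ss}(\alpha,q)},$$ and, for every $\alpha\in\Delta_\mu^+\setminus\{0\}$ with $\bar\alpha=\gcd(\alpha_1,\dots,\alpha_n)$, $$I_\mu^{ss}(\alpha,q)=\sum_{d\,\mid\,\bar\alpha}\frac1d\sum_{r\,\mid\,d}\mathrm{moeb}\!\left(\frac dr\right)A_\mu^{ss}\!\left(\frac\alpha d,q^r\right),$$ $$A_\mu^{ss}(\alpha,q)=\sum_{d\,\mid\,\bar\alpha}\frac1d\sum_{r\,\mid\,d}\mathrm{moeb}(r)\,I_\mu^{ss}\!\left(\frac\alpha d,q^r\right).$$ Here $\phi_d(q)$ denotes the number of monic irreducible polynomials of degree $d$ in $\mathbb{F}_q[t]$, excluding $t$.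
   Context: Quivers and representations. The quiver $\Gamma$ with companion matrix $[a_{ij}]$ ($n\times n$, entries in $\mathbb{N}$) has vertices $1,\dots,n$ and $a_{ij}$ arrows from $i$ to $j$. A representation over a field $k$ assigns a finite-dimensional vector space $V_i$ to each vertex and a linear map $V_i\to V_j$ to each arrow $i\to j$; its dimension vector is $(\dim V_i)_i\in\mathbb{N}^n$. $\mathrm{Rep}(\alpha,k)=\bigoplus_{i\to j}\mathrm{Hom}(k^{\alpha_i},k^{\alpha_j})$. A representation over $\mathbb{F}_q$ is absolutely indecomposable if it stays indecomposable after extension of scalars to $\bar{\mathbb{F}}_q$. Stability. $\theta$ is additive; the slope of a nonzero representation with dimension vector $\alpha$ is $\theta(\alpha)/\mathrm{ht}(\alpha)$, $\mathrm{ht}(\alpha)=\sum_i\alpha_i$. A representation is semistable if every nonzero proper subrepresentation has slope at most its slope (the zero representation counts as semistable). $\Delta_\mu^+=\{\alpha\in\mathbb{N}^n:\theta(\alpha)=\mu\cdot\mathrm{ht}(\alpha)\}$. For $\alpha\in\Delta_\mu^+$, $\mathrm{R}_\mu^{ss}(\alpha,\mathbb{F}_q)$ is the set of semistable representations in $\mathrm{Rep}(\alpha,\mathbb{F}_q)$; for $\alpha\in\mathbb{N}^n\setminus\Delta_\mu^+$ it is empty; for $\alpha=0$ it has one element. Its cardinality is known (Reineke) to be a polynomial in $q$. For $\alpha\in\Delta_\mu^+$, $M_\mu^{ss}(\alpha,q)$, $I_\mu^{ss}(\alpha,q)$, $A_\mu^{ss}(\alpha,q)$ are the numbers of isomorphism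 classes of, respectively, semistable, indecomposable semistable, absolutely indecomposable semistable representations of $\Gamma$ over $\mathbb{F}_q$ with dimension vector $\alpha$ (so $M_\mu^{ss}(0,q)=1$). Partitions. $\mathcal{P}$ is the set of all partitions (including the empty one); $|\lambda|$ is the sum of the parts, $m_\lambda^{(k)}$ the number of parts equal to $k$, $\lambda'_i=\sum_{k\ge i}m_\lambda^{(k)}$. Put $$\langle\lambda,\nu\rangle=\sum_{i\ge1}\lambda_i'\nu_i',\qquad \langle\!\langle\lambda,\nu\rangle\!\rangle=\sum_{i\ge1}\lambda_i'\nu_i'-\sum_{i\ge1}m_\lambda^{(i)}m_\nu^{(i)},\qquad b_\lambda(q)=\prod_{i\ge1}\prod_{k=1}^{m_\lambda^{(i)}}(1-q^k).$$ For $\lambda_*=(\lambda^1,\dots,\lambda^n)\in\mathcal{P}^n$ put $\lambda_*^{(s)}=(m_{\lambda^1}^{(s)},\dots,m_{\lambda^n}^{(s)})$ and $X^{|\lambda_*|}=X_1^{|\lambda^1|}\cdots X_n^{|\lambda^n|}$; for $\alpha\in\mathbb{N}^n$, $X^\alpha=X_1^{\alpha_1}\cdots X_n^{\alpha_n}$. Generating function: $$P_\mu(q,X_1,\dots,X_n)=\sum_{\lambda_*\in\mathcal{P}^n}\frac{q^{\sum_{1\le i,j\le n}a_{ij}\langle\!\langle\lambda^i,\lambda^j\rangle\!\rangle}\prod_{s\ge1}|\mathrm{R}_\mu^{ss}(\lambda_*^{(s)},\mathbb{F}_q)|}{\prod_{1\le i\le n}q^{\langle\lambda^i,\lambda^i\rangle}b_{\lambda^i}(q^{-1})}X^{|\lambda_*|}\in\mathbb{Q}(q)[[X_1,\dots,X_n]],$$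 with constant term $1$. $\mathrm{moeb}$ is the classical Möbius function; sums over divisors run over positive divisors. *)

(* Defs.v *)
From HB Require Import structures.
From mathcomp Require Import all_boot all_order all_algebra all_field.
From mathcomp Require Import finmap boolp classical_sets functions cardinality.
From mathcomp Require Import fsbigop.

Set Implicit Arguments.
Unset Strict Implicit.
Unset Printing Implicit Defensive.

Import Order.TTheory GRing.Theory Num.Theory.
Local Open Scope ring_scope.

Notation dimv n := {ffun 'I_n -> nat}.

Definition ht n (alpha : dimv n) : nat := (\sum_(i < n) alpha i)%N.

Definition dgcd n (alpha : dimv n) : nat := \big[gcdn/0%N]_(i < n) alpha i.

Definition ddiv n (alpha : dimv n) (d : nat) : dimv n :=
  [ffun i => (alpha i %/ d)%N].

(** * Formal power series in X_1, ..., X_n *)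

(* A power series is the family of its coefficients; [mps] is kept distinct
   from the function type, whose canonical product is the pointwise one. *)
Definition mps (R : comNzRingType) (n : nat) : Type := dimv n -> R.
HB.instance Definition _ (R : comNzRingType) n :=
  GRing.Zmodule.copy (mps R n) (dimv n -> R).

Section PowerSeriesRing.
Variables (R : comNzRingType) (n : nat).
Implicit Types (f g h : mps R n) (alpha beta : dimv n).

Definition box N := {ffun 'I_n -> 'I_N.+1}.
Definition unbox N (b : box N) : dimv n := [ffun i => b i : nat].

(* All pairs of exponents of sum alpha have entries at most ht alpha. *)
Definition mps_mul f g : mps R n := fun alpha =>
  \sum_(bc : box (ht alpha) * box (ht alpha) |
        unbox bc.1 + unbox bc.2 == alpha) f (unbox bc.1) * g (unbox bc.2).

Definition mps_one : mps R n := fun alpha => (alpha == 0)%:R.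

Definition mkbox N alpha : box N := [ffun i => inord (alpha i)].

Lemma unbox_inj N : injective (@unbox N).
Proof.
move=> b c /ffunP e; apply/ffunP => i; apply: val_inj.
by have := e i; rewrite !ffunE.
Qed.

Lemma mkboxK N alpha : (forall i, alpha i <= N)%N -> unbox (mkbox N alpha) = alpha.
Proof. by move=> le; apply/ffunP => i; rewrite !ffunE inordK ?ltnS. Qed.

Lemma unboxK N (b : box N) : mkbox N (unbox b) = b.
Proof. by apply/ffunP => i; rewrite !ffunE inord_val. Qed.

Lemma leq_ht alpha i : (alpha i <= ht alpha)%N.
Proof. by rewrite /ht (bigD1 i) //= leq_addr. Qed.

Lemma leq_dimvDl alpha beta i : (alpha i <= (alpha + beta)%R i)%N.
Proof. by rewrite !ffunE leq_addr. Qed.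

(* Convolution sums may be computed with any large enough box. *)
Lemma sum_boxE N alpha (F : dimv n -> R) :
    (forall i, alpha i <= N)%N ->
    (forall beta, F beta != 0 -> forall i, (beta i <= alpha i)%N) ->
  \sum_(b : box N) F (unbox b) = \sum_(b : box (ht alpha)) F (unbox b).
Proof.
move=> leN supp.
rewrite (bigID (fun b => F (unbox b) == 0)) /= big1 => [|b /eqP//].
rewrite add0r [RHS](bigID (fun b => F (unbox b) == 0)) /= [X in _ = X + _]big1.
  rewrite add0r (reindex_onto (fun b : box (ht alpha) => mkbox N (unbox b))
    (fun b => mkbox (ht alpha) (unbox b))) /=; last first.
    move=> b nz; rewrite mkboxK ?unboxK // => i.
    exact: leq_trans (supp _ nz i) (leq_ht _ _).
  have e b : F (unbox (mkbox N (unbox b))) != 0 ->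
      mkbox (ht alpha) (unbox (mkbox N (unbox b))) = b ->
      unbox (mkbox N (unbox b)) = unbox b.
    move=> nz eb; rewrite -[in RHS]eb [RHS]mkboxK // => i.
    exact: leq_trans (supp _ nz i) (leq_ht _ _).
  apply: eq_big => [b|b]; last by move=> /andP[nz /eqP /e ->].
  apply/andP/idP => [[nz /eqP /(e _ nz) <-] //|nz].
  have -> : unbox (mkbox N (unbox b)) = unbox b.
    by apply: mkboxK => i; exact: leq_trans (supp _ nz i) (leN i).
  by rewrite nz unboxK eqxx.
by move=> b /eqP.
Qed.

Lemma mps_mulE N f g alpha : (forall i, alpha i <= N)%N ->
  mps_mul f g alpha = \sum_(b : box N) \sum_(c : box N)
    (if unbox b + unbox c == alpha then f (unbox b) * g (unbox c) else 0).
Proof.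
move=> leN; rewrite /mps_mul.
transitivity (\sum_(b : box (ht alpha)) \sum_(c : box (ht alpha))
    (if unbox b + unbox c == alpha then f (unbox b) * g (unbox c) else 0)).
  by rewrite pair_bigA [LHS]big_mkcond.
transitivity (\sum_(b : box (ht alpha)) \sum_(c : box N)
    (if unbox b + unbox c == alpha then f (unbox b) * g (unbox c) else 0)).
  apply: eq_bigr => b _; symmetry.
  apply: (@sum_boxE N alpha (fun c =>
    if unbox b + c == alpha then f (unbox b) * g c else 0)) => // c.
  case: ifP => [/eqP e _ i|_]; last by rewrite eqxx.
  by rewrite -[X in leq _ (fun_of_fin X i)]e addrC leq_dimvDl.
symmetry; apply: (@sum_boxE N alpha (fun b => \sum_(c : box N)
    if b + unbox c == alpha then f b * g (unbox c) else 0)) => // b.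
apply: contraNP => nle; apply/eqP; rewrite big1 // => c _; case: ifP => // /eqP e.
by case: nle => i; rewrite -[X in leq _ (fun_of_fin X i)]e leq_dimvDl.
Qed.

Lemma mps_mulC : commutative mps_mul.
Proof.
move=> f g; apply/funext => alpha.
rewrite !(@mps_mulE (ht alpha)) //; try exact: leq_ht.
rewrite exchange_big; apply: eq_bigr => b _; apply: eq_bigr => c _.
by rewrite addrC mulrC.
Qed.

Lemma mps_mulDl : left_distributive mps_mul +%R.
Proof.
move=> f g h; apply/funext => alpha.
etransitivity; last exact: big_split.
by apply: eq_bigr => bc _; exact: mulrDl.
Qed.

Lemma mps_mul1 : left_id mps_one mps_mul.
Proof.
move=> f; apply/funext => alpha; rewrite (@mps_mulE (ht alpha)) //; last exact: leq_ht.
have e0 : unbox (mkbox (ht alpha) 0) = 0 by apply: mkboxK => i; rewrite ffunE.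
have ea : unbox (mkbox (ht alpha) alpha) = alpha by apply: mkboxK; exact: leq_ht.
rewrite (bigD1 (mkbox _ 0)) //= [X in _ + X]big1 => [|b nb]; last first.
  apply: big1 => c _; rewrite /mps_one.
  suff /negPf -> : unbox b != 0 by rewrite mul0r if_same.
  by apply: contraNneq nb => b0; rewrite -b0 unboxK.
rewrite addr0 (bigD1 (mkbox _ alpha)) //= big1 => [|c nc]; last first.
  rewrite e0 add0r; case: ifP => // /eqP eca.
  by case/eqP: nc; apply: unbox_inj; rewrite ea.
by rewrite e0 ea add0r eqxx /mps_one eqxx mul1r addr0.
Qed.

Lemma mps_mulA : associative mps_mul.
Proof.
have key N f g h alpha : (forall i, alpha i <= N)%N -> mps_mul (mps_mul f g) h alpha =
  \sum_(b : box N) \sum_(c : box N) \sum_(d : box N)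
    (if unbox b + unbox c + unbox d == alpha
     then f (unbox b) * g (unbox c) * h (unbox d) else 0).
  move=> leN; rewrite (@mps_mulE N) //.
  transitivity (\sum_(e : box N) \sum_(d : box N)
    \sum_(b : box N) \sum_(c : box N)
    (if (unbox e == unbox b + unbox c) && (unbox b + unbox c + unbox d == alpha)
     then f (unbox b) * g (unbox c) * h (unbox d) else 0)).
    apply: eq_bigr => e _; apply: eq_bigr => d _; case: ifP => [/eqP ed|ne].
      rewrite (@mps_mulE N); last first.
        by move=> i; rewrite (leq_trans _ (leN i)) // -ed leq_dimvDl.
      rewrite mulr_suml; apply: eq_bigr => b _; rewrite mulr_suml.
      apply: eq_bigr => c _; rewrite eq_sym; case: eqP => [<-|]; last by rewrite mul0r.
      by rewrite ed eqxx.
    rewrite big1 // => b _; rewrite big1 // => c _.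
    by case: eqP => //= <-; rewrite ne.
  rewrite exchange_big /=.
  under eq_bigr do rewrite exchange_big /=.
  under eq_bigr do under eq_bigr do rewrite exchange_big /=.
  rewrite exchange_big /=; apply: eq_bigr => b _.
  rewrite exchange_big /=; apply: eq_bigr => c _; apply: eq_bigr => d _.
  case: eqP => [ed|ne]; last by rewrite big1 // => e _; rewrite andbF.
  have ebc : unbox (mkbox N (unbox b + unbox c)) = unbox b + unbox c.
    by apply: mkboxK => i; rewrite (leq_trans _ (leN i)) // -ed leq_dimvDl.
  rewrite (bigD1 (mkbox _ (unbox b + unbox c))) //= ebc eqxx big1 ?addr0 // => e ne.
  by rewrite andbT; case: eqP => // ee; case/eqP: ne; rewrite -ee unboxK.
move=> f g h; apply/funext => alpha; rewrite mps_mulC.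
rewrite !(key (ht alpha)); try exact: leq_ht.
rewrite exchange_big /=; under eq_bigr do rewrite exchange_big /=.
rewrite exchange_big /=; apply: eq_bigr => b _.
rewrite exchange_big /=; apply: eq_bigr => c _; apply: eq_bigr => d _.
rewrite [unbox c + _ + _]addrC addrA; case: ifP => // _.
by rewrite [LHS]mulrC mulrA.
Qed.

Lemma mps_one_neq0 : mps_one != 0.
Proof.
by apply/eqP => /(congr1 (@^~ 0)) /eqP; rewrite /mps_one eqxx oner_eq0.
Qed.

HB.instance Definition _ := GRing.Zmodule_isComNzRing.Build (mps R n)
  mps_mulA mps_mulC mps_mul1 mps_mulDl mps_one_neq0.

Definition mps_unit : {pred mps R n} := fun f => `[< exists g, g * f = 1 >].

Definition mps_inv f : mps R n := xget f [set g | g * f = 1].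

Lemma mps_mulVf : {in mps_unit, left_inverse 1 mps_inv *%R}.
Proof.
by move=> f /asboolP ex; rewrite /mps_inv; case: xgetP => [g _ //|no]; case: ex => g /no.
Qed.

Lemma mps_unitP f g : g * f = 1 -> mps_unit f.
Proof. by move=> e; apply/asboolP; exists g. Qed.

Lemma mps_inv_out : {in [predC mps_unit], mps_inv =1 id}.
Proof.
move=> f /asboolPn no; rewrite /mps_inv; case: xgetP => [g _ e|//].
by case: no; exists g.
Qed.

HB.instance Definition _ := GRing.ComNzRing_hasMulInverse.Build (mps R n)
  mps_mulVf mps_unitP mps_inv_out.

(* The monomial X^alpha. *)
Definition mps_mon alpha : mps R n := fun beta => (beta == alpha)%:R.

Lemma coef_mps_monM alpha f gamma : (mps_mon alpha * f) (alpha + gamma) = f gamma.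
Proof.
pose N := ht (alpha + gamma); have leN : forall i, ((alpha + gamma)%R i <= N)%N.
  exact: leq_ht.
rewrite [LHS](@mps_mulE N) //.
have ea : unbox (mkbox N alpha) = alpha.
  by apply: mkboxK => i; apply: leq_trans (leN i); rewrite !ffunE leq_addr.
have ec : unbox (mkbox N gamma) = gamma.
  by apply: mkboxK => i; apply: leq_trans (leN i); rewrite !ffunE leq_addl.
rewrite (bigD1 (mkbox N alpha)) //= [X in _ + X]big1 => [|b nb]; last first.
  apply: big1 => c _; rewrite /mps_mon.
  have [eb|_] := eqVneq (unbox b) alpha; last by rewrite mul0r if_same.
  by case/eqP: nb; apply: unbox_inj; rewrite ea.
rewrite addr0 (bigD1 (mkbox N gamma)) //= big1 => [|c nc]; last first.
  rewrite ea; case: eqP => // e; case/eqP: nc; apply: unbox_inj; rewrite ec.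
  by apply/ffunP => i; have /ffunP/(_ i) := e; rewrite !ffunE => /addnI.
by rewrite ea ec eqxx /mps_mon eqxx mul1r addr0.
Qed.

Lemma coef_mps_monM_out alpha f beta :
  (forall gamma, beta <> alpha + gamma) -> (mps_mon alpha * f) beta = 0.
Proof.
move=> no; rewrite [LHS]/(mps_mul _ _ _) /mps_mul big1 // => -[b c] /eqP /= e.
rewrite /mps_mon; have [eb|_] := eqVneq (unbox b) alpha; last by rewrite mul0r.
by case: (no (unbox c)); rewrite -eb; exact: esym e.
Qed.

Lemma unit_1subX alpha : alpha != 0 -> 1 - mps_mon alpha \is a GRing.unit.
Proof.
move=> nz; apply/asboolP.
pose g : mps R n := fun beta => `[< exists k, beta = alpha *+ k >]%:R.
exists g; rewrite mulrC mulrBl mul1r; apply/funext => beta.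
transitivity (g beta - (mps_mon alpha * g) beta); first by [].
rewrite [RHS]/(mps_one beta) /mps_one.
have [[gamma ->]|/forallNP no] := pselect (exists gamma, beta = alpha + gamma).
  rewrite coef_mps_monM; have -> : g (alpha + gamma) = g gamma.
    rewrite /g; congr (_%:R); congr nat_of_bool; apply/asboolP/asboolP => -[k e].
      case: k e => [|k] e; last by exists k; move: e; rewrite mulrS => /ffunP e;
        apply/ffunP => i; have := e i; rewrite !ffunE => /addnI.
      have /ffunP e0 := e; exfalso; case/eqP: nz; apply/ffunP => i.
      by have /eqP := e0 i; rewrite mulr0n !ffunE addn_eq0 => /andP[/eqP].
    by exists k.+1; rewrite e mulrS.
  rewrite subrr; case: eqP => // /ffunP e0; case/eqP: nz; apply/ffunP => i.
  by have /eqP := e0 i; rewrite !ffunE addn_eq0 => /andP[/eqP].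
rewrite coef_mps_monM_out // subr0 /g; congr (_%:R); congr nat_of_bool.
apply/asboolP/eqP => [[[|k] //]|->]; last by exists 0%N.
by rewrite mulrS => /no.
Qed.

(* The substitution X_i |-> X_i ^ d, for d > 0. *)
Definition mps_subst_exp (d : nat) f : mps R n := fun beta =>
  if [forall i, d %| beta i]%N then f (ddiv beta d) else 0.

(* s is the infinite product of the f i with P i: every coefficient of the
   finite subproducts is eventually equal to that of s, along finite sets of
   indices ordered by inclusion. *)
Definition has_prod (I : choiceType) (P : pred I) (F : I -> mps R n)
    (s : mps R n) : Prop :=
  forall beta, exists J : {fset I}, forall J' : {fset I}, (J `<=` J')%fset ->
    (\prod_(i <- J' | P i) F i) beta = s beta.

End PowerSeriesRing.

Arguments mps_mon R {n} alpha.

(** * Partitions *)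

Record partition := Partition {
  parts :> seq nat;
  _ : sorted geq parts && (0%N \notin parts)
}.
HB.instance Definition _ := [isSub for parts].
HB.instance Definition _ := [Choice of partition by <:].

Definition psize (lam : partition) : nat := sumn lam.

Definition pmult (lam : partition) (k : nat) : nat := count_mem k lam.

(* All sums and products over i >= 1 below are cut at a bound beyond which the
   terms are 0, resp. 1: a part of lam is at most psize lam. *)
Definition pconj (lam : partition) (i : nat) : nat :=
  (\sum_(i <= k < (psize lam).+1) pmult lam k)%N.

Definition pform (lam nu : partition) : nat :=
  (\sum_(1 <= i < (psize lam).+1) pconj lam i * pconj nu i)%N.

Definition pform' (lam nu : partition) : int :=
  (pform lam nu)%:Z
    - (\sum_(1 <= i < (psize lam).+1) pmult lam i * pmult nu i)%N%:Z.

Definition pb (lam : partition) (q : rat) : rat :=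
  \prod_(1 <= i < (psize lam).+1) \prod_(1 <= k < (pmult lam i).+1) (1 - q ^+ k).

(** * Representations of quivers *)

Section Quiver.
Variables (n : nat) (a : 'M[nat]_n).
Implicit Types alpha : dimv n.

(* There are a i j arrows from i to j. *)
Definition arrow := {ij : 'I_n * 'I_n & 'I_(a ij.1 ij.2)}.
Definition src (e : arrow) : 'I_n := (tag e).1.
Definition tgt (e : arrow) : 'I_n := (tag e).2.

(* Matrices act on row vectors: the arrow e maps v to v *m V e. *)
Definition Rep alpha (k : fieldType) :=
  {dffun forall e : arrow, 'M[k]_(alpha (src e), alpha (tgt e))}.

Section Field.
Variables (alpha : dimv n) (k : fieldType).
Implicit Types V W : Rep alpha k.

Definition iso V W : Prop :=
  exists g : forall i, 'M[k]_(alpha i),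
    (forall i, g i \in unitmx) /\
    (forall e, V e *m g (tgt e) = g (src e) *m W e).

Definition subspaces := forall i, {vspace 'rV[k]_(alpha i)}.

Definition subrep V (U : subspaces) : Prop :=
  forall e v, v \in U (src e) -> v *m V e \in U (tgt e).

Definition subdim (U : subspaces) : dimv n := [ffun i => \dim (U i)].

Definition indecomposable V : Prop :=
  alpha <> 0 /\
  forall U W : subspaces, subrep V U -> subrep V W ->
    (forall i, (U i + W i)%VS = fullv /\ (U i :&: W i)%VS = 0%VS) ->
    (forall i, U i = 0%VS) \/ (forall i, W i = 0%VS).

End Field.

Definition base_change alpha (k l : fieldType) (f : {rmorphism k -> l})
    (V : Rep alpha k) : Rep alpha l :=
  [ffun e : arrow => map_mx f (V e) : 'M[l]_(alpha (src e), alpha (tgt e))].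

Definition alg_closure (F : finFieldType) : closedFieldType :=
  tag (countable_algebraic_closure F).
Definition to_alg_closure (F : finFieldType) : {rmorphism F -> alg_closure F} :=
  sval (tagged (countable_algebraic_closure F)).

Lemma to_alg_closure_integral (F : finFieldType) :
  integralRange (to_alg_closure F).
Proof. exact: (svalP (tagged (countable_algebraic_closure F))). Qed.

Definition abs_indecomposable alpha (F : finFieldType) (V : Rep alpha F) : Prop :=
  indecomposable (base_change (to_alg_closure F) V).

Variables (theta : {additive {ffun 'I_n -> int} -> int}) (mu : rat).

Definition thetad alpha : int := theta [ffun i => (alpha i)%:Z].

Definition slope alpha : rat := (thetad alpha)%:~R / (ht alpha)%:R.

Definition Delta alpha : bool := (thetad alpha)%:~R == mu * (ht alpha)%:R.

Definition semistable alpha (k : fieldType) (V : Rep alpha k) : Prop :=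
  forall U : subspaces alpha k, subrep V U ->
    (exists i, U i <> 0%VS) -> (exists i, U i <> fullv) ->
    slope (subdim U) <= slope alpha.

Section Counting.
Variable F : finFieldType.

Definition Rss alpha : {set Rep alpha F} :=
  if Delta alpha then finset (fun V => `[< semistable V >]) else finset.set0.

Definition nclasses alpha (P : Rep alpha F -> Prop) : nat :=
  #|equivalence_partition (fun V W => `[< iso V W >]) (finset (fun V => `[< P V >]))|.

Definition Mss alpha : nat := nclasses (@semistable alpha F).

Definition Iss alpha : nat :=
  nclasses (fun V : Rep alpha F => semistable V /\ indecomposable V).

Definition Ass alpha : nat :=
  nclasses (fun V : Rep alpha F => semistable V /\ abs_indecomposable V).

(* Monic irreducible polynomials of degree d over F, other than 'X. *)
Definition phi (d : nat) : nat :=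
  #|finset (fun p : {poly_d.+1 F} => [&& val p \is monic, size p == d.+1,
      val p != 'X & `[< irreducible_poly p >]])|.

Definition tuple_size (lam : {ffun 'I_n -> partition}) : dimv n :=
  [ffun i => psize (lam i)].

Definition tuple_mult (lam : {ffun 'I_n -> partition}) (s : nat) : dimv n :=
  [ffun i => pmult (lam i) s].

(* The value at q = #|F| of a coefficient in Q(q); replacing q by q ^ d there
   amounts to taking a field with #|F| ^ d elements, the cardinality of
   [Rss alpha] being given by a polynomial in #|F|. *)
Definition Pterm (lam : {ffun 'I_n -> partition}) : rat :=
  let q : rat := #|F|%:R in
  q ^ (\sum_(i < n) \sum_(j < n) (a i j)%:Z * pform' (lam i) (lam j))
  * (\prod_(1 <= s < (\sum_(i < n) psize (lam i))%N.+1) #|Rss (tuple_mult lam s)|%:R)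
  / (\prod_(i < n) (q ^+ pform (lam i) (lam i) * pb (lam i) q^-1)).

(* Finitely many tuples contribute to each coefficient. *)
Definition Pmu : mps rat n := fun beta =>
  \sum_(lam \in [set lam : {ffun 'I_n -> partition} | tuple_size lam = beta])
    Pterm lam.

Definition Mseries : mps rat n := fun alpha =>
  if Delta alpha then (Mss alpha)%:R else 0.

End Counting.
End Quiver.

(* The classical Moebius function, for m > 0. *)
Definition moeb (m : nat) : rat :=
  if all (fun p => logn p m == 1%N) (primes m) then (-1) ^+ size (primes m) else 0.

(* Main.v *)
(* A representation is encoded as a family of square matrices on one space, with
   idempotents for the vertices, so that only matrices occur.

   Second identity: semistables of slope mu are closed under sums and summands,
   and an indecomposable over a finite field is cancellable and prime for direct
   sums; adding one indecomposable V to the list of allowed summands multiplies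
   the series by (1 - X^dim V)^-1.

   Last two: End V modulo its radical is, by Wedderburn, generated by a root of
   an irreducible polynomial h, and over K the representation V splits into
   pieces attached to the roots of h in K, conjugate under Frobenius. Hence
   A(alpha, q^r) = sum_(d | r) d * I_d(d alpha, q), where I_d counts the
   indecomposables with deg h = d, and Moebius inversion applies.

   First identity: by Burnside M(alpha) counts pairs (X, g) with g an
   automorphism of X, divided by the order of GL. Splitting g into its primary
   parts turns the series into a product over monic irreducibles f != t, and
   restriction of scalars identifies the factor of f, of degree d, with the
   series of pairs (X, N) with N nilpotent over the field with q^d elements,
   taken at X^d. For N in Jordan form with image W, a representation X commuting
   with N is semistable iff its restriction to W and the subrepresentation
   ker N / (ker N meet W) of X / W are, and induction gives P_mu. *)

Require Import Defs.
From HB Require Import structures.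
From mathcomp Require Import all_boot all_order all_algebra all_field.
From mathcomp Require Import fingroup solvable.cyclic.
From mathcomp Require Import finmap boolp classical_sets functions cardinality.
From mathcomp Require Import fsbigop.
From mathcomp Require Import zify ring lra.

Set Implicit Arguments.
Unset Strict Implicit.
Unset Printing Implicit Defensive.

Import Order.TTheory GRing.Theory Num.Theory.
Local Open Scope ring_scope.
Local Notation dvec n := {ffun 'I_n -> nat}.

(** * Finite fields and Frobenius *)

(** The fields [GF r] are known only through their cardinalities, so every comparison of two fields
    goes through some embedding, built from roots of minimal polynomials. Absolute indecomposability
    is replaced by [split_end] (endomorphisms are scalars plus nilpotents), which is tested over the
    field itself; the algebraic closure enters only to show that the two agree. The obstacle is then
    to follow the radical of an endomorphism ring through a field extension. It is traced by a flag
    of subspaces, since lowering a flag is a linear condition that survives base change and implies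
    nilpotency. Semistability survives base change and restriction of scalars because a maximal
    destabilizing subspace is unique, hence invariant under Frobenius, respectively under
    multiplication by a scalar. Square matrices on one space have a second benefit: a representation
    with an endomorphism is a family with one more index, so isomorphism, summands and restriction
    of scalars apply to pairs unchanged. No infinite product is formed: the coefficient at [beta]
    only sees dimension vectors below [beta], respectively irreducible polynomials of degree at most
    [ht beta]. *)

Section MinimalRoot.
Variables (A B : fieldType) (f : {rmorphism A -> B}) (g : B).

(** Up to a scalar [h] is the minimal polynomial of [g]: it has least size among the nonzero
    polynomials with root [g], and a nonzero remainder modulo [h] would be smaller. *)
Lemma min_root_poly (P : {poly A}) : P != 0 -> root (map_poly f P) g ->
  exists2 h : {poly A}, (1 < size h)%N &
    forall Q : {poly A}, root (map_poly f Q) g = (h %| Q).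
Proof.
move=> nzP rP.
pose pr n := `[< exists2 h : {poly A}, h != 0 & size h = n /\ root (map_poly f h) g >].
have exn : exists n, pr n by exists (size P); apply/asboolP; exists P.
case: (ex_minnP exn) => n /asboolP[h nzh [szh rh]] minn.
exists h.
  rewrite ltnNge; apply/negP => /size1_polyC hC; move: rh nzh; rewrite hC map_polyC rootC.
  by rewrite fmorph_eq0 => /eqP ->; rewrite polyC0 eqxx.
move=> Q; apply/idP/idP => [rQ|/dvdpP[u ->]]; last first.
  by rewrite rmorphM rootM /= rh orbT.
rewrite /dvdp; apply: contraTT isT => nzr.
have: (n <= size (Q %% h)%R)%N.
  apply: minn; apply/asboolP; exists (Q %% h) => //; split => //.
  move: rQ; rewrite {1}(divp_eq Q h) rmorphD rmorphM /= /root hornerD hornerM.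
  by rewrite (rootP rh) mulr0 add0r.
by rewrite -szh leqNgt ltn_modpN0.
Qed.

End MinimalRoot.

Section FiniteFields.

Lemma finfield_gen (F : finFieldType) :
  exists2 g : F, g != 0 & forall x : F, x != 0 -> exists i, x = g ^+ i.
Proof.
have /cyclicP[u defU] := field_unit_group_cyclic [set: {unit F}]%G.
exists (val u) => [|x nz]; first by rewrite -unitfE (valP u).
have ux : x \is a GRing.unit by rewrite unitfE.
have : FinRing.unit F ux \in [set: {unit F}]%g by rewrite inE.
rewrite defU => /cycleP[i /(congr1 val)/= e]; exists i; rewrite e.
by rewrite FinRing.val_unitX.
Qed.

Lemma finfield_card (F : finFieldType) :
  exists p e, [/\ prime p, p \in [pchar F], (0 < e)%N & #|F| = (p ^ e)%N].
Proof.
have [p pr_p ch] := finPcharP F.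
have cF := card_pprimeChar ch.
exists p, (logn p #|F|); split => //.
rewrite lt0n; apply: contraTneq (finNzRing_gt1 F) => e0.
by rewrite cF e0 expn0.
Qed.

(** X^|K| - X is a product of distinct linear factors over [K], so a divisor is, up to a unit, the
    product of some of them. *)
Lemma root_finfield (K : finFieldType) (h : {poly K}) :
  (1 < size h)%N -> h %| 'X^#|K| - 'X -> exists z, root h z.
Proof.
rewrite finField_genPoly => sz /dvdp_prod_XsubC[m eh].
have : (1 < size (\prod_(i <- mask m (index_enum K)) ('X - i%:P))%R)%N.
  by rewrite -(eqp_size eh).
rewrite size_prod_XsubC => sm.
case em : (mask m (index_enum K)) sm => [//|z s] _; exists z.
by rewrite (eqp_root eh) em root_prod_XsubC inE eqxx.
Qed.

Lemma dvdp_XcardB (R : fieldType) (a r : nat) :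
  ('X^a - 'X : {poly R}) %| ('X^(a ^ r) - 'X).
Proof.
elim: r => [|r IH]; first by rewrite expn0 expr1 subrr dvdp0.
case: a IH => [|a] IH; first by rewrite exp0n // expr0.
have -> : 'X^(a.+1 ^ r.+1) - 'X = ('X^(a.+1 ^ r.+1) - 'X^(a.+1)) + ('X^(a.+1) - 'X) :> {poly R}.
  by rewrite addrA subrK.
rewrite dvdp_addr //.
rewrite expnSr exprM subrXX dvdp_mulr //.
Qed.

(** Take a generator [g] of the multiplicative group of [F] and its minimal polynomial [h] over the
    prime field. Since [h] divides X^|F| - X, which divides X^|K| - X, it has a root [z] in [K]; the
    morphism sends [P(g)] to [P(z)], which is well defined because [P(g) = 0] forces [h] to divide
    [P]. *)
Lemma finfield_embed (F K : finFieldType) (r : nat) :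
  #|K| = (#|F| ^ r)%N -> (0 < r)%N -> inhabited {rmorphism F -> K}.
Proof.
move=> cK r0; have [p [e [pr_p chF e0 cF]]] := finfield_card F.
have chK : p \in [pchar K].
  by apply: (@card_finPcharP _ _ (e * r)) => //; rewrite cK cF expnM.
pose cFf := GRing.in_alg (pPrimeCharType chF).
pose cKf := GRing.in_alg (pPrimeCharType chK).
have [g _ gP] := finfield_gen F.
have X0 : 'X^#|F| - 'X != 0 :> {poly 'F_p}.
  apply/eqP => /(congr1 (fun P : {poly _} => P`_1)); rewrite coefB coefXn coefX coef0.
  rewrite eqxx ltn_eqF ?finNzRing_gt1 // sub0r => /eqP.
  by rewrite oppr_eq0 oner_eq0.
have rX : root (map_poly cFf ('X^#|F| - 'X)) g.
  by rewrite rmorphB /= map_polyXn map_polyX /root !hornerE expf_card subrr.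
have [h sh hP] := min_root_poly X0 rX.
have [z rz] : exists z, root (map_poly cKf h) z.
  apply: root_finfield; first by rewrite size_map_poly.
  rewrite cK; apply: dvdp_trans (dvdp_XcardB _ _ r).
  have : h %| 'X^#|F| - 'X by rewrite -hP.
  by rewrite -(dvdp_map cKf) rmorphB /= map_polyXn map_polyX.
pose evF P := (map_poly cFf P).[g : pPrimeCharType chF].
pose evK P := (map_poly cKf P).[z : pPrimeCharType chK].
have ev0 P : evF P = 0 -> evK P = 0.
  move/eqP; rewrite -[_ == 0]/(root _ _) hP => /dvdpP[u ->].
  by rewrite /evK rmorphM /= hornerM (rootP rz) mulr0.
have ex x : exists P, evF P == x.
  have [->|/gP[i ->]] := eqVneq x 0; first by exists 0; rewrite /evF rmorph0 horner0.
  by exists 'X^i; rewrite /evF map_polyXn hornerXn.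
pose P x := xchoose (ex x); have PE x : evF (P x) = x by apply/eqP/(xchooseP (ex x)).
pose f x : K := evK (P x).
have evFB : {morph evF : a b / a - b} by move=> a b; rewrite /evF rmorphB /= hornerD hornerN.
have evKB : {morph evK : a b / a - b} by move=> a b; rewrite /evK rmorphB /= hornerD hornerN.
have fE a : evK a = f (evF a).
  apply/eqP; rewrite -subr_eq0 -evKB; apply/eqP/ev0; rewrite evFB PE subrr //.
have fB : zmod_morphism f.
  by move=> x y; rewrite -{1}(PE x) -{1}(PE y) -evFB -fE evKB.
have fM : monoid_morphism f.
  split=> [|x y].
    have -> : 1 = evF 1 by rewrite /evF rmorph1 hornerC.
    by rewrite -fE /evK rmorph1 hornerC.
  rewrite -{1}(PE x) -{1}(PE y).
  have -> : evF (P x) * evF (P y) = evF (P x * P y) by rewrite /evF rmorphM /= hornerM.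
  by rewrite -fE /evK rmorphM /= hornerM.
pose m1 := GRing.isZmodMorphism.Build F K f fB.
pose m2 := GRing.isMonoidMorphism.Build F K f fM.
pose ff : {rmorphism F -> K} := HB.pack f m1 m2.
by constructor.
Qed.

End FiniteFields.

(* Additivity needs F and K to have the same characteristic, hence the
   embedding in the arguments. *)
Definition frob (F K : finFieldType) (iota : {rmorphism F -> K}) (x : K) : K :=
  x ^+ #|F|.

Section Frobenius.
Variables (F K : finFieldType) (iota : {rmorphism F -> K}).
Local Notation frob := (frob iota).

Lemma frob_additive : zmod_morphism frob.
Proof.
have [p [e [pr_p ch e0 cF]]] := finfield_card F.
have chK : p \in [pchar K] by rewrite (fmorph_pchar iota).
move=> x y; rewrite /frob cF; elim: e {e0 cF} => [|e IH]; first by rewrite expn0 !expr1.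
rewrite expnSr !exprM IH -!(pFrobenius_autE chK).
by rewrite rmorphB.
Qed.

Lemma frob_multiplicative : monoid_morphism frob.
Proof. by split=> [|x y]; rewrite /frob ?expr1n ?exprMn. Qed.

HB.instance Definition _ := GRing.isZmodMorphism.Build K K frob frob_additive.
HB.instance Definition _ := GRing.isMonoidMorphism.Build K K frob frob_multiplicative.

Lemma frob_iota x : frob (iota x) = iota x.
Proof. by rewrite /frob -rmorphXn /= expf_card. Qed.

(** X^|F| - X already has all elements of [F] as roots, so its image over [K] has no roots outside
    [iota F]. *)
Lemma frob_fixed x : frob x = x -> exists y, x = iota y.
Proof.
move=> fx; have : root (map_poly iota ('X^#|F| - 'X)) x.
  by rewrite rmorphB /= map_polyXn map_polyX /root !hornerE -/(frob x) fx subrr.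
rewrite finField_genPoly rmorph_prod /= => rx.
have : root (\prod_(y <- [seq iota y | y <- index_enum F]) ('X - y%:P)) x.
  rewrite big_map; move: rx; congr (root _ x).
  by apply: eq_bigr => y _; rewrite rmorphB /= map_polyX map_polyC.
rewrite root_prod_XsubC => /mapP[y _ ->]; by exists y.
Qed.

Lemma frob_fixed_mx m p (A : 'M[K]_(m, p)) :
  map_mx frob A = A -> exists B, A = map_mx iota B.
Proof.
move=> fA; have ex i j : exists y, A i j == iota y.
  have [|y ->] := @frob_fixed (A i j); last by exists y.
  by move/matrixP: fA => /(_ i j); rewrite mxE.
exists (\matrix_(i, j) xchoose (ex i j)); apply/matrixP => i j.
by rewrite !mxE; apply/eqP/(xchooseP (ex i j)).
Qed.

Lemma frob_fixed_poly (P : {poly K}) :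
  map_poly frob P = P -> exists Q, P = map_poly iota Q.
Proof.
move=> fP; have ex i : exists y, P`_i == iota y.
  have [|y ->] := @frob_fixed P`_i; last by exists y.
  by rewrite -coef_map fP.
exists (\poly_(i < size P) xchoose (ex i)); apply/polyP => i.
rewrite coef_map coef_poly; case: ltnP => [_|/leq_sizeP/(_ i)->] //=.
  by apply/eqP/(xchooseP (ex i)).
by rewrite rmorph0.
Qed.

Lemma frob_map_poly_iota (Q : {poly F}) :
  map_poly frob (map_poly iota Q) = map_poly iota Q.
Proof. by rewrite -map_poly_comp; apply: eq_map_poly => x /=; rewrite frob_iota. Qed.

Lemma frob_map_mx_iota m p (A : 'M[F]_(m, p)) :
  map_mx frob (map_mx iota A) = map_mx iota A.
Proof. by apply/matrixP => i j; rewrite !mxE frob_iota. Qed.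

Lemma frob_inj : injective frob. Proof. exact: fmorph_inj. Qed.

Lemma iter_frob j x : iter j frob x = x ^+ (#|F| ^ j)%N.
Proof.
elim: j => [|j IH]; first by rewrite expn0 expr1.
by rewrite iterS IH expnSr exprM.
Qed.

Variable r : nat.
Hypothesis cardK : #|K| = (#|F| ^ r)%N.

Lemma iter_frob_card x : iter r frob x = x.
Proof. by rewrite iter_frob -cardK expf_card. Qed.

Section Irreducible.
Variables (h : {poly F}) (d : nat).
Hypotheses (hirr : irreducible_poly h) (hmon : h \is monic) (hsz : size h = d.+1).

Lemma irr_root_frob z : root (map_poly iota h) z -> root (map_poly iota h) (frob z).
Proof.
by move=> rz; rewrite -frob_map_poly_iota /root horner_map /= (rootP rz) rmorph0.
Qed.

(** The product [M] over the Frobenius orbit of [z] has Frobenius-fixed coefficients, so it comes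
    from a polynomial over [F]; this divides [h] and equals it by irreducibility. The orbit thus has
    length [d], and [d] divides [r] because the [r]-th iterate of Frobenius is the identity on
    [K]. *)
Lemma irr_roots z : root (map_poly iota h) z ->
  [/\ (d %| r)%N, uniq (traject frob z d) &
      map_poly iota h = \prod_(x <- traject frob z d) ('X - x%:P)].
Proof.
move=> rz.
set e := fingraph.order frob z.
have itz : iter e frob z = z by rewrite fingraph.iter_order //; exact: frob_inj.
have ut : uniq (traject frob z e) by apply: fingraph.orbit_uniq.
set M := \prod_(x <- traject frob z e) ('X - x%:P).
have ML : M %| map_poly iota h.
  apply: uniq_roots_dvdp; last by rewrite uniq_rootsE.
  apply/allP => x /trajectP[i _ ->]; elim: i => [//|i IH]; rewrite iterS.
  exact: irr_root_frob.
have [M0 defM] : exists Q, M = map_poly iota Q.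
  apply: frob_fixed_poly; rewrite /M rmorph_prod /=.
  under eq_bigr do rewrite rmorphB /= map_polyX map_polyC.
  rewrite -(big_map frob predT (fun x => 'X - x%:P)).
  apply: perm_big; have [e0|e0] := posnP e; first by rewrite e0.
  (* Frobenius permutes the orbit cyclically: applying it rotates the trajectory by one place. *)
  have -> : [seq frob x | x <- traject frob z e] = rot 1 (traject frob z e).
    rewrite -[e in LHS]prednK // -[e in RHS]prednK //= rot1_cons.
    rewrite -[in RHS]cats1.
    have -> : [:: z] = [:: iter e.-1 frob (frob z)] by rewrite -iterSr prednK // itz.
    rewrite cats1 -trajectSr.
    elim: (e.-1) (z) => [|n IH] y //=.
    by rewrite IH.
  by rewrite perm_sym perm_sym perm_rot.
have szM : size M = e.+1 by rewrite size_prod_XsubC size_traject.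
have e0 : (0 < e)%N by rewrite fingraph.order_gt0.
have eM : M %= map_poly iota h.
  rewrite defM eqp_map; apply: hirr.2; last by rewrite -(dvdp_map iota) -defM.
  by rewrite -(size_map_poly iota) -defM szM; lia.
have ed : e = d by have := eqp_size eM; rewrite szM size_map_poly hsz => -[].
have hM : map_poly iota h = M.
  apply/esym/eqP; rewrite -eqp_monic ?monic_map ?monic_prod_XsubC //.
split.
- rewrite -ed; have [/eqP//|lt0] := posnP (r %% e)%N.
  have : iter (r %% e) frob z = z.
    rewrite -[RHS]iter_frob_card {2}(divn_eq r e) addnC iterD; congr (iter _ _ _).
    by elim: (r %/ e)%N => [//|k IH]; rewrite mulSn iterD -IH itz.
  have lte : (r %% e < e)%N by rewrite ltn_mod.
  move=> /(congr1 (fun x => index x (traject frob z e))).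
  rewrite -(nth_traject frob lte) index_uniq ?size_traject //.
  have -> : index z (traject frob z e) = 0%N by case: (e) e0 => //= k _; rewrite eqxx.
  by move=> m0; rewrite m0 in lt0.
- by rewrite -ed.
- by rewrite hM /M ed.
Qed.

(** The quotient of the polynomial ring by [h] is a field with [#|F| ^ d] elements, so the class of
    ['X] is fixed by the corresponding power. *)
Lemma irr_dvd_XcardB : (h %| 'X^(#|F| ^ d) - 'X).
Proof.
have d0 : (0 < d)%N by have := hirr.1; rewrite hsz.
have mi : monic_irreducible_poly h by split.
pose L := {poly %/ h with mi}.
have cL : #|L| = (#|F| ^ d)%N by rewrite card_monic_qpoly ?hsz.
have := expf_card (in_qpoly h 'X : L).
rewrite cL => e.
have : in_qpoly h ('X ^+ (#|F| ^ d) - 'X) = 0.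
  rewrite rmorphB rmorphXn /=; apply/eqP; rewrite subr_eq0; apply/eqP; exact: e.
move/(congr1 val) => /=.
by rewrite /mk_monic hmon hsz /= ltnS d0 /= => h0; rewrite /dvdp Pdiv.IdomainMonic.modpE // h0.
Qed.


Lemma irr_root_exists : (d %| r)%N -> exists z, root (map_poly iota h) z.
Proof.
move=> dr; apply: root_finfield; first by rewrite size_map_poly; exact: hirr.1.
rewrite cardK -(divnK dr) mulnC expnM; apply: dvdp_trans (dvdp_XcardB _ _ _).
have := irr_dvd_XcardB.
by rewrite -(dvdp_map iota) rmorphB /= map_polyXn map_polyX.
Qed.

End Irreducible.

(** For [om] a generator of the multiplicative group of [K] and [f] its minimal polynomial, of
    degree [d], the [d]-th iterate of Frobenius fixes [om], hence all its powers, hence [K]. So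
    X^(|F|^d) - X has |F|^r roots, which gives [r <= d]; the reverse inequality comes from
    [irr_roots]. *)
Lemma primitive_poly_exists : (0 < r)%N -> exists (f : {poly F}) (om : K),
  [/\ irreducible_poly f, f \is monic, size f = r.+1, root (map_poly iota f) om & om != 0].
Proof.
move=> r0; have [g g0 gP] := finfield_gen K.
have X0 : 'X^#|K| - 'X != 0 :> {poly F}.
  rewrite -lead_coef_eq0 lead_coefDl ?lead_coefXn ?oner_eq0 //.
  by rewrite size_polyXn size_polyN size_polyX ltnS finNzRing_gt1.
have rX : root (map_poly iota ('X^#|K| - 'X)) g.
  by rewrite rmorphB /= map_polyXn map_polyX /root !hornerE expf_card subrr.
have [h sh hP] := min_root_poly X0 rX.
have h0 : h != 0 by rewrite -size_poly_eq0 -lt0n ltnW.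
pose f := (lead_coef h)^-1 *: h.
have lc : (lead_coef h)^-1 != 0 by rewrite invr_eq0 lead_coef_eq0.
have szf : size f = size h by rewrite size_scale.
have fm : f \is monic by rewrite monicE lead_coefZ mulVf ?lead_coef_eq0.
have rh : root (map_poly iota h) g by rewrite hP.
have rf : root (map_poly iota f) g by rewrite map_polyZ rootZ // fmorph_eq0.
have fi : irreducible_poly f.
  split; first by rewrite szf.
  move=> q sq qf; have [u fE] := dvdpP _ _ qf.
  have : root (map_poly iota u) g || root (map_poly iota q) g by rewrite -rootM -rmorphM /= -fE.
  have f0 : f != 0 by rewrite -size_poly_eq0 szf -lt0n ltnW.
  have [u0 q0] : u != 0 /\ q != 0 by move: f0; rewrite fE mulf_eq0 negb_or => /andP.
  rewrite !hP => /orP[hu|hq].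
    have := dvdp_leq u0 hu; rewrite -szf fE size_mul //; move: sq.
    have : (0 < size u)%N by rewrite size_poly_gt0.
    have : (0 < size q)%N by rewrite size_poly_gt0.
    by move: (size u) (size q) => a b; clear; lia.
  rewrite -dvdp_size_eqp // eqn_leq dvdp_leq //= szf; exact: dvdp_leq.
have sf : size f = (size f).-1.+1 by rewrite szf prednK // ltnW.
have [dr ut fE] := irr_roots fi fm sf rf.
exists f, g; split=> //; rewrite sf; congr _.+1.
set d := (size f).-1 in dr ut fE *.
have d0 : (0 < d)%N by rewrite /d szf -ltnS prednK // ltnW.
apply/eqP; rewrite eqn_leq dvdn_leq //=.
have itd x : iter d frob x = x.
  have itg : iter d frob g = g.
    have : root (map_poly iota f) (iter d.-1 frob g).
      by rewrite fE root_prod_XsubC; apply/trajectP; exists d.-1 => //; rewrite prednK.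
    move/irr_root_frob; rewrite -iterS prednK // fE root_prod_XsubC => /trajectP[j jd e].
    have ej : iter j frob (iter (d - j) frob g) = iter j frob g by rewrite -iterD subnKC // ltnW.
    have inj_it i x' y' : iter i frob x' = iter i frob y' -> x' = y'.
      by elim: i => [//|i IH] /= /frob_inj.
    have {inj_it}ej : iter (d - j) frob g = g by exact: inj_it ej.
    have [j0|j0] := posnP j; first by move: ej; rewrite j0 subn0.
    have lt : (d - j < d)%N by rewrite ltn_subrL j0.
    have n0 : nth g (traject frob g d) 0 = g by rewrite -[d in traject _ _ d]prednK.
    have := nth_traject frob lt g; rewrite ej -[RHS]n0.
    move/eqP; rewrite nth_uniq ?size_traject // subn_eq0 leqNgt jd //.
  have [->|/gP[i ->]] := eqVneq x 0.
    by elim: d {dr ut fE d0 itg} => //= j ->; rewrite rmorph0.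
  by rewrite iter_frob -exprM mulnC exprM -iter_frob itg.
rewrite -(leq_exp2l _ _ (finNzRing_gt1 F)) -cardK.
have qd1 : (1 < #|F| ^ d)%N by rewrite (ltn_exp2l 0) ?finNzRing_gt1.
have nz : 'X^(#|F| ^ d) - 'X != 0 :> {poly K}.
  rewrite -lead_coef_eq0 lead_coefDl ?lead_coefXn ?oner_eq0 //.
  rewrite size_polyXn size_polyN size_polyX ltnS.
  exact: qd1.
have := @max_poly_roots _ _ (enum K) nz; rewrite -cardE enum_uniq.
have -> : size ('X^(#|F| ^ d) - 'X : {poly K}) = (#|F| ^ d).+1.
  rewrite size_polyDl ?size_polyXn // size_polyN size_polyX ltnS.
  exact: qd1.
rewrite ltnS; apply=> //; apply/allP => x _.
by rewrite /root !hornerE -iter_frob itd subrr.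
Qed.

End Frobenius.

(** * Families of matrices up to isomorphism, Krull-Schmidt *)

Section PolynomialOfMatrix.

(** Evaluation at a square matrix of any size, including 0, where the matrices do not form a nonzero
    ring; in positive size it is [horner_mx]. *)
Definition pmx (k : fieldType) m (g : 'M[k]_m) (p : {poly k}) : 'M[k]_m :=
  \sum_(i < size p) p`_i *: (g ^+ i).

Lemma pmxE (k : fieldType) m (g : 'M[k]_m.+1) p : pmx g p = horner_mx g p.
Proof.
rewrite /pmx -[in RHS](coefK p) poly_def rmorph_sum /=.
apply: eq_bigr => i _.
by rewrite -mul_polyC rmorphM rmorphXn /= horner_mx_X horner_mx_C -mulmxE mul_scalar_mx.
Qed.

Variables (k : fieldType) (m : nat) (g : 'M[k]_m).
Implicit Types p q : {poly k}.

Lemma pmxD p q : pmx g (p + q) = pmx g p + pmx g q.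
Proof. by case: m g => [|n] h; [rewrite !thinmx0 | rewrite !pmxE rmorphD]. Qed.

Lemma pmxN p : pmx g (- p) = - pmx g p.
Proof. by case: m g => [|n] h; [rewrite !thinmx0 | rewrite !pmxE rmorphN]. Qed.

Lemma pmxB p q : pmx g (p - q) = pmx g p - pmx g q.
Proof. by rewrite pmxD pmxN. Qed.

Lemma pmxM p q : pmx g (p * q) = pmx g p *m pmx g q.
Proof. by case: m g => [|n] h; [rewrite !thinmx0 | rewrite !pmxE rmorphM]. Qed.

Lemma pmxXn p n : pmx g (p ^+ n) = pmx g p ^+ n.
Proof. by case: m g => [|n'] h; [rewrite !thinmx0 | rewrite !pmxE rmorphXn]. Qed.

Lemma pmxC c : pmx g c%:P = c%:M.
Proof. by case: m g => [|n] h; [rewrite !thinmx0 | rewrite !pmxE horner_mx_C]. Qed.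

Lemma pmxX : pmx g 'X = g.
Proof. by case: m g => [|n] h; [rewrite !thinmx0 | rewrite !pmxE horner_mx_X]. Qed.

Lemma pmx0 : pmx g 0 = 0.
Proof. by rewrite /pmx size_poly0 big_ord0. Qed.

Lemma pmx1 : pmx g 1 = 1%:M. Proof. exact: pmxC. Qed.

Lemma pmxZ c p : pmx g (c *: p) = c *: pmx g p.
Proof. by rewrite -mul_polyC pmxM pmxC mul_scalar_mx. Qed.

Lemma pmx_sum I (r : seq I) (P : pred I) (F : I -> {poly k}) :
  pmx g (\sum_(i <- r | P i) F i) = \sum_(i <- r | P i) pmx g (F i).
Proof. by apply: (big_morph (pmx g)); [exact: pmxD | exact: pmx0]. Qed.

Lemma pmxC2 p q : pmx g p *m pmx g q = pmx g q *m pmx g p.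
Proof. by rewrite -!pmxM mulrC. Qed.

Lemma pmx_dvd p q : p %| q -> pmx g p = 0 -> pmx g q = 0.
Proof. by case/dvdpP => u -> h; rewrite pmxM h mulmx0. Qed.

Lemma exp_intertwine n (g' : 'M[k]_n) (f : 'M[k]_(m, n)) j :
  g *m f = f *m g' -> g ^+ j *m f = f *m g' ^+ j.
Proof.
move=> e; elim: j => [|j IH]; first by rewrite !expr0 -[1]/(1%:M) mul1mx -[1]/(1%:M) mulmx1.
by rewrite exprSr -mulmxE -mulmxA e mulmxA IH -mulmxA mulmxE -exprSr.
Qed.

Lemma pmx_intertwine n (g' : 'M[k]_n) (f : 'M[k]_(m, n)) p :
  g *m f = f *m g' -> pmx g p *m f = f *m pmx g' p.
Proof.
move=> e; rewrite /pmx mulmx_suml mulmx_sumr; apply: eq_bigr => i _.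
by rewrite -scalemxAl -scalemxAr (exp_intertwine _ e).
Qed.

Lemma pmx_stable r (U : 'M[k]_(r, m)) p : (U *m g <= U)%MS -> (U *m pmx g p <= U)%MS.
Proof.
move=> st; rewrite /pmx mulmx_sumr; apply: summx_sub => i _.
rewrite -scalemxAr; apply: scalemx_sub; elim: (nat_of_ord i) => [|j IH].
  by rewrite expr0 -[1]/(1%:M) mulmx1.
by rewrite exprSr -mulmxE mulmxA; apply: submx_trans (submxMr _ IH) st.
Qed.

End PolynomialOfMatrix.

Lemma map_exp_mx (k l : fieldType) (f : {rmorphism k -> l}) m (g : 'M[k]_m) j :
  map_mx f (g ^+ j) = map_mx f g ^+ j.
Proof. by elim: j => [|j IH]; rewrite ?expr0 ?map_mx1 // !exprS -!mulmxE map_mxM IH. Qed.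

Lemma map_pmx (k l : fieldType) (f : {rmorphism k -> l}) m (g : 'M[k]_m) p :
  map_mx f (pmx g p) = pmx (map_mx f g) (map_poly f p).
Proof.
rewrite /pmx size_map_poly map_mx_sum; apply: eq_bigr => i _.
by rewrite map_mxZ map_exp_mx coef_map.
Qed.

Lemma mx_idem_split (k : fieldType) m (e : 'M[k]_m) : e *m e = e ->
  exists (i : 'M[k]_(\rank e, m)) (p : 'M[k]_(m, \rank e)),
    i *m p = 1%:M /\ p *m i = e.
Proof.
move=> ee; exists (row_base e), (col_base e); split; last exact: mulmx_base.
apply: (row_full_inj (col_base_full e)); apply: (row_free_inj (row_base_free e)) => /=.
have := mulmx_base e; move: (col_base e) (row_base e) => c r cr.
by rewrite mulmx1 -!mulmxA cr mulmxA cr ee.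
Qed.

(** Over a finite field this replaces the Fitting decomposition. The powers of [f] are periodic, of
    some period [c], from some exponent [a] on; [a.+1 * c] is beyond [a] and a multiple of [c], so
    doubling it does not change the power. *)
Lemma mx_pow_idem (k : finFieldType) m (f : 'M[k]_m) :
  exists2 n, (0 < n)%N & f ^+ n *m f ^+ n = f ^+ n.
Proof.
have [a [b [ab eab]]] : exists a b, (a < b)%N /\ f ^+ a = f ^+ b.
  pose F (i : 'I_(#|{: 'M[k]_m}|.+1)) := f ^+ i.
  have /injectivePn[i [j ij eij]] : ~~ injectiveb F.
    by apply/injectiveP => inj; have := leq_card F inj; rewrite card_ord ltnn.
  case: (ltngtP i j) => h; [by exists i, j|by exists j, i|].
  by case/eqP: ij; apply: val_inj.
pose c := (b - a)%N; have c0 : (0 < c)%N by rewrite /c; lia.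
have per t : (a <= t)%N -> f ^+ (t + c) = f ^+ t.
  move=> at'; have -> : (t + c = b + (t - a))%N by rewrite /c; lia.
  by rewrite exprD -eab -exprD subnKC.
have perk t s : (a <= t)%N -> f ^+ (t + s * c) = f ^+ t.
  move=> at'; elim: s => [|s IH]; first by rewrite mul0n addn0.
  by rewrite mulSn addnCA addnC per ?IH //; lia.
exists (a.+1 * c)%N; first by rewrite muln_gt0.
by rewrite mulmxE -exprD perk //; nia.
Qed.

Section Families.
Variables (E : finType) (k : fieldType).

Definition fam m := {ffun E -> 'M[k]_m}.

Definition hom m p (X : fam m) (Y : fam p) (f : 'M[k]_(m, p)) : Prop :=
  forall e, X e *m f = f *m Y e.

Definition isof m p (X : fam m) (Y : fam p) : Prop :=
  exists f g, [/\ hom X Y f, f *m g = 1%:M & g *m f = 1%:M].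

Definition summand m p (X : fam m) (Y : fam p) : Prop :=
  exists i j, [/\ hom X Y i, hom Y X j & i *m j = 1%:M].

(** A relation rather than a construction, so that the size of [Z] need not be a sum syntactically
    and isomorphic copies need no transport. *)
Definition biprod m p q (Z : fam m) (X : fam p) (Y : fam q) : Prop :=
  exists i1 p1 i2 p2,
    [/\ hom X Z i1, hom Z X p1, hom Y Z i2 & hom Z Y p2] /\
    [/\ i1 *m p1 = 1%:M, i2 *m p2 = 1%:M, i1 *m p2 = 0, i2 *m p1 = 0
      & p1 *m i1 + p2 *m i2 = 1%:M].

Definition dsum m p (X : fam m) (Y : fam p) : fam (m + p) :=
  [ffun e => block_mx (X e) 0 0 (Y e)].

Definition indec m (X : fam m) : Prop :=
  (0 < m)%N /\ forall f, hom X X f -> f *m f = f -> f = 0 \/ f = 1%:M.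

Definition retr m r (i : 'M[k]_(r, m)) (p : 'M[k]_(m, r)) (X : fam m) : fam r :=
  [ffun e => i *m X e *m p].

Section Hom.
Variables (m p q : nat) (X : fam m) (Y : fam p) (Z : fam q).

Lemma hom1 : hom X X 1%:M. Proof. by move=> e; rewrite mulmx1 mul1mx. Qed.

Lemma hom0 : hom X Y 0. Proof. by move=> e; rewrite mulmx0 mul0mx. Qed.

Lemma homM f g : hom X Y f -> hom Y Z g -> hom X Z (f *m g).
Proof. by move=> hf hg e; rewrite mulmxA hf -mulmxA hg mulmxA. Qed.

Lemma homD f g : hom X Y f -> hom X Y g -> hom X Y (f + g).
Proof. by move=> hf hg e; rewrite mulmxDr mulmxDl hf hg. Qed.

Lemma homN f : hom X Y f -> hom X Y (- f).
Proof. by move=> hf e; rewrite mulmxN mulNmx hf. Qed.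

Lemma homZ c f : hom X Y f -> hom X Y (c *: f).
Proof. by move=> hf e; rewrite -scalemxAr -scalemxAl hf. Qed.

Lemma hom_inv f g : hom X Y f -> f *m g = 1%:M -> g *m f = 1%:M -> hom Y X g.
Proof.
move=> hf fg gf e.
by rewrite -[LHS]mul1mx -gf -mulmxA (mulmxA f) -hf -(mulmxA _ f) fg mulmx1.
Qed.

End Hom.

Lemma homB m p (X : fam m) (Y : fam p) f g :
  hom X Y f -> hom X Y g -> hom X Y (f - g).
Proof. by move=> hf hg; apply/homD/homN. Qed.

Lemma hom_exp m (X : fam m) f n : hom X X f -> hom X X (f ^+ n).
Proof.
by move=> hf; elim: n => [|n IH]; [exact: hom1 | rewrite exprS; apply: homM].
Qed.

Lemma hom_sum m p (X : fam m) (Y : fam p) I (r : seq I) (P : pred I) F :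
  (forall i, P i -> hom X Y (F i)) -> hom X Y (\sum_(i <- r | P i) F i).
Proof.
by move=> hF; elim/big_ind: _ => //; [exact: hom0 | move=> *; exact: homD].
Qed.

Lemma hom_pmx m (X : fam m) f p : hom X X f -> hom X X (pmx f p).
Proof. by move=> hf; apply: hom_sum => i _; apply/homZ/hom_exp. Qed.

Lemma hom_invmx m (X : fam m) f : hom X X f -> f \in unitmx -> hom X X (invmx f).
Proof. by move=> hf uf; apply: hom_inv hf _ _; rewrite ?mulmxV ?mulVmx. Qed.

Lemma isof_refl m (X : fam m) : isof X X.
Proof. by exists 1%:M, 1%:M; rewrite mulmx1; split => //; apply: hom1. Qed.

Lemma isof_sym m p (X : fam m) (Y : fam p) : isof X Y -> isof Y X.
Proof. by case=> f [g [hf fg gf]]; exists g, f; split => //; apply: hom_inv hf _ _. Qed.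

Lemma isof_trans m p q (Y : fam p) (X : fam m) (Z : fam q) :
  isof X Y -> isof Y Z -> isof X Z.
Proof.
case=> f [g [hf fg gf]] [f' [g' [hf' fg' gf']]]; exists (f *m f'), (g' *m g); split.
- exact: homM hf hf'.
- by rewrite -mulmxA (mulmxA f') fg' mul1mx.
- by rewrite -mulmxA (mulmxA g) gf mul1mx.
Qed.

Lemma isof_size m p (X : fam m) (Y : fam p) : isof X Y -> m = p.
Proof.
by case=> f [g [_ /mulmx1_min a /mulmx1_min b]]; apply/eqP; rewrite eqn_leq a b.
Qed.

Lemma isof_summand m p (X : fam m) (Y : fam p) : isof X Y -> summand X Y.
Proof. by case=> f [g [hf fg gf]]; exists f, g; split => //; apply: hom_inv hf _ _. Qed.

Lemma summand_trans m p q (Y : fam p) (X : fam m) (Z : fam q) :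
  summand X Y -> summand Y Z -> summand X Z.
Proof.
case=> i [j [hi hj ij]] [i' [j' [hi' hj' ij']]]; exists (i *m i'), (j' *m j); split.
- exact: homM hi hi'.
- exact: homM hj' hj.
- by rewrite -mulmxA (mulmxA i') ij' mul1mx.
Qed.

Lemma hom_retr m r (i : 'M[k]_(r, m)) (p : 'M[k]_(m, r)) (X : fam m) :
    i *m p = 1%:M -> hom X X (p *m i) ->
  hom (retr i p X) X i /\ hom X (retr i p X) p.
Proof.
move=> ip he; split=> e; rewrite ffunE.
  by rewrite -!mulmxA he !mulmxA ip mul1mx.
by rewrite !mulmxA -(he e) -!mulmxA ip mulmx1.
Qed.

Lemma biprod_dsum m p (X : fam m) (Y : fam p) : biprod (dsum X Y) X Y.
Proof.
exists (row_mx 1%:M 0), (col_mx 1%:M 0), (row_mx 0 1%:M), (col_mx 0 1%:M).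
split; split.
- by move=> e; rewrite ffunE mul_mx_row mul_row_block !mulmx1 !mul1mx !mulmx0 !mul0mx !addr0.
- by move=> e; rewrite ffunE mul_block_col mul_col_mx !mulmx1 !mul1mx !mulmx0 !mul0mx !addr0.
- by move=> e; rewrite ffunE mul_mx_row mul_row_block !mulmx1 !mul1mx !mulmx0 !mul0mx !add0r.
- by move=> e; rewrite ffunE mul_block_col mul_col_mx !mulmx1 !mul1mx !mulmx0 !mul0mx !add0r.
- by rewrite mul_row_col mulmx1 mulmx0 addr0.
- by rewrite mul_row_col mulmx1 mulmx0 add0r.
- by rewrite mul_row_col mulmx0 mul0mx add0r.
- by rewrite mul_row_col mulmx0 mul0mx add0r.
- rewrite !mul_col_mx !mul_mx_row !(mul1mx, mul0mx, mulmx1, mulmx0).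
  by rewrite -!block_mxEv add_block_mx !addr0 !add0r -scalar_mx_block.
Qed.

Lemma biprod_iso m p q m' p' q' (Z : fam m) (X : fam p) (Y : fam q)
    (Z' : fam m') (X' : fam p') (Y' : fam q') :
  isof X X' -> isof Y Y' -> biprod Z X Y -> biprod Z' X' Y' -> isof Z Z'.
Proof.
case=> f [f' [hf ff' f'f]] [g [g' [hg gg' g'g]]].
have hf' := hom_inv hf ff' f'f; have hg' := hom_inv hg gg' g'g.
case=> i1 [p1 [i2 [p2 [[hi1 hp1 hi2 hp2] [e1 e2 e3 e4 e5]]]]].
case=> j1 [q1 [j2 [q2 [[hj1 hq1 hj2 hq2] [d1 d2 d3 d4 d5]]]]].
exists (p1 *m f *m j1 + p2 *m g *m j2), (q1 *m f' *m i1 + q2 *m g' *m i2).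
split.
- by apply: homD; [apply: homM hj1; apply: homM hf | apply: homM hj2; apply: homM hg].
- rewrite mulmxDl !mulmxDr -!mulmxA (mulmxA j1 q1) (mulmxA j1 q2) (mulmxA j2 q1) (mulmxA j2 q2).
  rewrite d1 d2 d3 d4 !mul1mx !mul0mx !mulmx0 addr0 add0r.
  by rewrite (mulmxA f) (mulmxA g) ff' gg' !mul1mx.
- rewrite mulmxDl !mulmxDr -!mulmxA (mulmxA i1 p1) (mulmxA i1 p2) (mulmxA i2 p1) (mulmxA i2 p2).
  rewrite e1 e2 e3 e4 !mul1mx !mul0mx !mulmx0 addr0 add0r.
  by rewrite (mulmxA f') (mulmxA g') f'f g'g !mul1mx.
Qed.

Lemma biprodC m p q (Z : fam m) (X : fam p) (Y : fam q) : biprod Z X Y -> biprod Z Y X.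
Proof.
case=> i1 [p1 [i2 [p2 [[hi1 hp1 hi2 hp2] [e1 e2 e3 e4 e5]]]]].
by exists i2, p2, i1, p1; split; split=> //; rewrite addrC.
Qed.

Lemma biprod_size m p q (Z : fam m) (X : fam p) (Y : fam q) :
  biprod Z X Y -> m = (p + q)%N.
Proof.
move=> b; apply: (@isof_size _ _ Z (dsum X Y)).
apply: biprod_iso b (biprod_dsum X Y); exact: isof_refl.
Qed.

Lemma biprod_summand m p q (Z : fam m) (X : fam p) (Y : fam q) :
  biprod Z X Y -> summand X Z.
Proof. by case=> i1 [p1 [i2 [p2 [[hi1 hp1 _ _] [e1 _ _ _ _]]]]]; exists i1, p1. Qed.

Lemma summand_biprod m p (X : fam p) (Z : fam m) :
  summand X Z -> exists q (Y : fam q), biprod Z X Y.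
Proof.
case=> i [j [hi hj ij]]; have he := homM hj hi.
have ee : (j *m i) *m (j *m i) = j *m i by rewrite -mulmxA (mulmxA i) ij mul1mx.
have he' : hom Z Z (1%:M - j *m i) by apply: homB => //; apply: hom1.
have ee' : (1%:M - j *m i) *m (1%:M - j *m i) = 1%:M - j *m i.
  by rewrite mulmxBl mul1mx mulmxBr mulmx1 ee subrr subr0.
have [i2 [p2 [ip2 pi2]]] := mx_idem_split ee'.
have [hi2 hp2] : hom (retr i2 p2 Z) Z i2 /\ hom Z (retr i2 p2 Z) p2.
  by apply: hom_retr => //; rewrite pi2.
exists (\rank (1%:M - j *m i)), (retr i2 p2 Z), i, j, i2, p2; split; split => //.
- rewrite -[p2]mulmx1 -ip2 (mulmxA p2) pi2 mulmxA mulmxBr mulmx1 mulmxA ij mul1mx.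
  by rewrite subrr mul0mx.
- rewrite -[i2]mul1mx -ip2 -(mulmxA i2) pi2 -!mulmxA mulmxBl mul1mx -mulmxA ij mulmx1.
  by rewrite subrr mulmx0.
- by rewrite pi2 addrC subrK.
Qed.

Lemma idem_biprod m (Z : fam m) (e : 'M[k]_m) : hom Z Z e -> e *m e = e ->
  exists (X : fam (\rank e)) q (Y : fam q), biprod Z X Y.
Proof.
move=> he ee; have [i1 [p1 [ip1 pi1]]] := mx_idem_split ee.
have [hi1 hp1] : hom (retr i1 p1 Z) Z i1 /\ hom Z (retr i1 p1 Z) p1.
  by apply: hom_retr => //; rewrite pi1.
have [|q [Y b]] := @summand_biprod _ _ (retr i1 p1 Z) Z; first by exists i1, p1.
by exists (retr i1 p1 Z), q, Y.
Qed.

Lemma indec_iso m p (X : fam m) (Y : fam p) : isof X Y -> indec X -> indec Y.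
Proof.
move=> XY [m0 iX]; split; first by rewrite -(isof_size XY).
case: XY => f [g [hf fg gf]] e he ee; have hg := hom_inv hf fg gf.
have -> : e = g *m (f *m e *m g) *m f.
  by rewrite !mulmxA gf mul1mx -mulmxA gf mulmx1.
have [||->|->] := iX (f *m e *m g).
- exact: homM (homM hf he) hg.
- by rewrite !mulmxA -(mulmxA (f *m e)) gf mulmx1 -(mulmxA f e e) ee.
- by left; rewrite mulmx0 mul0mx.
- by right; rewrite mulmx1 gf.
Qed.

Lemma summand_indec m p (X : fam m) (Y : fam p) :
  (0 < m)%N -> indec Y -> summand X Y -> isof X Y.
Proof.
move=> m0 [_ iY] [i [j [hi hj ij]]].
have [||ji|ji] := iY (j *m i).
- exact: homM hj hi.
- by rewrite -mulmxA (mulmxA i) ij mul1mx.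
- have : \rank (1%:M : 'M[k]_m) = 0%N.
    by rewrite -[1%:M]mul1mx -{1}ij -ij -mulmxA (mulmxA j) ji mul0mx mulmx0 mxrank0.
  by rewrite mxrank1 => m00; rewrite m00 in m0.
- by exists i, j.
Qed.

End Families.

(** * Krull-Schmidt over a finite field: local endomorphism rings, primality, cancellation *)

Section KrullSchmidt.
Variables (E : finType) (k : finFieldType).
Local Notation fam := (@fam E k).

Section Local.
Variables (m : nat) (X : fam m).
Hypothesis iX : indec X.

(** Some power of [f] is an idempotent endomorphism, hence 0 or 1, and 1 would make [f]
    invertible. *)
Lemma indec_unit_nil f : hom X X f -> f \notin unitmx -> exists n, f ^+ n = 0.
Proof.
move=> hf nu; have [n n0 ee] := mx_pow_idem f; exists n.
have [//|fn1] := iX.2 (f ^+ n) (hom_exp n hf) ee.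
case/negP: nu; have : f ^+ n.-1 *m f = 1%:M by rewrite mulmxE -exprSr prednK.
by move/mulmx1_unit => [].
Qed.

Lemma nil_nonunit (f : 'M[k]_m) n : f ^+ n = 0 -> f \notin unitmx.
Proof.
move=> fn; apply/negP => uf; have [m0 _] := iX.
have : f ^+ n *m (invmx f) ^+ n = 1%:M.
  have c : f * invmx f = invmx f * f by rewrite -!mulmxE mulmxV ?mulVmx.
  by rewrite mulmxE -exprMn_comm // -mulmxE mulmxV // expr1n.
rewrite fn mul0mx => /(congr1 mxrank); rewrite mxrank0 mxrank1 => m00.
by rewrite -m00 in m0.
Qed.

Lemma nonunit1B f : hom X X f -> f \notin unitmx -> 1%:M - f \in unitmx.
Proof.
move=> hf nu; have [n fn] := indec_unit_nil hf nu.
suff : (1%:M - f) *m (\sum_(i < n) f ^+ i) = 1%:M by case/mulmx1_unit.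
rewrite mulmxE -[1%:M]/1 -opprB mulNr -subrX1 fn sub0r opprK //.
Qed.

(** The endomorphism ring is local: if [f + g] were invertible, [f (f + g)^-1] would be nilpotent
    and its difference with 1, which is [g (f + g)^-1], invertible. *)
Lemma nonunitD f g : hom X X f -> hom X X g ->
  f \notin unitmx -> g \notin unitmx -> f + g \notin unitmx.
Proof.
move=> hf hg nf ng; apply/negP => u.
have hi : hom X X (invmx (f + g)) by apply: hom_invmx => //; apply: homD.
have := nonunit1B (homM hf hi).
have -> : f *m invmx (f + g) \notin unitmx by rewrite unitmx_mul negb_and nf.
move/(_ isT); have -> : 1%:M - f *m invmx (f + g) = g *m invmx (f + g).
  by rewrite -[1%:M](mulmxV u) -mulmxBl addrC addKr.
by rewrite unitmx_mul (negPf ng).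
Qed.

(** The identity of [X] is the sum of an endomorphism through [A] and one through [B]; by locality
    one of them is invertible, which makes [X] a summand of that factor. *)
Lemma indec_prime p q r (Z : fam p) (A : fam q) (B : fam r) :
  biprod Z A B -> summand X Z -> summand X A \/ summand X B.
Proof.
case=> i1 [p1 [i2 [p2 [[hi1 hp1 hi2 hp2] [_ _ _ _ e5]]]]] [i [j [hi hj ij]]].
have e : i *m p1 *m i1 *m j + i *m p2 *m i2 *m j = 1%:M.
  by rewrite -mulmxDl -!(mulmxA i) -mulmxDr e5 mulmx1.
have hA : hom X X (i *m p1 *m i1 *m j) by exact: homM (homM (homM hi hp1) hi1) hj.
have hB : hom X X (i *m p2 *m i2 *m j) by exact: homM (homM (homM hi hp2) hi2) hj.
have aux s (T : fam s) i' p' : hom X X (i *m p' *m i' *m j) -> hom T Z i' -> hom Z T p' ->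
    i *m p' *m i' *m j \in unitmx -> summand X T.
  move=> hu hi' hp' u; exists (invmx (i *m p' *m i' *m j) *m (i *m p')), (i' *m j); split.
  - by apply: homM (homM hi hp'); exact: hom_invmx.
  - exact: homM hi' hj.
  - by rewrite -(mulmxA (invmx _)) (mulmxA (i *m p')) mulVmx.
case uA : (i *m p1 *m i1 *m j \in unitmx); first by left; apply: aux hA hi1 hp1 uA.
case uB : (i *m p2 *m i2 *m j \in unitmx); first by right; apply: aux hB hi2 hp2 uB.
by have := nonunitD hA hB (negbT uA) (negbT uB); rewrite e unitmx1.
Qed.

(* The corner a : X -> X of the identity of Z is made invertible by an
   automorphism of the second decomposition; eliminating it leaves an
   isomorphism of the complements. *)
Lemma biprod_cancel p q r (Z : fam p) (U : fam q) (U' : fam r) :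
  biprod Z X U -> biprod Z X U' -> isof U U'.
Proof.
case=> i1 [p1 [i2 [p2 [[hi1 hp1 hi2 hp2] [e1 e2 e3 e4 e5]]]]].
have aux : forall j1 q1 j2 q2,
    [/\ hom X Z j1, hom Z X q1, hom U' Z j2 & hom Z U' q2] ->
    [/\ j1 *m q1 = 1%:M, j2 *m q2 = 1%:M, j1 *m q2 = 0, j2 *m q1 = 0
      & q1 *m j1 + q2 *m j2 = 1%:M] -> i1 *m q1 \in unitmx -> isof U U'.
  move=> j1 q1 j2 q2 [hj1 hq1 hj2 hq2] [d1 d2 d3 d4 d5] ua.
  have hV : hom X X (invmx (i1 *m q1)) by apply: hom_invmx => //; apply: homM hi1 hq1.
  have qj2 : q2 *m j2 = 1%:M - q1 *m j1 by rewrite -d5 addrC addKr.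
  have pi2 : p2 *m i2 = 1%:M - p1 *m i1 by rewrite -e5 addrC addKr.
  move: (invmx _) hV (mulmxV ua) (mulVmx ua) => v hV qv vq.
  (* The Schur complement of the invertible corner; its inverse is the block [j2 *m p2] of the
     inverse change of decomposition. *)
  exists (i2 *m q2 - i2 *m q1 *m v *m (i1 *m q2)), (j2 *m p2); split.
  - apply: homB; first exact: homM hi2 hq2.
    exact: homM (homM (homM hi2 hq1) hV) (homM hi1 hq2).
  - have A1 : i2 *m q2 *m (j2 *m p2) = 1%:M - i2 *m q1 *m (j1 *m p2).
      by rewrite -mulmxA (mulmxA q2) qj2 mulmxBl mul1mx mulmxBr e2 !mulmxA.
    have A2 : i1 *m q2 *m (j2 *m p2) = - (i1 *m q1 *m (j1 *m p2)).
      by rewrite -mulmxA (mulmxA q2) qj2 mulmxBl mul1mx mulmxBr e3 sub0r !mulmxA.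
    rewrite mulmxBl A1 -(mulmxA _ (i1 *m q2)) A2 mulmxN opprK.
    by rewrite -(mulmxA _ v) (mulmxA v) vq mul1mx subrK.
  - have B1 : j2 *m p2 *m (i2 *m q2) = 1%:M - j2 *m p1 *m (i1 *m q2).
      by rewrite -mulmxA (mulmxA p2) pi2 mulmxBl mul1mx mulmxBr d2 !mulmxA.
    have B2 : j2 *m p2 *m (i2 *m q1) = - (j2 *m p1 *m (i1 *m q1)).
      by rewrite -mulmxA (mulmxA p2) pi2 mulmxBl mul1mx mulmxBr d4 sub0r !mulmxA.
    rewrite mulmxBr B1 (mulmxA _ _ (i1 *m q2)) (mulmxA _ (i2 *m q1)) B2 !mulNmx opprK.
    by rewrite -(mulmxA _ _ v) qv mulmx1 subrK.
case=> j1 [q1 [j2 [q2 [[hj1 hq1 hj2 hq2] [d1 d2 d3 d4 d5]]]]].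
case ua : (i1 *m q1 \in unitmx); first by apply: (aux j1 q1 j2 q2).
(* The corner [i1 *m q1] is not invertible, so in [i1 *m q1 *m (j1 *m p1) + i1 *m q2 *m t = 1] the
   second term is. Shearing the second decomposition by [t] adds this term to the corner. *)
have [t [ht et]] : exists t, hom U' X t /\ t = j2 *m p1.
  by exists (j2 *m p1); split=> //; exact: homM hj2 hp1.
apply: (aux j1 (q1 + q2 *m t) (j2 - t *m j1) q2).
- split=> //; first exact: homD hq1 (homM hq2 ht).
  exact: homB hj2 (homM ht hj1).
- split=> //.
  + by rewrite mulmxDr d1 mulmxA d3 mul0mx addr0.
  + by rewrite mulmxBl d2 -mulmxA d3 mulmx0 subr0.
  + rewrite mulmxBl !mulmxDr d4 add0r (mulmxA j2) d2 mul1mx -!mulmxA d1 mulmx1.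
    by rewrite (mulmxA j1) d3 mul0mx mulmx0 addr0 subrr.
  + by rewrite mulmxDl mulmxBr addrACA -mulmxA subrr addr0.
have haa : hom X X (i1 *m q1 *m (j1 *m p1)) by exact: homM (homM hi1 hq1) (homM hj1 hp1).
have hbc : hom X X (i1 *m q2 *m t) by exact: homM (homM hi1 hq2) ht.
have ha : hom X X (i1 *m q1) by apply: homM hi1 hq1.
have naa : i1 *m q1 *m (j1 *m p1) \notin unitmx by rewrite unitmx_mul ua.
have e : i1 *m q1 *m (j1 *m p1) + i1 *m q2 *m t = 1%:M.
  by rewrite et -!mulmxA -mulmxDr (mulmxA q1) (mulmxA q2) -mulmxDl d5 mul1mx.
rewrite mulmxDr mulmxA; apply/negPn/negP => nu.
have nbc : i1 *m q2 *m t \notin unitmx.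
  have -> : i1 *m q2 *m t = - (i1 *m q1) + (i1 *m q1 + i1 *m q2 *m t) by rewrite addKr.
  apply: nonunitD => //; [exact: homN | exact: homD | ].
  by rewrite -scaleN1r unitmxZ ?ua // unitrN1.
by have := nonunitD haa hbc naa nbc; rewrite e unitmx1.
Qed.

End Local.

Lemma indec_summand_exists m (X : fam m) : (0 < m)%N ->
  exists p (V : fam p) q (Y : fam q), indec V /\ biprod X V Y.
Proof.
elim: {m}m.+1 {-2}m (ltnSn m) X => // N IH m mN X m0.
have [iX|niX] := pselect (indec X).
  exists m, X, 0%N, [ffun=> 0]; split=> //.
  exists 1%:M, 1%:M, 0, 0; split; split; rewrite ?mulmx1 ?mulmx0 ?addr0 //.
  - exact: hom1.
  - exact: hom1.
  - exact: hom0.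
  - exact: hom0.
  - by rewrite !thinmx0.
have [e [he ee e0 e1]] : exists e, [/\ hom X X e, e *m e = e, e <> 0 & e <> 1%:M].
  apply: contra_notP niX => no; split=> // e he ee.
  have [->|/eqP e0] := eqVneq e 0; first by left.
  have [->|/eqP e1] := eqVneq e 1%:M; first by right.
  by case: no; exists e.
have re0 : (0 < \rank e)%N by rewrite lt0n mxrank_eq0; apply/eqP.
have rem : (\rank e < m)%N.
  rewrite ltn_neqAle rank_leq_row andbT; apply/negP => re.
  have ue : e \in unitmx by rewrite -row_free_unit.
  by case: e1; rewrite -[LHS](mulKmx ue) ee mulVmx.
have [X1 [q [Y b]]] := idem_biprod he ee.
have [|p [V [r [W [iV bV]]]]] := IH _ _ X1 re0; first by lia.
exists p, V; have : summand V X by apply: summand_trans (biprod_summand bV) (biprod_summand b).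
by case/summand_biprod => s [T bT]; exists s, T.
Qed.

End KrullSchmidt.

Section MapFamily.
Variables (E : finType) (k l : fieldType) (f : {rmorphism k -> l}).

Definition mapf m (X : fam E k m) : fam E l m := [ffun e => map_mx f (X e)].

Lemma hom_mapf m p (X : fam E k m) (Y : fam E k p) g :
  hom X Y g -> hom (mapf X) (mapf Y) (map_mx f g).
Proof. by move=> hg e; rewrite !ffunE -!map_mxM hg. Qed.

Lemma summand_mapf m p (X : fam E k m) (Y : fam E k p) :
  summand X Y -> summand (mapf X) (mapf Y).
Proof.
case=> i [j [hi hj ij]]; exists (map_mx f i), (map_mx f j).
by split; rewrite -?map_mxM ?ij ?map_mx1 //; apply: hom_mapf.
Qed.

Lemma biprod_mapf m p q (Z : fam E k m) (X : fam E k p) (Y : fam E k q) :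
  biprod Z X Y -> biprod (mapf Z) (mapf X) (mapf Y).
Proof.
case=> i1 [p1 [i2 [p2 [[hi1 hp1 hi2 hp2] [e1 e2 e3 e4 e5]]]]].
exists (map_mx f i1), (map_mx f p1), (map_mx f i2), (map_mx f p2).
split; split; try exact: hom_mapf; rewrite -!map_mxM.
- by rewrite e1 map_mx1.
- by rewrite e2 map_mx1.
- by rewrite e3 map_mx0.
- by rewrite e4 map_mx0.
- by rewrite -map_mxD e5 map_mx1.
Qed.

End MapFamily.

(** * Quiver representations on a single space *)

Section QuiverFamilies.
Variables (n : nat) (A : finType) (sr tg : A -> 'I_n) (w : 'I_n -> rat).
Local Notation E := ('I_n + A)%type.

Section AnyField.
Variable k : fieldType.
Local Notation fam := (@fam E k).

(* A representation on a single space: inl i acts as the projection onto the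
   summand attached to the vertex i. *)
Definition quiv m (X : fam m) : Prop :=
  [/\ forall i j, X (inl i) *m X (inl j) = if i == j then X (inl i) else 0,
      \sum_i X (inl i) = 1%:M
    & forall e, X (inr e) = X (inl (sr e)) *m X (inr e) *m X (inl (tg e))].

Definition fdim m (X : fam m) : dvec n := [ffun i => \rank (X (inl i))].

Definition stable m (X : fam m) r (U : 'M[k]_(r, m)) : Prop :=
  forall e, (U *m X e <= U)%MS.

Definition wt m (X : fam m) r (U : 'M[k]_(r, m)) : rat :=
  \sum_i w i * (\rank (U *m X (inl i)))%:R.

(** For the weights used later this is semistability of slope [mu] in additive form, also valid for
    the zero space. Subspaces are row spaces of square matrices, so over a finite field they range
    over a finite type and a maximum of the weight exists. *)
Definition SS m (X : fam m) : Prop :=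
  wt X 1%:M = 0 /\ forall U : 'M[k]_m, stable X U -> wt X U <= 0.

Lemma quiv_summand m p (X : fam m) (Z : fam p) : summand X Z -> quiv Z -> quiv X.
Proof.
case=> i [j [hi hj ij]] [q1 q2 q3].
have XE e : X e = i *m Z e *m j by rewrite -hi -mulmxA ij mulmx1.
split=> [u v||e].
- rewrite [X (inl v)]XE !mulmxA hi -(mulmxA i) q1 XE.
  by case: eqP => // _; rewrite mulmx0 mul0mx.
- under eq_bigr do rewrite XE.
  by rewrite -mulmx_suml -mulmx_sumr q2 mulmx1.
- rewrite [X (inl (tg e))]XE !mulmxA -(mulmxA _ _ i) !hi mulmxA hi.
  by rewrite -(mulmxA i) -(mulmxA i) -q3 XE.
Qed.

Lemma quiv_biprod m p q (Z : fam m) (X : fam p) (Y : fam q) :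
  biprod Z X Y -> quiv X -> quiv Y -> quiv Z.
Proof.
case=> i1 [p1 [i2 [p2 [[hi1 hp1 hi2 hp2] [e1 e2 e3 e4 e5]]]]] [q1 q2 q3] [r1 r2 r3].
have ZE e : Z e = p1 *m X e *m i1 + p2 *m Y e *m i2.
  by rewrite -hp1 -hp2 -!mulmxA -mulmxDr e5 mulmx1.
have ZG M N f : (p1 *m M *m i1 + p2 *m N *m i2) *m Z f =
    p1 *m (M *m X f) *m i1 + p2 *m (N *m Y f) *m i2.
  by rewrite mulmxDl -!mulmxA -hi1 -hi2 !mulmxA.
have ZM e f : Z e *m Z f = p1 *m (X e *m X f) *m i1 + p2 *m (Y e *m Y f) *m i2.
  by rewrite (ZE e) ZG.
split=> [u v||e].
- rewrite ZM q1 r1; case: eqP => _; first by rewrite [RHS]ZE.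
  by rewrite !mulmx0 !mul0mx addr0.
- under eq_bigr do rewrite ZE.
  by rewrite big_split /= -!mulmx_suml -!mulmx_sumr q2 r2 !mulmx1.
- by rewrite ZM ZG -q3 -r3 ZE.
Qed.

Lemma fdim_iso m p (X : fam m) (Y : fam p) : isof X Y -> fdim X = fdim Y.
Proof.
case=> f [g [hf fg gf]]; apply/ffunP => i; rewrite !ffunE.
have fX : row_free f by apply/row_freeP; exists g.
have gX : row_free g by apply/row_freeP; exists f.
have hg := hom_inv hf fg gf; apply/eqP; rewrite eqn_leq; apply/andP; split.
  by rewrite -(mxrankMfree _ fX) hf mxrankM_maxr.
by rewrite -(mxrankMfree _ gX) hg mxrankM_maxr.
Qed.

Lemma fdim_biprod m p q (Z : fam m) (X : fam p) (Y : fam q) :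
  biprod Z X Y -> fdim Z = fdim X + fdim Y.
Proof.
move=> b; have /fdim_iso-> : isof Z (dsum X Y).
  apply: biprod_iso b (biprod_dsum X Y); exact: isof_refl.
by apply/ffunP => i; rewrite !ffunE rank_diag_block_mx.
Qed.

Lemma quiv_idem m (X : fam m) i : quiv X -> X (inl i) *m X (inl i) = X (inl i).
Proof. by case=> q1 _ _; rewrite q1 eqxx. Qed.

Lemma ht_fdim m (X : fam m) : quiv X -> ht (fdim X) = m.
Proof.
move=> qX; have [q1 q2 _] := qX.
have dx : mxdirect (\sum_i X (inl i)).
  apply/mxdirect_sumsP => i _; apply/eqP/rowV0P => v.
  rewrite sub_capmx => /andP[/submxP[u ->] /sub_sumsmxP[t]].
  move/(congr1 (mulmx^~ (X (inl i)))); rewrite -mulmxA quiv_idem // => ->.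
  rewrite mulmx_suml big1 // => j /andP[_ ji].
  by rewrite -mulmxA q1 (negPf ji) mulmx0.
rewrite /ht; under eq_bigr do rewrite ffunE.
rewrite -(mxdirectP dx) /=.
apply/eqP; rewrite eqn_leq rank_leq_row /= -{1}(mxrank1 k m) -q2.
apply: mxrankS; apply: summx_sub => i _; exact: (sumsmx_sup i).
Qed.

Lemma eqmx_wt m (X : fam m) r s (U : 'M_(r, m)) (V : 'M_(s, m)) :
  (U :=: V)%MS -> wt X U = wt X V.
Proof. by move=> e; apply: eq_bigr => i _; rewrite (eqmxMr _ e). Qed.

Lemma eqmx_stable m (X : fam m) r s (U : 'M_(r, m)) (V : 'M_(s, m)) :
  (U :=: V)%MS -> stable X U -> stable X V.
Proof. by move=> e st x; rewrite -e -(eqmxMr _ e). Qed.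

Lemma SS_le0 m (X : fam m) r (U : 'M_(r, m)) : SS X -> stable X U -> wt X U <= 0.
Proof.
case=> _ le st; rewrite -(eqmx_wt X (genmxE U)); apply: le.
exact: eqmx_stable (eqmx_sym (genmxE U)) st.
Qed.

Lemma stable_hom m p (X : fam m) (Y : fam p) f r (U : 'M_(r, m)) :
  hom X Y f -> stable X U -> stable Y (U *m f).
Proof. by move=> hf st e; rewrite -mulmxA -hf mulmxA submxMr. Qed.

Lemma stable_kermx m p (X : fam m) (Y : fam p) f : hom X Y f -> stable X (kermx f).
Proof. by move=> hf e; apply/sub_kermxP; rewrite -mulmxA hf mulmxA mulmx_ker mul0mx. Qed.

Lemma stable_cap m (X : fam m) r s (U : 'M_(r, m)) (V : 'M_(s, m)) :
  stable X U -> stable X V -> stable X (U :&: V)%MS.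
Proof.
move=> su sv e; rewrite sub_capmx; apply/andP; split.
  exact: submx_trans (submxMr _ (capmxSl _ _)) (su e).
exact: submx_trans (submxMr _ (capmxSr _ _)) (sv e).
Qed.

Lemma stable_add m (X : fam m) r s (U : 'M_(r, m)) (V : 'M_(s, m)) :
  stable X U -> stable X V -> stable X (U + V)%MS.
Proof. by move=> su sv e; rewrite addsmxMr; apply: addsmxS. Qed.

Lemma stable1 m (X : fam m) : stable X 1%:M.
Proof. by move=> e; exact: submx1. Qed.

(** An idempotent that preserves both subspaces commutes with their intersection. This makes the
    weight, a sum of ranks vertex by vertex, behave like a dimension. *)
Lemma cap_idem m (X : fam m) i r s (U : 'M_(r, m)) (V : 'M_(s, m)) : quiv X ->
  stable X U -> stable X V ->
  ((U :&: V)%MS *m X (inl i) :=: (U *m X (inl i) :&: V))%MS.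
Proof.
move=> qX su sv; apply/eqmxP/andP; split.
  rewrite sub_capmx submxMr ?capmxSl //=.
  exact: submx_trans (submxMr _ (capmxSr _ _)) (sv _).
apply/rV_subP => v; rewrite sub_capmx => /andP[/submxP[u ev] vV].
have vx : v *m X (inl i) = v by rewrite ev -!mulmxA quiv_idem.
rewrite -vx submxMr // sub_capmx vV andbT ev mulmxA.
by rewrite -mulmxA; apply: submx_trans (submxMl _ _) (su _).
Qed.

(** The rank formula for [f] at each vertex: the weight is additive along image and kernel. *)
Lemma wt_hom m p (X : fam m) (Y : fam p) f r (U : 'M_(r, m)) : quiv X ->
  hom X Y f -> stable X U ->
  wt X U = wt Y (U *m f) + wt X (U :&: kermx f)%MS.
Proof.
move=> qX hf su; rewrite -big_split; apply: eq_bigr => i _ /=.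
rewrite -mulrDr -natrD -mulmxA -hf mulmxA (cap_idem i qX su (stable_kermx hf)).
by rewrite mxrank_mul_ker.
Qed.

Lemma wt_add m (X : fam m) r s (U : 'M_(r, m)) (V : 'M_(s, m)) : quiv X ->
  stable X U -> stable X V ->
  wt X (U + V)%MS + wt X (U :&: V)%MS = wt X U + wt X V.
Proof.
move=> qX su sv; rewrite -!big_split; apply: eq_bigr => i _ /=.
rewrite -!mulrDr -!natrD (addsmxMr U V) (cap_idem i qX su sv); congr (_ * _%:R).
have -> : \rank (U *m X (inl i) :&: V)%MS = \rank (U *m X (inl i) :&: V *m X (inl i))%MS.
  apply/eqmx_rank/andP; split; last first.
    rewrite sub_capmx capmxSl; exact: submx_trans (capmxSr _ _) (sv _).
  apply/rV_subP => v; rewrite !sub_capmx => /andP[vU vV]; rewrite vU /=.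
  case/submxP: (vU) => u ev.
  have <- : v *m X (inl i) = v by rewrite ev -!mulmxA quiv_idem.
  exact: submxMr.
exact: mxrank_sum_cap.
Qed.

Lemma wt_free m p (X : fam m) (Y : fam p) f r (U : 'M_(r, m)) :
  hom X Y f -> row_free f -> wt Y (U *m f) = wt X U.
Proof.
move=> hf ff; apply: eq_bigr => i _.
by rewrite -mulmxA -hf mulmxA mxrankMfree.
Qed.

Lemma wt_dim m (X : fam m) : wt X 1%:M = \sum_i w i * (fdim X i)%:R.
Proof. by apply: eq_bigr => i _; rewrite mul1mx ffunE. Qed.

(** The weight of a stable subspace of [Z] is the weight of its image in [Y] plus that of its part
    in [X], both nonpositive. *)
Lemma SS_extension m p q (Z : fam m) (X : fam p) (Y : fam q) i f : quiv Z ->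
    hom X Z i -> hom Z Y f -> row_free i -> row_full f -> (kermx f :=: i)%MS ->
  SS X -> SS Y -> SS Z.
Proof.
move=> qZ hi hf ifr ffu ek sX sY; split=> [|U su].
  have ef : (1%:M *m f :=: (1%:M : 'M_q))%MS by apply/eqmxP; rewrite mul1mx submx1 sub1mx.
  have ei : (1%:M :&: kermx f :=: (1%:M : 'M_p) *m i)%MS.
    by rewrite mul1mx cap1mx.
  by rewrite (wt_hom qZ hf (stable1 Z)) (eqmx_wt _ ef) (eqmx_wt _ ei) (wt_free _ hi) // sX.1 sY.1 addr0.
rewrite (wt_hom qZ hf su).
have e : (U :&: kermx f)%MS = (U :&: kermx f)%MS *m pinvmx i *m i.
  by rewrite mulmxKpV // -ek capmxSr.
rewrite e (wt_free _ hi) //; rewrite -[leRHS]addr0; apply: lerD; last first.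
  apply: SS_le0 => // x; rewrite -(submxMfree _ _ ifr) -mulmxA hi mulmxA -e.
  exact: stable_cap su (stable_kermx hf) x.
by apply: SS_le0 => //; apply: stable_hom su.
Qed.

(** A stable subspace of [X] is one of [Z]. For the vanishing of the total weight: [X] and the
    kernel of the projection both have weight at most 0, and their weights add up to 0. *)
Lemma SS_summand m p (X : fam m) (Z : fam p) : quiv Z -> summand X Z -> SS Z -> SS X.
Proof.
move=> qZ [i [j [hi hj ij]]] sZ.
have ifr : row_free i by apply/row_freeP; exists j.
have le U : stable X U -> wt X U <= 0.
  by move=> sU; rewrite -(wt_free U hi) //; apply: SS_le0 => //; apply: stable_hom sU.
split=> [|U]; last exact: le.
apply/eqP; rewrite eq_le le ?andTb; last exact: stable1.
have := sZ.1; rewrite (wt_hom qZ hj (stable1 Z)).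
have ej : (1%:M *m j :=: (1%:M : 'M_m))%MS.
  by apply/eqmxP; rewrite submx1 sub1mx mul1mx; apply/row_fullP; exists i.
rewrite (eqmx_wt _ ej).
move/eqP; rewrite addr_eq0 => /eqP->; rewrite oppr_ge0.
by apply: SS_le0 => //; apply: stable_cap (stable1 Z) (stable_kermx hj).
Qed.

Lemma SS_iso m p (X : fam m) (Y : fam p) : isof X Y -> quiv Y -> SS Y -> SS X.
Proof. by move=> /isof_summand s qY; apply: SS_summand. Qed.

Lemma quiv_iso m p (X : fam m) (Y : fam p) : isof X Y -> quiv Y -> quiv X.
Proof. by move=> /isof_summand; apply: quiv_summand. Qed.

Lemma SS_biprod m p q (Z : fam m) (X : fam p) (Y : fam q) : quiv Z ->
  biprod Z X Y -> SS X -> SS Y -> SS Z.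
Proof.
move=> qZ [i1 [p1 [i2 [p2 [[hi1 hp1 hi2 hp2] [e1 e2 e3 e4 e5]]]]]].
apply: (SS_extension qZ hi1 hp2).
- by apply/row_freeP; exists p1.
- by apply/row_fullP; exists i2.
apply/eqmxP/andP; split; last exact/sub_kermxP.
by rewrite -[kermx p2]mulmx1 -e5 mulmxDr !mulmxA mulmx_ker mul0mx addr0 submxMl.
Qed.

Lemma SS_sub m p (Z : fam m) (X : fam p) i :
  hom X Z i -> row_free i -> wt X 1%:M = 0 -> SS Z -> SS X.
Proof.
move=> hi ifr w0 sZ; split=> // U sU.
by rewrite -(wt_free U hi) //; apply: SS_le0 => //; apply: stable_hom sU.
Qed.

End AnyField.

Section MaximalDestabilizing.
Variable k : finFieldType.
Local Notation fam := (@fam E k).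

(** Take the largest rank among the stable subspaces of maximal weight. If [U'] has the same weight,
    then since the weight of the intersection is at most the maximum, [wt_add] gives the sum maximal
    weight, so [U] already contains [U']. Equal weight and rank is all that a conjugate of [U] under
    an automorphism provides. *)
Lemma max_destabilizing m (X : fam m) : quiv X ->
    ~ (forall U : 'M[k]_m, stable X U -> wt X U <= 0) ->
  exists U : 'M[k]_m, [/\ stable X U, 0 < wt X U &
    forall U' : 'M[k]_m, stable X U' -> wt X U' = wt X U -> \rank U' = \rank U ->
      (U' <= U)%MS].
Proof.
move=> qX nss.
have [U0 [s0 w0]] : exists U : 'M[k]_m, stable X U /\ 0 < wt X U.
  apply: contra_notP nss => no U sU; rewrite leNgt; apply/negP => lt; apply: no.
  by exists U.
pose P (U : 'M[k]_m) := `[< stable X U >].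
have P0 : P U0 by apply/asboolP.
have [U1 /asboolP s1 max1] := Order.TotalTheory.arg_maxP (fun U : 'M[k]_m => wt X U) P0.
have max1' (V : 'M[k]_m) : stable X V -> wt X V <= wt X U1.
  by move=> sV; apply: max1; apply/asboolP.
pose Q (U : 'M[k]_m) := P U && (wt X U == wt X U1).
have Q1 : Q U1 by rewrite /Q eqxx andbT; apply/asboolP.
have [U /andP[/asboolP sU /eqP wU] maxU] := arg_maxnP (fun U : 'M[k]_m => \rank U) Q1.
have w1 : 0 < wt X U1 by exact: lt_le_trans w0 (max1' _ s0).
exists U; split; rewrite ?wU // => U' sU' wU' rU'.
have sA := stable_add sU' sU; have sC := stable_cap sU' sU.
have: (\rank (U' + U)%MS <= \rank U)%N.
  apply: maxU; rewrite /Q; apply/andP; split; first exact/asboolP.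
  rewrite eq_le max1' //=.
  have := wt_add qX sU' sU; rewrite wU' wU => e.
  by rewrite -(lerD2r (wt X (U' :&: U)%MS)) e lerD2l; exact: max1'.
move=> le; apply: submx_trans (addsmxSl U' U) _.
by rewrite -(geq_leqif (mxrank_leqif_sup (addsmxSr U' U))).
Qed.

End MaximalDestabilizing.

(** * Semistability under extension of a finite field *)

Section BaseChange.
Variables (F K : finFieldType) (iota : {rmorphism F -> K}).

Lemma mapf_quiv (k l : fieldType) (f : {rmorphism k -> l}) m (X : @fam E k m) :
  quiv X -> quiv (mapf f X).
Proof.
case=> q1 q2 q3; split=> [i j||e].
- by rewrite !ffunE -map_mxM q1; case: eqP => //; rewrite map_mx0.
- under eq_bigr do rewrite ffunE.
  by rewrite -map_mx_sum q2 map_mx1.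
- by rewrite !ffunE -!map_mxM -q3.
Qed.

Lemma mapf_fdim (k l : fieldType) (f : {rmorphism k -> l}) m (X : @fam E k m) :
  fdim (mapf f X) = fdim X.
Proof. by apply/ffunP => i; rewrite !ffunE mxrank_map. Qed.

(* An echelon form of U is unique once its pivot columns are fixed. *)
Lemma frob_stable_rational m r (U : 'M[K]_(r, m)) :
  (map_mx (frob iota) U <= U)%MS ->
  exists s (V : 'M[F]_(s, m)), (map_mx iota V :=: U)%MS.
Proof.
move=> fU; exists (\rank U).
have full : row_full (row_base U)^T.
  by rewrite -col_leq_rank mxrank_tr (eqP (row_base_free U)).
pose S : 'M[K]_(m, \rank U) := (rowsub (fullrankfun full) 1%:M)^T.
have fS : map_mx (frob iota) S = S.
  by rewrite /S -map_trmx map_mxsub (map_mx1 (frob iota)).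
have uB : row_base U *m S \in unitmx.
  rewrite -unitmx_tr trmx_mul trmxK mul_rowsub_mx mul1mx.
  exact: fullrowsub_unit.
move: {full} S fS uB => S fS uB.
set B := _ *m _ in uB; pose U' := invmx B *m row_base U.
have eU : (U' :=: U)%MS.
  by apply: eqmx_trans (eq_row_base U); apply: eqmxMfull; rewrite row_full_unit unitmx_inv.
have U1 : U' *m S = 1%:M by rewrite /U' -mulmxA -/B mulVmx.
have fU1 : map_mx (frob iota) U' *m S = 1%:M.
  by rewrite -[X in _ *m X]fS -map_mxM U1 (map_mx1 (frob iota)).
have /submxP[M eM] : (map_mx (frob iota) U' <= U')%MS.
  rewrite eU; apply: submx_trans fU.
  by rewrite map_submx eU.
have M1 : M = 1%:M by move: fU1; rewrite eM -mulmxA U1 mulmx1.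
have [V eV] : exists V, U' = map_mx iota V.
  by apply: frob_fixed_mx; rewrite eM M1 mul1mx.
by exists V; rewrite -eV.
Qed.

(* The maximal destabilizing subrepresentation is unique, hence stable under
   Frobenius, hence defined over F. *)
Lemma SS_mapf m (X : @fam E F m) : quiv X -> SS X -> SS (mapf iota X).
Proof.
move=> qX sX; have qK := mapf_quiv iota qX.
split; first by rewrite wt_dim mapf_fdim -wt_dim sX.1.
apply: contrapT => /(max_destabilizing qK).
case=> U [sU wU maxU].
have fX e : map_mx (frob iota) (mapf iota X e) = mapf iota X e.
  by rewrite ffunE frob_map_mx_iota.
pose U' := map_mx (frob iota) U.
have le : (U' <= U)%MS.
  apply: maxU; last exact: mxrank_map.
    by move=> e; rewrite -fX /U' -map_mxM map_submx.
  by apply: eq_bigr => i _; rewrite -{1}fX /U' -map_mxM mxrank_map.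
have [r [V eV]] := frob_stable_rational le.
have sV : stable X V.
  move=> e; rewrite -(map_submx iota) map_mxM eV (eqmxMr _ eV).
  by have := sU e; rewrite ffunE.
have := SS_le0 sX sV; rewrite leNgt => /negP; apply.
suff -> : wt X V = wt (mapf iota X) U by [].
rewrite -(eqmx_wt _ eV); apply: eq_bigr => i _.
by rewrite ffunE -map_mxM mxrank_map.
Qed.

End BaseChange.
End QuiverFamilies.

(** * Eigenprojections and restriction of scalars *)

Section EigenProjection.
Variable L : fieldType.

(** The Lagrange interpolation idempotent: when [h] kills [s] and [x] is a simple root of [h], the
    projection onto the [x]-eigenspace of [s]. *)
Definition epr m (s : 'M[L]_m) (h : {poly L}) (x : L) : 'M[L]_m :=
  let h1 := h %/ ('X - x%:P) in (h1.[x])^-1 *: pmx s h1.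

Section OneRoot.
Variables (m : nat) (s : 'M[L]_m) (h : {poly L}) (x : L).
Hypotheses (sh : pmx s h = 0) (hx : root h x) (h1x : (h %/ ('X - x%:P)).[x] != 0).
Local Notation e := (epr s h x).

Lemma epr_eigen : s *m e = x *: e.
Proof.
apply/eqP; rewrite -subr_eq0 /epr -scalemxAr scalerA [x * _]mulrC -scalerA -scalerBr.
have -> : s *m pmx s (h %/ ('X - x%:P)) - x *: pmx s (h %/ ('X - x%:P)) = pmx s h.
  have eh : h = ('X - x%:P) * (h %/ ('X - x%:P)) by rewrite mulrC divpK // dvdp_XsubCl.
  by rewrite [in RHS]eh pmxM pmxB pmxX pmxC mulmxBl mul_scalar_mx.
by rewrite sh scaler0.
Qed.

Lemma epr_pmxl q : pmx s q *m e = q.[x] *: e.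
Proof.
elim/poly_ind: q => [|q c IH]; first by rewrite pmx0 mul0mx horner0 scale0r.
rewrite pmxD pmxM pmxX pmxC mulmxDl -mulmxA epr_eigen -scalemxAr IH mul_scalar_mx.
by rewrite !hornerE scalerA scalerDl [x * _]mulrC.
Qed.

Lemma epr_comm q : e *m pmx s q = pmx s q *m e.
Proof. by rewrite /epr -scalemxAl pmxC2 -scalemxAr. Qed.

Lemma epr_pmxr q : e *m pmx s q = q.[x] *: e.
Proof. by rewrite epr_comm epr_pmxl. Qed.

Lemma epr_idem : e *m e = e.
Proof. by rewrite {1}/epr -scalemxAl epr_pmxl scalerA mulVf ?scale1r. Qed.

End OneRoot.

Lemma hom_epr (E : finType) m (X : fam E L m) s h x : hom X X s -> hom X X (epr s h x).
Proof. by move=> hs; apply/homZ/hom_pmx. Qed.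

Section AllRoots.
Variables (m : nat) (s : 'M[L]_m) (xs : seq L).
Hypothesis uxs : uniq xs.
Local Notation h := (\prod_(x <- xs) ('X - x%:P)).
Hypothesis sh : pmx s h = 0.

Lemma prod_XsubC_div x : x \in xs -> h %/ ('X - x%:P) = \prod_(y <- xs | y != x) ('X - y%:P).
Proof.
move=> xin; rewrite (bigD1_seq x) //= mulrC mulpK ?polyXsubC_eq0 //.
Qed.

Lemma prod_XsubC_div_neq0 x : x \in xs -> (h %/ ('X - x%:P)).[x] != 0.
Proof.
move=> xin; rewrite prod_XsubC_div // horner_prod prodf_seq_neq0.
apply/allP => y _; apply/implyP => yx.
by rewrite !hornerE subr_eq0 eq_sym.
Qed.

Lemma prod_XsubC_root x : x \in xs -> root h x. Proof. by rewrite root_prod_XsubC. Qed.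

Lemma prod_XsubC_div_eq0 x y : x \in xs -> y \in xs -> y != x ->
  (h %/ ('X - y%:P)).[x] = 0.
Proof.
move=> xin yin yx; rewrite prod_XsubC_div // horner_prod.
apply/eqP; rewrite prodf_seq_eq0; apply/hasP; exists x => //.
by rewrite eq_sym yx /= !hornerE subrr.
Qed.

Lemma epr_orth x y : x \in xs -> y \in xs -> y != x -> epr s h y *m epr s h x = 0.
Proof.
move=> xin yin yx; rewrite {1}/epr -scalemxAl epr_pmxl ?prod_XsubC_root ?prod_XsubC_div_neq0 //.
by rewrite (prod_XsubC_div_eq0 xin yin yx) scale0r scaler0.
Qed.

(** The sum of the Lagrange polynomials minus 1 vanishes on [xs] and has degree smaller than the
    number of these points, so it is 0. *)
Lemma epr_sum : \sum_(x <- xs) epr s h x = 1%:M.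
Proof.
have [x0|nil] : xs = [::] \/ xs != [::] by case: (xs); [left|right].
  by move: sh; rewrite x0 !big_nil pmx1 => ->.
pose hq x : {poly L} := h %/ ('X - x%:P).
have -> : \sum_(x <- xs) epr s h x = pmx s (\sum_(x <- xs) (hq x).[x]^-1 *: hq x).
  by rewrite pmx_sum; apply: eq_bigr => x _; rewrite pmxZ.
suff -> : \sum_(x <- xs) (hq x).[x]^-1 *: hq x = 1 by rewrite pmx1.
apply/eqP; rewrite -subr_eq0; apply/negPn/negP => nz.
set P := _ - 1 in nz.
have rP : all (root P) xs.
  apply/allP => x xin; rewrite /root /P !hornerE horner_sum (bigD1_seq x) //=.
  rewrite hornerZ mulVf ?prod_XsubC_div_neq0 // big1_seq ?addr0 ?subrr // => y /andP[yx yin].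
  by rewrite hornerZ /hq (prod_XsubC_div_eq0 xin yin yx) mulr0.
have := max_poly_roots nz rP uxs; rewrite ltnNge => /negP; apply.
have s0 : (0 < size xs)%N by case: (xs) nil.
apply: leq_trans (size_polyD _ _) _; rewrite geq_max size_polyN size_poly1 s0 andbT.
rewrite big_seq; elim/big_ind: _ => [|p q hp hq'|x xin]; first by rewrite size_poly0.
  by apply: leq_trans (size_polyD _ _) _; rewrite geq_max hp.
apply: leq_trans (size_scale_leq _ _) _.
by rewrite /hq size_divp ?polyXsubC_eq0 // size_prod_XsubC size_XsubC subn1.
Qed.

End AllRoots.
End EigenProjection.

Section FrobeniusEigen.
Variables (F K : finFieldType) (iota : {rmorphism F -> K}) (r : nat).
Hypothesis cardK : #|K| = (#|F| ^ r)%N.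
Variables (h : {poly F}) (d : nat).
Hypotheses (hirr : irreducible_poly h) (hmon : h \is monic) (hsz : size h = d.+1).
Variable z : K.
Hypothesis rz : root (map_poly iota h) z.
Variables (m : nat) (s : 'M[F]_m).
Hypothesis sh : pmx s h = 0.

Local Notation sK := (map_mx iota s).
Local Notation hK := (map_poly iota h).
Local Notation xs := (traject (frob iota) z d).

Lemma map_pmx_root : pmx sK hK = 0.
Proof. by rewrite -map_pmx sh map_mx0. Qed.

Let hE : hK = \prod_(x <- xs) ('X - x%:P).
Proof. by case: (irr_roots cardK hirr hmon hsz rz). Qed.

Let uxs : uniq xs. Proof. by case: (irr_roots cardK hirr hmon hsz rz). Qed.

Lemma irr_div_neq0 x : x \in xs -> (hK %/ ('X - x%:P)).[x] != 0.
Proof. by rewrite hE; apply: prod_XsubC_div_neq0. Qed.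

Lemma irr_trajectP x : (x \in xs) = root hK x.
Proof. by rewrite hE root_prod_XsubC. Qed.

Lemma frob_epr x : map_mx (frob iota) (epr sK hK x) = epr sK hK (frob iota x).
Proof.
rewrite /epr map_mxZ map_pmx fmorphV -horner_map map_divp rmorphB /= map_polyX map_polyC.
by rewrite frob_map_poly_iota frob_map_mx_iota.
Qed.

Section Stable.
Variables (b : nat) (u : 'M[F]_(b, m)).
Hypothesis su : (u *m s <= u)%MS.
Local Notation uK := (map_mx iota u).

Lemma rank_epr_iter i : \rank (uK *m epr sK hK (iter i (frob iota) z)) = \rank (uK *m epr sK hK z).
Proof.
elim: i => [//|i <-]; rewrite iterS -frob_epr.
by rewrite -[in LHS](frob_map_mx_iota iota u) -map_mxM mxrank_map.
Qed.

(** A subspace defined over [F] and stable under [s] is the direct sum of its [d] eigenpieces, which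
    Frobenius permutes transitively; hence they have equal ranks. *)
Lemma rank_epr : (d * \rank (uK *m epr sK hK z) = \rank u)%N.
Proof.
pose B (i : 'I_d) := uK *m epr sK hK (iter i (frob iota) z).
have xin (i : 'I_d) : iter i (frob iota) z \in xs by apply/trajectP; exists i.
have ninj (i j : 'I_d) : i != j -> iter i (frob iota) z != iter j (frob iota) z.
  apply: contra => /eqP e; apply/eqP; apply: val_inj => /=.
  have := congr1 (fun x => index x xs) e.
  rewrite -!(nth_traject _ (ltn_ord _)) !index_uniq ?size_traject //.
have orth (i j : 'I_d) : j != i -> B j *m epr sK hK (iter i (frob iota) z) = 0.
  move=> ji; rewrite /B -mulmxA hE epr_orth ?mulmx0 -?hE ?map_pmx_root //.
  exact: ninj.
have id (i : 'I_d) : B i *m epr sK hK (iter i (frob iota) z) = B i.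
  by rewrite /B -mulmxA epr_idem ?map_pmx_root ?irr_div_neq0 // -irr_trajectP.
have dx : mxdirect (\sum_i <<B i>>).
  apply/mxdirect_sumsP => i _; apply/eqP/rowV0P => v.
  rewrite sub_capmx genmxE => /andP[/submxP[t ->] /sub_sumsmxP[t']].
  move/(congr1 (mulmx^~ (epr sK hK (iter i (frob iota) z)))).
  rewrite -mulmxA id => ->; rewrite mulmx_suml big1 // => j /andP[_ ji].
  have /submxP[t2 ->] : (t' j *m <<B j>> <= B j)%MS by rewrite mulmx_sub ?genmxE.
  by rewrite -mulmxA orth ?mulmx0.
have <- : \rank (\sum_i <<B i>>)%MS = \rank u.
  rewrite -(mxrank_map iota); apply/eqmx_rank/andP; split.
    apply/sumsmx_subP => i _; rewrite genmxE /B /epr -scalemxAr scalemx_sub //.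
    by apply: pmx_stable; rewrite -map_mxM map_submx.
  have -> : uK = \sum_i B i.
    rewrite -{1}[uK]mulmx1 -(epr_sum uxs (s := sK)) -hE ?map_pmx_root //.
    rewrite mulmx_sumr (big_nth z) size_traject big_mkord.
    by apply: eq_bigr => i _; rewrite nth_traject.
  by apply: summx_sub => i _; apply: (sumsmx_sup i); rewrite ?genmxE.
rewrite (mxdirectP dx) /=.
under eq_bigr do rewrite genmxE rank_epr_iter.
by rewrite sum_nat_const card_ord.
Qed.

End Stable.

(** If [v] is defined over [F] and killed by one eigenprojection, it is killed by all the Frobenius
    conjugates of that projection, and these add up to 1. *)
Lemma epr_rational0 b (v : 'M[F]_(b, m)) : map_mx iota v *m epr sK hK z = 0 -> v = 0.
Proof.
move=> v0; apply: (map_mx_inj (f := iota)); rewrite map_mx0.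
rewrite -[LHS]mulmx1 -(epr_sum uxs (s := sK)) -hE ?map_pmx_root //.
rewrite mulmx_sumr big_seq big1 // => x /trajectP[i _ ->].
elim: i => [//|i IH]; rewrite iterS -frob_epr -(frob_map_mx_iota iota v) -map_mxM IH.
by rewrite map_mx0.
Qed.

End FrobeniusEigen.

Lemma irr_root_dvd (k l : fieldType) (f : {rmorphism k -> l}) (h p : {poly k}) (x : l) :
  irreducible_poly h -> root (map_poly f h) x -> root (map_poly f p) x -> h %| p.
Proof.
move=> hirr rh rp; have [sg|sg] := eqVneq (size (gcdp h p)) 1%N.
  have : coprimep (map_poly f h) (map_poly f p) by rewrite coprimep_map /coprimep sg.
  by move/coprimep_root => /(_ x rh); rewrite (rootP rp) eqxx.
have := hirr.2 _ sg (dvdp_gcdl h p) => e.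
by rewrite -(eqp_dvdl _ e) dvdp_gcdr.
Qed.

(** * Restriction of scalars along a finite extension *)

Section Restriction.
Variables (F K : finFieldType) (iota : {rmorphism F -> K}) (r : nat).
Hypotheses (cardK : #|K| = (#|F| ^ r)%N).
Variables (f : {poly F}) (om : K).
Hypotheses (firr : irreducible_poly f) (fmon : f \is monic) (fsz : size f = r.+1).
Hypotheses (rom : root (map_poly iota f) om) (om0 : om != 0).
Local Notation fK := (map_poly iota f).
Local Notation "A ^i" := (map_mx iota A) (at level 2, format "A ^i").

(* v |-> v^i *m P is an F-linear bijection from F^m to K^a. *)
Definition isres m a (P : 'M[K]_(m, a)) : Prop :=
  m = (r * a)%N /\ forall v : 'rV[F]_m, v^i *m P = 0 -> v = 0.

Lemma isres_inj m a (P : 'M[K]_(m, a)) b (U V : 'M[F]_(b, m)) :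
  isres P -> U^i *m P = V^i *m P -> U = V.
Proof.
move=> [_ inj] e; apply/row_matrixP => j; apply/eqP; rewrite -subr_eq0; apply/eqP.
apply: inj; rewrite map_mxB mulmxBl !map_row -!row_mul.
by rewrite e subrr.
Qed.

Lemma isres_surj m a (P : 'M[K]_(m, a)) b (Y : 'M[K]_(b, a)) :
  isres P -> exists V : 'M[F]_(b, m), V^i *m P = Y.
Proof.
move=> rP; pose g (v : 'rV[F]_m) : 'rV[K]_a := v^i *m P.
have ginj : injective g by move=> u v; apply: isres_inj.
have card_eq : (#|{: 'rV[K]_a}| <= #|{: 'rV[F]_m}|)%N.
  by rewrite !card_mx cardK rP.1 !mul1n expnM.
have ex y : exists v, g v == y.
  have /codomP[v ->] : y \in codom g by apply: (inj_card_onto ginj).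
  by exists v.
exists (\matrix_j xchoose (ex (row j Y))); apply/row_matrixP => j.
rewrite row_mul -map_row rowK; apply/eqP; exact: (xchooseP (ex (row j Y))).
Qed.

Lemma isres_full m a (P : 'M[K]_(m, a)) : isres P -> row_full P.
Proof. by case/(isres_surj 1%:M) => V e; apply/row_fullP; exists V^i. Qed.

Lemma isres_exists a : exists P : 'M[K]_(r * a, a), isres P.
Proof.
elim: a => [|a [P [_ rP]]].
  by exists 0; split=> // v _; move: v; rewrite muln0 => v; rewrite thinmx0.
(* The powers of [om] below [r] are a basis of [K] over [F]: they are independent because the
   minimal polynomial [f] has degree [r]. *)
pose b : 'M[K]_(r, 1) := \col_j om ^+ j.
have rb (v : 'rV[F]_r) : v^i *m b = 0 -> v = 0.
  move=> e; have rv : root (map_poly iota (rVpoly v)) om.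
    rewrite map_rVpoly /root (horner_coef_wide _ (size_poly _ _)).
    have := congr1 (fun M : 'M_1 => M 0 0) e; rewrite !mxE => e'.
    rewrite -[X in _ == X]e'; apply/eqP/eq_bigr => j _.
    by rewrite coef_rVpoly_ord !mxE.
  have dv := irr_root_dvd firr rom rv.
  have v0 : rVpoly v = 0.
    apply/eqP; rewrite -size_poly_leq0 leqNgt; apply/negP => lt.
    have := dvdp_leq (p := f) _ dv; rewrite -size_poly_gt0 => /(_ lt); rewrite fsz.
    by rewrite leqNgt ltnS size_poly.
  by rewrite -[v]rVpolyK v0 linear0.
suff [Q [e rQ]] : exists Q : 'M[K]_(r + r * a, 1 + a), isres Q.
  by move: Q e rQ; rewrite -mulnS => Q e rQ; exists Q.
exists (block_mx b 0 0 P); split=> [|v]; first by rewrite mulnS.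
rewrite -[v]hsubmxK map_row_mx mul_row_block !mulmx0 addr0 add0r.
move=> e; have : row_mx ((lsubmx v)^i *m b) ((rsubmx v)^i *m P) = row_mx 0 0.
  by rewrite e row_mx0.
by case/eq_row_mx => /rb -> /rP ->; rewrite row_mx0.
Qed.

Section Projector.
Variables (m a : nat) (P : 'M[K]_(m, a)) (s : 'M[F]_m).
Hypotheses (rP : isres P) (sP : s^i *m P = om *: P).

Lemma res_scalar_root : pmx s f = 0.
Proof.
apply: (isres_inj rP); rewrite map_mx0 mul0mx map_pmx.
have -> : pmx s^i fK *m P = P *m pmx (om%:M) fK.
  by apply: pmx_intertwine; rewrite sP mul_mx_scalar.
have sc q : pmx (om%:M : 'M_a) q = (q.[om])%:M.
  elim/poly_ind: q => [|q c IH]; first by rewrite pmx0 horner0 raddf0.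
  by rewrite pmxD pmxM pmxX pmxC IH !hornerE -scalar_mxM raddfD.
by rewrite sc (rootP rom) raddf0 mulmx0.
Qed.

Lemma res_comm (E : finType) (X : fam E F m) (X' : fam E K a) :
  (forall e, (X e)^i *m P = P *m X' e) -> hom X X s.
Proof.
move=> XX' e; apply: (isres_inj rP); rewrite !map_mxM -!mulmxA sP XX'.
by rewrite -scalemxAr XX' mulmxA sP scalemxAl.
Qed.

(** Here [s] is multiplication by [om] on the restricted space. [P] is fixed by the
    [om]-eigenprojection [e] of the base change of [s], and [rank_epr] gives [e] rank [m / r = a];
    the column spaces of [P] and [e] then coincide, so [e] factors through [P]. *)
Lemma res_projector : exists Q : 'M[K]_(a, m),
  [/\ Q *m P = 1%:M, P *m Q = epr s^i fK om & exists V : 'M[F]_(a, m), Q = V^i *m (P *m Q)].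
Proof.
have sf := res_scalar_root; set e := epr _ _ _.
have sfK : pmx s^i fK = 0 by rewrite -map_pmx sf map_mx0.
have nz : (fK %/ ('X - om%:P)).[om] != 0.
  apply: (irr_div_neq0 cardK firr fmon fsz rom).
  by rewrite (irr_trajectP cardK firr fmon fsz rom).
have ee : e *m e = e by apply: epr_idem.
have eP : e *m P = P.
  rewrite /e /epr -scalemxAl (@pmx_intertwine _ _ _ _ om%:M) ?mul_mx_scalar //.
  have sc q : pmx (om%:M : 'M_a) q = (q.[om])%:M.
    elim/poly_ind: q => [|q c IH]; first by rewrite pmx0 horner0 raddf0.
    by rewrite pmxD pmxM pmxX pmxC IH !hornerE -scalar_mxM raddfD.
  by rewrite sc mul_mx_scalar scalerA mulVf ?scale1r.
have [V VP] := isres_surj 1%:M rP.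
have rr : (r * \rank e)%N = m.
  have := rank_epr cardK firr fmon fsz rom sf (submx1 (1%:M *m s)).
  by rewrite map_mx1 mul1mx mxrank1.
have r0 : (0 < r)%N by have := firr.1; rewrite fsz ltnS.
have re : \rank e = a.
  by apply/eqP; rewrite -(eqn_pmul2l r0) rr rP.1.
have [T eT] : exists T, e = P *m T.
  have : (P^T <= e^T)%MS by rewrite -[P in X in (X <= _)%MS]eP trmx_mul submxMl.
  move=> le; have : (e^T <= P^T)%MS.
    by rewrite -(geq_leqif (mxrank_leqif_sup le)) !mxrank_tr re (eqP (isres_full rP)).
  by case/submxP => D /(congr1 trmx); rewrite trmx_mul !trmxK => ->; exists D^T.
have QP : V^i *m e *m P = 1%:M by rewrite -mulmxA eP.
have PQ : P *m (V^i *m e) = e.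
  have -> : V^i *m e = T by rewrite eT mulmxA VP mul1mx.
  by rewrite -eT.
by exists (V^i *m e); rewrite QP PQ; split=> //; exists V.
Qed.

End Projector.

Section Families.
Variables (E : finType) (m a : nat) (P : 'M[K]_(m, a)).
Hypothesis rP : isres P.

Definition resf (X : fam E F m) (X' : fam E K a) : Prop :=
  forall e, (X e)^i *m P = P *m X' e.

Lemma resf_exists X' : exists X, resf X X'.
Proof.
have ex e : exists V : 'M[F]_m, V^i *m P == P *m X' e.
  by have [V eV] := isres_surj (P *m X' e) rP; exists V; rewrite eV.
by exists [ffun e => xchoose (ex e)] => e; rewrite ffunE; apply/eqP/(xchooseP (ex e)).
Qed.

Lemma res_mul (Y : 'M[K]_a) : exists s : 'M[F]_m, s^i *m P = P *m Y.
Proof. exact: isres_surj. Qed.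

(** Restricting to [F] and extending back to [K] recovers [X'] as the [om]-eigenspace of the
    multiplication by [om], which commutes with the family. *)
Lemma resf_summand X X' : resf X X' -> summand X' (mapf iota X).
Proof.
move=> XX'; have [s sP] := res_mul om%:M; rewrite mul_mx_scalar in sP.
have [Q [QP PQ _]] := res_projector rP sP.
have hs := res_comm rP sP XX'.
have hP : hom (mapf iota X) X' P by move=> e; rewrite ffunE XX'.
have he : hom (mapf iota X) (mapf iota X) (P *m Q).
  by rewrite PQ; apply: hom_epr => e; rewrite ffunE -!map_mxM hs.
exists Q, P; split=> // e.
by rewrite -[RHS]mul1mx -QP -mulmxA (mulmxA P) -he !mulmxA -(mulmxA Q) hP mulmxA QP mul1mx.
Qed.

End Families.

Section Quivers.
Variables (n : nat) (A : finType) (sr tg : A -> 'I_n) (w : 'I_n -> rat).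
Local Notation E := ('I_n + A)%type.
Local Notation quiv := (quiv sr tg).
Local Notation SS := (SS w).
Local Notation wt := (wt w).
Variables (m a : nat) (P : 'M[K]_(m, a)).
Hypothesis rP : isres P.
Variables (X : fam E F m) (X' : fam E K a).
Hypothesis XX' : resf P X X'.

Lemma resf_quiv : quiv X <-> quiv X'.
Proof.
split=> [qX|[q1 q2 q3]].
  by apply: quiv_summand (resf_summand rP XX') _; apply: mapf_quiv.
split=> [i j||e].
- apply: (isres_inj rP); rewrite map_mxM -mulmxA XX' mulmxA XX' -mulmxA q1.
  by case: eqP => _; rewrite ?XX' // map_mx0 mul0mx mulmx0.
- apply: (isres_inj rP); rewrite map_mx1 mul1mx map_mx_sum mulmx_suml.
  by under eq_bigr do rewrite XX'; rewrite -mulmx_sumr q2 mulmx1.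
- apply: (isres_inj rP); rewrite XX' q3 !map_mxM -!mulmxA XX'.
  by rewrite mulmxA (mulmxA _ P) XX' !mulmxA XX'.
Qed.

Lemma res_rank s b (u : 'M[F]_(b, m)) : s^i *m P = om *: P -> (u *m s <= u)%MS ->
  \rank u = (r * \rank (u^i *m P))%N.
Proof.
move=> sP us; have [Q [QP PQ _]] := res_projector rP sP.
rewrite -(rank_epr cardK firr fmon fsz rom (res_scalar_root rP sP) us) -PQ mulmxA.
by rewrite mxrankMfree //; apply/row_freeP; exists P.
Qed.

Lemma resf_wt s b (U : 'M[F]_(b, m)) : s^i *m P = om *: P -> (U *m s <= U)%MS ->
  wt X U = r%:R * wt X' (U^i *m P).
Proof.
move=> sP us; rewrite mulr_sumr; apply: eq_bigr => i _.
have hs := res_comm rP sP XX'.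
rewrite (@res_rank s) //; last by rewrite -mulmxA hs mulmxA submxMr.
by rewrite map_mxM -mulmxA XX' mulmxA natrM mulrCA.
Qed.

Lemma resf_fdim i : fdim X i = (r * fdim X' i)%N.
Proof.
have [s sP] := res_mul rP om%:M; rewrite mul_mx_scalar in sP.
have hs := res_comm rP sP XX'.
by rewrite !ffunE (@res_rank s) // ?hs ?submxMl // XX' eqmxMfull // isres_full.
Qed.

(** Subspaces over [K] are the subspaces over [F] stable under [s], the multiplication by [om], with
    weights multiplied by [r]. Subspaces not stable under [s] are dealt with by uniqueness: [s] is
    an automorphism of [X], so it preserves a maximal destabilizing subspace. *)
Lemma resf_SS : quiv X -> SS X <-> SS X'.
Proof.
move=> qX; have qX' := resf_quiv.1 qX.
have [s sP] := res_mul rP om%:M; rewrite mul_mx_scalar in sP.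
have [t tP] := res_mul rP om^-1%:M; rewrite mul_mx_scalar in tP.
have hs := res_comm rP sP XX'.
have r0 : (0 < r)%N by have := firr.1; rewrite fsz ltnS.
have r0q : 0 < r%:R :> rat by rewrite ltr0n.
have st : s *m t = 1%:M.
  apply: (isres_inj rP); rewrite map_mxM -mulmxA tP -scalemxAr sP scalerA mulVf //.
  by rewrite scale1r map_mx1 mul1mx.
have w1 : wt X 1%:M = r%:R * wt X' 1%:M.
  rewrite (resf_wt sP) ?submx1 //; congr (_ * _); apply: eqmx_wt.
  by rewrite map_mx1 mul1mx; apply/eqmxP; rewrite submx1 sub1mx isres_full.
split=> [sX|sX'].
  split=> [|Z sZ].
    by move/eqP: w1; rewrite sX.1 eq_sym mulf_eq0 gt_eqF //= => /eqP.
  (* The preimage of [Z] under the bijection [v |-> v^i *m P], as a row space over [F]. *)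
  pose U := (\sum_(v : 'rV[F]_m | (v^i *m P <= Z)%MS) <<v>>)%MS.
  have UP (v : 'rV_m) : (v <= U)%MS = (v^i *m P <= Z)%MS.
    apply/idP/idP => [/sub_sumsmxP[D ->]|vZ]; last first.
      by apply: (sumsmx_sup v) => //; rewrite genmxE.
    rewrite map_mx_sum mulmx_suml; apply: summx_sub => u uZ.
    have /submxP[D' ->] : (D u *m <<u>> <= u)%MS by rewrite mulmx_sub ?genmxE.
    by rewrite map_mxM -mulmxA; apply: mulmx_sub.
  have st' (M : 'M[F]_m) (M' : 'M[K]_a) : M^i *m P = P *m M' -> (Z *m M' <= Z)%MS -> (U *m M <= U)%MS.
    move=> MM' ZM; apply/row_subP => i; rewrite row_mul UP map_mxM -mulmxA MM' mulmxA.
    by apply: submx_trans ZM; apply: submxMr; rewrite -UP row_sub.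
  have sU : stable X U by move=> e; apply: st' (XX' e) (sZ e).
  have sUs : (U *m s <= U)%MS.
    by apply: (st' _ om%:M); rewrite ?mul_mx_scalar // scalemx_sub.
  have eZ : (U^i *m P :=: Z)%MS.
    apply/eqmxP/andP; split.
      by apply/row_subP => i; rewrite row_mul -map_row -UP row_sub.
    apply/row_subP => i; have [v ev] := isres_surj (row i Z) rP.
    by rewrite -ev submxMr // map_submx UP ev row_sub.
  have := sX.2 U sU; rewrite (resf_wt sP sUs) (eqmx_wt _ _ eZ).
  by rewrite pmulr_rle0.
split; first by rewrite w1 sX'.1 mulr0.
apply: contrapT => /(max_destabilizing qX)[U [sU wU maxU]].
have fs : row_free s by apply/row_freeP; exists t.
(* [U *m s] is again stable, of the same weight and rank as [U], so maximality puts it inside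
   [U]. *)
have sUs : (U *m s <= U)%MS.
  apply: maxU; first exact: stable_hom hs sU.
    by rewrite (wt_free _ _ hs).
  by rewrite mxrankMfree.
have := wU; rewrite (resf_wt sP sUs) pmulr_rgt0 // ltNge => /negP; apply.
apply: SS_le0 => // e; rewrite -mulmxA -XX' mulmxA -map_mxM submxMr // map_submx.
exact: sU.
Qed.

End Quivers.
End Restriction.

(** * The residue field of an indecomposable *)

Section FiniteSubring.
Variables (R : finNzRingType) (S : {pred R}).

Definition subring_type of subring_closed S : predArgType := {x : R | x \in S}.

Variable clS : subring_closed S.
Local Notation T := (subring_type clS).

HB.instance Definition _ := Finite.copy T {x : R | x \in S}.
HB.instance Definition _ := SubType.copy T {x : R | x \in S}.
HB.instance Definition _ := GRing.SubChoice_isSubNzRing.Build R S T clS.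
HB.instance Definition _ := FinRing.isNzRing.Build T.

(** A finite domain is a field by Wedderburn, and its multiplicative group is cyclic. *)
Lemma finite_subdomain_gen :
  (forall x y, x \in S -> y \in S -> x * y = 0 -> x = 0 \/ y = 0) ->
  exists2 u, u \in S & forall x, x \in S -> x = 0 \/ exists i, x = u ^+ i.
Proof.
move=> domS.
have dT : GRing.integral_domain_axiom T.
  move=> x y /(congr1 val); rewrite rmorphM rmorph0 /=.
  case/(domS _ _ (valP x) (valP y)) => e; apply/orP; [left|right]; apply/eqP/val_inj => /=;
    by rewrite e.
have [g _ gP] := finfield_gen (FinDomainFieldType dT).
exists (val (g : T)); first exact: (valP (g : T)).
move=> x xS; pose y : T := Sub x xS.
have [y0|y0] := eqVneq y 0.
  by left; move/(congr1 val): y0; rewrite SubK rmorph0.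
right; have [i yi] := gP y y0; exists i.
move: yi => /(congr1 (val : T -> R)); rewrite SubK => ->.
exact: (rmorphXn (val : T -> R) i (g : T)).
Qed.

End FiniteSubring.

(** On the commutative algebra generated by [u], raising to the power [#|k| ^ j] is a ring morphism
    that fixes the scalars. *)
Lemma pmx_exp_card (k : finFieldType) m (u : 'M[k]_m) (a : {poly k}) j :
  pmx (u ^+ (#|k| ^ j)) a = pmx u a ^+ (#|k| ^ j).
Proof.
have [p [e [pr_p ch e0 cF]]] := finfield_card k.
have chP : p \in [pchar {poly k}] by apply: (rmorph_pchar (polyC : k -> {poly k})).
have np : [pchar {poly k}].-nat (#|k| ^ j)%N.
  by rewrite (eq_pnat _ (pcharf_eq chP)) cF -expnM pnatX pnat_id.
have ck (c : k) : c ^+ (#|k| ^ j) = c.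
  by elim: j {np} => [|i IH]; rewrite ?expr1 // expnSr exprM IH expf_card.
rewrite -pmxXn; elim/poly_ind: a => [|a c IH].
  by rewrite expr0n expn_eq0 -leqn0 leqNgt ltnW ?finNzRing_gt1 // !pmx0.
rewrite exprDn_pchar // exprMn -polyC_exp ck.
by rewrite !pmxD !pmxM !pmxC IH !pmxXn !pmxX.
Qed.

Section Structure.
Variables (E : finType) (k : finFieldType) (m : nat) (X : fam E k m).
Hypothesis iX : indec X.

(** For indecomposable [X] over a finite field this is the radical of the local endomorphism
    ring. *)
Definition nonunit_endo (x : 'M[k]_m) : Prop := hom X X x /\ x \notin unitmx.
Local Notation J := nonunit_endo.

Lemma nonunit_endoD x y : J x -> J y -> J (x + y).
Proof. by case=> hx nx [hy ny]; split; [exact: homD | exact: (nonunitD iX)]. Qed.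

Lemma nonunit_endoMl x y : hom X X x -> J y -> J (x *m y).
Proof. by move=> hx [hy ny]; split; [exact: homM hx hy | rewrite unitmx_mul negb_and ny orbT]. Qed.

Lemma nonunit_endoMr x y : J x -> hom X X y -> J (x *m y).
Proof. by move=> [hx nx] hy; split; [exact: homM hx hy | rewrite unitmx_mul negb_and nx]. Qed.

Lemma nonunit_endo0 : J 0.
Proof.
split; first exact: hom0.
by apply: (@nil_nonunit _ _ _ _ iX _ 1); rewrite expr1.
Qed.

Lemma nonunit_endoZ c x : J x -> J (c *: x).
Proof.
move=> Jx; rewrite -mul_scalar_mx; apply: nonunit_endoMl => //.
by move=> e; rewrite mul_scalar_mx mul_mx_scalar.
Qed.

Definition Jset : {set 'M[k]_m} := [set x | `[< J x >]].

Lemma JsetP x : (x \in Jset) = `[< J x >]. Proof. by rewrite inE. Qed.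

(* Nakayama: a generator b of the last row satisfies b (1 - y) in the span of
   the other rows times J, with y in J. *)
Lemma nakayama t (B : 'M[k]_(t, m)) :
  (B <= \sum_(j in Jset) <<B *m j>>)%MS -> B = 0.
Proof.
have sumP s (C : 'M[k]_(s, m)) (v : 'rV_m) : (v <= \sum_(j in Jset) <<C *m j>>)%MS ->
    exists D : 'M[k]_m -> 'rV_s, v = \sum_(j in Jset) D j *m C *m j.
  case/sub_sumsmxP => D ->.
  have ex j : exists D' : 'rV_s, D j *m <<C *m j>>%MS == D' *m C *m j.
    have /submxP[D' e] : (D j *m <<C *m j>> <= C *m j)%MS by rewrite mulmx_sub ?genmxE.
    by exists D'; rewrite e mulmxA.
  exists (fun j => xchoose (ex j)); apply: eq_bigr => j _.
  by apply/eqP/(xchooseP (ex j)).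
elim: t B => [|t IH] B; first by rewrite flatmx0.
rewrite -[B](@vsubmxK _ 1 t); set b := usubmx _; set B' := dsubmx _ => le.
have [D eb] : exists D : 'M[k]_m -> 'rV_(1 + t), b = \sum_(j in Jset) D j *m col_mx b B' *m j.
  apply: sumP; apply: submx_trans le.
  by have := addsmxSl b B'; rewrite addsmxE.
pose y := \sum_(j in Jset) (lsubmx (D j)) 0 0 *: j.
pose v := \sum_(j in Jset) rsubmx (D j) *m B' *m j.
have Jy : J y.
  rewrite /y; elim/big_ind: _ => [||j]; [exact: nonunit_endo0 | exact: nonunit_endoD | ].
  by rewrite JsetP => /asboolP; apply: nonunit_endoZ.
have ey : b *m (1%:M - y) = v.
  rewrite mulmxBr mulmx1; apply/eqP; rewrite subr_eq addrC; apply/eqP.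
  rewrite {1}eb /v /y mulmx_sumr -big_split; apply: eq_bigr => j _ /=.
  rewrite -[D j in LHS]hsubmxK mul_row_col mulmxDl; congr (_ + _).
  by rewrite {1}[lsubmx _]mx11_scalar mul_scalar_mx -scalemxAl scalemxAr.
have u1 : 1%:M - y \in unitmx by apply: (nonunit1B iX); case: Jy.
have h1 : hom X X (invmx (1%:M - y)).
  by apply: hom_invmx => //; apply: homB; [exact: hom1 | case: Jy].
have eb' : b = v *m invmx (1%:M - y) by rewrite -ey mulmxK.
have B'0 : B' = 0.
  apply: IH; have : (B' <= \sum_(j in Jset) <<col_mx b B' *m j>>)%MS.
    by apply: submx_trans le; have := addsmxSr b B'; rewrite addsmxE.
  move/submx_trans; apply; apply/sumsmx_subP => j; rewrite JsetP => /asboolP Jj.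
  rewrite genmxE mul_col_mx col_mx_sub; apply/andP; split; last first.
    by apply: (sumsmx_sup j); rewrite ?genmxE // JsetP; apply/asboolP.
  rewrite eb' /v !mulmx_suml; apply: summx_sub => i; rewrite JsetP => /asboolP Ji.
  rewrite -!mulmxA; apply: mulmx_sub; apply: (sumsmx_sup (i *m (invmx (1%:M - y) *m j))).
    by rewrite JsetP; apply/asboolP; apply: nonunit_endoMr => //; apply: homM h1 _; case: Jj.
  by rewrite genmxE.
rewrite eb' /v B'0 big1 ?mul0mx ?col_mx0 // => i _.
by rewrite mulmx0 mul0mx.
Qed.

(** The images of the whole space under the powers of the radical. The flag encodes nilpotency of
    the radical by inclusions of row spaces, which can be tested after any extension of the
    field. *)
Fixpoint radflag i : 'M[k]_m :=
  if i is i'.+1 then (\sum_(j in Jset) <<radflag i' *m j>>)%MS else 1%:M.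

Lemma radflag_lower i x : J x -> (radflag i *m x <= radflag i.+1)%MS.
Proof.
by move=> Jx; apply: (sumsmx_sup x); rewrite ?genmxE // JsetP; apply/asboolP.
Qed.

Lemma radflag_stable i x : hom X X x -> (radflag i *m x <= radflag i)%MS.
Proof.
move=> hx; case: i => [|i]; first exact: submx1.
rewrite sumsmxMr; apply/sumsmx_subP => j; rewrite JsetP => /asboolP Jj.
rewrite (eqmxMr _ (genmxE _)) -mulmxA; apply: radflag_lower.
exact: nonunit_endoMr.
Qed.

Lemma radflag_desc i : (radflag i.+1 <= radflag i)%MS.
Proof.
apply/sumsmx_subP => j; rewrite JsetP => /asboolP[hj _].
by rewrite genmxE radflag_stable.
Qed.

(** By Nakayama the flag decreases strictly until it reaches 0. *)
Lemma radflag_rank i : (\rank (radflag i) <= m - i)%N.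
Proof.
elim: i => [|i IH]; first by rewrite subn0 rank_leq_row.
have [e|ne] := eqVneq (\rank (radflag i.+1)) (\rank (radflag i)).
  suff -> : radflag i.+1 = 0 by rewrite mxrank0.
  apply/eqP; rewrite -mxrank_eq0 e mxrank_eq0; apply/eqP/nakayama.
  rewrite -/(radflag i.+1) -(geq_leqif (mxrank_leqif_sup (radflag_desc i))) e //.
have := mxrankS (radflag_desc i); move: ne IH; lia.
Qed.

Lemma radflag0 : radflag m = 0.
Proof. by apply/eqP; rewrite -mxrank_eq0 -leqn0; have := radflag_rank m; rewrite subnn. Qed.

(* End X modulo its radical acts faithfully on the last nonzero step of the
   radical flag; it is a finite division ring, hence a field with cyclic
   multiplicative group. *)
Lemma residue_generator : exists2 u, hom X X u &
  forall x, hom X X x -> J x \/ exists i, J (x - u ^+ i).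
Proof.
have m0 := iX.1.
have [i [nz z]] : exists i, radflag i != 0 /\ radflag i.+1 = 0.
  have ex : exists i, radflag i == 0 by exists m; rewrite radflag0.
  case: (ex_minnP ex) => [[|i]] /eqP ri mini.
    move: ri => /(congr1 mxrank); rewrite mxrank0 /= mxrank1 => m00.
    by rewrite m00 in m0.
  by exists i; split=> //; apply/negP => /mini; rewrite ltnn.
have kill x : J x -> radflag i *m x = 0.
  by move=> Jx; apply/eqP; rewrite -submx0 -z; apply: radflag_lower.
have st x (hx : hom X X x) := radflag_stable i hx.
move: (radflag i) nz kill st => W nz kill st {i z}.
have [s [B [Bf BW]]] : exists s (B : 'M[k]_(s.+1, m)), row_free B /\ (B :=: W)%MS.
  move: nz (row_base W) (row_base_free W) (eq_row_base W); rewrite -mxrank_eq0.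
  by case: (\rank W) => // s _ B Bf BW; exists s, B.
pose de x := B *m x *m pinvmx B.
have deE x : hom X X x -> de x *m B = B *m x.
  by move=> hx; rewrite mulmxKpV // (eqmxMr _ BW) BW; apply: st.
have Binj p : injective (fun y : 'M_(p, s.+1) => y *m B) by apply: (row_free_inj Bf).
pose S : {pred 'M[k]_s.+1} := [pred y | `[< exists2 x, hom X X x & y = de x >]].
have SP y : y \in S <-> exists2 x, hom X X x & y = de x.
  rewrite -[y \in S]/(`[< exists2 x, hom X X x & y = de x >]).
  by split=> [/asboolP|h]; last exact/asboolP.
have de1 : de 1%:M = 1%:M by apply: Binj; rewrite /= deE ?mul1mx ?mulmx1 //; apply: hom1.
have deB x y : de (x - y) = de x - de y by rewrite /de mulmxBr mulmxBl.
have deM x y : hom X X x -> hom X X y -> de (x *m y) = de x *m de y.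
  move=> hx hy; apply: Binj; rewrite /= deE; last exact: homM hx hy.
  by rewrite -mulmxA deE // mulmxA deE // mulmxA.
have de0 x : hom X X x -> de x = 0 -> J x.
  move=> hx d0; split=> //; apply/negP => ux.
  have : B *m x = 0 by rewrite -deE // d0 mul0mx.
  move/(congr1 (mulmx^~ (invmx x))); rewrite mulmxK // mul0mx => B0.
  by move: Bf; rewrite /row_free B0 mxrank0.
have Jde x : J x -> de x = 0.
  move=> Jx; have Bx : B *m x = 0.
    have /submxP[D ->] : (B <= W)%MS by rewrite BW.
    by rewrite -mulmxA kill // mulmx0.
  by rewrite /de Bx mul0mx.
have clS : subring_closed S.
  split.
  - by apply/SP; exists 1%:M; [exact: hom1 | rewrite de1].
  - move=> _ _ /SP[x hx ->] /SP[y hy ->]; apply/SP; exists (x - y); last by rewrite deB.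
    exact: homB.
  - move=> _ _ /SP[x hx ->] /SP[y hy ->]; apply/SP; exists (x *m y); last by rewrite deM.
    exact: homM hx hy.
have [|v /SP[u hu ->] gen] := finite_subdomain_gen clS.
  move=> _ _ /SP[x hx ->] /SP[y hy ->]; rewrite -mulmxE -deM // => /de0 -/(_ (homM hx hy)) [_].
  rewrite unitmx_mul negb_and => /orP[nx|ny]; [left|right]; exact: Jde.
exists u => // x hx.
have deX j : de (u ^+ j) = de u ^+ j.
  elim: j => [|j IH]; first by rewrite !expr0 de1.
  by rewrite !exprS -!mulmxE deM ?IH //; apply: hom_exp.
have [|d0|[j dj]] := gen (de x); first by apply/SP; exists x.
  by left; apply: de0.
right; exists j; apply: de0; first by apply: homB => //; apply: hom_exp.
by rewrite deB deX dj subrr.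
Qed.

(** Let [u] generate the endomorphisms modulo the radical [J], and let [h] be monic of least degree
    with [h(u)] in [J]; it is irreducible because a product of units is a unit. Only [h(u)^N = 0] is
    known, so [u] is lifted to an exact root: [g = u^Q] with [Q = #|k| ^ (d * N)] satisfies
    [h(g) = h(u)^Q = 0], and [g] agrees with [u] modulo [J] because [h] divides X^Q - X. *)
Theorem indec_structure : exists (g : 'M[k]_m) (h : {poly k}),
  [/\ hom X X g, irreducible_poly h, h \is monic & pmx g h = 0] /\
  forall x, hom X X x -> exists a, J (x - pmx g a).
Proof.
have m0 := iX.1; have [u hu gen] := residue_generator.
have hp p : hom X X (pmx u p) by apply: hom_pmx.
pose P n := `[< exists2 p : {poly k}, p != 0 & size p = n /\ J (pmx u p) >].
have exP : exists n, P n.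
  have [p [p0 pu]] : exists p : {poly k}, p != 0 /\ pmx u p = 0.
    clear -m0; case: (m) m0 u => // m' _ u; exists (mxminpoly u).
    by rewrite pmxE mx_root_minpoly monic_neq0 ?mxminpoly_monic.
  exists (size p); apply/asboolP; exists p => //; split=> //; rewrite pu.
  exact: nonunit_endo0.
case: (ex_minnP exP) => n /asboolP[h0 nz0 [sz0 Jh0]] minn.
have minJ p : p != 0 -> J (pmx u p) -> (n <= size p)%N.
  by move=> pn Jp; apply: minn; apply/asboolP; exists p.
pose h := (lead_coef h0)^-1 *: h0.
have lc : (lead_coef h0)^-1 != 0 by rewrite invr_eq0 lead_coef_eq0.
have szh : size h = n by rewrite size_scale.
have hm : h \is monic by rewrite monicE lead_coefZ mulVf ?lead_coef_eq0.
have hn := monic_neq0 hm.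
have Jh : J (pmx u h) by rewrite pmxZ; apply: nonunit_endoZ.
have n1 : (1 < n)%N.
  rewrite ltnNge; apply/negP => n1.
  have /size1_polyC hC : (size h <= 1)%N by rewrite szh.
  have c0 : h`_0 != 0 by rewrite -polyC_eq0 -hC.
  case: Jh => _; rewrite hC pmxC => /negP; apply.
  by rewrite -scalemx1 unitmxZ ?unitmx1 // unitfE.
have hirr : irreducible_poly h.
  split; first by rewrite szh.
  move=> q sq qh; have [v hE] := dvdpP _ _ qh.
  have [v0 q0] : v != 0 /\ q != 0 by move: hn; rewrite hE mulf_eq0 negb_or => /andP.
  have [_] := Jh; rewrite hE pmxM unitmx_mul negb_and => /orP[nv|nq].
    have : (n <= size v)%N by apply: minJ => //; split.
    rewrite -szh hE size_mul //; move: sq v0 q0; rewrite -!size_poly_gt0.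
    by move: (size v) (size q) => a b; lia.
  rewrite -hE -dvdp_size_eqp // eqn_leq dvdp_leq //= szh; apply: minJ => //; by split.
have [d szd] : exists d, size h = d.+1 by exists n.-1; rewrite szh prednK // ltnW.
have Jdvd p : h %| p -> J (pmx u p).
  by case/dvdpP => v ->; rewrite pmxM; apply: nonunit_endoMl.
have [N hN] := indec_unit_nil iX Jh.1 Jh.2.
pose Q := (#|k| ^ (d * N))%N.
have hXQ : h %| 'X^Q - 'X.
  apply: dvdp_trans (irr_dvd_XcardB hirr hm szd) _.
  by rewrite /Q expnM; apply: dvdp_XcardB.
have d0 : (0 < d)%N by have := hirr.1; rewrite szd.
pose g := u ^+ Q; exists g, h; split; first split => //.
- exact: hom_exp.
- rewrite pmx_exp_card.
  have le : (N <= #|k| ^ (d * N))%N.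
    apply: leq_trans (_ : N <= d * N)%N _; first by rewrite leq_pmull.
    by apply: ltnW; apply: ltn_expl; exact: finNzRing_gt1.
  by rewrite -(subnKC le) exprD hN mul0r.
move=> x hx; have [Jx|[i Ji]] := gen x hx; first by exists 0; rewrite pmx0 subr0.
exists 'X^i; have -> : x - pmx g 'X^i = (x - u ^+ i) + pmx u ('X^i - ('X^Q) ^+ i).
  by rewrite pmxB !pmxXn !pmxX addrA subrK.
apply: nonunit_endoD => //; apply: Jdvd; rewrite -opprB dvdpNr subrXX.
by rewrite dvdp_mulr.
Qed.

End Structure.

(** * Homomorphisms and the radical under field extension *)

Section HomBaseChange.
Variables (E : finType) (k l : fieldType) (f : {rmorphism k -> l}).
Variables (m p : nat) (X : fam E k m) (Y : fam E k p).

(** Homomorphisms are the solutions of a homogeneous linear system over [k], and kernels and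
    intersections of row spaces commute with field extension. *)
Lemma hom_mapf_span (phi : 'M[l]_(m, p)) : hom (mapf f X) (mapf f Y) phi ->
  exists (c : 'I_(m * p) -> l) (psi : 'I_(m * p) -> 'M[k]_(m, p)),
    (forall j, hom X Y (psi j)) /\ phi = \sum_j c j *: map_mx f (psi j).
Proof.
move=> hphi.
pose A (e : E) : 'M[k]_(m * p) := lin_mx (mulmx (X e)) - lin_mx (mulmxr (Y e)).
have AE e (M : 'M_(m, p)) : mxvec M *m A e = mxvec (X e *m M - M *m Y e).
  by rewrite mulmxBr !mul_vec_lin /= linearB.
pose Ks : 'M[k]_(m * p) := (\bigcap_e kermx (A e))%MS.
have KsP (v : 'rV_(m * p)) : (v <= Ks)%MS -> hom X Y (vec_mx v).
  move/sub_bigcapmxP => vK e; apply/eqP; rewrite -subr_eq0; apply/eqP.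
  apply: (can_inj mxvecK); rewrite -AE vec_mxK linear0.
  by apply/sub_kermxP/vK.
have le : (mxvec phi <= map_mx f Ks)%MS.
  have -> : (map_mx f Ks :=: \bigcap_e map_mx f (kermx (A e)))%MS.
    rewrite /Ks; elim: (index_enum E) => [|e s IH]; first by rewrite !big_nil map_mx1.
    rewrite !big_cons; apply: eqmx_trans (map_capmx _ _ _) _.
    by apply: cap_eqmx.
  apply/sub_bigcapmxP => e _; rewrite map_kermx; apply/sub_kermxP.
  have -> : map_mx f (A e) = lin_mx (mulmx (mapf f X e)) - lin_mx (mulmxr (mapf f Y e)).
    by rewrite map_mxB; congr (_ - _); apply: map_lin_mx => B /=; rewrite map_mxM ffunE.
  by rewrite mulmxBr !mul_vec_lin /= hphi subrr.
case/submxP: le => D eD; exists (D 0), (fun j => vec_mx (row j Ks)); split=> [j|].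
  by apply: KsP; apply: row_sub.
rewrite -[phi]mxvecK eD mulmx_sum_row linear_sum; apply: eq_bigr => j _.
by rewrite linearZ /= -map_row map_vec_mx.
Qed.

End HomBaseChange.

Section Radical.
Variables (E : finType) (k : finFieldType) (m : nat) (X : fam E k m).
Hypothesis iX : indec X.

Definition structure (g : 'M[k]_m) (h : {poly k}) : Prop :=
  [/\ hom X X g, irreducible_poly h, h \is monic & pmx g h = 0] /\
  forall x, hom X X x -> exists a, nonunit_endo X (x - pmx g a).

Variables (l : fieldType) (f : {rmorphism k -> l}).
Local Notation XL := (mapf f X).
Local Notation U i := (map_mx f (radflag X i)).

(** Stands for membership in the radical over [l]. It refers to the flag extended from [k], so
    nothing has to be known about the endomorphism ring over [l]. *)
Definition lowers (y : 'M[l]_m) : Prop := forall i, (U i *m y <= U i.+1)%MS.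
Definition preserves (y : 'M[l]_m) : Prop := forall i, (U i *m y <= U i)%MS.

Lemma lowersD x y : lowers x -> lowers y -> lowers (x + y).
Proof. by move=> lx ly i; rewrite mulmxDr addmx_sub. Qed.

Lemma lowersZ c x : lowers x -> lowers (c *: x).
Proof. by move=> lx i; rewrite -scalemxAr scalemx_sub. Qed.

Lemma lowers0 : lowers 0. Proof. by move=> i; rewrite mulmx0 sub0mx. Qed.

Lemma lowersMl x y : preserves x -> lowers y -> lowers (x *m y).
Proof. by move=> px ly i; rewrite mulmxA; apply: submx_trans (submxMr _ (px i)) (ly i). Qed.

Lemma lowersMr x y : lowers x -> preserves y -> lowers (x *m y).
Proof. by move=> lx py i; rewrite mulmxA; apply: submx_trans (submxMr _ (lx i)) (py i.+1). Qed.

Lemma lowers_sum I (r : seq I) (P : pred I) F :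
  (forall i, P i -> lowers (F i)) -> lowers (\sum_(i <- r | P i) F i).
Proof. by move=> lF; elim/big_ind: _; [exact: lowers0 | exact: lowersD | ]. Qed.

Lemma lowers_nil y : lowers y -> y ^+ m = 0.
Proof.
move=> ly; have le i : (y ^+ i <= U i)%MS.
  elim: i => [|i IH]; first by rewrite map_mx1 submx1.
  by rewrite exprSr -mulmxE; apply: submx_trans (submxMr _ IH) (ly i).
by apply/eqP; rewrite -submx0 -(map_mx0 f) -(radflag0 iX).
Qed.

Lemma nonunit_lowers x : nonunit_endo X x -> lowers (map_mx f x).
Proof. by move=> Jx i; rewrite -map_mxM map_submx; apply: radflag_lower. Qed.

Lemma hom_preserves phi : hom XL XL phi -> preserves phi.
Proof.
case/hom_mapf_span => c [psi [hpsi ->]] i; rewrite mulmx_sumr; apply: summx_sub => j _.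
by rewrite -scalemxAr scalemx_sub // -map_mxM map_submx radflag_stable.
Qed.

Lemma structure_mapf g h phi : structure g h -> hom XL XL phi ->
  exists a, lowers (phi - pmx (map_mx f g) a).
Proof.
move=> [_ st] /hom_mapf_span[c [psi [hpsi ->]]].
have ex j := st _ (hpsi j); pose a j := xget 0 [set a | nonunit_endo X (psi j - pmx g a)].
have aP j : nonunit_endo X (psi j - pmx g (a j)) by have [b hb] := ex j; apply: (xgetPex 0 (ex j)).
exists (\sum_j c j *: map_poly f (a j)); rewrite pmx_sum -sumrB.
apply: lowers_sum => j _; rewrite pmxZ -scalerBr; apply: lowersZ.
by rewrite -map_pmx -map_mxB; apply: nonunit_lowers.
Qed.

(** The power [j + 1] of the corner is [i (y p i)^j y p], and [y p i] still lowers the flag, hence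
    is nilpotent. *)
Lemma lowers_corner a (i : 'M[l]_(a, m)) (p : 'M[l]_(m, a)) y :
  lowers y -> hom XL XL (p *m i) -> exists N, (i *m y *m p) ^+ N = 0.
Proof.
move=> ly he; have lye : lowers (y *m (p *m i)) by apply: lowersMr (hom_preserves he).
exists m.+1; rewrite exprS -mulmxE.
have aux j : i *m y *m p *m (i *m y *m p) ^+ j = i *m (y *m (p *m i)) ^+ j *m y *m p.
  elim: j => [|j IH]; first by rewrite !expr0 -[1 in LHS]/(1%:M) -[1 in RHS]/(1%:M) !mulmx1.
  by rewrite exprSr -mulmxE mulmxA IH exprSr -mulmxE !mulmxA.
by rewrite aux lowers_nil // mulmx0 !mul0mx.
Qed.

End Radical.

(** The residue field of the endomorphism ring is [k] itself: a form of absolute indecomposability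
    that mentions no extension of [k]. *)
Definition split_end (E : finType) (k : fieldType) m (X : fam E k m) : Prop :=
  (0 < m)%N /\ forall phi, hom X X phi -> exists c N, (phi - c%:M) ^+ N = 0.

(** For an idempotent [phi], [(phi - c)^j phi = (1 - c)^j phi], so either [phi = 0] or [c = 1]. In
    the second case [phi - 1] is nilpotent and the opposite of an idempotent, hence 0. *)
Lemma split_indec (E : finType) (k : fieldType) m (X : fam E k m) :
  split_end X -> indec X.
Proof.
case=> m0 sX; split=> // phi hphi idem; have [c [N e]] := sX phi hphi.
have pw j : (phi - c%:M) ^+ j *m phi = (1 - c) ^+ j *: phi.
  elim: j => [|j IH]; first by rewrite !expr0 -[1 in LHS]/(1%:M) mul1mx scale1r.
  rewrite exprSr -mulmxE -mulmxA; have -> : (phi - c%:M) *m phi = (1 - c) *: phi.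
    by rewrite mulmxBl idem mul_scalar_mx scalerBl scale1r.
  by rewrite -scalemxAr IH scalerA exprS.
have := pw N; rewrite e mul0mx => /esym/eqP; rewrite scaler_eq0 expf_eq0.
case/orP => [/andP[_ /eqP c1]|/eqP]; last by left.
right; have c1' : c = 1 by apply/esym/eqP; rewrite -subr_eq0 c1.
have idem' : (phi - 1%:M) *m (phi - 1%:M) = - (phi - 1%:M).
  by rewrite mulmxBl mul1mx mulmxBr mulmx1 idem subrr sub0r.
apply/eqP; rewrite -subr_eq0; apply/eqP.
have pw' j : (phi - 1%:M) ^+ j.+1 = (-1) ^+ j *: (phi - 1%:M).
  elim: j => [|j IH]; first by rewrite expr1 expr0 scale1r.
  by rewrite exprSr IH -mulmxE -scalemxAl idem' scalerN -scaleNr exprS mulN1r.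
rewrite c1' in e; have := pw' N; rewrite exprSr e mul0r => /esym/eqP.
by rewrite scaler_eq0 expf_eq0 oppr_eq0 oner_eq0 andbF /= => /eqP.
Qed.

Section Degree.
Variables (E : finType) (k : finFieldType) (m : nat) (X : fam E k m).

(** Write [g] as [c] plus a nilpotent. Then [h(g) - h(c)] is nilpotent and [h(g) = 0], so the scalar
    [h(c)] vanishes and the irreducible [h] has a root in [k]. *)
Lemma split_structure g h : split_end X -> structure X g h -> size h = 2.
Proof.
move=> sX; have iX := split_indec sX; case: sX => m0 sX [[hg hirr hm gh] _].
have [c [N e]] := sX g hg.
have rc : root h c.
  have /dvdpP[q eq] : ('X - c%:P) %| (h - h.[c]%:P).
    by rewrite dvdp_XsubCl /root !hornerE subrr.
  have e2 : pmx g (h - h.[c]%:P) ^+ N = 0.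
    rewrite eq mulrC -pmxXn exprMn pmxM pmxXn pmxB pmxX pmxC e mul0mx //.
  move: e2; rewrite pmxB gh pmxC sub0r => e2; rewrite /root -oppr_eq0.
  have := nil_nonunit iX e2.
  have -> : - (h.[c])%:M = (- h.[c]) *: 1%:M :> 'M_m by rewrite scalemx1 raddfN.
  by case: eqP => // /eqP nz; rewrite unitmxZ ?unitmx1 // unitfE.
have : 'X - c%:P %= h by apply: hirr.2; rewrite ?size_XsubC ?dvdp_XsubCl.
by move/eqp_size; rewrite size_XsubC.
Qed.

(** If [h] is linear then [g] is a scalar, and every endomorphism over [l] is a scalar plus a map
    that lowers the flag. *)
Lemma structure_split (l : fieldType) (f : {rmorphism k -> l}) g h :
  indec X -> structure X g h -> size h = 2 -> split_end (mapf f X).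
Proof.
move=> iX st sz; have [[hg hirr hm gh] _] := st; split=> [|phi hphi]; first exact: iX.1.
have [a la] := structure_mapf st hphi.
have eh : h = 'X - (- h`_0)%:P.
  rewrite polyCN opprK; apply/polyP => i; rewrite coefD coefX coefC.
  case: i => [|[|i]]; rewrite ?add0r ?addr0 //.
    by have := monicP hm; rewrite lead_coefE sz.
  by rewrite nth_default // sz.
have eg : g = (- h`_0)%:M.
  by move: gh; rewrite {1}eh pmxB pmxX pmxC => /eqP; rewrite subr_eq0 => /eqP.
have sc q c : pmx (c%:M : 'M[l]_m) q = (q.[c])%:M.
  elim/poly_ind: q => [|q d IH]; first by rewrite pmx0 horner0 raddf0.
  by rewrite pmxD pmxM pmxX pmxC IH !hornerE -scalar_mxM raddfD.
exists (a.[f (- h`_0)]), m.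
by move: la; rewrite eg map_scalar_mx sc => /(lowers_nil iX).
Qed.

(** The eigenprojection at [z] is an idempotent endomorphism over [l], hence 0 or 1. Either value
    gives a polynomial that kills [g], of degree [d - 1] respectively 1, while none of degree below
    [d] exists. *)
Lemma mapf_indec_size (l : fieldType) (f : {rmorphism k -> l}) g h z :
  structure X g h -> root (map_poly f h) z -> indec (mapf f X) -> size h = 2.
Proof.
move=> [[hg hirr hm gh] _] rz [m0 iL].
have [d szd] : exists d, size h = d.+1 by exists (size h).-1; rewrite prednK // ltnW ?hirr.1.
have d0 : (0 < d)%N by have := hirr.1; rewrite szd.
set hL := map_poly f h in rz.
have ghL : pmx (map_mx f g) hL = 0 by rewrite -map_pmx gh map_mx0.
have h1E : hL %/ ('X - z%:P) * ('X - z%:P) = hL by rewrite divpK // dvdp_XsubCl.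
set h1 := hL %/ _ in h1E.
(* [h] divides X^(|k|^d) - X, whose derivative is -1; so [z] is a simple root. *)
have simple : h1.[z] != 0.
  apply/negP => /eqP h1z.
  have /dvdpP[v ev] : hL %| 'X^(#|k| ^ d) - 'X.
    have := irr_dvd_XcardB hirr hm szd.
    by rewrite -(dvdp_map f) rmorphB /= map_polyXn map_polyX.
  have := congr1 (fun P => P^`().[z]) ev.
  have [p [e [pr_p ch e0 cF]]] := finfield_card k.
  have Q0 : (#|k| ^ d)%:R = 0 :> l.
    have chl : p \in [pchar l] by apply: (rmorph_pchar f).
    by apply/eqP; rewrite cF -expnM natrX expf_eq0 muln_gt0 e0 d0 (pcharf0 chl) eqxx.
  rewrite derivB derivXn derivX hornerD hornerN hornerC -scaler_nat hornerZ Q0 mul0r sub0r.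
  rewrite derivM hornerD !hornerM (rootP rz) mulr0 add0r.
  rewrite -[hL in hL^`()]h1E derivM hornerD !hornerM derivXsubC h1z mul0r addr0 hornerXsubC.
  by rewrite subrr !mulr0 => /eqP; rewrite oppr_eq0 oner_eq0.
pose ep := epr (map_mx f g) hL z.
have hep : hom (mapf f X) (mapf f X) ep by apply/hom_epr/hom_mapf.
have epi : ep *m ep = ep by apply: epr_idem.
have ege : map_mx f g *m ep = z *: ep by apply: epr_eigen.
(* The minimal polynomial of [g] is unchanged by field extension, and the irreducible [h] divides it
   because it is not coprime to it. *)
have minL q : q != 0 -> pmx (map_mx f g) q = 0 -> (d < size q)%N.
  move=> q0 gq.
  have : exists2 M : {poly k}, M \is monic & pmx g M = 0 /\
      forall q : {poly l}, pmx (map_mx f g) q = 0 -> map_poly f M %| q.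
    clear -m0; case: (m) m0 g => // m' _ g'; exists (mxminpoly g').
      exact: mxminpoly_monic.
    split=> [|q']; first by rewrite pmxE mx_root_minpoly.
    by rewrite pmxE -mxminpoly_map; apply: mxminpoly_min.
  case=> M Mm [gM minM].
  have hM : h %| M.
    have sM : size (gcdp h M) != 1%N.
      apply/negP => /eqP s1; have /Bezout_eq1_coprimepP[[a b] /= ab] : coprimep h M by rewrite /coprimep s1.
      have := congr1 (pmx g) ab; rewrite pmxD !pmxM gh gM !mulmx0 addr0 pmx1 => /esym e1.
      by have := mxrank1 k m; rewrite e1 mxrank0 => m00; rewrite -m00 in m0.
    by rewrite -(eqp_dvdl _ (hirr.2 _ sM (dvdp_gcdl h M))) dvdp_gcdr.
  have := dvdp_leq q0 (dvdp_trans (_ : hL %| map_poly f M) (minM q gq)).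
  by rewrite dvdp_map => /(_ hM); rewrite size_map_poly szd.
have [e0|e1] := iL ep hep epi.
  have : pmx (map_mx f g) h1 = 0.
    move/eqP: e0; rewrite /ep /epr scaler_eq0 invr_eq0 -/h1 (negPf simple) /=.
    by move/eqP.
  have h10 : h1 != 0 by apply: contraNneq simple => ->; rewrite horner0.
  move/(minL _ h10); rewrite /h1 size_divp ?polyXsubC_eq0 // size_XsubC size_map_poly szd subn1 ltnn //.
have : pmx (map_mx f g) ('X - z%:P) = 0.
  by rewrite pmxB pmxX pmxC; move: ege; rewrite e1 mulmx1 scalemx1 => ->; rewrite subrr.
move/minL; rewrite polyXsubC_eq0 size_XsubC => /(_ isT); rewrite szd.
by move: d0; lia.
Qed.

End Degree.

(** * The pieces of an indecomposable over a larger finite field *)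

Section Components.
Variables (E : finType) (F K : finFieldType) (iota : {rmorphism F -> K}) (r : nat).
Hypothesis cardK : #|K| = (#|F| ^ r)%N.
Variables (m : nat) (V : fam E F m) (g : 'M[F]_m) (h : {poly F}) (d : nat).
Hypotheses (iV : indec V) (st : structure V g h) (szh : size h = d.+1).

Local Notation VK := (mapf iota V).
Local Notation gK := (map_mx iota g).
Local Notation hK := (map_poly iota h).
Local Notation eps x := (epr gK hK x).

Let hirr : irreducible_poly h. Proof. by case: st => [[]]. Qed.
Let hmon : h \is monic. Proof. by case: st => [[]]. Qed.
Let hg : hom V V g. Proof. by case: st => [[]]. Qed.
Let gh0 : pmx g h = 0. Proof. by case: st => [[]]. Qed.
Let ghK : pmx gK hK = 0. Proof. by rewrite -map_pmx gh0 map_mx0. Qed.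
Let hgK : hom VK VK gK. Proof. exact: hom_mapf. Qed.

Lemma root_simple x : root hK x -> (hK %/ ('X - x%:P)).[x] != 0.
Proof.
move=> rx; apply: (irr_div_neq0 cardK hirr hmon szh rx).
by rewrite (irr_trajectP cardK hirr hmon szh rx).
Qed.

Lemma component_rank x b (u : 'M[F]_(b, m)) : root hK x -> (u *m g <= u)%MS ->
  (d * \rank (map_mx iota u *m eps x))%N = \rank u.
Proof. by move=> rx; apply: (rank_epr cardK hirr hmon szh rx gh0). Qed.

Definition component a (x : K) (i : 'M[K]_(a, m)) (p : 'M[K]_(m, a)) : Prop :=
  [/\ root hK x, i *m p = 1%:M & p *m i = eps x].

Lemma component_exists x : root hK x -> exists a i p, @component a x i p.
Proof.
move=> rx; have [|i [p [ip pi]]] := @mx_idem_split _ _ (eps x).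
  by apply: epr_idem => //; apply: root_simple.
by exists (\rank (eps x)), i, p.
Qed.

Section OneComponent.
Variables (a : nat) (x : K) (i : 'M[K]_(a, m)) (p : 'M[K]_(m, a)).
Hypothesis cx : component x i p.
Local Notation W := (retr i p VK).

Lemma component_hom : hom W VK i /\ hom VK W p.
Proof.
by case: cx => _ ip pi; apply: hom_retr => //; rewrite pi; apply: hom_epr.
Qed.

Lemma component_summand : summand W VK.
Proof.
by have [hi hp] := component_hom; exists i, p; case: cx.
Qed.

Lemma component_mult e : (d * \rank (W e))%N = \rank (V e).
Proof.
case: cx => rx ip pi; rewrite -(component_rank (u := V e) rx); last by rewrite hg submxMl.
congr (_ * _)%N; rewrite -pi mulmxA [in RHS]mxrankMfree; last by apply/row_freeP; exists p.
have [hi hp] := component_hom; have := hp e; rewrite ffunE => ->.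
by rewrite eqmxMfull //; apply/row_fullP; exists i.
Qed.

(** An endomorphism [phi] of the piece, extended by 0, is [al(g)] up to a map that lowers the flag.
    On the piece [g] acts as [x], so [phi - al(x)] is a corner of a lowering map and therefore
    nilpotent. *)
Lemma component_split : split_end W.
Proof.
case: (cx) => rx ip pi; have [hi hp] := component_hom; split.
  have : (d * \rank (eps x) = m)%N.
    have := component_rank (u := 1%:M) rx (submx1 _).
    by rewrite map_mx1 mul1mx mxrank1.
  have : (\rank (eps x) <= a)%N by rewrite -pi; apply: leq_trans (mxrankM_maxr _ _) (rank_leq_row _).
  by move=> le dm; have := iV.1; rewrite -dm muln_gt0 => /andP[_ /leq_trans]; apply.
move=> phi hphi; have hphi' : hom VK VK (p *m phi *m i).
  exact: homM (homM hp hphi) hi.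
have [al low] := structure_mapf st hphi'.
exists al.[x]; have [N eN] : exists N, (i *m (p *m phi *m i - pmx gK al) *m p) ^+ N = 0.
  by apply: (lowers_corner iV low); rewrite pi; apply: hom_epr.
exists N; rewrite -[RHS]eN; congr (_ ^+ N).
rewrite mulmxBr mulmxBl !mulmxA ip mul1mx -!mulmxA ip mulmx1; congr (_ - _).
have -> : i *m (pmx gK al *m p) = i *m (p *m i) *m (pmx gK al *m p) by rewrite (mulmxA i p) ip mul1mx.
rewrite pi -mulmxA (mulmxA (eps x)) (epr_pmxr ghK rx) -(scalemxAl al.[x]) -(scalemxAr al.[x]) -pi.
by rewrite -mulmxA ip mulmx1 ip scalemx1.
Qed.

End OneComponent.

(** A homomorphism between the pieces at [x] and [y] is a polynomial in [g] plus a lowering map, cut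
    by the two eigenprojections. These are orthogonal and commute with [g], so only the lowering
    part remains; an isomorphism would make the identity of a piece nilpotent. *)
Lemma component_noniso a b x y (i : 'M[K]_(a, m)) (p : 'M[K]_(m, a))
    (j : 'M[K]_(b, m)) (q : 'M[K]_(m, b)) :
  component x i p -> component y j q -> x != y ->
  ~ isof (retr i p VK) (retr j q VK).
Proof.
move=> cx cy xy [f [f' [hf ff' f'f]]].
have [hi hp] := component_hom cx; have [hj hq] := component_hom cy.
have sW := component_split cx.
case: (cx) (cy) => rx ip pi [ry jq qj].
have hf' := hom_inv hf ff' f'f.
have hA : hom VK VK (p *m f *m j) by apply: homM (homM hp hf) hj.
have hB : hom VK VK (q *m f' *m i) by apply: homM (homM hq hf') hi.
have [al low] := structure_mapf st hA.
have hex : hom VK VK (eps x) by apply: hom_epr.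
have hey : hom VK VK (eps y) by apply: hom_epr.
have lowA : lowers V iota (p *m f *m j).
  have -> : p *m f *m j = eps x *m (p *m f *m j - pmx gK al) *m eps y.
    rewrite mulmxBr mulmxBl (epr_pmxr ghK rx) -(scalemxAl al.[x]).
    have -> : eps x *m eps y = 0.
      have [dr ux hE] := irr_roots cardK hirr hmon szh ry.
      have xin : x \in traject (frob iota) y d by rewrite (irr_trajectP cardK hirr hmon szh ry).
      have yin : y \in traject (frob iota) y d by rewrite (irr_trajectP cardK hirr hmon szh ry).
      by rewrite hE epr_orth // -hE.
    by rewrite scaler0 subr0 -pi -qj -!mulmxA (mulmxA i p) ip mul1mx (mulmxA j q) jq mul1mx.
  apply: lowersMr (hom_preserves hey); exact: lowersMl (hom_preserves hex) low.
have e1 : p *m f *m j *m (q *m f' *m i) = eps x.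
  by rewrite -!mulmxA (mulmxA j q) jq mul1mx (mulmxA f) ff' mul1mx pi.
have lowE : lowers V iota (eps x) by rewrite -e1; apply: lowersMr (hom_preserves hB).
have [N eN] : exists N, (i *m eps x *m p) ^+ N = 0.
  by apply: (lowers_corner iV lowE); rewrite pi.
have : i *m eps x *m p = 1%:M by rewrite -pi mulmxA ip mul1mx ip.
move=> e2; have := nil_nonunit (split_indec sW) eN.
by rewrite e2 unitmx1.
Qed.

(* If h had no root in K near the residue of i g p, then g - c would be
   invertible in K[g] and the identity of W a sum of two non-units. *)
Lemma split_summand_root a (W : fam E K a) : split_end W -> summand W VK ->
  exists x, root hK x.
Proof.
move=> sW [i [p [hi hp ip]]]; have iW := split_indec sW; have [a0 sW'] := sW.
have hx : hom W W (i *m gK *m p) by apply: homM (homM hi hgK) hp.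
have [c [N eN]] := sW' _ hx; exists c; apply/negPn/negP => nr.
have cop : coprimep ('X - c%:P) hK by rewrite coprimep_sym coprimep_XsubC.
have /Bezout_eq1_coprimepP[[b v] /= bez] := cop.
have he : hom VK VK (p *m i) by apply: homM hp hi.
have [al low] := structure_mapf st he.
set n := p *m i - pmx gK al in low.
pose A := pmx gK ('X - c%:P); pose B := pmx gK b.
have hA : hom VK VK A by apply: hom_pmx.
have hB : hom VK VK B by apply: hom_pmx.
have AB : A *m B = 1%:M.
  have := congr1 (pmx gK) bez; rewrite pmxD !pmxM ghK mulmx0 addr0 pmx1 => <-.
  by rewrite /A /B pmxC2.
have ie : i *m (p *m i) = i by rewrite mulmxA ip mul1mx.
have ep : p *m i *m p = p by rewrite -mulmxA ip mulmx1.
have id : 1%:M = i *m A *m p *m (i *m B *m p) + i *m (n - A *m n *m B) *m p.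
  have -> : i *m A *m p *m (i *m B *m p) = i *m (A *m (p *m i) *m B) *m p by rewrite !mulmxA.
  have -> : p *m i = n + pmx gK al by rewrite /n subrK.
  have -> : A *m (n + pmx gK al) *m B = A *m n *m B + pmx gK al.
    by rewrite mulmxDr mulmxDl /A pmxC2 -(mulmxA (pmx gK al)) AB mulmx1.
  rewrite -mulmxDl -mulmxDr addrC addrA subrK /n subrK.
  by rewrite ie ip.
have lowD : lowers V iota (n - A *m n *m B).
  apply: lowersD => //; rewrite -scaleN1r; apply: lowersZ.
  by apply: lowersMr (hom_preserves hB); apply: lowersMl (hom_preserves hA) low.
have [N' eN'] := lowers_corner iV (i := i) (p := p) lowD he.
have n2 := nil_nonunit iW eN'.
have hAp : hom W W (i *m A *m p) by apply: homM (homM hi hA) hp.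
have hBp : hom W W (i *m B *m p) by apply: homM (homM hi hB) hp.
have n1 : i *m A *m p \notin unitmx.
  have -> : i *m A *m p = i *m gK *m p - c%:M.
    rewrite /A pmxB pmxX pmxC mulmxBr mulmxBl; congr (_ - _).
    by rewrite mul_mx_scalar -scalemxAl ip scalemx1.
  by have := nil_nonunit iW eN.
have hn : hom VK VK n by apply: homB => //; apply: hom_pmx.
have h2 : hom W W (i *m (n - A *m n *m B) *m p).
  apply: homM hp; apply: homM hi _; apply: homB => //.
  exact: homM (homM hA hn) hB.
have n3 : i *m A *m p *m (i *m B *m p) \notin unitmx by rewrite unitmx_mul (negPf n1).
by have := nonunitD iW (homM hAp hBp) h2 n3 n2; rewrite -id unitmx1.
Qed.

(** The identity of [W] is the sum of the maps [i *m eps y *m p] over the roots [y]; by locality one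
    of them is invertible. *)
Lemma split_summand_component a (W : fam E K a) x : split_end W -> summand W VK ->
  root hK x -> exists y b i p, @component b y i p /\ isof W (retr i p VK).
Proof.
move=> sW [i [p [hi hp ip]]] rx; have iW := split_indec sW; have [a0 _] := sW.
have [dr ux hE] := irr_roots cardK hirr hmon szh rx.
have hx y : hom W W (i *m eps y *m p) by apply: homM (homM hi (hom_epr _ _ hgK)) hp.
have [[y [yin uy]]|no] := pselect (exists y, y \in traject (frob iota) x d /\ i *m eps y *m p \in unitmx).
  have ry : root hK y by rewrite -(irr_trajectP cardK hirr hmon szh rx).
  have [b [j [q cy]]] := component_exists ry.
  exists y, b, j, q; split=> //.
  have [hj hq] := component_hom cy.
  apply: (summand_indec a0 (split_indec (component_split cy))).
  exists (invmx (i *m eps y *m p) *m (i *m q)), (j *m p); split.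
  - by apply: homM (homM hi hq); apply: hom_invmx.
  - exact: homM hj hp.
  - case: (cy) => _ jq <-.
    case: (cy) uy => _ _ <- uy.
    by rewrite -(mulmxA (invmx _)) (mulmxA (i *m q)) -(mulmxA i q) mulVmx.
have : i *m 1%:M *m p \notin unitmx.
  rewrite -(epr_sum ux (s := gK)) -?hE // mulmx_sumr mulmx_suml big_seq.
  suff [] : hom W W (\sum_(y <- traject (frob iota) x d | y \in traject (frob iota) x d) i *m eps y *m p) /\
    \sum_(y <- traject (frob iota) x d | y \in traject (frob iota) x d) i *m eps y *m p \notin unitmx by [].
  elim/big_ind: _ => [|u v [hu nu] [hv nv]|y yin].
  - split; first exact: hom0.
    by apply: (@nil_nonunit _ _ _ _ iW _ 1); rewrite expr1.
  - by split; [exact: homD | exact: (nonunitD iW)].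
  - by split=> //; apply/negP => uy; apply: no; exists y.
by rewrite mulmx1 ip unitmx1.
Qed.

End Components.

Section CommonSummand.
Variables (E : finType) (F K : finFieldType) (iota : {rmorphism F -> K}).

(** The maps between the two base changes are combinations of homomorphisms [psi u] and [chi v] over
    [F]. If no [psi u *m chi v] were invertible, all would lie in the radical, and the projector
    onto [W] would lower the flag: idempotent and nilpotent, it would be 0. *)
Lemma common_summand_iso m m' a (V : fam E F m) (V' : fam E F m') (W : fam E K a) :
  (0 < a)%N -> indec V -> indec V' -> summand W (mapf iota V) -> summand W (mapf iota V') ->
  isof V V'.
Proof.
move=> a0 iV iV' [i [p [hi hp ip]]] [j [q [hj hq jq]]].
have [c [psi [hpsi e1]]] := hom_mapf_span (homM hp hj).
have [c' [chi [hchi e2]]] := hom_mapf_span (homM hq hi).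
have [[u [v uv]]|no] := pselect (exists u v, psi u *m chi v \in unitmx).
  apply: summand_indec iV.1 iV' _.
  exists (psi u), (chi v *m invmx (psi u *m chi v)); split=> //.
    by apply: homM (hchi v) _; apply: hom_invmx => //; apply: homM (hpsi u) (hchi v).
  by rewrite mulmxA mulmxV.
have low : lowers V iota (p *m j *m (q *m i)).
  rewrite e1 e2 mulmx_suml; apply: lowers_sum => u _; rewrite mulmx_sumr.
  apply: lowers_sum => v _; rewrite -scalemxAl -scalemxAr scalerA; apply: lowersZ.
  rewrite -map_mxM; apply: nonunit_lowers; split; first exact: homM (hpsi u) (hchi v).
  by apply/negP => uv; apply: no; exists u, v.
have e : p *m j *m (q *m i) = p *m i by rewrite -mulmxA (mulmxA j) jq mul1mx.
have pi j' : (p *m i) ^+ j'.+1 = p *m i.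
  elim: j' => [|j' IH]; first by rewrite expr1.
  by rewrite exprS IH -mulmxE -mulmxA (mulmxA i) ip mul1mx.
have := lowers_nil iV low; rewrite e => pi0'.
have pi0 : p *m i = 0 by have := pi m.-1; rewrite (prednK iV.1) pi0' => <-.
have : \rank (1%:M : 'M[K]_a) = 0%N by rewrite -[1%:M]mul1mx -{1}ip -ip -mulmxA (mulmxA p) pi0 mul0mx mulmx0 mxrank0.
by rewrite mxrank1 => a00; rewrite a00 in a0.
Qed.

End CommonSummand.

(** * Counting isomorphism classes, change of field *)

Section Transversals.
Variables (T : Type) (iso : T -> T -> Prop).
Hypotheses (isoxx : forall x, iso x x) (isoC : forall x y, iso x y -> iso y x)
  (isoT : forall y x z, iso x y -> iso y z -> iso x z).

(** Representatives are given through an indexing [f], since the classes over [K] are naturally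
    indexed by pairs of a representation over [F] and a root. *)
Definition transv (P : T -> Prop) (I : eqType) (L : seq I) (f : I -> T) : Prop :=
  [/\ uniq L, forall i, i \in L -> P (f i),
      forall i j, i \in L -> j \in L -> iso (f i) (f j) -> i = j
    & forall x, P x -> exists2 i, i \in L & iso x (f i)].

End Transversals.

Lemma transv_leq (T T' : Type) (iso : T -> T -> Prop) (iso' : T' -> T' -> Prop)
    (P : T -> Prop) (P' : T' -> Prop) (I I' : eqType) (L : seq I) (L' : seq I') f f'
    (R : T -> T' -> Prop) :
  (forall x, iso x x) -> (forall x y, iso' x y -> iso' y x) ->
  (forall y x z, iso' x y -> iso' y z -> iso' x z) ->
  transv iso P L f -> transv iso' P' L' f' ->
  (forall x, P x -> exists2 y, P' y & R x y) ->
  (forall x x' y y', R x y -> R x' y' -> P x -> P x' -> P' y -> P' y' -> iso' y y' -> iso x x') ->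
  (size L <= size L')%N.
Proof.
move=> isoxx isoC isoT [uL PL iL sL] [uL' PL' iL' sL'] tot inj.
have ex i : i \in L -> exists j, j \in L' /\ exists2 y, P' y /\ R (f i) y & iso' y (f' j).
  by move=> /PL/tot[y Py Ry]; have [j jL ij] := sL' y Py; exists j; split => //; exists y.
case: L uL PL iL sL ex => [//|i0 L0]; set L := i0 :: L0 => uL PL iL sL ex.
have [j0 _] := ex i0 (mem_head _ _).
have [g gP] : exists g : I -> I', forall i, i \in L ->
    g i \in L' /\ exists2 y, P' y /\ R (f i) y & iso' y (f' (g i)).
  have ex' i : exists j, i \in L ->
      j \in L' /\ exists2 y, P' y /\ R (f i) y & iso' y (f' j).
    by have [/ex[j hj]|ni] := boolP (i \in L); [exists j | exists j0].
  by have [g gP] := boolp.choice ex'; exists g.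
have <- : size (map g L) = size L by rewrite size_map.
apply: uniq_leq_size => [|_ /mapP[i iin ->]]; last by case: (gP i iin).
rewrite map_inj_in_uniq // => i j iin jin eg; apply: iL => //.
have [_ [y [Py Ry] yi]] := gP i iin; have [_ [y' [Py' Ry'] yj]] := gP j jin.
apply: inj Ry Ry' (PL _ iin) (PL _ jin) Py Py' _.
by apply: isoT yi _; rewrite eg; apply: isoC.
Qed.

Lemma uniq_flatten_map (I T : eqType) (s : seq I) (t : I -> seq T) (key : T -> I) :
  uniq s -> (forall i, i \in s -> uniq (t i)) ->
  (forall i x, i \in s -> x \in t i -> key x = i) -> uniq (flatten (map t s)).
Proof.
elim: s => [//|i s IH] /= /andP[ni us] ut kt; rewrite cat_uniq ut ?mem_head //= IH //; first last.
- by move=> j x js; apply: kt; rewrite inE js orbT.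
- by move=> j js; apply: ut; rewrite inE js orbT.
rewrite andbT; apply/hasPn => x /flattenP[_ /mapP[j js ->] xj]; apply/negP => xi.
have e1 := kt i x (mem_head _ _) xi.
have e2 : key x = j by apply: kt => //; rewrite inE js orbT.
by move: ni; rewrite -e1 e2 js.
Qed.

Lemma size_flatten_map (I T : Type) (s : seq I) (t : I -> seq T) :
  size (flatten (map t s)) = (\sum_(i <- s) size (t i))%N.
Proof. by rewrite size_flatten sumnE /shape -map_comp big_map. Qed.

Lemma card_equivalence_transv (T : finType) (iso : T -> T -> Prop) (P : T -> Prop) :
  (forall x, iso x x) -> (forall x y, iso x y -> iso y x) ->
  (forall y x z, iso x y -> iso y z -> iso x z) ->
  exists L : seq T, transv iso P L id /\
    size L = #|equivalence_partition (fun x y => `[< iso x y >]) (finset (fun x => `[< P x >]))|.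
Proof.
move=> isoxx isoC isoT; pose R : rel T := fun x y => `[< iso x y >].
pose D : {set T} := finset (fun x => `[< P x >]); rewrite -/R -/D.
have eqR : {in D & &, equivalence_rel R}.
  move=> x y z _ _ _; split; first exact/asboolP.
  move=> /asboolP xy; apply/asboolP/asboolP => h; last exact: isoT xy h.
  exact: isoT (isoC _ _ xy) h.
have pt := equivalence_partitionP eqR.
set Q := equivalence_partition R D in pt *.
have tX := transversalP pt; set X := transversal Q D in tX.
exists (enum X); split; last by rewrite -cardE (card_transversal tX).
have XD := transversal_sub tX.
split; first exact: enum_uniq.
- by move=> x; rewrite mem_enum => /(fintype.subsetP XD); rewrite inE => /asboolP.
- move=> x y; rewrite !mem_enum => xX yX xy.
  have xD := fintype.subsetP XD _ xX; have yD := fintype.subsetP XD _ yX.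
  apply: (finset.pblock_inj tX xX yX); apply/eqP.
  rewrite finset.eq_pblock ?(finset.cover_partition pt) //; last by case/and3P: pt.
  by rewrite finset.pblock_equivalence_partition //; apply/asboolP.
- move=> x Px; have xD : x \in D by rewrite inE; apply/asboolP.
  have xQ : finset.pblock Q x \in Q by rewrite finset.pblock_mem // (finset.cover_partition pt).
  have /imsetP[y yX e] : finset.pblock Q x \in [set finset.pblock Q y | y in X]%SET.
    by rewrite (finset.pblock_transversal tX).
  exists y; first by rewrite mem_enum.
  have yD := fintype.subsetP XD _ yX.
  have : y \in finset.pblock Q x by rewrite e finset.mem_pblock (finset.cover_partition pt).
  by rewrite finset.pblock_equivalence_partition // => /asboolP.
Qed.

Section Objects.
Variables (E : finType) (k : fieldType).

Definition obj := {m : nat & fam E k m}.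
HB.instance Definition _ := gen_eqMixin obj.
HB.instance Definition _ := gen_choiceMixin obj.

Definition obj_of m (X : fam E k m) : obj := existT _ m X.
Definition oiso (x y : obj) : Prop := isof (projT2 x) (projT2 y).

Lemma oiso_refl x : oiso x x. Proof. exact: isof_refl. Qed.
Lemma oiso_sym x y : oiso x y -> oiso y x. Proof. exact: isof_sym. Qed.
Lemma oiso_trans y x z : oiso x y -> oiso y z -> oiso x z. Proof. exact: isof_trans. Qed.

Lemma transv_map (P : obj -> Prop) (I : eqType) (L : seq I) f :
  transv oiso P L f -> transv oiso P (map f L) id.
Proof.
case=> uL PL iL sL; split.
- rewrite map_inj_in_uniq // => i j iin jin e; apply: iL => //.
  by rewrite e; apply: oiso_refl.
- by move=> _ /mapP[i iin ->]; apply: PL.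
- by move=> _ _ /mapP[i iin ->] /mapP[j jin ->] ij; rewrite (iL i j).
- by move=> x /sL[i iin xi]; exists (f i) => //; apply: map_f.
Qed.

Lemma transv_size (P Q : obj -> Prop) (I J : eqType) (L : seq I) (M : seq J) f g :
  (forall x, P x <-> Q x) -> transv oiso P L f -> transv oiso Q M g -> size L = size M.
Proof.
move=> PQ tL tM; apply/eqP; rewrite eqn_leq; apply/andP; split.
  apply: (transv_leq (R := eq) oiso_refl oiso_sym oiso_trans tL tM).
    by move=> x /PQ Qx; exists x.
  by move=> x x' _ _ <- <-.
apply: (transv_leq (R := eq) oiso_refl oiso_sym oiso_trans tM tL).
  by move=> x /PQ Qx; exists x.
by move=> x x' _ _ <- <-.
Qed.

End Objects.

Lemma obj_transv_exists (E : finType) (k : finFieldType) m (P : obj E k -> Prop) :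
  (forall x, P x -> projT1 x = m) -> exists L : seq (obj E k), transv (@oiso E k) P L id.
Proof.
move=> Pm; have [L [[uL PL iL sL] _]] := @card_equivalence_transv (fam E k m) (@isof E k m m)
  (fun X => P (obj_of X)) (@isof_refl _ _ _) (@isof_sym _ _ _ _) (@isof_trans _ _ _ _ _).
exists (map (@obj_of E k m) L); apply: transv_map; split=> // x Px.
have := Pm x Px; case: x Px => m' X Px /= em; move: X Px; rewrite em => X Px.
by have [Y YL XY] := sL X Px; exists Y.
Qed.

(** * Absolutely indecomposables over [K] counted through indecomposables over [F] *)

Section CountSplit.
Variables (n : nat) (A : finType) (sr tg : A -> 'I_n) (w : 'I_n -> rat).
Local Notation E := ('I_n + A)%type.

Definition good (k : fieldType) (alpha : dvec n) m (X : fam E k m) : Prop :=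
  [/\ quiv sr tg X, SS w X & fdim X = alpha].

Definition good_indec (k : fieldType) alpha (x : obj E k) : Prop :=
  good alpha (projT2 x) /\ indec (projT2 x).

Definition good_split (k : fieldType) alpha (x : obj E k) : Prop :=
  good alpha (projT2 x) /\ split_end (projT2 x).

Lemma good_indec_size k alpha (x : obj E k) : good_indec alpha x -> projT1 x = ht alpha.
Proof. by move=> [[q _ <-] _]; rewrite (ht_fdim q). Qed.

Lemma good_iso (k : fieldType) alpha m p (X : fam E k m) (Y : fam E k p) :
  isof X Y -> good alpha X -> good alpha Y.
Proof.
move=> XY [q s f]; have YX := isof_sym XY; split.
- exact: quiv_iso YX q.
- exact: SS_iso YX q s.
- by rewrite -(fdim_iso XY).
Qed.

Lemma good_summand (k : fieldType) alpha m p (X : fam E k m) (Z : fam E k p) :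
  summand X Z -> good alpha Z -> good (fdim X) X.
Proof. by move=> s [q sz _]; split=> //; [exact: quiv_summand s q | exact: SS_summand q s sz]. Qed.

Lemma split_iso (k : fieldType) m p (X : fam E k m) (Y : fam E k p) :
  isof X Y -> split_end X -> split_end Y.
Proof.
move=> XY [m0 sX]; split; first by rewrite -(isof_size XY).
case: XY => f [g [hf fg gf]] phi hphi; have hg := hom_inv hf fg gf.
have [c [N e]] := sX _ (homM (homM hf hphi) hg); exists c, N.
have pw j : (phi - c%:M) ^+ j = g *m (f *m phi *m g - c%:M) ^+ j *m f.
  elim: j => [|j IH]; first by rewrite !expr0 -[1 in RHS]/(1%:M) mulmx1 gf.
  rewrite exprSr IH exprSr -!mulmxE -!mulmxA; congr (_ *m (_ *m _)).
  by rewrite mulmxBr mulmxBl -!mulmxA gf mulmx1 mul_scalar_mx mul_mx_scalar.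
by rewrite pw e mulmx0 mul0mx.
Qed.

Variables (F K : finFieldType) (iota : {rmorphism F -> K}) (r : nat).
Hypotheses (cardK : #|K| = (#|F| ^ r)%N) (r0 : (0 < r)%N).

Definition str (x : obj E F) : 'M[F]_(projT1 x) * {poly F} :=
  xget (0, 0) [set gh | structure (projT2 x) gh.1 gh.2]%classic.

(** For an indecomposable, the degree over [F] of the residue field of its endomorphism ring. *)
Definition deg (x : obj E F) : nat := (size (str x).2).-1.

Lemma strP x : indec (projT2 x) -> structure (projT2 x) (str x).1 (str x).2.
Proof.
move=> iX; rewrite /str; case: xgetP => [//|no].
by have [g [h gh]] := indec_structure iX; case: (no (g, h)).
Qed.

Lemma size_str x : indec (projT2 x) -> size (str x).2 = (deg x).+1.
Proof. by move=> /strP[[_ [s _] _ _] _]; rewrite /deg prednK // ltnW. Qed.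

Lemma deg_gt0 x : indec (projT2 x) -> (0 < deg x)%N.
Proof. by move=> ix; have [[_ [s _] _ _] _] := strP ix; rewrite /deg -ltnS prednK // ltnW. Qed.

(** Over [K], [W] is indecomposable, hence prime for direct sums: splitting off an indecomposable
    summand of [X], either it contains [W] after base change or the complement does. *)
Lemma split_in_base_change m (X : fam E F m) a (W : fam E K a) : quiv sr tg X -> SS w X ->
  split_end W -> summand W (mapf iota X) ->
  exists x : obj E F, [/\ good (fdim (projT2 x)) (projT2 x), indec (projT2 x)
    & summand W (mapf iota (projT2 x))].
Proof.
elim: {m}m.+1 {-2}m (ltnSn m) X => // N IH m mN X qX sX sW WX.
have m0 : (0 < m)%N.
  case: m mN X qX sX WX => // _ X _ _ [i [j [_ _ ij]]].
  have := mulmx1_min ij; case: sW; lia.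
have [p [V [q [Y [iV b]]]]] := indec_summand_exists X m0.
have iW := split_indec sW.
have gX : good (fdim X) X by [].
have [WV|WY] := indec_prime iW (biprod_mapf iota b) WX.
  by exists (obj_of V); split=> //; apply: good_summand (biprod_summand b) gX.
have [qY sY _] := good_summand (biprod_summand (biprodC b)) gX.
apply: (IH q) WY => //.
by have := biprod_size b; have := iV.1; lia.
Qed.

Definition zeros (x : obj E F) : seq K :=
  [seq z <- enum K | root (map_poly iota (str x).2) z].

Definition comp_obj (p : obj E F * K) : obj E K :=
  xget (existT _ 0 [ffun=> 0]) [set W | exists a i q,
    @component F K iota _ (str p.1).1 (str p.1).2 a p.2 i q /\
    W = obj_of (retr i q (mapf iota (projT2 p.1)))]%classic.

Lemma comp_objP x z : indec (projT2 x) -> z \in zeros x ->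
  exists a i q, @component F K iota _ (str x).1 (str x).2 a z i q /\
    comp_obj (x, z) = obj_of (retr i q (mapf iota (projT2 x))).
Proof.
move=> ix; rewrite mem_filter => /andP[rz _].
have [a [i [q c]]] := component_exists cardK (strP ix) (size_str ix) rz.
rewrite /comp_obj; case: xgetP => [W _ [a' [i' [q' [c' ->]]]]|no]; first by exists a', i', q'.
by case: (no (obj_of (retr i q (mapf iota (projT2 x))))); exists a, i, q.
Qed.

Lemma size_zeros x : indec (projT2 x) -> (deg x %| r)%N -> size (zeros x) = deg x.
Proof.
move=> ix dr; have st := strP ix; have sz := size_str ix; have [[_ hi hm _] _] := st.
have [z rz] := irr_root_exists iota cardK hi hm sz dr.
have [_ ut hE] := irr_roots cardK hi hm sz rz.
rewrite -[RHS](size_traject (frob iota) z); apply: perm_size; apply: uniq_perm => //.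
  by rewrite filter_uniq // enum_uniq.
by move=> y; rewrite mem_filter mem_enum andbT (irr_trajectP cardK hi hm sz rz).
Qed.

Lemma comp_obj_split x z : indec (projT2 x) -> good (fdim (projT2 x)) (projT2 x) ->
  z \in zeros x ->
  [/\ split_end (projT2 (comp_obj (x, z))),
      summand (projT2 (comp_obj (x, z))) (mapf iota (projT2 x)) &
      good (fdim (projT2 (comp_obj (x, z)))) (projT2 (comp_obj (x, z))) /\
      forall i, fdim (projT2 x) i = (deg x * fdim (projT2 (comp_obj (x, z))) i)%N].
Proof.
move=> ix [q s _] zx; have [a [i [p [c ->]]]] := comp_objP ix zx => /=.
have st := strP ix; have sz := size_str ix.
have sm := component_summand st c.
split=> //; first exact: (component_split cardK ix st sz c).
split; last first.
  move=> e; rewrite ffunE -(component_mult cardK st sz c).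
  by congr (_ * _)%N; rewrite [RHS]ffunE.
have gK : good (fdim (projT2 x)) (mapf iota (projT2 x)).
  by split; [exact: mapf_quiv | exact: (SS_mapf iota q s) | exact: mapf_fdim].
exact: good_summand sm gK.
Qed.

Lemma component_unique m (V : fam E F m) g h a b x (i : 'M[K]_(a, m)) p (j : 'M[K]_(b, m)) q :
  structure V g h -> component iota g h x i p -> component iota g h x j q ->
  isof (retr i p (mapf iota V)) (retr j q (mapf iota V)).
Proof.
move=> st cx cy; have [hi hp] := component_hom st cx; have [hj hq] := component_hom st cy.
case: cx cy => _ ip pi [_ jq qj]; exists (i *m q), (j *m p); split.
- exact: homM hi hq.
- by rewrite -mulmxA (mulmxA q) qj -pi !mulmxA ip mul1mx.
- by rewrite -mulmxA (mulmxA p) pi -qj !mulmxA jq mul1mx.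
Qed.

(** [W] is a summand of the base change of its own restriction to [F], hence of the base change of
    one indecomposable [x], and there it is the piece at some root. The existence of a root in [K]
    forces [deg x] to divide [r]. *)
Lemma split_component_obj (alpha : dvec n) (W : obj E K) (s : dvec n -> seq (obj E F)) :
  (forall beta, transv (@oiso E F) (@good_indec F beta) (s beta) id) ->
  good_split alpha W ->
  exists x z, [/\ (deg x %| r)%N, x \in s [ffun i => (deg x * alpha i)%N],
    z \in zeros x & oiso W (comp_obj (x, z))].
Proof.
move=> ts [[qW sW fW] spW].
have [f [om [fi fm fs rom om0]]] := primitive_poly_exists iota cardK r0.
have [P rP] := isres_exists fi fs rom (projT1 W).
have [X XW] := resf_exists cardK rP (projT2 W).
have qX := (resf_quiv cardK fi fm fs rom sr tg rP XW).2 qW.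
have sX := (resf_SS cardK fi fm fs rom om0 w rP XW qX).2 sW.
have WX := resf_summand cardK fi fm fs rom rP XW.
have [x0 [gx0 ix0 Wx0]] := split_in_base_change qX sX spW WX.
have [_ gs _ ss] := ts (fdim (projT2 x0)).
have [x xs ix0x] := ss x0 (conj gx0 ix0).
have [gx ix] := gs x xs.
have Wx : summand (projT2 W) (mapf iota (projT2 x)).
  exact: summand_trans Wx0 (summand_mapf iota (isof_summand ix0x)).
have st := strP ix; have sz := size_str ix; have [[_ hi hm _] _] := st.
have [z0 rz0] := split_summand_root ix st spW Wx.
have [dr _ _] := irr_roots cardK hi hm sz rz0.
have [z [b [i [p [cz Wz]]]]] := split_summand_component cardK ix st sz spW Wx rz0.
have zx : z \in zeros x by rewrite mem_filter mem_enum andbT; case: cz.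
exists x, z.
have iso_c : oiso W (comp_obj (x, z)).
  have [a [j [q [cz' ->]]]] := comp_objP ix zx.
  exact: isof_trans Wz (component_unique st cz cz').
split=> //.
have [_ _ [_ fE]] := comp_obj_split ix (let: And3 q s _ := gx in And3 q s erefl) zx.
suff <- : fdim (projT2 x0) = [ffun i => (deg x * alpha i)%N] by [].
have <- : fdim (projT2 x) = fdim (projT2 x0) by case: gx.
apply/ffunP => e; rewrite [RHS]ffunE fE -fW; congr (_ * _)%N.
by rewrite (fdim_iso iso_c).
Qed.

(** The classes over [K] are indexed by the pairs of an indecomposable [x] over [F] with [deg x]
    dividing [r] and a root [z] in [K] of its polynomial. There are [deg x] such roots, and each
    piece has dimension vector that of [x] divided by [deg x]. *)
Lemma count_split (alpha : dvec n) (s : dvec n -> seq (obj E F)) (L : seq (obj E K)) :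
  (forall beta, transv (@oiso E F) (@good_indec F beta) (s beta) id) ->
  transv (@oiso E K) (@good_split K alpha) L id ->
  size L = (\sum_(d <- divisors r) d * count (fun x => deg x == d) (s [ffun i => (d * alpha i)%N]))%N.
Proof.
move=> ts tL.
pose Sd d := [seq x <- s [ffun i => (d * alpha i)%N] | deg x == d].
pose S := flatten [seq Sd d | d <- divisors r].
have SP x : x \in S <-> (deg x %| r)%N /\ x \in s [ffun i => (deg x * alpha i)%N].
  split=> [/flattenP[_ /mapP[d dr ->]]|[dr xs]].
    by rewrite mem_filter => /andP[/eqP-> xs]; rewrite -dvdn_divisors in dr.
  apply/flattenP; exists (Sd (deg x)); last by rewrite mem_filter eqxx.
  by apply: map_f; rewrite -dvdn_divisors.
have uS : uniq S.
  apply: (@uniq_flatten_map _ _ _ _ deg); first exact: divisors_uniq.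
    by move=> d _; apply: filter_uniq; case: (ts [ffun i => (d * alpha i)%N]).
  by move=> d x _; rewrite mem_filter => /andP[/eqP].
have Sin x : x \in S -> indec (projT2 x) /\ good [ffun i => (deg x * alpha i)%N] (projT2 x).
  by case/SP => _ xs; have [_ gs _ _] := ts [ffun i => (deg x * alpha i)%N]; case: (gs x xs).
have gself x : x \in S -> good (fdim (projT2 x)) (projT2 x).
  by move=> /Sin[_ [q ss _]].
pose M := flatten [seq [seq (x, z) | z <- zeros x] | x <- S].
have MP x z : (x, z) \in M <-> x \in S /\ z \in zeros x.
  split=> [/flattenP[_ /mapP[y yS ->] /mapP[u uy [-> ->]]] //|[xS zx]].
  by apply/flattenP; exists [seq (x, z) | z <- zeros x]; apply: map_f.
have tM : transv (@oiso E K) (@good_split K alpha) M comp_obj.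
  split.
  - apply: (@uniq_flatten_map _ _ _ _ fst) => // [x xS|x [y z] xS /mapP[u _ [-> _]] //].
    by rewrite map_inj_uniq; [apply: filter_uniq; apply: enum_uniq | move=> u v []].
  - case=> x z /MP[xS zx]; have [ix [_ _ fx]] := Sin x xS.
    have [sp _ [[q ss _] fE]] := comp_obj_split ix (gself x xS) zx.
    split=> //; split=> //; apply/ffunP => e; apply/eqP.
    by rewrite -(eqn_pmul2l (deg_gt0 ix)) -fE fx ffunE.
  - case=> x z [y u] /MP[xS zx] /MP[yS uy] iso_xy.
    have [ix [_ _ fx]] := Sin x xS; have [iy [_ _ fy]] := Sin y yS.
    have [sx smx [[qx _ _] fEx]] := comp_obj_split ix (gself x xS) zx.
    have [sy smy [_ fEy]] := comp_obj_split iy (gself y yS) uy.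
    have xy : oiso x y.
      apply: common_summand_iso sx.1 ix iy smx _.
      exact: summand_trans (isof_summand iso_xy) smy.
    have dxy : deg x = deg y.
      have : (0 < ht (fdim (projT2 (comp_obj (x, z)))))%N by rewrite (ht_fdim qx) sx.1.
      rewrite /ht lt0n sum_nat_eq0 negb_forall => /existsP[e]; rewrite -lt0n => e0.
      apply/eqP; rewrite -(eqn_pmul2r e0) -fEx (fdim_iso iso_xy) -fEy.
      by rewrite (fdim_iso xy).
    have {xy} exy : x = y.
      have [_ _ inj _] := ts [ffun i => (deg x * alpha i)%N].
      by apply: inj => //; [case/SP: xS | rewrite dxy; case/SP: yS].
    subst y; congr (_, _); apply/eqP/negPn/negP => zu.
    have [a [i [p [cz ez]]]] := comp_objP ix zx.
    have [b [j [q [cu eu]]]] := comp_objP ix uy.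
    apply: (component_noniso cardK ix (strP ix) (size_str ix) cz cu zu).
    by move: iso_xy; rewrite /oiso ez eu.
  - move=> W gW; have [x [z [dr xs zx WW]]] := split_component_obj ts gW.
    by exists (x, z) => //; apply/MP; split=> //; apply/SP.
rewrite (transv_size (fun x => iff_refl _) tL tM) size_flatten_map.
under eq_bigr do rewrite size_map.
transitivity (\sum_(x <- S) deg x)%N.
  apply: eq_big_seq => x xS; apply: size_zeros; first by case: (Sin x xS).
  by case/SP: xS.
rewrite big_flatten big_map; apply: eq_bigr => d _.
rewrite -size_filter -/(Sd d) -sum1_size big_distrr /=; apply: eq_big_seq => x.
by rewrite mem_filter muln1 => /andP[/eqP].
Qed.

End CountSplit.

(** * Divisor sums *)

Section DivisorSums.
Implicit Types (n d e : nat).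

Lemma divisors_mul_perm n d : (0 < n)%N -> (d %| n)%N ->
  perm_eq [seq e <- divisors n | (d %| e)%N] [seq (d * e)%N | e <- divisors (n %/ d)].
Proof.
move=> n0 dn; have d0 := dvdn_gt0 n0 dn.
have nd0 : (0 < n %/ d)%N by rewrite divn_gt0 // dvdn_leq.
apply: uniq_perm; first by rewrite filter_uniq ?divisors_uniq.
  by rewrite map_inj_uniq ?divisors_uniq // => u v /eqP; rewrite eqn_pmul2l // => /eqP.
move=> x; rewrite mem_filter -dvdn_divisors //; apply/andP/mapP => [[dx xn]|[e en ->]].
  exists (x %/ d)%N; last by rewrite mulnC divnK.
  by rewrite -dvdn_divisors // dvdn_divRL // divnK.
rewrite dvdn_mulr //; split=> //.
by move: en; rewrite -dvdn_divisors // dvdn_divRL // mulnC.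
Qed.

Lemma divisors_div_perm n : (0 < n)%N ->
  perm_eq (divisors n) [seq (n %/ d)%N | d <- divisors n].
Proof.
move=> n0; have inv x : (x %| n)%N -> (n %/ (n %/ x))%N = x by move=> xn; rewrite divnA // mulKn.
apply: uniq_perm; first exact: divisors_uniq.
  rewrite map_inj_in_uniq ?divisors_uniq // => u v.
  by rewrite -!dvdn_divisors // => un vn e; rewrite -[u]inv // e inv.
move=> x; rewrite -dvdn_divisors //; apply/idP/mapP => [xn|[e]].
  by exists (n %/ x)%N; rewrite -?dvdn_divisors ?inv // dvdn_div.
by rewrite -dvdn_divisors // => en ->; rewrite dvdn_div.
Qed.

Lemma divisors_swap n (G : nat -> nat -> rat) : (0 < n)%N ->
  \sum_(D <- divisors n) \sum_(d <- divisors D) G d D =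
  \sum_(d <- divisors n) \sum_(e <- divisors (n %/ d)) G d (d * e)%N.
Proof.
move=> n0.
transitivity (\sum_(D <- divisors n) \sum_(d <- divisors n | (d %| D)%N) G d D).
  apply: eq_big_seq => D; rewrite -dvdn_divisors // => Dn.
  rewrite -[RHS]big_filter; apply: perm_big; apply: uniq_perm; rewrite ?filter_uniq ?divisors_uniq //.
  move=> x; rewrite mem_filter -!dvdn_divisors ?(dvdn_gt0 n0 Dn) //.
  by apply/idP/andP => [xD|[]//]; split=> //; apply: dvdn_trans Dn.
rewrite (exchange_big_dep predT) //=; apply: eq_big_seq => d; rewrite -dvdn_divisors // => dn.
by rewrite -big_filter (perm_big _ (divisors_mul_perm n0 dn)) big_map.
Qed.

Lemma divisors_rev n (G : nat -> rat) : (0 < n)%N ->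
  \sum_(d <- divisors n) G (n %/ d)%N = \sum_(d <- divisors n) G d.
Proof. by move=> n0; rewrite [RHS](perm_big _ (divisors_div_perm n0)) big_map. Qed.

Lemma divisors_sym n (G : nat -> nat -> rat) : (0 < n)%N ->
  \sum_(d <- divisors n) \sum_(e <- divisors (n %/ d)) G d e =
  \sum_(e <- divisors n) \sum_(d <- divisors (n %/ e)) G d e.
Proof.
move=> n0.
have key (H : nat -> nat -> rat) : \sum_(d <- divisors n) \sum_(e <- divisors (n %/ d)) H d e =
    \sum_(D <- divisors n) \sum_(d <- divisors D) H d (D %/ d)%N.
  rewrite (divisors_swap (fun d D => H d (D %/ d)%N)) //.
  apply: eq_big_seq => d; rewrite -dvdn_divisors // => dn.
  by apply: eq_bigr => e _; rewrite mulKn ?(dvdn_gt0 n0 dn).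
rewrite key [RHS](key (fun e d => G d e)); apply: eq_big_seq => D.
rewrite -dvdn_divisors // => Dn; have D0 := dvdn_gt0 n0 Dn.
rewrite -divisors_rev //; apply: eq_big_seq => d; rewrite -dvdn_divisors // => dD.
by rewrite divnA // mulKn.
Qed.

Lemma moeb_mul_prime p d : prime p -> ~~ (p %| d)%N -> (0 < d)%N -> moeb (p * d) = - moeb d.
Proof.
move=> pp pd d0; have p0 := prime_gt0 pp.
have perm : perm_eq (primes (p * d)) (p :: primes d).
  apply: uniq_perm; first exact: primes_uniq.
    by rewrite /= primes_uniq andbT mem_primes pp d0.
  by move=> x; rewrite inE primesM // primes_prime // inE.
have al : all (fun r => logn r (p * d) == 1%N) (primes (p * d)) =
    all (fun r => logn r d == 1%N) (primes d).
  rewrite (perm_all _ perm) /= lognM // logn_prime // eqxx.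
  have -> : logn p d = 0%N by apply/eqP; rewrite -leqn0 leqNgt logn_gt0 mem_primes pp d0.
  rewrite andTb; apply: eq_in_all => x; rewrite mem_primes => /and3P[px _ xd].
  rewrite lognM // logn_prime //.
  by have -> : (x == p) = false by apply: contraNF pd => /eqP <-.
rewrite /moeb al (perm_size perm) /=; case: ifP => _; last by rewrite oppr0.
by rewrite exprS mulN1r.
Qed.

(** Choose a prime [p] dividing [n]. Multiples of [p^2] contribute 0, and the divisors [d] prime to
    [p] cancel against the [p * d]. *)
Lemma moeb_sum n : (0 < n)%N -> \sum_(d <- divisors n) moeb d = (n == 1%N)%:R.
Proof.
move=> n0; have [->|n1] := eqVneq n 1%N; first by rewrite /= big_seq1.
have [p pp pn] : exists2 p, prime p & (p %| n)%N.
  by exists (pdiv n); [apply: pdiv_prime; lia | exact: pdiv_dvd].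
have p0 := prime_gt0 pp; have np0 : (0 < n %/ p)%N by rewrite divn_gt0 // dvdn_leq.
rewrite (bigID (fun d => p %| d)%N) /= -big_filter (perm_big _ (divisors_mul_perm n0 pn)) big_map.
rewrite (bigID (fun d => p %| d)%N) /= big_seq_cond big1 ?add0r; last first.
  move=> d /andP[]; rewrite -dvdn_divisors // => dn pd.
  have d0 : (0 < d)%N by exact: dvdn_gt0 np0 dn.
  rewrite /moeb; case: ifP => // /allP/(_ p).
  rewrite mem_primes pp muln_gt0 prime_gt0 // d0 dvdn_mulr // => /(_ isT).
  rewrite lognM // (logn_prime p pp) eqxx => /eqP.
  have : (0 < logn p d)%N by rewrite logn_gt0 mem_primes pp d0.
  by lia.
have -> : \sum_(d <- divisors n | ~~ (p %| d)%N) moeb d =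
    \sum_(d <- divisors (n %/ p) | ~~ (p %| d)%N) moeb d.
  rewrite -big_filter -[RHS]big_filter; apply: perm_big; apply: uniq_perm; rewrite ?filter_uniq ?divisors_uniq //.
  move=> x; rewrite !mem_filter; case px : (p %| x)%N => //=.
  rewrite -!dvdn_divisors //.
  apply/idP/idP => [xn|xn]; last exact: dvdn_trans xn (dvdn_div pn).
  have cop : coprime x p by rewrite coprime_sym prime_coprime // px.
  by rewrite -(Gauss_dvdl _ cop) divnK.
rewrite -big_split /= big_seq_cond big1 // => d /andP[].
rewrite -dvdn_divisors // => dn pd.
have d0 : (0 < d)%N by exact: dvdn_gt0 np0 dn.
by rewrite moeb_mul_prime // addNr.
Qed.

Lemma moeb_inversion n (f : nat -> rat) : (0 < n)%N ->
  \sum_(r <- divisors n) moeb (n %/ r) * \sum_(e <- divisors r) f e = f n.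
Proof.
move=> n0; under eq_bigr do rewrite mulr_sumr.
rewrite (divisors_swap (fun e r => moeb (n %/ r) * f e)) //.
rewrite (bigD1_seq n) ?divisors_uniq -?dvdn_divisors //= divnn n0 big_seq1 muln1 divnn n0.
rewrite mul1r -[RHS]addr0; congr (_ + _); apply: big1_seq => e /andP[en].
rewrite -dvdn_divisors // => edn; rewrite -mulr_suml.
have e0 := dvdn_gt0 n0 edn.
have ne0 : (0 < n %/ e)%N by rewrite divn_gt0 // dvdn_leq.
rewrite [X in X * _](_ : _ = \sum_(t <- divisors (n %/ e)) moeb (n %/ e %/ t)); last first.
  by apply: eq_bigr => t _; rewrite divnMA.
rewrite divisors_rev // moeb_sum //.
case: eqP => [e1|]; last by rewrite mul0r.
by case/eqP: en; rewrite -(divnK edn) e1 mul1n.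
Qed.

(** Substitute the formula for [I] and group the terms by [D = d * e]. With [d = r * u], the sum
    over [u] leaves only [t = D / r], so the argument [r * t] becomes [D]; the remaining sum of
    [moeb r] over the divisors of [D] vanishes unless [D = 1]. *)
Lemma moeb_double_inversion n (I B : nat -> nat -> rat) : (0 < n)%N ->
  (forall d r, (d %| n)%N -> (0 < r)%N ->
    I d r = \sum_(e <- divisors (n %/ d)) e%:R^-1 *
      \sum_(t <- divisors e) moeb (e %/ t) * B (d * e)%N (r * t)%N) ->
  \sum_(d <- divisors n) d%:R^-1 * \sum_(r <- divisors d) moeb r * I d r = B 1%N 1%N.
Proof.
move=> n0 IE.
pose H d e := (d * e)%:R^-1 * \sum_(r <- divisors d) \sum_(t <- divisors e)
  moeb r * moeb (e %/ t) * B (d * e)%N (r * t)%N.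
transitivity (\sum_(d <- divisors n) \sum_(e <- divisors (n %/ d)) H d e).
  apply: eq_big_seq => d; rewrite -dvdn_divisors // => dn; have d0 := dvdn_gt0 n0 dn.
  rewrite /H; under [RHS]eq_bigr do rewrite natrM invfM -mulrA.
  rewrite -mulr_sumr; congr (_ * _).
  transitivity (\sum_(r <- divisors d) moeb r * \sum_(e <- divisors (n %/ d)) e%:R^-1 *
      \sum_(t <- divisors e) moeb (e %/ t) * B (d * e)%N (r * t)%N).
    by apply: eq_big_seq => r; rewrite -dvdn_divisors // => rd; rewrite IE // (dvdn_gt0 d0 rd).
  under eq_bigr do rewrite mulr_sumr.
  rewrite exchange_big /=; apply: eq_bigr => e _.
  rewrite mulr_sumr; apply: eq_bigr => r _.
  rewrite mulrCA; congr (_ * _); rewrite mulr_sumr; apply: eq_bigr => t _.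
  by rewrite mulrA.
have -> : \sum_(d <- divisors n) \sum_(e <- divisors (n %/ d)) H d e =
    \sum_(D <- divisors n) \sum_(d <- divisors D) H d (D %/ d)%N.
  rewrite (divisors_swap (fun d D => H d (D %/ d)%N)) //.
  apply: eq_big_seq => d; rewrite -dvdn_divisors // => dn.
  by apply: eq_bigr => e _; rewrite mulKn ?(dvdn_gt0 n0 dn).
transitivity (\sum_(D <- divisors n) D%:R^-1 * ((D == 1%N)%:R * B D D)).
  apply: eq_big_seq => D; rewrite -dvdn_divisors // => Dn; have D0 := dvdn_gt0 n0 Dn.
  transitivity (D%:R^-1 * \sum_(d <- divisors D) \sum_(r <- divisors d) \sum_(t <- divisors (D %/ d))
      moeb r * moeb (D %/ d %/ t) * B D (r * t)%N).
    rewrite mulr_sumr; apply: eq_big_seq => d; rewrite -dvdn_divisors // => dD.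
    by rewrite /H [(d * _)%N]mulnC divnK.
  congr (_ * _).
  rewrite (divisors_swap (fun r d => \sum_(t <- divisors (D %/ d))
    moeb r * moeb (D %/ d %/ t) * B D (r * t)%N)) //.
  rewrite -moeb_sum // mulr_suml; apply: eq_big_seq => r; rewrite -dvdn_divisors // => rD.
  have r0 := dvdn_gt0 D0 rD.
  have m0 : (0 < D %/ r)%N by rewrite divn_gt0 // dvdn_leq.
  under eq_bigr do under eq_bigr do rewrite divnMA.
  under eq_bigr do rewrite divnMA.
  rewrite (divisors_sym (fun u t => moeb r * moeb (D %/ r %/ u %/ t) * B D (r * t)%N)) //.
  rewrite (bigD1_seq (D %/ r)%N) ?divisors_uniq -?dvdn_divisors //= divnn m0 big_seq1 divn1.
  rewrite divnn m0 [(r * _)%N]mulnC divnK // mulr1 -[RHS]addr0; congr (_ + _).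
  apply: big1_seq => t /andP[tn]; rewrite -dvdn_divisors // => tdm.
  have t0 := dvdn_gt0 m0 tdm.
  have ne0 : (0 < D %/ r %/ t)%N by rewrite divn_gt0 // dvdn_leq.
  rewrite -mulr_suml -mulr_sumr.
  rewrite [X in _ * X * _](_ : _ = \sum_(u <- divisors (D %/ r %/ t)) moeb (D %/ r %/ t %/ u)); last first.
    by apply: eq_bigr => u _; rewrite -!divnMA [(u * t)%N]mulnC.
  rewrite divisors_rev // moeb_sum //.
  case: eqP => [e1|]; last by rewrite mulr0 mul0r.
  by case/eqP: tn; rewrite -(divnK tdm) e1 mul1n.
rewrite (bigD1_seq 1%N) ?divisors_uniq -?dvdn_divisors ?dvd1n //= ?eqxx invr1 ?mulr1n !mul1r.
rewrite big1 ?addr0 // => D /negPf->.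
by rewrite mul0r mulr0.
Qed.

End DivisorSums.

(** * Representations as families of matrices *)

Lemma dep_choice (I : Type) (T : I -> Type) (P : forall i, T i -> Prop) :
  (forall i, exists x, P i x) -> exists f : forall i, T i, forall i, P i (f i).
Proof.
by move=> ex; exists (fun i => proj1_sig (boolp.cid (ex i))) => i; exact: (proj2_sig (boolp.cid (ex i))).
Qed.

Lemma sum_only (V : zmodType) (I : finType) (i : I) (F : I -> V) :
  (forall j, j != i -> F j = 0) -> \sum_j F j = F i.
Proof. by move=> F0; rewrite (bigD1 i) //= big1 ?addr0. Qed.

Section Inclusions.
Variables (k : fieldType) (n : nat) (f : 'I_n -> nat).
Local Notation N := (\sum_i f i)%N.

Definition inc i : 'M[k]_(f i, N) := submxcol 1%:M i.
Definition prj i : 'M[k]_(N, f i) := submxrow 1%:M i.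

Lemma inc_prjE i j : inc i *m prj j = mxsub (tagnat.Rank i) (tagnat.Rank j) 1%:M.
Proof. by rewrite /inc /prj /submxcol /submxrow -mxsub_mul mulmx1. Qed.

Lemma inc_prj i : inc i *m prj i = 1%:M.
Proof.
rewrite inc_prjE; apply/matrixP => u v.
by rewrite mxE [LHS]mxE [RHS]mxE -val_eqE tagnat.eq_Rank eqxx.
Qed.

Lemma inc_prj0 i j : i != j -> inc i *m prj j = 0.
Proof.
move=> /negPf ij; rewrite inc_prjE; apply/matrixP => u v.
by rewrite mxE [LHS]mxE [RHS]mxE -val_eqE tagnat.eq_Rank ij.
Qed.

Lemma prj_inc_idem i : prj i *m inc i *m (prj i *m inc i) = prj i *m inc i.
Proof. by rewrite mulmxA -(mulmxA (prj i)) inc_prj mulmx1. Qed.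

Lemma sum_prj_inc : \sum_i prj i *m inc i = 1%:M.
Proof.
rewrite -mul_mxrow_mxcol /inc /prj.
by rewrite submxrowK submxcolK mul1mx.
Qed.
End Inclusions.

Section RowSpaces.
Variables (k : fieldType) (m : nat).
Implicit Types U W : {vspace 'rV[k]_m}.

(** Translates between the vector spaces used in the definitions of the statement and the row spaces
    used in the proof. *)
Definition rowspace_of U r (B : 'M[k]_(r, m)) : Prop :=
  forall v : 'rV_m, (v \in U) = (v <= B)%MS.

Lemma rowspace_vspace r (B : 'M[k]_(r, m)) : exists U, rowspace_of U B.
Proof.
exists (limg (linfun (mulmxr B : 'rV[k]_r -> 'rV[k]_m))) => v; apply/memv_imgP/submxP.
  by case=> u _ ->; exists u; rewrite lfunE.
by case=> u ->; exists u; rewrite ?memvf // lfunE.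
Qed.

Lemma rowspace_submx U W r s (B : 'M[k]_(r, m)) (C : 'M[k]_(s, m)) :
  rowspace_of U B -> rowspace_of W C -> (U <= W)%VS = (B <= C)%MS.
Proof.
move=> UB WC; apply/subvP/idP => [UW|BC v].
  by apply/row_subP => i; rewrite -WC UW // UB row_sub.
by rewrite UB WC => vB; exact: submx_trans vB BC.
Qed.

Lemma vspace_rowspace U : exists B : 'M[k]_(\dim U, m), rowspace_of U B /\ row_free B.
Proof.
pose b := vbasis U; have bU : basis_of U b := vbasisP U.
pose B := \matrix_i b`_i : 'M[k]_(\dim U, m).
have BE (c : 'rV_(\dim U)) : c *m B = \sum_i c 0 i *: b`_i.
  by rewrite mulmx_sum_row; apply: eq_bigr => i _; rewrite rowK.
exists B; split.
  move=> v; apply/idP/submxP => [vU|[c ->]].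
    exists (\row_i coord b i v); rewrite BE [LHS](coord_vbasis vU).
    by apply: eq_bigr => i _; rewrite mxE.
  rewrite BE; apply: memv_suml => i _; apply: memvZ; apply: vbasis_mem.
  by rewrite mem_nth // size_tuple.
apply/inj_row_free => c; rewrite BE => /freeP c0; apply/rowP => i; rewrite mxE.
by apply: c0; apply: basis_free bU.
Qed.

Lemma rowspace_dim U r (B : 'M[k]_(r, m)) : rowspace_of U B -> \dim U = \rank B.
Proof.
move=> UB; have [C [UC /eqP <-]] := vspace_rowspace U.
apply/eqP; rewrite eqn_leq !mxrankS //.
  by rewrite -(rowspace_submx UB UC) subvv.
by rewrite -(rowspace_submx UC UB) subvv.
Qed.

Lemma rowspace_full U r (B : 'M[k]_(r, m)) : rowspace_of U B -> U = fullv <-> (1%:M <= B)%MS.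
Proof.
move=> UB; have F : rowspace_of (fullv : {vspace 'rV[k]_m}) (1%:M : 'M_m).
  by move=> v; rewrite memvf submx1.
rewrite -(rowspace_submx F UB); split=> [->|fU]; first exact: subvv.
by apply/eqP; rewrite eqEsubv subvf.
Qed.

Lemma rowspace_0 U r (B : 'M[k]_(r, m)) : rowspace_of U B -> U = 0%VS <-> B = 0.
Proof.
move=> UB; have F : rowspace_of (0%VS : {vspace 'rV[k]_m}) (0 : 'M_m).
  by move=> v; rewrite memv0 submx0.
split=> [U0|B0]; first by apply/eqP; rewrite -submx0 -(rowspace_submx UB F) U0 subvv.
by apply/eqP; rewrite -subv0 (rowspace_submx UB F) B0 sub0mx.
Qed.

Lemma rowspace_add U W r s (B : 'M[k]_(r, m)) (C : 'M[k]_(s, m)) :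
  rowspace_of U B -> rowspace_of W C -> rowspace_of (U + W)%VS (B + C)%MS.
Proof.
move=> UB WC v; apply/memv_addP/sub_addsmxP => [[x xU [y yW ->]]|[[x y] /= ->]].
  have /submxP[a ->] : (x <= B)%MS by rewrite -UB.
  have /submxP[b ->] : (y <= C)%MS by rewrite -WC.
  by exists (a, b).
by exists (x *m B); [rewrite UB submxMl | exists (y *m C); rewrite ?WC ?submxMl].
Qed.

Lemma rowspace_cap U W r s (B : 'M[k]_(r, m)) (C : 'M[k]_(s, m)) :
  rowspace_of U B -> rowspace_of W C -> rowspace_of (U :&: W)%VS (B :&: C)%MS.
Proof. by move=> UB WC v; rewrite memv_cap sub_capmx UB WC. Qed.
End RowSpaces.

Section Assembly.
Variables (n : nat) (A : finType) (sr tg : A -> 'I_n).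
Local Notation E := ('I_n + A)%type.

Section OverField.
Variable k : fieldType.
Implicit Types f : 'I_n -> nat.

(** The dimensions form a plain function because the Jordan dimensions occurring later are computed.
    With one arrow [id] at each vertex the same type describes families of square matrices, one per
    vertex. *)
Definition grep f := {dffun forall e : A, 'M[k]_(f (sr e), f (tg e))}.

Definition assemble f (V : grep f) : fam E k (\sum_i f i)%N :=
  [ffun x => match x with
    | inl i => prj k f i *m inc k f i
    | inr e => prj k f (sr e) *m V e *m inc k f (tg e)
    end].

Definition gsum f f' (g : forall i, 'M[k]_(f i, f' i)) : 'M[k]_(\sum_i f i, \sum_i f' i)%N :=
  \sum_i prj k f i *m g i *m inc k f' i.

Lemma inc_gsum f f' (g : forall i, 'M[k]_(f i, f' i)) i :
  inc k f i *m gsum g = g i *m inc k f' i.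
Proof.
rewrite mulmx_sumr [LHS](sum_only (i := i)) => [|j ij].
  by rewrite !mulmxA inc_prj mul1mx.
by rewrite !mulmxA inc_prj0 1?eq_sym // !mul0mx.
Qed.

Lemma gsum_prj f f' (g : forall i, 'M[k]_(f i, f' i)) i :
  gsum g *m prj k f' i = prj k f i *m g i.
Proof.
rewrite mulmx_suml [LHS](sum_only (i := i)) => [|j ij].
  by rewrite -!mulmxA inc_prj mulmx1.
by rewrite -!mulmxA inc_prj0 // !mulmx0.
Qed.

Lemma gsumM f f' f'' (g : forall i, 'M[k]_(f i, f' i)) (h : forall i, 'M[k]_(f' i, f'' i)) :
  gsum g *m gsum h = gsum (fun i => g i *m h i).
Proof.
rewrite {1}/gsum mulmx_suml; apply: eq_bigr => i _.
by rewrite -!mulmxA inc_gsum.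
Qed.

Lemma gsum1 f : gsum (fun i => 1%:M : 'M_(f i)) = 1%:M.
Proof. by rewrite -(sum_prj_inc k f); apply: eq_bigr => i _; rewrite mulmx1. Qed.

Lemma gsum_hom f f' (V : grep f) (W : grep f') (g : forall i, 'M[k]_(f i, f' i)) :
  (forall e, V e *m g (tg e) = g (sr e) *m W e) -> hom (assemble V) (assemble W) (gsum g).
Proof.
move=> Vg [i|e]; rewrite !ffunE.
  by rewrite -mulmxA inc_gsum !mulmxA gsum_prj.
by rewrite -mulmxA inc_gsum !mulmxA gsum_prj -[in LHS](mulmxA _ (V e)) Vg !mulmxA.
Qed.

(** Commutation with the vertex idempotents makes [phi] block diagonal. *)
Lemma hom_gsum f f' (V : grep f) (W : grep f') phi : hom (assemble V) (assemble W) phi ->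
  phi = gsum (fun i => inc k f i *m phi *m prj k f' i) /\
  forall e, V e *m (inc k f (tg e) *m phi *m prj k f' (tg e)) =
    inc k f (sr e) *m phi *m prj k f' (sr e) *m W e.
Proof.
move=> hphi; split.
  rewrite -[LHS]mul1mx -(sum_prj_inc k f) mulmx_suml; apply: eq_bigr => i _.
  have := hphi (inl i); rewrite !ffunE => e.
  transitivity (prj k f i *m inc k f i *m (prj k f i *m inc k f i *m phi)).
    by rewrite [RHS]mulmxA prj_inc_idem.
  by rewrite e !mulmxA.
move=> e; have := congr1 (fun M => inc k f (sr e) *m M *m prj k f' (tg e)) (hphi (inr e)).
rewrite !ffunE !mulmxA inc_prj mul1mx => ->.
by rewrite -[LHS]mulmxA inc_prj mulmx1.
Qed.

Lemma assemble_quiv f (V : grep f) : quiv sr tg (assemble V).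
Proof.
split=> [i j||e]; rewrite ?ffunE.
- rewrite mulmxA -(mulmxA (prj k f i)); case: eqP => [<-|/eqP ij].
    by rewrite inc_prj mulmx1.
  by rewrite inc_prj0 // mulmx0 mul0mx.
- by rewrite -(sum_prj_inc k f); apply: eq_bigr => i _; rewrite ffunE.
have ip i (M : 'M[k]_(f i, \sum_i f i)) : prj k f i *m inc k f i *m (prj k f i *m M) = prj k f i *m M.
  by rewrite mulmxA -(mulmxA (prj k f i)) inc_prj mulmx1.
by rewrite -[prj k f (sr e) *m V e *m _]mulmxA ip -[RHS]mulmxA -[X in _ = _ *m X]mulmxA
  (mulmxA (inc k f (tg e))) inc_prj mul1mx.
Qed.

Lemma inc_free f i : row_free (inc k f i).
Proof. by apply/row_freeP; exists (prj k f i); rewrite inc_prj. Qed.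

Lemma prj_full f i : row_full (prj k f i).
Proof. by apply/row_fullP; exists (inc k f i); rewrite inc_prj. Qed.

Lemma assemble_fdim f (V : grep f) i : fdim (assemble V) i = f i.
Proof.
rewrite !ffunE mxrankMfree ?inc_free //; exact/eqP/prj_full.
Qed.

Lemma assemble_iso f (V W : grep f) : isof (assemble V) (assemble W) <->
  exists g : forall i, 'M[k]_(f i), (forall i, g i \in unitmx) /\
    (forall e, V e *m g (tg e) = g (sr e) *m W e).
Proof.
split=> [[phi [psi [hphi fg gf]]]|[g [ug Vg]]].
  have [pE rel] := hom_gsum hphi; have [qE _] := hom_gsum (hom_inv hphi fg gf).
  exists (fun i => inc k f i *m phi *m prj k f i); split=> // i.
  have : (inc k f i *m phi *m prj k f i) *m (inc k f i *m psi *m prj k f i) = 1%:M.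
    have := congr1 (fun M => inc k f i *m M *m prj k f i) fg.
    rewrite mulmx1 inc_prj => <-.
    have e1 : inc k f i *m phi = inc k f i *m phi *m prj k f i *m inc k f i by rewrite {1}pE inc_gsum.
    by rewrite !mulmxA -e1.
  by case/mulmx1_unit.
exists (gsum g), (gsum (fun i => invmx (g i))); split; first exact: gsum_hom.
  by rewrite gsumM -(gsum1 f); apply: eq_bigr => i _; rewrite mulmxV.
by rewrite gsumM -(gsum1 f); apply: eq_bigr => i _; rewrite mulVmx.
Qed.

Lemma assemble_ex m (X : fam E k m) (alpha : dvec n) : quiv sr tg X -> fdim X = alpha ->
  exists V : grep alpha, isof X (assemble V).
Proof.
move=> qX; have [q1 q2 q3] := qX.
have sp i : exists ab : 'M[k]_(\rank (X (inl i)), m) * 'M[k]_(m, \rank (X (inl i))),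
    ab.1 *m ab.2 = 1%:M /\ ab.2 *m ab.1 = X (inl i).
  by have [a [b ab]] := mx_idem_split (quiv_idem i qX); exists (a, b).
have [f [a [b [fE ab1 ab2]]]] : exists (f : 'I_n -> nat) (a : forall i, 'M[k]_(f i, m))
    (b : forall i, 'M[k]_(m, f i)), [/\ forall i, f i = \rank (X (inl i)),
      forall i, a i *m b i = 1%:M & forall i, b i *m a i = X (inl i)].
  pose ab i := proj1_sig (boolp.cid (sp i)).
  exists (fun i => \rank (X (inl i))), (fun i => (ab i).1), (fun i => (ab i).2).
  by split=> // i; have [] := proj2_sig (boolp.cid (sp i)).
have ab0 i j : i != j -> a i *m b j = 0.
  move=> /negPf ij; have := q1 i j; rewrite ij -!ab2 => /(congr1 (fun M => a i *m M *m b j)).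
  by rewrite mulmx0 mul0mx !mulmxA ab1 mul1mx -[LHS]mulmxA ab1 mulmx1.
have [V XV] : exists V : grep f, isof X (assemble V).
  pose V : grep f := [ffun e => a (sr e) *m X (inr e) *m b (tg e)].
  pose phi := \sum_i b i *m inc k f i; pose psi := \sum_i prj k f i *m a i.
  have iphi i : a i *m phi = inc k f i.
    rewrite /phi mulmx_sumr [LHS](sum_only (i := i)) => [|j ji].
      by rewrite mulmxA ab1 mul1mx.
    by rewrite mulmxA ab0 1?eq_sym // mul0mx.
  have phip i : phi *m prj k f i = b i.
    rewrite /phi mulmx_suml [LHS](sum_only (i := i)) => [|j ji].
      by rewrite -mulmxA inc_prj mulmx1.
    by rewrite -mulmxA inc_prj0 // mulmx0.
  exists V, phi, psi; split.
  - case=> [i|e]; rewrite !ffunE; first by rewrite -ab2 -mulmxA iphi mulmxA phip.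
    by rewrite [X in X *m phi]q3 -!ab2 -!mulmxA iphi !mulmxA phip.
  - by rewrite /psi mulmx_sumr -q2; apply: eq_bigr => i _; rewrite mulmxA phip.
  rewrite /psi mulmx_suml -(sum_prj_inc k f); apply: eq_bigr => i _.
  by rewrite -mulmxA iphi.
(* The ranks agree with [alpha] only by extensionality, so the representation is transported along
   [e]. *)
move=> fa; have e : f = alpha by apply/funext => i; rewrite -fa ffunE.
by clear -XV e; case: _ / e in V XV *; exists V.
Qed.

(** Idempotent endomorphisms correspond to decompositions into two complementary subrepresentations:
    image and kernel in one direction, the vertexwise projections along the second summand in the
    other. *)
Lemma assemble_indec f (V : grep f) : indec (assemble V) <->
  ~ (forall i, f i = 0%N) /\
  forall U W : forall i, {vspace 'rV[k]_(f i)},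
    (forall e v, v \in U (sr e) -> v *m V e \in U (tg e)) ->
    (forall e v, v \in W (sr e) -> v *m V e \in W (tg e)) ->
    (forall i, (U i + W i)%VS = fullv /\ (U i :&: W i)%VS = 0%VS) ->
    (forall i, U i = 0%VS) \/ (forall i, W i = 0%VS).
Proof.
split=> [[N0 iV]|[nz dec]].
  split=> [f0|U W sU sW UW]; first by rewrite big1 // in N0.
  have /dep_choice[B BU] : forall i, exists B : 'M[k]_(f i), rowspace_of (U i) B.
    move=> i; have [B [UB _]] := vspace_rowspace (U i); exists <<B>>%MS => v.
    by rewrite genmxE UB.
  have /dep_choice[C CW] : forall i, exists B : 'M[k]_(f i), rowspace_of (W i) B.
    move=> i; have [C [WC _]] := vspace_rowspace (W i); exists <<C>>%MS => v.
    by rewrite genmxE WC.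
  have BC0 i : (B i :&: C i)%MS = 0.
    exact: (rowspace_0 (rowspace_cap (BU i) (CW i))).1 (UW i).2.
  have BC1 i : (1%:M <= B i + C i)%MS.
    exact: (rowspace_full (rowspace_add (BU i) (CW i))).1 (UW i).1.
  pose g i := proj_mx (B i) (C i).
  have gid i r (M : 'M_(r, f i)) : (M <= B i)%MS -> M *m g i = M by apply: proj_mx_id.
  have g0 i r (M : 'M_(r, f i)) : (M <= C i)%MS -> M *m g i = 0 by apply: proj_mx_0.
  have gg i : g i *m g i = g i by apply: proj_mx_proj.
  clearbody g.
  have sB e : (B (sr e) *m V e <= B (tg e))%MS.
    by apply/row_subP => u; rewrite row_mul -BU; apply: sU; rewrite BU row_sub.
  have sC e : (C (sr e) *m V e <= C (tg e))%MS.
    by apply/row_subP => u; rewrite row_mul -CW; apply: sW; rewrite CW row_sub.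
  have hg e : V e *m g (tg e) = g (sr e) *m V e.
    apply/row_matrixP => u; rewrite !rowE !mulmxA.
    move: (delta_mx 0 u) => v.
    have /sub_addsmxP[[x y] /= ->] : (v <= B (sr e) + C (sr e))%MS.
      exact: submx_trans (submx1 _) (BC1 _).
    rewrite !mulmxDl; congr (_ + _).
      rewrite (gid _ _ (x *m B (sr e))) ?submxMl //.
      by rewrite gid // -mulmxA (submx_trans (submxMl _ _) (sB e)).
    rewrite (g0 _ _ (y *m C (sr e))) ?submxMl // mul0mx.
    by rewrite g0 // -mulmxA (submx_trans (submxMl _ _) (sC e)).
  have rec i : inc k f i *m gsum g *m prj k f i = g i.
    by rewrite inc_gsum -mulmxA inc_prj mulmx1.
  have [||gz|g1] := iV (gsum g).
  - exact: gsum_hom.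
  - by rewrite gsumM; apply: eq_bigr => i _; rewrite gg.
  - left=> i; apply/(rowspace_0 (BU i)).
    by rewrite -(gid i _ (B i)) // -rec gz mulmx0 mul0mx mulmx0.
  right=> i; apply/(rowspace_0 (CW i)).
  by have := g0 i _ (C i) (submx_refl _); rewrite -rec g1 mulmx1 inc_prj mulmx1.
split; first by rewrite lt0n sum_nat_eq0; apply/negP => /forallP f0; apply: nz => i; apply/eqP/f0.
move=> phi hphi ee; have [pE rel] := hom_gsum hphi.
pose g i := inc k f i *m phi *m prj k f i.
have gg i : g i *m g i = g i.
  have := congr1 (fun M => inc k f i *m M *m prj k f i) ee.
  have e1 : inc k f i *m phi = inc k f i *m phi *m prj k f i *m inc k f i by rewrite {1}pE inc_gsum.
  by rewrite /g !mulmxA -e1.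
have pg : phi = gsum g := pE.
have {}rel e : V e *m g (tg e) = g (sr e) *m V e := rel e.
clearbody g => {pE}.
have /dep_choice[U gU] : forall i, exists U, rowspace_of U (g i).
  by move=> i; apply: rowspace_vspace.
have /dep_choice[W gW] : forall i, exists U, rowspace_of U (1%:M - g i).
  by move=> i; apply: rowspace_vspace.
have [|||U0|W0] := dec U W.
- by move=> e v; rewrite !gU => /submxP[x ->]; rewrite -mulmxA -rel; rewrite mulmxA submxMl.
- move=> e v; rewrite !gW => /submxP[x ->]; rewrite -mulmxA mulmxBl mul1mx -rel.
  by rewrite -{1}(mulmx1 (V e)) -mulmxBr mulmxA submxMl.
- move=> i; split.
    apply/(rowspace_full (rowspace_add (gU i) (gW i))).
    rewrite -[X in (X <= _)%MS](subrK (g i)) addrC; apply: addmx_sub_adds; exact: submx_refl.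
  apply/(rowspace_0 (rowspace_cap (gU i) (gW i))).
  apply/eqP/rowV0P => v; rewrite sub_capmx => /andP[/submxP[x ->] /submxP[y e]].
  by rewrite -gg mulmxA e -mulmxA mulmxBl mul1mx gg subrr mulmx0.
- left; rewrite pg; apply: big1 => i _.
  by rewrite ((rowspace_0 (gU i)).1 (U0 i)) mulmx0 mul0mx.
right; rewrite pg -(gsum1 f); apply: eq_bigr => i _.
have /eqP := (rowspace_0 (gW i)).1 (W0 i); rewrite subr_eq0 => /eqP.
by move=> <-.
Qed.

Variable w : 'I_n -> rat.

(** The weight of a stable subspace depends only on its images at the vertices, which form a
    subrepresentation; conversely a subrepresentation sums up to a stable subspace with these
    images. *)
Lemma assemble_SS f (V : grep f) : \sum_i w i * (f i)%:R = 0 -> SS w (assemble V) <->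
  forall U : forall i, {vspace 'rV[k]_(f i)},
    (forall e v, v \in U (sr e) -> v *m V e \in U (tg e)) ->
    \sum_i w i * (\dim (U i))%:R <= 0.
Proof.
move=> w0; split=> [[_ sV] U sU|sV].
  have /dep_choice[B BU] : forall i, exists B : 'M[k]_(f i), rowspace_of (U i) B.
    move=> i; have [B [UB _]] := vspace_rowspace (U i); exists <<B>>%MS => v.
    by rewrite genmxE UB.
  have sB e : (B (sr e) *m V e <= B (tg e))%MS.
    by apply/row_subP => u; rewrite row_mul -BU; apply: sU; rewrite BU row_sub.
  pose M := (\sum_i <<B i *m inc k f i>>)%MS.
  have MB i : (M *m prj k f i :=: B i)%MS.
    apply/eqmxP/andP; split.
      rewrite sumsmxMr_gen; apply/sumsmx_subP => j _.
      rewrite genmxE (eqmxMr _ (genmxE _)); have [<-|ij] := eqVneq i j.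
        by rewrite -mulmxA inc_prj mulmx1.
      by rewrite -mulmxA inc_prj0 1?eq_sym // mulmx0 sub0mx.
    rewrite -[X in (X <= _)%MS]mulmx1 -(inc_prj k f i) mulmxA submxMr //.
    by apply: (sumsmx_sup i) => //; rewrite genmxE.
  have := sV M; rewrite /wt (eq_bigr (fun i => w i * (\dim (U i))%:R)); first last.
    move=> i _; congr (_ * _%:R); rewrite ffunE mulmxA mxrankMfree ?inc_free // (MB i).
    by rewrite (rowspace_dim (BU i)).
  apply=> -[i|e]; rewrite ffunE.
    by rewrite mulmxA (eqmxMr _ (MB i)); apply: (sumsmx_sup i) => //; rewrite genmxE.
  rewrite !mulmxA -mulmxA (eqmxMr _ (MB _)) mulmxA; apply: (sumsmx_sup (tg e)) => //.
  by rewrite genmxE submxMr.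
split=> [|U sU]; first by rewrite wt_dim -[RHS]w0; apply: eq_bigr => i _; rewrite assemble_fdim.
have /dep_choice[B BU] : forall i, exists B, rowspace_of B (U *m prj k f i).
  by move=> i; apply: rowspace_vspace.
rewrite /wt (eq_bigr (fun i => w i * (\dim (B i))%:R)); last first.
  by move=> i _; congr (_ * _%:R); rewrite ffunE mulmxA mxrankMfree ?inc_free // (rowspace_dim (BU i)).
apply: sV => e v; rewrite !BU => /submxP[x ->].
have := sU (inr e); rewrite ffunE => /(submxMr (prj k f (tg e))).
rewrite !mulmxA -[X in (X <= _)%MS]mulmxA inc_prj mulmx1 => le.
by apply: submx_trans le; rewrite -!mulmxA submxMl.
Qed.

End OverField.

Lemma assemble_mapf (k l : fieldType) (phi : {rmorphism k -> l}) f (V : grep k f) :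
  assemble ([ffun e => map_mx phi (V e)] : grep l f) = mapf phi (assemble V).
Proof.
have ei i : map_mx phi (inc k f i) = inc l f i by apply/matrixP => u v; rewrite !mxE rmorph_nat.
have ep i : map_mx phi (prj k f i) = prj l f i by apply/matrixP => u v; rewrite !mxE rmorph_nat.
apply/ffunP => -[i|e]; rewrite !ffunE /=; first by rewrite map_mxM ei ep.
by rewrite !map_mxM ei ep.
Qed.

End Assembly.

Section Dictionary.
Variables (n : nat) (a : 'M[nat]_n).
Variables (theta : {additive {ffun 'I_n -> int} -> int}) (mu : rat).
Local Notation A := (arrow a).
Local Notation sr := (@src n a).
Local Notation tg := (@tgt n a).
Implicit Types alpha beta : dvec n.

(* Semistability of slope mu amounts to the weight sum_i w_i dim_i being zero
   on the representation and nonpositive on its subrepresentations. *)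
Definition weight (i : 'I_n) : rat := (theta [ffun j => (j == i)%:R])%:~R - mu.

Lemma weight_sum beta :
  \sum_i weight i * (beta i)%:R = (thetad theta beta)%:~R - mu * (ht beta)%:R.
Proof.
have -> : thetad theta beta = \sum_i theta [ffun j => (j == i)%:R] *+ beta i.
  rewrite /thetad; have -> : [ffun i => (beta i)%:Z] =
      \sum_(i < n) ([ffun j => (j == i)%:R] : {ffun 'I_n -> int}) *+ beta i.
    apply/ffunP => j; rewrite ffunE sum_ffunE (bigD1 j) //= big1 ?addr0 => [|i ij].
      by rewrite ffunMnE ffunE eqxx mulr1n natz.
    by rewrite ffunMnE ffunE eq_sym (negPf ij) mul0rn.
  by rewrite raddf_sum; apply: eq_bigr => i _; rewrite raddfMn.
rewrite /ht natr_sum mulr_sumr rmorph_sum -sumrB; apply: eq_bigr => i _.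
by rewrite /weight mulrBl rmorphMn /= !mulr_natr.
Qed.

Lemma DeltaE beta : Delta theta mu beta <-> \sum_i weight i * (beta i)%:R = 0.
Proof.
rewrite weight_sum /Delta; split=> [/eqP->|/eqP]; first by rewrite subrr.
by rewrite subr_eq0.
Qed.

Lemma ht_eq0 beta : ht beta = 0%N <-> beta = 0.
Proof.
split=> [/eqP|->]; last by rewrite /ht big1 // => i _; rewrite ffunE.
rewrite sum_nat_eq0 => /forallP h; apply/ffunP => i; rewrite ffunE; exact/eqP/(h i).
Qed.

(** By [weight_sum] the weight is [theta - mu * ht], whose sign compares the slope with [mu].
    [semistable] tests only nonzero proper subrepresentations, and the two remaining ones have
    weight 0. *)
Lemma semistable_SS alpha (k : fieldType) (V : Rep a alpha k) :
  SS weight (assemble V) <-> Delta theta mu alpha /\ semistable theta V.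
Proof.
suff [key1 key2] : (SS weight (assemble V) -> Delta theta mu alpha) /\ (Delta theta mu alpha ->
    SS weight (assemble V) <-> semistable theta V).
  split=> [sV|[D sV]]; last by rewrite key2.
  by have D := key1 sV; rewrite -key2.
split=> [[w0 _]|D].
  by apply/DeltaE; rewrite -[RHS]w0 wt_dim; apply: eq_bigr => i _; rewrite assemble_fdim.
rewrite assemble_SS; last exact/DeltaE.
have slopeD : (0 < ht alpha)%N -> slope theta alpha = mu.
  move=> h0; move/eqP: D => D; rewrite /slope D mulfK // pnatr_eq0; lia.
have dimE (U : subspaces alpha k) : \sum_i weight i * (\dim (U i))%:R =
    (thetad theta (subdim U))%:~R - mu * (ht (subdim U))%:R.
  by rewrite -weight_sum; apply: eq_bigr => i _; rewrite ffunE.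
have ht0 (U : subspaces alpha k) : (exists i, U i <> 0%VS) -> (0 < ht (subdim U))%N.
  case=> i Ui; rewrite lt0n; apply/eqP => /ht_eq0 /ffunP/(_ i); rewrite !ffunE => /eqP.
  by rewrite dimv_eq0 => /eqP.
have hta (U : subspaces alpha k) : (exists i, U i <> 0%VS) -> (0 < ht alpha)%N.
  move=> /ht0 h; apply: leq_trans h _; apply: leq_sum => i _; rewrite ffunE.
  by apply: leq_trans (dimvS (subvf _)) _; rewrite dimvf /dim /= mul1n.
split=> [sV U sU U0 U1|sV U sU].
  rewrite slopeD ?(hta U) // /slope ler_pdivrMr ?ltr0n ?ht0 // -subr_le0 -dimE.
  exact: sV.
have [U0|/forallNP U0] := pselect (exists i, U i <> 0%VS); last first.
  by rewrite big1 // => i _; have /contrapT -> := U0 i; rewrite dimv0 mulr0.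
have [U1|/forallNP U1] := pselect (exists i, U i <> fullv); last first.
  rewrite le_eqVlt; apply/orP; left; apply/eqP; rewrite -[RHS]((DeltaE alpha).1 D).
  apply: eq_bigr => i _; have /contrapT -> := U1 i.
  by rewrite dimvf /dim /= mul1n.
have := sV U sU U0 U1; rewrite slopeD ?(hta U) // /slope ler_pdivrMr ?ltr0n ?ht0 //.
by rewrite -subr_le0 -dimE.
Qed.

Lemma indecomposable_indec alpha (k : fieldType) (V : Rep a alpha k) :
  indec (assemble V) <-> indecomposable V.
Proof.
rewrite assemble_indec; split=> -[nz h]; split=> //.
  by move=> a0; apply: nz => i; rewrite a0 ffunE.
by move=> a0; apply: nz; apply/ffunP => i; rewrite a0 ffunE.
Qed.

(** If the endomorphisms are scalars plus nilpotents, the residue polynomial [h] is linear and this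
    persists over the closure. Conversely [h] has a root in the closure, and indecomposability there
    forces degree 1. *)
Lemma split_end_abs alpha (F : finFieldType) (V : Rep a alpha F) :
  split_end (assemble V) <-> abs_indecomposable V.
Proof.
rewrite /abs_indecomposable -indecomposable_indec.
have -> : assemble (base_change (to_alg_closure F) V) = mapf (to_alg_closure F) (assemble V).
  exact: (@assemble_mapf n A sr tg _ _ (to_alg_closure F) alpha V).
split=> [sV|iV].
  have iV := split_indec sV; have [g [h st]] := indec_structure iV.
  by apply: split_indec; apply: structure_split iV st (split_structure sV st).
have iX : indec (assemble V).
  case: iV => m0 iV; split=> // f hf ff.
  have [||/eqP|/eqP] := iV (map_mx (to_alg_closure F) f); first exact: hom_mapf.
  - by rewrite -map_mxM ff.
  - by rewrite map_mx_eq0 => /eqP; left.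
  by rewrite -(map_mx1 (to_alg_closure F)) => /eqP/map_mx_inj ->; right.
have [g [h st]] := indec_structure iX.
have /closed_rootP[z rz] : size (map_poly (to_alg_closure F) h) != 1%N.
  by rewrite size_map_poly; case: st => -[_ [+ _] _ _] _; case: ltngtP.
have sz := mapf_indec_size st rz iV.
(* The trivial extension: the conclusion is wanted over [F] itself. *)
have := structure_split idfun iX st sz; congr (split_end _).
by apply/ffunP => e; rewrite !ffunE map_mx_id.
Qed.

Lemma nclasses_transv alpha (F : finFieldType) (P : Rep a alpha F -> Prop)
    (Q : obj ('I_n + A)%type F -> Prop) L :
  (forall V, P V <-> Q (obj_of (assemble V))) ->
  (forall x, Q x -> quiv sr tg (projT2 x) /\ fdim (projT2 x) = alpha) ->
  (forall x y, oiso x y -> Q x -> Q y) ->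
  transv (@oiso _ F) Q L id -> size L = nclasses P.
Proof.
move=> PQ Qq Qi tL.
have isoE (V W : Rep a alpha F) : iso V W <-> isof (assemble V) (assemble W).
  by rewrite assemble_iso.
have [|||M [tM sM]] := @card_equivalence_transv (Rep a alpha F) (@iso n a alpha F) P.
- by move=> V; rewrite isoE; apply: isof_refl.
- by move=> V W; rewrite !isoE; apply: isof_sym.
- by move=> V W U; rewrite !isoE; apply: isof_trans.
transitivity (size M); last exact: sM.
apply: (@transv_size _ _ Q Q _ _ L M id (fun V => obj_of (assemble V)) _ tL) => //.
case: tM => uM PM iM {}sM; split=> //.
- by move=> V /PM /PQ.
- by move=> V W VM WM /isoE; apply: iM.
move=> x Qx; have [q fa] := Qq x Qx; have [V xV] := assemble_ex q fa.
have /PQ/sM[W WM VW] : Q (obj_of (assemble V)) by apply: Qi Qx.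
by exists W => //; apply: isof_trans xV _; rewrite -isoE.
Qed.

Local Notation gd k := (@good n A sr tg weight k).

Lemma good_assemble alpha (k : fieldType) (V : Rep a alpha k) :
  Delta theta mu alpha -> gd k alpha (assemble V) <-> semistable theta V.
Proof.
move=> D; split=> [[_ /semistable_SS[] //]|sV]; split.
- exact: assemble_quiv.
- exact/semistable_SS.
by apply/ffunP => i; rewrite assemble_fdim.
Qed.

Lemma Mss_transv alpha (F : finFieldType) L : Delta theta mu alpha ->
  transv (@oiso _ F) (fun x => gd F alpha (projT2 x)) L id -> size L = Mss a theta F alpha.
Proof.
move=> D; apply: nclasses_transv => [V|x [q _ f] //|x y]; last exact: good_iso.
by rewrite good_assemble.
Qed.

Lemma Iss_transv alpha (F : finFieldType) L : Delta theta mu alpha ->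
  transv (@oiso _ F) (@good_indec n A sr tg weight F alpha) L id -> size L = Iss a theta F alpha.
Proof.
move=> D; apply: nclasses_transv => [V|x [[q _ f] _] //|x y xy [g i]].
  by rewrite /good_indec good_assemble // indecomposable_indec.
by split; [apply: good_iso g | apply: indec_iso i].
Qed.

Lemma Ass_transv alpha (F : finFieldType) L : Delta theta mu alpha ->
  transv (@oiso _ F) (@good_split n A sr tg weight F alpha) L id -> size L = Ass a theta F alpha.
Proof.
move=> D; apply: nclasses_transv => [V|x [[q _ f] _] //|x y xy [g i]].
  by rewrite /good_split good_assemble // split_end_abs.
by split; [apply: good_iso g | apply: split_iso i].
Qed.

Lemma good_Delta (k : fieldType) alpha m (X : fam ('I_n + A)%type k m) :
  gd k alpha X -> Delta theta mu alpha.
Proof. by case=> _ [w0 _] fa; apply/DeltaE; rewrite -[RHS]w0 wt_dim fa. Qed.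

End Dictionary.

(** * The two Moebius identities between indecomposables and absolutely indecomposables *)

Section CountingIdentities.
Variables (n : nat) (a : 'M[nat]_n).
Variables (theta : {additive {ffun 'I_n -> int} -> int}) (mu : rat).
Variables (q : nat) (GF : nat -> finFieldType).
Hypotheses (cardGF : forall r, (0 < r)%N -> #|GF r| = (q ^ r)%N).
Local Notation A := (arrow a).
Local Notation E := ('I_n + A)%type.
Local Notation w := (weight theta mu).
Local Notation Delta := (Delta theta mu).
Local Notation good_indec F := (@good_indec n A (@src n a) (@tgt n a) w F).
Local Notation good_split F := (@good_split n A (@src n a) (@tgt n a) w F).
Implicit Types alpha beta : dvec n.

Lemma dgcd_gt0 alpha : alpha != 0 -> (0 < dgcd alpha)%N.
Proof.
move=> nz; rewrite lt0n; apply: contraNneq nz => g0; apply/eqP/ffunP => i; rewrite ffunE.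
have : (dgcd alpha %| alpha i)%N by apply: (biggcdn_inf i).
by rewrite g0 dvd0n => /eqP.
Qed.

Lemma dvdn_dgcd d alpha : (d %| dgcd alpha)%N <-> forall i, (d %| alpha i)%N.
Proof.
split=> [h i|h]; last by apply/dvdn_biggcdP => i _.
by apply: dvdn_trans h _; apply: (biggcdn_inf i).
Qed.

Lemma dgcd_ddiv d alpha : alpha != 0 -> (d %| dgcd alpha)%N -> dgcd (ddiv alpha d) = (dgcd alpha %/ d)%N.
Proof.
move=> nz da; have d0 : (0 < d)%N := dvdn_gt0 (dgcd_gt0 nz) da.
apply/eqP; rewrite eqn_dvd; apply/andP; split.
  rewrite dvdn_divRL //; apply/dvdn_dgcd => i.
  have /dvdn_dgcd/(_ i) := dvdnn (dgcd (ddiv alpha d)); rewrite ffunE.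
  by rewrite dvdn_divRL ?(iffLR (dvdn_dgcd d alpha)).
apply/dvdn_dgcd => i; rewrite ffunE dvdn_divRL ?(iffLR (dvdn_dgcd d alpha)) //.
by rewrite divnK //; apply: (biggcdn_inf i).
Qed.

Lemma Delta_ddiv d alpha : alpha != 0 -> (d %| dgcd alpha)%N -> Delta alpha -> Delta (ddiv alpha d).
Proof.
move=> nz da /DeltaE D; have d0 : (0 < d)%N := dvdn_gt0 (dgcd_gt0 nz) da.
apply/DeltaE; have dn : (d%:R : rat) != 0 by rewrite pnatr_eq0; lia.
apply: (mulIf dn); rewrite mul0r -[RHS]D mulr_suml; apply: eq_bigr => i _.
by rewrite -mulrA -natrM ffunE divnK // (iffLR (dvdn_dgcd d alpha)).
Qed.

Lemma card_GF_ext r t : (0 < r)%N -> (0 < t)%N -> #|GF (r * t)| = (#|GF r| ^ t)%N.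
Proof. by move=> r0 t0; rewrite !cardGF ?muln_gt0 ?r0 // expnM. Qed.

Section Base.
Variables (r : nat) (s : dvec n -> seq (obj E (GF r))).
Hypotheses (r0 : (0 < r)%N)
  (ts : forall beta, transv (@oiso _ _) (good_indec (GF r) beta) (s beta) id).

(** Over an extension of degree [deg x] the polynomial of [x] has a root, and the dimension vector
    of [x] is [deg x] times that of the piece at this root. *)
Lemma deg_dvd_dgcd alpha x : x \in s alpha -> (deg x %| dgcd alpha)%N.
Proof.
case: (ts alpha) => _ gs _ _ /gs [gx ix].
have d0 := deg_gt0 ix.
have [iota] := finfield_embed (card_GF_ext r0 d0) d0.
have sz := size_zeros iota (card_GF_ext r0 d0) ix (dvdnn _).
have [z zx] : exists z, z \in zeros iota x.
  by case: (zeros iota x) sz d0 => [<- //|z zs _ _]; exists z; apply: mem_head.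
have [qx sx fx] := gx; rewrite -fx in gx.
have [_ _ [_ fd]] := comp_obj_split (card_GF_ext r0 d0) ix gx zx.
by apply/dvdn_dgcd => i; rewrite -fx fd dvdn_mulr.
Qed.

Lemma Ass_count beta t : (0 < t)%N -> Delta beta ->
  Ass a theta (GF (r * t)) beta =
    (\sum_(d <- divisors t) d * count (fun x => deg x == d) (s [ffun i => (d * beta i)%N]))%N.
Proof.
move=> t0 D; have ct := card_GF_ext r0 t0.
have [iota] := finfield_embed ct t0.
have [L tL] : exists L, transv (@oiso _ _) (good_split (GF (r * t)) beta) L id.
  apply: (@obj_transv_exists _ _ (ht beta)) => x [[qx _ fx] _].
  by rewrite -fx (ht_fdim qx).
by rewrite -(Ass_transv D tL) (count_split iota ct t0 ts tL).
Qed.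

End Base.

(** The indecomposables of dimension [alpha] are sorted by their degree [d], and Moebius inversion
    of [count_split] at [alpha / d] yields [d] times the number of those of degree [d]. The base
    field is any [GF r], as the converse formula substitutes all of them. *)
Lemma Iss_of_Ass alpha r : (0 < r)%N -> Delta alpha -> alpha != 0 ->
  (Iss a theta (GF r) alpha)%:R =
  \sum_(d <- divisors (dgcd alpha)) (d%:R : rat)^-1 *
    \sum_(t <- divisors d) moeb (d %/ t) * (Ass a theta (GF (r * t)) (ddiv alpha d))%:R.
Proof.
move=> r0 D nz; have g0 := dgcd_gt0 nz.
have [s ts] : exists s : dvec n -> seq (obj E (GF r)), forall beta,
    transv (@oiso _ _) (good_indec (GF r) beta) (s beta) id.
  apply: (@dep_choice _ _ (fun beta l => transv (@oiso _ _) (good_indec (GF r) beta) l id)) => beta.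
  apply: (@obj_transv_exists _ _ (ht beta)) => x.
  by move=> gx; apply: (good_indec_size gx).
rewrite -(Iss_transv D (ts alpha)).
have -> : size (s alpha) = (\sum_(d <- divisors (dgcd alpha)) count (fun x => deg x == d) (s alpha))%N.
  have := @deg_dvd_dgcd r s r0 ts alpha; elim: (s alpha) => [|x l IH] h /=.
    by rewrite big1.
  rewrite big_split /= -IH => [|y yl]; last by apply: h; rewrite inE yl orbT.
  rewrite (bigD1_seq (deg x)) ?divisors_uniq -?dvdn_divisors ?h ?mem_head //= eqxx.
  by rewrite big1 ?addn0 // => d /negPf; rewrite eq_sym => ->.
rewrite natr_sum; apply: eq_big_seq => d; rewrite -dvdn_divisors // => dg.
have d0 : (0 < d)%N := dvdn_gt0 g0 dg.
pose f e : rat := (e * count (fun x => deg x == e) (s [ffun i => (e * ddiv alpha d i)%N]))%:R.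
transitivity (d%:R^-1 * f d).
  rewrite /f natrM mulKf ?pnatr_eq0 -?lt0n //; congr (count _ (s _))%:R.
  by apply/ffunP => i; rewrite !ffunE mulnC divnK // (iffLR (dvdn_dgcd d alpha)).
congr (_ * _); rewrite -(moeb_inversion f d0); apply: eq_big_seq => t.
rewrite -dvdn_divisors // => td; have t0 := dvdn_gt0 d0 td.
by rewrite (Ass_count r0 ts t0) ?natr_sum //; exact: Delta_ddiv.
Qed.

Lemma Ass_of_Iss alpha : Delta alpha -> alpha != 0 ->
  (Ass a theta (GF 1%N) alpha)%:R =
  \sum_(d <- divisors (dgcd alpha)) (d%:R : rat)^-1 *
    \sum_(r <- divisors d) moeb r * (Iss a theta (GF r) (ddiv alpha d))%:R.
Proof.
move=> D nz; have g0 := dgcd_gt0 nz.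
pose I d r : rat := (Iss a theta (GF r) (ddiv alpha d))%:R.
pose B d r : rat := (Ass a theta (GF r) (ddiv alpha d))%:R.
rewrite (@moeb_double_inversion _ I B) // => [|d r dg r0].
  by rewrite /B (_ : ddiv alpha 1 = alpha) //; apply/ffunP => i; rewrite ffunE divn1.
have d0 : (0 < d)%N := dvdn_gt0 g0 dg.
rewrite /I Iss_of_Ass ?Delta_ddiv //; last first.
  apply: contra_neq nz => e; apply/ffunP => i; have /ffunP/(_ i) := e.
  by rewrite !ffunE => e0; rewrite -(divnK (iffLR (dvdn_dgcd d alpha) dg i)) e0.
rewrite dgcd_ddiv //; apply: eq_bigr => e _; congr (_ * _); apply: eq_bigr => t _.
rewrite /B; congr (_ * (Ass _ _ _ _)%:R).
by apply/ffunP => i; rewrite !ffunE divnMA.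
Qed.

End CountingIdentities.

(** * Unique decomposition as a product of series *)

Lemma good_biprod n (A : finType) (sr tg : A -> 'I_n) (w : 'I_n -> rat) (k : fieldType)
    (alpha beta : dvec n) m p q (Z : fam ('I_n + A)%type k m) (X : fam ('I_n + A)%type k p)
    (Y : fam ('I_n + A)%type k q) :
  biprod Z X Y -> good sr tg w alpha X -> good sr tg w beta Y -> good sr tg w (alpha + beta) Z.
Proof.
move=> b [qX sX fX] [qY sY fY]; have qZ := quiv_biprod b qX qY.
by split=> //; [exact: SS_biprod qZ b sX sY | rewrite (fdim_biprod b) fX fY].
Qed.

Section KrullSchmidtProduct.
Variables (n : nat) (A : finType) (sr tg : A -> 'I_n) (w : 'I_n -> rat) (k : finFieldType).
Local Notation E := ('I_n + A)%type.
Local Notation ob := (obj E k).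
Local Notation fam := (@fam E k).
Local Notation good := (@good n A sr tg w k).
Local Notation X_ := (mps_mon rat).
Implicit Types (alpha beta gamma : dvec n) (L : seq ob).

(** The sums of copies of members of [L], described through indecomposable summands so that no
    multiplicities have to be handled. *)
Definition add_closure L gamma (Z : ob) : Prop :=
  good gamma (projT2 Z) /\
  forall m (X : fam m), indec X -> summand X (projT2 Z) ->
    exists2 V, V \in L & isof X (projT2 V).

Lemma add_closure_transv L gamma : exists M : seq ob, transv (@oiso E k) (add_closure L gamma) M id.
Proof.
by apply: (@obj_transv_exists _ _ (ht gamma)) => x [[qx _ <-] _]; rewrite (ht_fdim qx).
Qed.

Definition good_list L : Prop :=
  [/\ uniq L, forall V, V \in L -> good_indec sr tg w (fdim (projT2 V)) V
    & forall V W, V \in L -> W \in L -> oiso V W -> V = W].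

Lemma good_zero : good 0 ([ffun=> 0] : fam 0).
Proof.
split.
- by split=> [i j||e]; apply/matrixP => -[].
- by split=> [|U _]; rewrite /wt big1 // => i _; rewrite (thinmx0 (_ *m _)) mxrank0 mulr0.
by apply/ffunP => i; rewrite !ffunE mxrank0.
Qed.

Lemma indec_fdim_neq0 m (X : fam m) : quiv sr tg X -> indec X -> fdim X != 0.
Proof.
move=> qX [m0 _]; apply: contraTneq m0 => f0; rewrite -(ht_fdim qX) f0.
by rewrite (_ : ht 0 = 0%N) // /ht big1 // => i _; rewrite ffunE.
Qed.

Lemma add_closure_nil gamma M : transv (@oiso E k) (add_closure [::] gamma) M id ->
  (size M)%:R = (gamma == 0)%:R :> rat.
Proof.
move=> tM.
have z0 Z : add_closure [::] gamma Z -> projT1 Z = 0%N /\ gamma = 0.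
  case: Z => m Z [[qZ _ fZ] h] /=; have [m0|/(indec_summand_exists Z)] := posnP m; last first.
    by case=> p [V [q [Y [iV b]]]]; have [W] := h _ V iV (biprod_summand b); rewrite in_nil.
  subst m; split=> //; rewrite -fZ; apply/ffunP => i; rewrite !ffunE.
  by rewrite [X in \rank X]thinmx0 mxrank0.
case: (eqVneq gamma 0) => [g0|gn] in tM *; last first.
  case: tM => _ PM _ _; case: M PM => // Z M /(_ Z (mem_head _ _))/z0[_ /eqP].
  by rewrite (negPf gn).
congr (_%:R); pose Z : ob := obj_of ([ffun=> 0] : fam 0).
have mZ W : W \in [:: Z] -> W = Z by rewrite inE => /eqP.
apply: (@transv_size _ _ _ (add_closure [::] 0) _ _ M [:: Z] id id _ tM); first by rewrite g0.
split=> // [W|W W'|Z' aZ]; first move/mZ=> -> /=; last 2 first.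
- by move=> /mZ-> /mZ->.
- exists Z; first exact: mem_head.
  move: (aZ); rewrite -g0 => /z0[m0 _]; case: Z' m0 aZ => m Z' /= m0 _.
  by subst m; exists 0, 0; split; [move=> e| |]; apply/matrixP => -[].
split=> [|m X [m0 iX] [i [j [_ _ ij]]]]; first exact: good_zero.
suff : (0 < m)%N = false by rewrite m0.
have := mxrankM_maxl i j; rewrite ij mxrank1 => /leq_trans/(_ (rank_leq_col _)).
by rewrite leqn0 => /eqP->.
Qed.

(** The sums that do not contain [V] are those over [L]; the others are [V] plus a complement,
    unique up to isomorphism by cancellation, again a sum over [V :: L]. *)
Lemma add_closure_cons V L : good_list (V :: L) ->
  forall gamma M N, transv (@oiso E k) (add_closure L gamma) M id ->
  (transv (@oiso E k) (add_closure (V :: L) gamma) N id ->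
   (forall delta, gamma <> fdim (projT2 V) + delta) -> size N = size M) /\
  forall delta N', gamma = fdim (projT2 V) + delta ->
   transv (@oiso E k) (add_closure (V :: L) gamma) N id ->
   transv (@oiso E k) (add_closure (V :: L) delta) N' id -> size N = (size M + size N')%N.
Proof.
move=> [/= /andP[VL uL] gL iL] gamma M N tM.
have [gV iV] := gL V (mem_head _ _).
have noV Z : add_closure L gamma Z -> ~ summand (projT2 V) (projT2 Z).
  move=> [_ h] s; have [W WL VW] := h _ _ iV s.
  by move: VL; rewrite (iL V W) ?mem_head ?inE ?WL ?orbT.
have sub Z : add_closure L gamma Z -> add_closure (V :: L) gamma Z.
  move=> [g h]; split=> // m X iX /(h _ _ iX)[W WL XW]; exists W => //.
  by rewrite inE WL orbT.
have sup Z : add_closure (V :: L) gamma Z -> ~ summand (projT2 V) (projT2 Z) ->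
    add_closure L gamma Z.
  move=> [g h] ns; split=> // m X iX sX; have [W WL XW] := h _ _ iX sX; exists W => //.
  move: WL; rewrite inE => /orP[/eqP WV|//]; case: ns.
  by apply: summand_trans sX; rewrite -WV; exact: isof_summand (isof_sym XW).
have split Z : add_closure (V :: L) gamma Z -> summand (projT2 V) (projT2 Z) ->
    exists Y : ob, biprod (projT2 Z) (projT2 V) (projT2 Y) /\
      gamma = fdim (projT2 V) + fdim (projT2 Y) /\ add_closure (V :: L) (fdim (projT2 Y)) Y.
  move=> [g h] /summand_biprod[q [Y b]]; exists (obj_of Y); split=> //=.
  have sY := biprod_summand (biprodC b).
  split; first by case: g => _ _ <-; exact: fdim_biprod b.
  split; first exact: good_summand sY g.
  by move=> m X iX sX; apply: h iX _; exact: summand_trans sX sY.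
split=> [tN no|delta N' gE tN tN'].
  apply: (@transv_size _ _ (add_closure (V :: L) gamma) (add_closure L gamma) _ _ N M id id) => // Z.
  split=> [aZ|]; last exact: sub.
  by apply: sup => // s; have [Y [_ [e _]]] := split Z aZ s; case: (no _ e).
pose D (y : ob) : ob := obj_of (dsum (projT2 V) (projT2 y)).
have bD y : biprod (projT2 (D y)) (projT2 V) (projT2 y) by exact: biprod_dsum.
have Dinj y y' : oiso (D y) (D y') -> oiso y y'.
  move=> h; apply: (biprod_cancel iV (bD y)).
  case: h => f [g [hf fg gf]]; have hg := hom_inv hf fg gf.
  case: (bD y') => i1 [p1 [i2 [p2 [[hi1 hp1 hi2 hp2] [e1 e2 e3 e4 e5]]]]].
  have c r s (x : 'M_(r, _)) (y0 : 'M_(_, s)) : (x *m g) *m (f *m y0) = x *m y0.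
    by rewrite -mulmxA (mulmxA g) gf mul1mx.
  exists (i1 *m g), (f *m p1), (i2 *m g), (f *m p2); split; split; rewrite ?c //; try exact: homM.
  by rewrite -!mulmxA -mulmxDr (mulmxA p1) (mulmxA p2) -mulmxDl e5 mul1mx.
have sD y : summand (projT2 V) (projT2 (D y)) := biprod_summand (bD y).
rewrite -(size_map D N') -size_cat.
apply: (@transv_size _ _ (add_closure (V :: L) gamma) (add_closure (V :: L) gamma) _ _ N _ id id) => //.
case: tM tN' => uM PM iM sM [uN PN iN sN]; split.
- rewrite cat_uniq uM map_inj_in_uniq ?uN ?andbT //=; last first.
    by move=> y y' yN yN' e; apply: iN => //; apply: Dinj; rewrite e; apply: oiso_refl.
  apply/hasPn => _ /mapP[y yN ->]; apply/negP => /PM/noV; apply; exact: sD.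
- move=> Z; rewrite mem_cat => /orP[/PM/sub //|/mapP[y yN ->]].
  have [gy hy] := PN y yN; split; first by rewrite gE; apply: good_biprod (bD y) gV gy.
  move=> m X iX /(indec_prime iX (bD y))[sX|sX]; last exact: hy iX sX.
  by exists V; [exact: mem_head | apply: summand_indec sX => //; case: iX].
- move=> Z Z'; rewrite !mem_cat.
  case/orP=> [ZM|/mapP[y yN ->]] /orP[ZM'|/mapP[y' yN' ->]] ZZ'.
  + exact: iM.
  + case: (noV _ (PM _ ZM)); apply: summand_trans (sD y') _.
    exact: isof_summand (isof_sym ZZ').
  + case: (noV _ (PM _ ZM')); apply: summand_trans (sD y) _.
    exact: isof_summand ZZ'.
  by congr D; apply: iN => //; apply: Dinj.
move=> Z aZ; have [s|ns] := pselect (summand (projT2 V) (projT2 Z)); last first.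
  by have [Z' Z'M ZZ'] := sM Z (sup Z aZ ns); exists Z' => //; rewrite mem_cat Z'M.
have [Y [b [e aY]]] := split Z aZ s.
have eY : fdim (projT2 Y) = delta by apply/ffunP => i; have /ffunP/(_ i) := e; rewrite gE !ffunE => /addnI.
rewrite eY in aY; have [y yN Yy] := sN Y aY; exists (D y).
  by rewrite mem_cat map_f ?orbT.
by apply: biprod_iso (isof_refl _) Yy b (bD y).
Qed.

(** The recursion says that multiplication by [1 - X^v], with [v] the dimension vector of [V], turns
    the series of [V :: L] into that of [L]. *)
Lemma coef_add_closure L : good_list L -> forall gamma M,
  transv (@oiso E k) (add_closure L gamma) M id ->
  (size M)%:R = (\prod_(V <- L) (1 - X_ (fdim (projT2 V)))^-1) gamma.
Proof.
elim: L => [_ gamma M tM|V L IH gVL]; first by rewrite big_nil (add_closure_nil tM).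
have gL : good_list L.
  case: gVL => /= /andP[_ uL] gL iL; split=> // [W WL|W W' WL WL'].
    by apply: gL; rewrite inE WL orbT.
  by apply: iL; rewrite inE ?WL ?WL' orbT.
have [[qV _ _] iV] : good_indec sr tg w (fdim (projT2 V)) V.
  by case: gVL => _ h _; apply: h (mem_head _ _).
have v0 := indec_fdim_neq0 qV iV; have uV := unit_1subX rat v0.
have [M' tM'] := dep_choice (add_closure_transv (V :: L)).
pose f : mps rat n := fun gamma => (size (M' gamma))%:R.
suff fE : f = \prod_(W <- V :: L) (1 - X_ (fdim (projT2 W)))^-1.
  move=> gamma M tM; rewrite -fE /f; congr (_%:R).
  exact: (@transv_size _ _ _ _ _ _ _ _ id id _ tM (tM' gamma)).
rewrite big_cons; apply: (mulrI uV); rewrite mulrA divrr // mul1r.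
apply/funext => gamma; have [M tM] := add_closure_transv L gamma.
rewrite -(IH gL _ _ tM) mulrBl mul1r.
transitivity (f gamma - (X_ (fdim (projT2 V)) * f) gamma); first by [].
have [key1 key2] := add_closure_cons gVL (M' gamma) tM.
have [[delta gE]|/forallNP no] := pselect (exists delta, gamma = fdim (projT2 V) + delta).
  rewrite {2}gE coef_mps_monM /f (key2 _ (M' delta) gE (tM' _) (tM' _)).
  by rewrite natrD addrK.
by rewrite coef_mps_monM_out // subr0 /f key1.
Qed.

End KrullSchmidtProduct.

(** * The product over indecomposables *)

Section SecondIdentity.
Variables (n : nat) (a : 'M[nat]_n).
Variables (theta : {additive {ffun 'I_n -> int} -> int}) (mu : rat) (F : finFieldType).
Local Notation A := (arrow a).
Local Notation E := ('I_n + A)%type.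
Local Notation w := (weight theta mu).
Local Notation good_indec := (@good_indec n A (@src n a) (@tgt n a) w F).
Local Notation good := (@good n A (@src n a) (@tgt n a) w F).
Implicit Types alpha beta : dvec n.

Lemma Mseries_transv beta M :
  transv (@oiso E F) (fun x => good beta (projT2 x)) M id -> Mseries a theta mu F beta = (size M)%:R.
Proof.
move=> tM; rewrite /Mseries; case: ifP => D; first by rewrite (Mss_transv D tM).
case: tM => _ PM _ _; case: M PM => // x M /(_ x (mem_head _ _))/good_Delta.
by rewrite D.
Qed.

Lemma good_transv beta :
  exists M, transv (@oiso E F) (fun x => good beta (projT2 x)) M id.
Proof.
by apply: (@obj_transv_exists _ _ (ht beta)) => x [qx _ <-]; rewrite (ht_fdim qx).
Qed.

Definition dim_box beta : {fset dvec n} := [fset unbox b | b in {: box n (ht beta)}]%fset.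

Lemma mem_dim_box alpha beta : (forall i, alpha i <= beta i)%N -> alpha \in dim_box beta.
Proof.
move=> le; apply/imfsetP; exists (mkbox (ht beta) alpha) => //.
by rewrite mkboxK // => i; apply: leq_trans (le i) (leq_ht _ _).
Qed.

Theorem Mseries_prod_Iss :
  has_prod (fun alpha => Delta theta mu alpha && (alpha != 0))
    (fun alpha => (1 - mps_mon rat alpha) ^- Iss a theta F alpha) (Mseries a theta mu F).
Proof.
(* Summands of a representation of dimension [beta] have dimension at most [beta]. The count holds
   for every list of indecomposables containing these, so enlarging [J'] changes nothing at
   [beta]. *)
move=> beta; exists (dim_box beta) => J' /fsubsetP sJ.
have [s ts] : exists s, forall alpha, transv (@oiso E F) (good_indec alpha) (s alpha) id.
  apply: (@dep_choice _ _ (fun alpha l => transv (@oiso E F) (good_indec alpha) l id)) => alpha.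
  apply: (@obj_transv_exists _ _ (ht alpha)) => x.
  by move=> gx; apply: (good_indec_size gx).
pose P alpha := Delta theta mu alpha && (alpha != 0).
pose L := flatten [seq s alpha | alpha <- [seq alpha <- J' | P alpha]].
have sP alpha x : x \in s alpha -> good_indec alpha x by case: (ts alpha) => _ + _ _; apply.
have LP x : x \in L -> exists2 alpha, x \in s alpha & alpha \in J' /\ P alpha.
  by case/flattenP => _ /mapP[alpha + ->] xs; rewrite mem_filter => /andP[Pa aJ]; exists alpha.
have gL : good_list (@src n a) (@tgt n a) w L.
  split.
  - apply: (@uniq_flatten_map _ (obj E F) _ s (fun x => fdim (projT2 x))).
    + by rewrite filter_uniq // fset_uniq.
    + by move=> alpha _; case: (ts alpha).
    by move=> alpha x _ /sP[[]].
  - by move=> x /LP[alpha /sP gx _]; have [[_ _ fx] _] := gx; rewrite fx.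
  move=> x y /LP[alpha xs _] /LP[alpha' ys _] xy.
  have [[_ _ fx] _] := sP _ _ xs; have [[_ _ fy] _] := sP _ _ ys.
  have e : alpha = alpha' by rewrite -fx -fy; apply: fdim_iso xy.
  by rewrite -e in ys; case: (ts alpha) => _ _ inj _; apply: inj.
have [M tM] := good_transv beta; rewrite (Mseries_transv tM).
have tM' : transv (@oiso E F) (add_closure (@src n a) (@tgt n a) w L beta) M id.
  case: tM => uM PM iM sM; split=> // [x /PM gx|x [gx _]]; last exact: sM.
  split=> // m X iX sX; have gX := good_summand sX gx; have [qX _ _] := gX.
  have [V VL XV] : exists2 V, V \in s (fdim X) & oiso (obj_of X) V.
    by case: (ts (fdim X)) => _ _ _ sur; apply: sur.
  exists V => //; apply/flattenP; exists (s (fdim X)) => //; apply: map_f.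
  rewrite mem_filter /P (good_Delta gX) (indec_fdim_neq0 qX iX) /=; apply: sJ.
  apply: mem_dim_box => i; have [q [Y b]] := summand_biprod sX.
  by have [_ _ <-] := gx; rewrite (fdim_biprod b) leq_dimvDl.
rewrite (coef_add_closure gL tM'); congr (_ beta).
rewrite /L big_flatten big_map big_filter; apply: eq_bigr => alpha /andP[D _].
rewrite -(Iss_transv D (ts alpha)) -exprVn.
transitivity (\prod_(V <- s alpha) (1 - mps_mon rat alpha)^-1).
  by rewrite big_const_seq count_predT iter_mulr_1.
by apply: eq_big_seq => V /sP[[_ _ ->]].
Qed.

End SecondIdentity.

(** * Masses: counting with automorphisms *)

Section Masses.
Variables (E : finType) (k : finFieldType).
Local Notation fam := (@fam E k).

Definition nunits m := #|[set g : 'M[k]_m | g \in unitmx]%SET|.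
Definition auts m (X : fam m) : {set 'M[k]_m} := finset (fun g => (g \in unitmx) && `[< hom X X g >]).
Definition naut (x : obj E k) := #|auts (projT2 x)|.

Lemma nunits_gt0 m : (0 < nunits m)%N.
Proof. by rewrite card_gt0; apply/set0Pn; exists 1%:M; rewrite inE unitmx1. Qed.

Lemma naut_gt0 x : (0 < naut x)%N.
Proof.
rewrite card_gt0; apply/set0Pn; exists 1%:M; rewrite inE unitmx1; apply/asboolP; exact: hom1.
Qed.

Lemma isof_unit m (X Y : fam m) : isof X Y <-> exists2 f, f \in unitmx & hom X Y f.
Proof.
split=> [[f [g [hf fg gf]]]|[f uf hf]]; first by exists f => //; case/mulmx1_unit: fg.
by exists f, (invmx f); rewrite mulmxV ?mulVmx.
Qed.

Lemma auts_isos m p (X : fam m) (Y : fam p) (f : 'M_(m, p)) g : hom X Y f ->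
  f *m g = 1%:M -> g *m f = 1%:M -> #|auts X| = #|auts Y|.
Proof.
move=> hf fg gf; have hg := hom_inv hf fg gf.
have inj : {in auts X &, injective (fun h => g *m h *m f)}.
  move=> h h' _ _ e; have := congr1 (fun M => f *m M *m g) e.
  by rewrite !mulmxA fg !mul1mx -!mulmxA fg !mulmx1.
rewrite -(card_in_imset inj); congr #|pred_of_set _|; apply/setP => h; apply/imsetP/idP.
  case=> h'; rewrite inE => /andP[uh /asboolP hh] ->; rewrite inE; apply/andP; split.
    have e : (g *m h' *m f) *m (g *m invmx h' *m f) = 1%:M.
      by rewrite !mulmxA -(mulmxA _ f g) fg mulmx1 -(mulmxA g h') mulmxV // mulmx1.
    by case/mulmx1_unit: e.
  by apply/asboolP; apply: homM (homM hg hh) hf.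
rewrite inE => /andP[uh /asboolP hh]; exists (f *m h *m g); last first.
  by rewrite !mulmxA gf mul1mx -mulmxA gf mulmx1.
rewrite inE; apply/andP; split; last by apply/asboolP; apply: homM (homM hf hh) hg.
have e : (f *m h *m g) *m (f *m invmx h *m g) = 1%:M.
  by rewrite !mulmxA -(mulmxA _ g f) gf mulmx1 -(mulmxA f h) mulmxV // mulmx1.
by case/mulmx1_unit: e.
Qed.

Lemma naut_iso x y : oiso x y -> naut x = naut y.
Proof. by case=> f [g [hf fg gf]]; exact: auts_isos hf fg gf. Qed.

Lemma card_fibers (T U : finType) (S : {set T}) (h : T -> U) :
  #|S| = (\sum_u #|[set x in S | h x == u]%SET|)%N.
Proof.
rewrite -sum1_card (partition_big h predT) //=; apply: eq_bigr => u _.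
by rewrite -sum1_card; apply: eq_bigl => x; rewrite inE.
Qed.

Lemma orbit_count x m : projT1 x = m ->
  (#|finset (fun Y : fam m => `[< isof (projT2 x) Y >])| * naut x = nunits m)%N.
Proof.
case: x => m' X /= em; subst m'; rewrite /naut /=.
pose c (g : 'M[k]_m) : fam m := [ffun e => invmx g *m X e *m g].
have hc g : g \in unitmx -> hom X (c g) g.
  by move=> ug e; rewrite ffunE !mulmxA mulmxV // mul1mx.
rewrite /nunits (card_fibers _ c) (bigID (fun Y => `[< isof X Y >])) /= addnC big1 ?add0n.
  rewrite -sum1dep_card big_distrl /=; apply: eq_bigr => Y /asboolP/isof_unit[f uf hf].
  rewrite mul1n; have inj : {in auts X &, injective (fun h => h *m f)}.
    by move=> h h' _ _ /(congr1 (mulmx^~ (invmx f))); rewrite !mulmxK.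
  rewrite -(card_in_imset inj); congr #|pred_of_set _|; apply/setP => g; rewrite !inE.
  apply/imsetP/andP.
    case=> h; rewrite inE => /andP[uh /asboolP hh] ->; split; first by rewrite unitmx_mul uh.
    apply/eqP/ffunP => e; rewrite ffunE -mulmxA (homM hh hf e).
    by rewrite mulmxA mulVmx ?mul1mx // unitmx_mul uh.
  case=> ug /eqP cg; exists (g *m invmx f); last by rewrite mulmxKV.
  rewrite inE unitmx_mul ug unitmx_inv uf; apply/asboolP; rewrite /= .
  apply: (@homM _ _ _ _ _ X Y X); first by rewrite -cg; exact: hc.
  by apply: hom_inv hf _ _; rewrite ?mulmxV ?mulVmx.
move=> Y; move=> /asboolPn no; apply/eqP; rewrite cards_eq0; apply/eqP/setP => g; rewrite !inE.
apply/negP => /andP[ug /eqP cg]; apply: no; apply/isof_unit; exists g => //.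
by rewrite -cg; exact: hc.
Qed.

Lemma sum_transv (P : obj E k -> Prop) m L (phi : obj E k -> rat) :
  (forall x, P x -> projT1 x = m) -> (forall x y, oiso x y -> P x -> P y) ->
  (forall x y, oiso x y -> phi x = phi y) ->
  transv (@oiso E k) P L id ->
  \sum_(X : fam m | `[< P (obj_of X) >]) phi (obj_of X) =
    \sum_(x <- L) phi x * ((nunits m)%:R / (naut x)%:R).
Proof.
move=> Pm Pi phii [uL PL iL sL].
have e x : x \in L -> phi x * ((nunits m)%:R / (naut x)%:R) =
    \sum_(X : fam m | `[< P (obj_of X) >]) if `[< isof (projT2 x) X >] then phi (obj_of X) else 0.
  move=> xL; rewrite -(orbit_count (Pm x (PL x xL))) natrM mulfK; last first.
    by rewrite pnatr_eq0 -lt0n naut_gt0.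
  rewrite -big_mkcondr /= -sum1dep_card natr_sum mulr_sumr.
  apply: eq_big => X; last by move=> /asboolP xX; rewrite mulr1; apply: phii.
  apply/asboolP/andP => [xX|[_ /asboolP] //]; split; apply/asboolP => //.
  exact: (Pi x (obj_of X) xX (PL x xL)).
rewrite [RHS](eq_big_seq _ e) exchange_big /=; apply: eq_bigr => X /asboolP PX.
have [x xL xX] := sL _ PX; rewrite (bigD1_seq x) //= asboolT; last exact: isof_sym xX.
rewrite big_seq_cond big1 ?addr0 // => y /andP[yL yx]; rewrite asboolF // => yX.
by case/eqP: yx; apply: iL => //; apply: isof_trans yX xX.
Qed.

(** By orbit counting this is the number of classes, each weighted by the inverse of its number of
    automorphisms. *)
Definition mass (P : obj E k -> Prop) m : rat :=
  #|finset (fun X : fam m => `[< P (obj_of X) >])|%:R / (nunits m)%:R.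

Lemma mass_transv (P : obj E k -> Prop) m L :
  (forall x, P x -> projT1 x = m) -> (forall x y, oiso x y -> P x -> P y) ->
  transv (@oiso E k) P L id -> mass P m = \sum_(x <- L) (naut x)%:R^-1.
Proof.
move=> Pm Pi tL; have := sum_transv (phi := fun=> 1) Pm Pi (fun _ _ _ => erefl) tL.
rewrite /mass -sum1dep_card natr_sum => ->; rewrite mulr_suml; apply: eq_bigr => x _.
by rewrite mul1r mulrAC mulfV ?mul1r // pnatr_eq0 -lt0n nunits_gt0.
Qed.

Lemma naut_dsum m p (X : fam m) (Y : fam p) :
  (forall f, hom X Y f -> f = 0) -> (forall f, hom Y X f -> f = 0) ->
  naut (obj_of (dsum X Y)) = (naut (obj_of X) * naut (obj_of Y))%N.
Proof.
move=> XY YX; rewrite /naut /= -cardsX.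
have inj : {in finset.setX (auts X) (auts Y) &, injective (fun gh => block_mx gh.1 0 0 gh.2)}.
  by move=> [g h] [g' h'] _ _ /= /eq_block_mx[-> _ _ ->].
rewrite -(card_in_imset inj); congr #|pred_of_set _|; apply/setP => g; apply/idP/imsetP.
  rewrite inE => /andP[ug /asboolP hg]; rewrite -(submxK g) in ug hg *.
  have hge e := hg e; have {}hge e : [/\ X e *m ulsubmx g = ulsubmx g *m X e,
      X e *m ursubmx g = ursubmx g *m Y e, Y e *m dlsubmx g = dlsubmx g *m X e
      & Y e *m drsubmx g = drsubmx g *m Y e].
    have := hge e; rewrite !ffunE !mulmx_block !mul0mx !mulmx0 !add0r !addr0.
    by case/eq_block_mx.
  have u0 : ursubmx g = 0 by apply: XY => e; case: (hge e).
  have d0 : dlsubmx g = 0 by apply: YX => e; case: (hge e).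
  rewrite u0 d0 in ug *; exists (ulsubmx g, drsubmx g) => //.
  rewrite !inE /= !unitmxE; move: ug; rewrite unitmxE det_ublock unitrM => /andP[-> ->] /=.
  by apply/andP; split; apply/asboolP => e; case: (hge e).
case=> -[a b]; rewrite !inE /= => /andP[/andP[ua /asboolP ha] /andP[ub /asboolP hb]] ->.
rewrite unitmxE det_ublock unitrM -!unitmxE ua ub; apply/asboolP => e.
by rewrite !ffunE !mulmx_block !mul0mx !mulmx0 !add0r !addr0 ha hb.
Qed.

End Masses.

Lemma transv_sum (E E' : finType) (k k' : finFieldType) (P : obj E k -> Prop) (P' : obj E' k' -> Prop)
    L L' (R : obj E k -> obj E' k' -> Prop) :
  transv (@oiso E k) P L id -> transv (@oiso E' k') P' L' id ->
  (forall x, P x -> exists2 y, P' y & R x y) ->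
  (forall y, P' y -> exists2 x, P x & R x y) ->
  (forall x x' y y', R x y -> R x' y' -> P x -> P x' -> P' y -> P' y' -> oiso x x' <-> oiso y y') ->
  (forall x y, R x y -> P x -> P' y -> naut x = naut y) ->
  \sum_(x <- L) (naut x)%:R^-1 = \sum_(y <- L') (naut y)%:R^-1 :> rat.
Proof.
move=> [uL PL iL sL] [uL' PL' iL' sL'] totl totr Riso Rn.
have /dep_choice[h hP] x : exists y : obj E' k', x \in L -> y \in L' /\ exists2 y0, P' y0 /\ R x y0 & oiso y0 y.
  case xL : (x \in L); last by exists (obj_of ([ffun=> 0] : fam E' k' 0)).
  have [y0 Py0 Rxy] := totl x (PL x xL); have [y yL' y0y] := sL' y0 Py0.
  by exists y => _; split=> //; exists y0.
transitivity (\sum_(y <- map h L) (naut y)%:R^-1 : rat).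
  rewrite big_map; apply: eq_big_seq => x xL; have [yL' [y0 [Py0 Rxy] iy]] := hP x xL.
  by rewrite (Rn x y0) ?(naut_iso iy) //; exact: PL.
apply: perm_big; apply: uniq_perm => //.
  rewrite map_inj_in_uniq // => x x' xL xL' e; apply: iL => //.
  have [_ [y0 [Py0 Rxy] iy]] := hP x xL; have [_ [y1 [Py1 Rxy'] iy']] := hP x' xL'.
  apply: (Riso x x' y0 y1 Rxy Rxy' (PL _ xL) (PL _ xL') Py0 Py1).2.
  by apply: oiso_trans iy _; rewrite e; apply: oiso_sym.
move=> y; apply/mapP/idP => [[x xL ->]|yL']; first by have [] := hP x xL.
have [x Px Rxy] := totr y (PL' y yL'); have [x' xL' xx'] := sL x Px; exists x' => //.
have [hL' [y0 [Py0 Rxy'] iy]] := hP x' xL'; apply: iL' => //.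
apply: oiso_trans iy.
exact: (Riso x x' y y0 Rxy Rxy' Px (PL _ xL') (PL' _ yL') Py0).1 xx'.
Qed.

(** * Pairs of a representation and a primary endomorphism *)

Section PrimaryPairs.
Variables (n : nat) (A : finType) (sr tg : A -> 'I_n) (w : 'I_n -> rat).
Local Notation E := ('I_n + A)%type.
Local Notation E1 := (E + unit)%type.
Implicit Types beta : dvec n.

Section AnyField.
Variable k : fieldType.

(* A family indexed by E1 is a family indexed by E with one more matrix. *)
Definition base m (Z : fam E1 k m) : fam E k m := [ffun e => Z (inl e)].
Definition op m (Z : fam E1 k m) : 'M[k]_m := Z (inr tt).
Definition extend m (X : fam E k m) (g : 'M[k]_m) : fam E1 k m :=
  [ffun e => match e with inl e => X e | inr _ => g end].

Lemma base_extend m (X : fam E k m) g : base (extend X g) = X.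
Proof. by apply/ffunP => e; rewrite !ffunE. Qed.

Lemma op_extend m (X : fam E k m) g : op (extend X g) = g.
Proof. by rewrite /op ffunE. Qed.

Lemma extend_base m (Z : fam E1 k m) : extend (base Z) (op Z) = Z.
Proof. by apply/ffunP => -[e|[]]; rewrite !ffunE. Qed.

Lemma hom_extend m p (Z : fam E1 k m) (Y : fam E1 k p) f :
  hom Z Y f <-> hom (base Z) (base Y) f /\ op Z *m f = f *m op Y.
Proof.
split=> [h|[h1 h2] [e|[]]]; last 1 first.
- exact: h2.
- by split=> [e|]; [rewrite !ffunE; exact: h | exact: h].
by have := h1 e; rewrite !ffunE.
Qed.

Lemma hom_base m p (Z : fam E1 k m) (Y : fam E1 k p) f : hom Z Y f -> hom (base Z) (base Y) f.
Proof. by move=> h; have [] := (hom_extend Z Y f).1 h. Qed.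

Lemma hom_op m p (Z : fam E1 k m) (Y : fam E1 k p) f : hom Z Y f -> op Z *m f = f *m op Y.
Proof. by move=> h; have [] := (hom_extend Z Y f).1 h. Qed.

Lemma biprod_base m p q (Z : fam E1 k m) (X : fam E1 k p) (Y : fam E1 k q) :
  biprod Z X Y -> biprod (base Z) (base X) (base Y).
Proof.
case=> i1 [p1 [i2 [p2 [[hi1 hp1 hi2 hp2] e]]]]; exists i1, p1, i2, p2.
by split=> //; split; apply: hom_base.
Qed.

(** Semistability is asked of the representation alone: the subrepresentations tested need not be
    preserved by [op Z]. *)
Definition primary (p : {poly k}) beta m (Z : fam E1 k m) : Prop :=
  [/\ good sr tg w beta (base Z), hom (base Z) (base Z) (op Z)
    & exists N, pmx (op Z) (p ^+ N) = 0].

Lemma primary_size p beta m (Z : fam E1 k m) : primary p beta Z -> m = ht beta.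
Proof. by case=> -[qZ _ <-] _ _; rewrite (ht_fdim qZ). Qed.

Lemma hom_opN m p (Z : fam E1 k m) (Y : fam E1 k p) f r : hom Z Y f ->
  pmx (op Z) r *m f = f *m pmx (op Y) r.
Proof. by move=> /hom_op; apply: pmx_intertwine. Qed.

Lemma primary_summand p beta m q (Y : fam E1 k q) (Z : fam E1 k m) :
  summand Y Z -> primary p beta Z -> primary p (fdim (base Y)) Y.
Proof.
move=> [i [j [hi hj ij]]] [gZ hZ [N zN]]; have sb : summand (base Y) (base Z).
  by exists i, j; split=> //; exact: hom_base.
have opE : op Y = i *m op Z *m j.
  by rewrite -(hom_op hi) -mulmxA ij mulmx1.
split; first exact: good_summand sb gZ.
  by rewrite opE; apply: homM (homM (hom_base hi) hZ) (hom_base hj).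
by exists N; rewrite -[LHS]mulmx1 -ij mulmxA (hom_opN _ hi) zN mulmx0 mul0mx.
Qed.

Lemma primary_iso p beta m q (Y : fam E1 k q) (Z : fam E1 k m) :
  isof Z Y -> primary p beta Z -> primary p beta Y.
Proof.
move=> ZY pZ; have [g h N] := primary_summand (isof_summand (isof_sym ZY)) pZ.
split=> //; case: pZ => gZ _ _; suff -> : beta = fdim (base Y) by [].
case: gZ => _ _ <-; apply: fdim_iso; case: ZY => f [f' [/hom_base hf ff' f'f]].
by exists f, f'.
Qed.

Lemma primary_weaken p p' beta m (Z : fam E1 k m) : p %| p' ->
  primary p beta Z -> primary p' beta Z.
Proof.
move=> pp' [g h [N zN]]; split=> //; exists N; apply: pmx_dvd zN; exact: dvdp_exp2r.
Qed.

Lemma primary_biprod p beta gamma m q r (Z : fam E1 k m) (X : fam E1 k q) (Y : fam E1 k r) :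
  biprod Z X Y -> primary p beta X -> primary p gamma Y -> primary p (beta + gamma) Z.
Proof.
move=> b [gX hX [N zN]] [gY hY [M zM]].
have gZ := good_biprod (biprod_base b) gX gY.
case: b => i1 [p1 [i2 [p2 [[hi1 hp1 hi2 hp2] [_ _ _ _ e]]]]].
have opE : op Z = p1 *m op X *m i1 + p2 *m op Y *m i2.
  by rewrite -(hom_op hp1) -(hom_op hp2) -!mulmxA -mulmxDr e mulmx1.
split=> //.
  rewrite opE; apply: homD; first exact: homM (homM (hom_base hp1) hX) (hom_base hi1).
  exact: homM (homM (hom_base hp2) hY) (hom_base hi2).
exists (N + M)%N; rewrite -[LHS]mulmx1 -e mulmxDr !mulmxA (hom_opN _ hp1) (hom_opN _ hp2).
by rewrite exprD !pmxM zN zM !(mul0mx, mulmx0) addr0.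
Qed.

Lemma coprime_primary_hom0 p1 p2 beta gamma m r (X : fam E1 k m) (Y : fam E1 k r) :
  coprimep p1 p2 -> primary p1 beta X -> primary p2 gamma Y ->
  forall f, hom X Y f -> f = 0.
Proof.
move=> cp [_ _ [N zN]] [_ _ [M zM]] f hf.
have /Bezout_eq1_coprimepP[[u v] /= uv] : coprimep (p1 ^+ N) (p2 ^+ M).
  by rewrite coprimep_expl // coprimep_expr.
rewrite -[f]mul1mx -(pmx1 (op X)) -uv pmxD !pmxM zN mulmx0 add0r -mulmxA.
by rewrite (hom_opN _ hf) zM !mulmx0.
Qed.

(** A Bezout relation between [p1^N] and [p2^N] gives two complementary idempotents that are
    polynomials in [op Z], hence commute with the whole family. *)
Lemma primary_split p1 p2 beta m (Z : fam E1 k m) :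
  coprimep p1 p2 -> primary (p1 * p2) beta Z ->
  exists q (X : fam E1 k q) r (Y : fam E1 k r),
    [/\ biprod Z X Y, primary p1 (fdim (base X)) X, primary p2 (fdim (base Y)) Y
      & beta = fdim (base X) + fdim (base Y)].
Proof.
move=> cp pZ; have [gZ hZ [N zN]] := pZ.
have /Bezout_eq1_coprimepP[[u v] /= uv] : coprimep (p1 ^+ N) (p2 ^+ N).
  by rewrite coprimep_expl // coprimep_expr.
set a := u * _ in uv; set b := v * _ in uv.
have ab0 : pmx (op Z) (a * b) = 0.
  by apply: pmx_dvd zN; rewrite exprMn /a /b mulrACA dvdp_mull.
have split_idem c : pmx (op Z) (c * (1 - c)) = 0 -> pmx (op Z) c *m pmx (op Z) c = pmx (op Z) c.
  by rewrite mulrBr mulr1 pmxB pmxM => /eqP; rewrite subr_eq0 => /eqP <-.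
have ea : 1 - a = b by rewrite -uv addrC addKr.
have eb : 1 - b = a by rewrite -uv addrK.
have ex e : e *m e = e -> exists r (i : 'M[k]_(r, m)) (j : 'M_(m, r)), i *m j = 1%:M /\ j *m i = e.
  by move=> /mx_idem_split[i [j ij]]; exists (\rank e), i, j.
have [r1 [i1 [q1 [iq1 qi1]]]] := ex _ (split_idem b (etrans (congr1 (fun c => pmx _ (b * c)) eb) (etrans (congr1 _ (mulrC b a)) ab0))).
have [r2 [i2 [q2 [iq2 qi2]]]] := ex _ (split_idem a (etrans (congr1 (fun c => pmx _ (a * c)) ea) ab0)).
have hp c : hom Z Z (pmx (op Z) c).
  by apply/hom_extend; split; [apply: hom_pmx | rewrite -{1}(pmxX (op Z)) pmxC2 pmxX].
have [hi1 hq1] : hom (retr i1 q1 Z) Z i1 /\ hom Z (retr i1 q1 Z) q1.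
  by apply: hom_retr => //; rewrite qi1; exact: hp.
have [hi2 hq2] : hom (retr i2 q2 Z) Z i2 /\ hom Z (retr i2 q2 Z) q2.
  by apply: hom_retr => //; rewrite qi2; exact: hp.
have bp : biprod Z (retr i1 q1 Z) (retr i2 q2 Z).
  exists i1, q1, i2, q2; split=> //; split=> //.
  - rewrite -[i1]mul1mx -iq1 -(mulmxA i1) qi1 -[q2]mulmx1 -iq2 (mulmxA q2) qi2.
    by rewrite !mulmxA -(mulmxA i1) -pmxM mulrC ab0 mulmx0 mul0mx.
  - rewrite -[i2]mul1mx -iq2 -(mulmxA i2) qi2 -[q1]mulmx1 -iq1 (mulmxA q1) qi1.
    by rewrite !mulmxA -(mulmxA i2) -pmxM ab0 mulmx0 mul0mx.
  by rewrite qi1 qi2 -pmxD addrC uv pmx1.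
have [_ _ Xp] := primary_summand (biprod_summand bp) pZ.
have [gX hX _] := primary_summand (biprod_summand bp) pZ.
have [gY hY _] := primary_summand (biprod_summand (biprodC bp)) pZ.
exists _, (retr i1 q1 Z), _, (retr i2 q2 Z); split=> //.
- split=> //; exists N; rewrite -[LHS]mulmx1 -iq1 mulmxA (hom_opN _ hi1).
  have -> : i1 = i1 *m pmx (op Z) b by rewrite -qi1 mulmxA iq1 mul1mx.
  rewrite -(mulmxA i1) -pmxM mulrC.
  rewrite (_ : p1 ^+ N * b = v * (p1 * p2) ^+ N); last by rewrite /b exprMn; ring.
  by rewrite pmxM zN !mulmx0 mul0mx.
- split=> //; exists N; rewrite -[LHS]mulmx1 -iq2 mulmxA (hom_opN _ hi2).
  have -> : i2 = i2 *m pmx (op Z) a by rewrite -qi2 mulmxA iq2 mul1mx.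
  rewrite -(mulmxA i2) -pmxM mulrC.
  rewrite (_ : p2 ^+ N * a = u * (p1 * p2) ^+ N); last by rewrite /a exprMn; ring.
  by rewrite pmxM zN !mulmx0 mul0mx.
by case: gZ => _ _ <-; apply: fdim_biprod (biprod_base bp).
Qed.

End AnyField.

Section Mass.
Variable k : finFieldType.
Local Notation primary_obj p beta := (fun x : obj E1 k => primary p beta (projT2 x)).

Definition mass_series (p : {poly k}) : mps rat n :=
  fun beta => mass (primary_obj p beta) (ht beta).

Lemma primary_transv p beta : exists L, transv (@oiso E1 k) (primary_obj p beta) L id.
Proof. by apply: (@obj_transv_exists _ _ (ht beta)) => x /primary_size. Qed.

Lemma mass_series_transv p beta L : transv (@oiso E1 k) (primary_obj p beta) L id ->
  mass_series p beta = \sum_(x <- L) (naut x)%:R^-1.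
Proof.
by apply: mass_transv => [x /primary_size //|x y xy]; apply: primary_iso.
Qed.

(** There are no nonzero homomorphisms between parts primary for coprime polynomials. So the classes
    for [p1 * p2] are the pairs of classes, and the orders of the automorphism groups multiply. *)
Lemma mass_series_mul p1 p2 : coprimep p1 p2 ->
  mass_series (p1 * p2) = mass_series p1 * mass_series p2.
Proof.
move=> cp; apply/funext => beta; rewrite [RHS]/(mps_mul _ _ _) /mps_mul.
have [s1 t1] := dep_choice (primary_transv p1); have [s2 t2] := dep_choice (primary_transv p2).
have [L tL] := primary_transv (p1 * p2) beta; rewrite (mass_series_transv tL).
pose D (xy : obj E1 k * obj E1 k) : obj E1 k := obj_of (dsum (projT2 xy.1) (projT2 xy.2)).
have bD xy : biprod (projT2 (D xy)) (projT2 xy.1) (projT2 xy.2) by exact: biprod_dsum.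
pose I := [seq bc : box n (ht beta) * box n (ht beta) <- index_enum _ | unbox bc.1 + unbox bc.2 == beta].
pose M := flatten [seq [seq (x, y) | x <- s1 (unbox bc.1), y <- s2 (unbox bc.2)] | bc <- I].
have P1 b x : x \in s1 b -> primary p1 b (projT2 x) by case: (t1 b) => _ + _ _; apply.
have P2 b x : x \in s2 b -> primary p2 b (projT2 x) by case: (t2 b) => _ + _ _; apply.
have fd p b m (Z : fam E1 k m) : primary p b Z -> fdim (base Z) = b by case=> -[].
have MP xy : xy \in M -> [/\ xy.1 \in s1 (fdim (base (projT2 xy.1))),
    xy.2 \in s2 (fdim (base (projT2 xy.2))) &
    fdim (base (projT2 xy.1)) + fdim (base (projT2 xy.2)) = beta].
  case/flattenP => _ /mapP[bc + ->] /allpairsP[[x y] /= [xs ys ->]].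
  rewrite mem_filter => /andP[/eqP e _] /=.
  by rewrite (fd _ _ _ _ (P1 _ _ xs)) (fd _ _ _ _ (P2 _ _ ys)).
have hom0 x y : (x \in s1 (fdim (base (projT2 x)))) -> (y \in s2 (fdim (base (projT2 y)))) ->
    (forall f, hom (projT2 x) (projT2 y) f -> f = 0) /\
    (forall f, hom (projT2 y) (projT2 x) f -> f = 0).
  move=> /P1 px /P2 py; split; first exact: coprime_primary_hom0 cp px py.
  by apply: coprime_primary_hom0 py px; rewrite coprimep_sym.
have tM : transv (@oiso E1 k) (primary_obj (p1 * p2) beta) M D.
  split.
  - apply: (@uniq_flatten_map _ _ _ _ (fun xy : obj E1 k * obj E1 k =>
      (mkbox (ht beta) (fdim (base (projT2 xy.1))), mkbox (ht beta) (fdim (base (projT2 xy.2)))))).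
    + by apply: filter_uniq; exact: index_enum_uniq.
    + move=> bc _; apply: allpairs_uniq; first by case: (t1 (unbox bc.1)).
        by case: (t2 (unbox bc.2)).
      by move=> [? ?] [? ?] _ _ /= [-> ->].
    move=> [b c] _ _ /allpairsP[[x y] /= [xs ys ->]] /=.
    by rewrite (fd _ _ _ _ (P1 _ _ xs)) (fd _ _ _ _ (P2 _ _ ys)) !unboxK.
  - move=> xy /MP[/P1 xs /P2 ys <-]; apply: (primary_biprod (bD xy)).
      by apply: primary_weaken xs; rewrite dvdp_mulr.
    by apply: primary_weaken ys; rewrite dvdp_mull.
  - move=> xy xy' /MP[xs ys _] /MP[xs' ys' _] h.
    have [_ yx'] := hom0 _ _ xs' ys; have [xy0 _] := hom0 _ _ xs ys'.
    have [_ yx0] := hom0 _ _ xs ys'; have [x'y _] := hom0 _ _ xs' ys.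
    case: h (bD xy) (bD xy') => f [g [hf fg gf]].
    case=> i1 [q1 [i2 [q2 [[hi1 hq1 hi2 hq2] [e1 e2 e3 e4 e5]]]]].
    case=> j1 [r1 [j2 [r2 [[hj1 hr1 hj2 hr2] [d1 d2 d3 d4 d5]]]]].
    have hg := hom_inv hf fg gf.
    have z1 : i1 *m f *m r2 = 0 by apply: xy0; apply: homM (homM hi1 hf) hr2.
    have z2 : i2 *m f *m r1 = 0 by apply: yx'; apply: homM (homM hi2 hf) hr1.
    have z3 : j1 *m g *m q2 = 0 by apply: x'y; apply: homM (homM hj1 hg) hq2.
    have z4 : j2 *m g *m q1 = 0 by apply: yx0; apply: homM (homM hj2 hg) hq1.
    have X1 : oiso xy.1 xy'.1.
      exists (i1 *m f *m r1), (j1 *m g *m q1); split; first exact: homM (homM hi1 hf) hr1.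
        have := congr1 (fun M => i1 *m f *m M *m g *m q1) d5.
        rewrite mulmx1 mulmxDr !mulmxDl !mulmxA z1 !mul0mx addr0 => ->.
        by rewrite -(mulmxA i1) fg mulmx1.
      have := congr1 (fun M => j1 *m g *m M *m f *m r1) e5.
      rewrite mulmx1 mulmxDr !mulmxDl !mulmxA z3 !mul0mx addr0 => ->.
      by rewrite -(mulmxA j1) gf mulmx1.
    have X2 : oiso xy.2 xy'.2.
      exists (i2 *m f *m r2), (j2 *m g *m q2); split; first exact: homM (homM hi2 hf) hr2.
        have := congr1 (fun M => i2 *m f *m M *m g *m q2) d5.
        rewrite mulmx1 mulmxDr !mulmxDl !mulmxA z2 !mul0mx add0r => ->.
        by rewrite -(mulmxA i2) fg mulmx1.
      have := congr1 (fun M => j2 *m g *m M *m f *m r2) e5.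
      rewrite mulmx1 mulmxDr !mulmxDl !mulmxA z4 !mul0mx add0r => ->.
      by rewrite -(mulmxA j2) gf mulmx1.
    have fX (x y : obj E1 k) : oiso x y -> fdim (base (projT2 x)) = fdim (base (projT2 y)).
      case=> h [h' [/hom_base hh hh' h'h]]; apply: fdim_iso; by exists h, h'.
    rewrite [LHS]surjective_pairing [RHS]surjective_pairing; congr (_, _).
      by case: (t1 (fdim (base (projT2 xy.1)))) => _ _ inj _; apply: inj => //; rewrite (fX _ _ X1).
    by case: (t2 (fdim (base (projT2 xy.2)))) => _ _ inj _; apply: inj => //; rewrite (fX _ _ X2).
  move=> Z /(primary_split cp)[q [X [r [Y [b pX pY e]]]]].
  have [x xs Xx] : exists2 x, x \in s1 (fdim (base X)) & oiso (obj_of X) x.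
    by case: (t1 (fdim (base X))) => _ _ _; apply.
  have [y ys Yy] : exists2 y, y \in s2 (fdim (base Y)) & oiso (obj_of Y) y.
    by case: (t2 (fdim (base Y))) => _ _ _; apply.
  have lX i : (fdim (base X) i <= ht beta)%N.
    by apply: leq_trans _ (leq_ht beta i); rewrite e leq_dimvDl.
  have lY i : (fdim (base Y) i <= ht beta)%N.
    by apply: leq_trans _ (leq_ht beta i); rewrite e addrC leq_dimvDl.
  exists (x, y); last exact: biprod_iso Xx Yy b (bD (x, y)).
  apply/flattenP; exists [seq (x, y) | x <- s1 (fdim (base X)), y <- s2 (fdim (base Y))].
    apply/mapP; exists (mkbox (ht beta) (fdim (base X)), mkbox (ht beta) (fdim (base Y))).
      by rewrite mem_filter mem_index_enum andbT /= (mkboxK lX) (mkboxK lY) e.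
    by rewrite /= (mkboxK lX) (mkboxK lY).
  by apply/allpairsP; exists (x, y).
transitivity (\sum_(xy <- M) (naut xy.1)%:R^-1 * (naut xy.2)%:R^-1 : rat).
  transitivity (\sum_(z <- map D M) (naut z)%:R^-1 : rat).
    apply: (transv_sum (R := eq) tL (transv_map tM)) => [x Px|x Px|x x' _ _ <- <-|x _ <-] //.
      by exists x.
    by exists x.
  rewrite big_map; apply: eq_big_seq => xy /MP[xs ys _]; have [z1 z2] := hom0 _ _ xs ys.
  rewrite naut_dsum // natrM invfM; case: xy {xs ys z1 z2} => -[? ?] [? ?]; by [].
rewrite /M big_flatten big_map /I big_filter; apply: eq_bigr => bc _.
rewrite (mass_series_transv (t1 _)) (mass_series_transv (t2 _)) big_allpairs_dep /=.
by rewrite mulr_suml; apply: eq_bigr => x _; rewrite mulr_sumr.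
Qed.

End Mass.
End PrimaryPairs.

(** * Primary decomposition of invertible endomorphisms *)

Section FactorsOfUnits.
Variable k : fieldType.
Implicit Types f h p : {poly k}.

Lemma irr_factor_exists h : (1 < size h)%N ->
  exists f, [/\ irreducible_poly f, f \is monic & f %| h].
Proof.
have [N] := ubnP (size h); elim: N h => // N IH h hN h1.
have h0 : h != 0 by rewrite -size_poly_gt0; lia.
have [ih|] := pselect (irreducible_poly h).
  have c0 : (lead_coef h)^-1 != 0 by rewrite invr_eq0 lead_coef_eq0.
  exists ((lead_coef h)^-1 *: h); split; last by rewrite dvdpZl.
    split; first by rewrite size_scale.
    move=> q q1; rewrite dvdpZr // => /(ih.2 q q1) e; rewrite (eqp_trans e) //.
    by rewrite eqp_sym eqp_scale.
  by rewrite monicE lead_coefZ mulVf ?lead_coef_eq0.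
move=> ni; have [q [q1 qh nq]] : exists q : {poly k}, [/\ size q != 1%N, q %| h & ~~ (q %= h)].
  apply: contra_notP ni => /forallNP no; split=> // q q1 qh.
  by apply: contra_notT (no q) => nq.
have q0 : q != 0 by apply: contraTneq qh => ->; rewrite dvd0p.
have sq : (1 < size q)%N by have := size_poly_gt0 q; rewrite q0; lia.
have [|f [fi fm fq]] := IH q _ sq; last by exists f; split=> //; exact: dvdp_trans fq qh.
have := dvdp_leq h0 qh; rewrite leq_eqVlt => /orP[/eqP e|lt]; last exact: leq_trans lt hN.
by case/negP: nq; rewrite -(dvdp_size_eqp qh) e.
Qed.

Lemma dvdp_exp_of_irr h p : h != 0 ->
  (forall f, irreducible_poly f -> f \is monic -> f %| h -> f %| p) -> exists N, h %| p ^+ N.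
Proof.
have [N] := ubnP (size h); elim: N h => // N IH h hN h0 hp.
have [h1|] := ltnP 1 (size h); last first.
  move=> le; exists 0%N; rewrite expr0 dvdp1.
  by have := size_poly_gt0 h; rewrite h0 eqn_leq le.
have [f [fi fm fh]] := irr_factor_exists h1.
have f0 : f != 0 by rewrite monic_neq0.
have eh := divpK fh; have d0 : h %/ f != 0 by rewrite divpN0 // dvdp_leq.
have [|||M dM] := IH (h %/ f).
- rewrite ltnS in hN; rewrite size_divp //; apply: leq_trans hN; rewrite ltn_subrL (ltnW h1) andbT.
  by have := fi.1; case: (size f) => [|[|]].
- exact: d0.
- by move=> g gi gm gd; apply: hp => //; rewrite -eh dvdp_mulr.
by exists M.+1; rewrite -eh exprSr; apply: dvdp_mul => //; apply: hp.
Qed.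

(** The characteristic polynomial of a unit has nonzero constant term, so ['X] is not among its
    irreducible factors. These have degree at most [m], and thus a finite product [p] can cover all
    of them. *)
Lemma unit_primary m (g : 'M[k]_m) p : g \in unitmx ->
  (forall f, irreducible_poly f -> f \is monic -> f != 'X -> (size f <= m.+1)%N -> f %| p) ->
  exists N, pmx g (p ^+ N) = 0.
Proof.
move=> ug hp; have [h [h0 sh hr hg]] : exists h : {poly k},
    [/\ h != 0, (size h <= m.+1)%N, h.[0] != 0 & pmx g h = 0].
  case: m g ug {hp} => [|m] g ug.
    exists 1; split; rewrite ?oner_neq0 ?size_poly1 ?hornerC ?oner_neq0 //.
    by apply/matrixP => -[].
  exists (char_poly g); split.
  - by rewrite monic_neq0 ?char_poly_monic.
  - by rewrite size_char_poly.
  - rewrite horner_coef0 char_poly_det mulf_neq0 ?signr_eq0 // -unitfE.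
    by rewrite -unitmxE.
  by rewrite pmxE Cayley_Hamilton.
have [|N dN] := @dvdp_exp_of_irr h p h0; last by exists N; apply: pmx_dvd dN hg.
move=> f fi fm fh; apply: hp => //; last exact: leq_trans (dvdp_leq h0 fh) sh.
apply: contraNneq hr => fX; have /dvdpP[q ->] := fh.
by rewrite fX hornerM hornerX mulr0.
Qed.

End FactorsOfUnits.

Section MassProducts.
Variables (n : nat) (A : finType) (sr tg : A -> 'I_n) (w : 'I_n -> rat) (k : finFieldType).
Local Notation E := ('I_n + A)%type.
Local Notation ms := (@mass_series n A sr tg w k).

Lemma mass_series_1 : ms 1 = 1.
Proof.
apply/funext => beta; rewrite [RHS]/(beta == 0)%:R /mass_series /mass.
have -> : finset (fun X : fam (E + unit)%type k (ht beta) =>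
    `[< primary sr tg w 1 beta (projT2 (obj_of X)) >]) = if beta == 0 then [set: _]%SET else finset.set0.
  apply/setP => X; rewrite inE; case: eqP => [b0|bn]; rewrite ?inE.
    apply/asboolP; subst beta; have h0 : ht (0 : dvec n) = 0%N by exact/ht_eq0.
    have triv a b (M M' : 'M[k]_(a, b)) : a = 0%N -> M = M'.
      by move=> e; subst a; apply/matrixP => -[].
    split; last by exists 0%N; apply: triv.
    - split.
      + by split=> [i j||e]; apply: triv.
      + split=> [|U _]; rewrite /wt big1 // => i _;
          by rewrite (triv _ _ (_ *m _) 0) // mxrank0 mulr0.
      by apply/ffunP => i; rewrite [LHS]ffunE [RHS]ffunE (triv _ _ (base _ _) 0) // mxrank0.
    by move=> e; apply: triv.
  apply/asboolP => -[_ _ [N]]; rewrite expr1n pmx1; apply/eqP.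
  have : (0 < ht beta)%N by rewrite lt0n; apply/eqP => /ht_eq0.
  by case: (ht beta) X => // m X _; rewrite /= (oner_neq0 'M[k]_m.+1).
case: eqP => [b0|_]; last by rewrite cards0 mul0r.
have h0 : ht beta = 0%N by exact/ht_eq0.
rewrite cardsT card_ffun card_mx /nunits.
have -> : finset (fun g : 'M[k]_(ht beta) => g \in unitmx) = [set: _]%SET.
  apply/setP => g; rewrite !inE; move: g; rewrite h0 => g.
  by rewrite unitmxE det_mx00 unitr1.
by rewrite cardsT card_mx h0 muln0 expn0 exp1n divrr // unitfE oner_eq0.
Qed.

Lemma mass_series_prod (r : seq {poly k}) : uniq r ->
  (forall f, f \in r -> irreducible_poly f /\ f \is monic) ->
  ms (\prod_(f <- r) f) = \prod_(f <- r) ms f.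
Proof.
elim: r => [_ _|f r IH /= /andP[fr ur] hr]; first by rewrite !big_nil mass_series_1.
have hr' g : g \in r -> irreducible_poly g /\ g \is monic by move=> gr; apply: hr; rewrite inE gr orbT.
have [fi fm] := hr f (mem_head _ _).
rewrite !big_cons mass_series_mul ?IH //.
elim: (r) fr hr' => [|g s IHs]; first by rewrite big_nil coprimep1.
rewrite inE negb_or => /andP[fg fs] hs; rewrite big_cons coprimepMr IHs ?andbT //; last first.
  by move=> h hin; apply: hs; rewrite inE hin orbT.
have [gi gm] := hs g (mem_head _ _).
have [//|nc] := boolP (coprimep f g).
have e1 := fi.2 _ nc (dvdp_gcdl f g); have e2 := gi.2 _ nc (dvdp_gcdr f g).
have : f %= g by apply: eqp_trans e2; rewrite eqp_sym.
by rewrite eqp_monic // (negPf fg).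
Qed.

(** Since [p] is coprime to ['X], the [p]-primary pairs are exactly the pairs of a representation
    and an automorphism. Each class of representations then contributes [naut] divided by [naut]. *)
Lemma mass_series_units p beta M : coprimep p 'X ->
  (forall g : 'M[k]_(ht beta), g \in unitmx -> exists N, pmx g (p ^+ N) = 0) ->
  transv (@oiso E k) (fun x => good sr tg w beta (projT2 x)) M id ->
  ms p beta = (size M)%:R.
Proof.
move=> cX un tM.
have nu0 : (nunits k (ht beta))%:R != 0 :> rat by rewrite pnatr_eq0 -lt0n nunits_gt0.
have sE : \sum_(X : fam E k (ht beta) | `[< good sr tg w beta X >]) (naut (obj_of X))%:R =
    (size M)%:R * (nunits k (ht beta))%:R :> rat.
  rewrite (@sum_transv E k (fun x => good sr tg w beta (projT2 x)) (ht beta) M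
    (fun x => (naut x)%:R)) //.
  - rewrite (eq_bigr (fun=> (nunits k (ht beta))%:R)).
      by rewrite big_const_seq count_predT iter_addr_0 mulr_natl.
    by move=> x _; rewrite mulrC divfK // pnatr_eq0 -lt0n naut_gt0.
  - by move=> x [qx _ <-]; rewrite (ht_fdim qx).
  - by move=> x y xy; apply: good_iso.
  by move=> x y /naut_iso->.
rewrite /mass_series /mass; apply: (mulIf nu0); rewrite divfK // -sE.
rewrite (card_fibers _ (@base n A k _)) natr_sum [RHS]big_mkcond /=; apply: eq_bigr => X _.
case: asboolP => [gX|nX]; last first.
  apply/eqP; rewrite pnatr_eq0 cards_eq0; apply/eqP/setP => Z; rewrite !inE.
  by apply/negP => /andP[/asboolP[+ _ _] /eqP e]; rewrite /= e.
congr (_%:R); have inj : injective (@extend n A k _ X).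
  by move=> g h /(congr1 (@op n A k _)); rewrite !op_extend.
rewrite /naut /= -(card_imset _ inj); congr #|pred_of_set _|; apply/setP => Z; rewrite !inE.
apply/andP/imsetP => [[/asboolP[_ /= hZ [N zN]] /eqP e]|[g]].
  exists (op Z); last by rewrite -e extend_base.
  rewrite inE -e; apply/andP; split; last exact/asboolP.
  have /Bezout_eq1_coprimepP[[u v] /= uv] : coprimep (p ^+ N) 'X by rewrite coprimep_expl.
  have := pmx1 (op Z); rewrite -uv pmxD !pmxM zN mulmx0 add0r pmxX => /mulmx1_unit[] //.
rewrite inE => /andP[ug /asboolP hg] ->; rewrite base_extend; split=> //; apply/asboolP; split=> /=.
- by rewrite base_extend.
- by rewrite base_extend op_extend.
by rewrite op_extend; apply: un.
Qed.

End MassProducts.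

Section Irreducibles.
Variable F : finFieldType.

Definition irrs d : seq {poly F} :=
  [seq val p | p <- enum (finset (fun p : {poly_d.+1 F} => [&& val p \is monic, size p == d.+1,
      val p != 'X & `[< irreducible_poly p >]]))].

Lemma size_irrs d : size (irrs d) = phi F d.
Proof. by rewrite size_map -cardE. Qed.

Lemma mem_irrs d f : f \in irrs d <->
  [/\ irreducible_poly f, f \is monic, size f = d.+1 & f != 'X].
Proof.
split=> [/mapP[p]|[fi fm sf fX]].
  by rewrite mem_enum inE => /and4P[pm /eqP sp pX /asboolP ip] ->.
have sz : (size f <= d.+1)%N by rewrite sf.
pose p : {poly_d.+1 F} := NPoly sz.
by apply/mapP; exists p => //; rewrite mem_enum inE; apply/and4P; split; rewrite ?sf //; apply/asboolP.
Qed.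

Lemma uniq_irrs d : uniq (irrs d).
Proof. by rewrite map_inj_uniq ?enum_uniq //; exact: val_inj. Qed.
End Irreducibles.

(** * Primary pairs over [F] and nilpotent pairs over [K] *)

Section RestrictionOfPairs.
Variables (F K : finFieldType) (iota : {rmorphism F -> K}) (r : nat).
Hypotheses (cardK : #|K| = (#|F| ^ r)%N).
Variables (f : {poly F}) (om : K).
Hypotheses (firr : irreducible_poly f) (fmon : f \is monic) (fsz : size f = r.+1).
Hypotheses (rom : root (map_poly iota f) om) (om0 : om != 0).
Local Notation fK := (map_poly iota f).
Local Notation "A ^i" := (map_mx iota A) (at level 2, format "A ^i").
Local Notation isres := (@isres F K iota r).
Variables (n : nat) (A : finType) (sr tg : A -> 'I_n) (w : 'I_n -> rat).
Local Notation E := ('I_n + A)%type.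
Local Notation E1 := (E + unit)%type.
Local Notation primaryF := (@primary n A sr tg w F f).
Local Notation primaryK := (@primary n A sr tg w K 'X).

(** A nilpotent pair over [K] is stored with eigenvalue 0; the shift restores the eigenvalue [om],
    as an operator killed by a power of [f] has over [K]. *)
Definition shift a (Y : fam E1 K a) : fam E1 K a := extend (base Y) (op Y + om%:M).

Lemma hom_shift a b (Y : fam E1 K a) (Y' : fam E1 K b) phi :
  hom (shift Y) (shift Y') phi <-> hom Y Y' phi.
Proof.
rewrite !hom_extend !base_extend !op_extend mulmxDl mulmxDr mul_scalar_mx mul_mx_scalar.
by split=> -[h1 h2]; split=> //; [exact: addIr h2 | rewrite h2].
Qed.

Definition restricts (x : obj E1 F) (y : obj E1 K) : Prop :=
  exists2 P : 'M[K]_(projT1 x, projT1 y), isres P & resf iota P (projT2 x) (shift (projT2 y)).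

(** A high power of the Frobenius kind is additive on polynomials in [u], fixes scalars and kills
    the nilpotent part. So multiplication by [om] is itself a power of the operator. *)
Lemma nil_shift_exp a (u : 'M[K]_a) N j : u ^+ N = 0 -> (N <= j)%N ->
  (u + om%:M) ^+ (#|K| ^ j) = om%:M.
Proof.
move=> uN Nj; have := pmx_exp_card (u + om%:M) ('X - om%:P) j.
rewrite !pmxB !pmxX !pmxC addrK => e; apply/eqP; rewrite -subr_eq0 e.
have le : (N <= #|K| ^ j)%N.
  apply: leq_trans Nj (ltnW (ltn_expl _ _)); exact: finNzRing_gt1.
by rewrite -(subnK le) exprD uN mulr0.
Qed.

Section Corr.
Variables (m a : nat) (Z : fam E1 F m) (Y : fam E1 K a) (P : 'M[K]_(m, a)).
Hypotheses (rP : isres P) (ZY : resf iota P Z (shift Y)).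

Lemma res_cancel b (U V : 'M[K]_(a, b)) : P *m U = P *m V -> U = V.
Proof.
have [B BP] := row_fullP (isres_full cardK rP) => e.
by rewrite -[U]mul1mx -BP -mulmxA e mulmxA BP mul1mx.
Qed.

Lemma restricts_base : resf iota P (base Z) (base Y).
Proof. by move=> e; rewrite /base !ffunE; have := ZY (inl e); rewrite !ffunE. Qed.

Lemma restricts_op : (op Z)^i *m P = P *m (op Y + om%:M).
Proof. by have := ZY (inr tt); rewrite ffunE. Qed.

Lemma restricts_exp k : (op Z ^+ k)^i *m P = P *m (op Y + om%:M) ^+ k.
Proof. by rewrite map_exp_mx; apply: exp_intertwine; exact: restricts_op. Qed.

Lemma restricts_good (beta gamma : dvec n) : (forall i, beta i = r * gamma i)%N ->
  good sr tg w beta (base Z) <-> good sr tg w gamma (base Y).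
Proof.
move=> bg; have r0 : (0 < r)%N by have := firr.1; rewrite fsz ltnS.
have fd : fdim (base Z) = beta <-> fdim (base Y) = gamma.
  have e i := resf_fdim cardK firr fmon fsz rom rP restricts_base i.
  split=> h; apply/ffunP => i; last by rewrite e h bg.
  apply/eqP; rewrite -(eqn_pmul2l r0) -bg -h e; exact/eqP.
have qd := resf_quiv cardK firr fmon fsz rom sr tg rP restricts_base.
split=> -[q s d]; split; do ?[exact/fd | exact/qd].
  by apply/(resf_SS cardK firr fmon fsz rom om0 w rP restricts_base q).
by apply/(resf_SS cardK firr fmon fsz rom om0 w rP restricts_base (qd.2 q)).
Qed.

Lemma restricts_endo : hom (base Z) (base Z) (op Z) <-> hom (base Y) (base Y) (op Y).
Proof.
have bE := restricts_base; have oE := restricts_op; split=> h e.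
  have : P *m (base Y e *m (op Y + om%:M)) = P *m ((op Y + om%:M) *m base Y e).
    by rewrite !mulmxA -bE -oE -!mulmxA -bE -oE !mulmxA -!map_mxM h.
  move/res_cancel; rewrite mulmxDl mulmxDr mul_scalar_mx mul_mx_scalar; exact: addIr.
apply: (isres_inj rP); rewrite !map_mxM -!mulmxA bE oE !mulmxA bE oE -!mulmxA; congr (P *m _).
by rewrite mulmxDl mulmxDr h mul_scalar_mx mul_mx_scalar.
Qed.

Lemma restricts_nil : (exists N, pmx (op Y) ('X ^+ N) = 0) -> exists N, pmx (op Z) (f ^+ N) = 0.
Proof.
case=> N zN; exists N; apply: (isres_inj rP); rewrite map_mx0 mul0mx map_pmx.
  rewrite (pmx_intertwine _ restricts_op) rmorphXn /=.
  have /dvdpP[h ->] : 'X - om%:P %| fK by rewrite dvdp_XsubCl.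
  rewrite exprMn pmxM [X in _ *m (_ *m X)](_ : _ = 0) ?mulmx0 //.
  by rewrite pmxXn pmxB pmxX pmxC addrK -zN pmxXn pmxX.
Qed.
End Corr.

(** The power [s] of [op Z] satisfies [f(s) = 0] exactly, since [f(s)] is a high power of [f(op Z)].
    So [s] serves as multiplication by [om], and the [om]-eigenspace of its base change is the space
    of the pair over [K]. *)
Lemma restricts_from m (Z : fam E1 F m) beta : primaryF beta Z ->
  exists a (Y : fam E1 K a), restricts (obj_of Z) (obj_of Y) /\ exists N, pmx (op Y) ('X ^+ N) = 0.
Proof.
move=> [gZ hZ [N zN]]; pose k := (#|F| ^ (r * N))%N.
have kE : k = (#|K| ^ N)%N by rewrite /k cardK expnM.
pose s := op Z ^+ k.
have sf : pmx s f = 0.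
  rewrite pmx_exp_card -pmxXn; apply: pmx_dvd zN; apply: dvdp_exp2l.
  rewrite -/k kE; apply: ltnW; apply: ltn_expl; exact: finNzRing_gt1.
have sfK : pmx s^i fK = 0 by rewrite -map_pmx sf map_mx0.
have nz : (fK %/ ('X - om%:P)).[om] != 0.
  apply: (irr_div_neq0 cardK firr fmon fsz rom).
  by rewrite (irr_trajectP cardK firr fmon fsz rom).
have ee := epr_idem sfK rom nz; have es := epr_eigen sfK rom.
have hs : hom (mapf iota Z) (mapf iota Z) s^i.
  apply: hom_mapf; apply/hom_extend; split; first exact: hom_exp.
  by rewrite /s !mulmxE -exprS exprSr.
have he := hom_epr fK om hs.
have [a [Q [P [QP PQ]]]] : exists a (Q : 'M[K]_(a, m)) (P : 'M_(m, a)),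
    Q *m P = 1%:M /\ P *m Q = epr s^i fK om.
  by have [Q [P QP]] := mx_idem_split ee; exists (\rank (epr s^i fK om)), Q, P.
have [hQ hP] := hom_retr QP (eq_ind_r (fun e => hom (mapf iota Z) (mapf iota Z) e) he PQ).
set Y0 := retr Q P (mapf iota Z) in hQ hP.
have sP : s^i *m P = om *: P.
  rewrite -[P in LHS]mulmx1 -QP (mulmxA P) PQ mulmxA es -scalemxAl; congr (_ *: _).
  by rewrite -PQ -mulmxA QP mulmx1.
have rP : isres P.
  split.
    have <- : \rank ((1%:M : 'M[F]_m)^i *m epr s^i fK om) = a.
      rewrite map_mx1 mul1mx -PQ; apply/eqP; rewrite eqn_leq; apply/andP; split.
        exact: leq_trans (mxrankM_maxr _ _) (rank_leq_row _).
      have := mxrankM_maxr Q (P *m Q *m P); rewrite !mulmxA QP mul1mx QP mxrank1 => h.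
      by apply: leq_trans h _; exact: mxrankM_maxl.
    rewrite (rank_epr cardK firr fmon fsz rom sf) ?mxrank1 //; exact: submx1.
  move=> v vP; apply: (epr_rational0 cardK firr fmon fsz rom sf).
  by rewrite -PQ mulmxA vP mul0mx.
pose Y := extend (base Y0) (op Y0 - om%:M).
have sY : shift Y = Y0 by rewrite /shift base_extend op_extend subrK extend_base.
exists a, Y; split.
  by exists P => //=; rewrite sY => e; have := hP e; rewrite ffunE.
(* The power [#|K| ^ N] of [op Y0 - om] is that of [op Y0] minus [om], which is 0 because this power
   of [op Y0] is [s] seen on the eigenspace. *)
exists (#|K| ^ N)%N; rewrite /Y op_extend pmxXn pmxX.
have := pmx_exp_card (op Y0) ('X - om%:P) N.
rewrite !pmxB !pmxX !pmxC => <-.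
have : P *m op Y0 ^+ (#|K| ^ N) = P *m om%:M.
  rewrite mul_mx_scalar -sP /s map_exp_mx kE; symmetry; apply: exp_intertwine.
  by have := hP (inr tt); rewrite ffunE.
by move/(res_cancel rP) ->; rewrite subrr.
Qed.

Lemma restricts_to a (Y : fam E1 K a) : exists m (Z : fam E1 F m), restricts (obj_of Z) (obj_of Y).
Proof.
have [P rP] := isres_exists firr fsz rom a.
have [Z ZY] := resf_exists cardK rP (shift Y).
by exists (r * a)%N, Z, P.
Qed.

Section Homs.
Variables (m a m' a' : nat) (Z : fam E1 F m) (Y : fam E1 K a) (P : 'M[K]_(m, a)).
Variables (Z' : fam E1 F m') (Y' : fam E1 K a') (P' : 'M[K]_(m', a')).
Hypotheses (rP : isres P) (ZY : resf iota P Z (shift Y)).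
Hypotheses (rP' : isres P') (ZY' : resf iota P' Z' (shift Y')).
Hypotheses (nY : exists N, pmx (op Y) ('X ^+ N) = 0) (nY' : exists N, pmx (op Y') ('X ^+ N) = 0).

(** A map that commutes with the operators commutes with their powers, in particular with
    multiplication by [om]; hence it is linear over [K]. *)
Lemma hom_restricts phi : hom Z Z' phi -> exists2 psi, hom Y Y' psi & phi^i *m P' = P *m psi.
Proof.
move=> hphi; have [N zN] := nY; have [N' zN'] := nY'; rewrite !pmxXn !pmxX in zN zN'.
(* One exponent large enough for both nilpotency indices, so that the same power is multiplication
   by [om] on both sides. *)
pose k := (#|K| ^ (N + N'))%N.
have s1 : (op Z ^+ k)^i *m P = om *: P.
  by rewrite (restricts_exp ZY) (nil_shift_exp zN) ?leq_addr // mul_mx_scalar.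
have s2 : (op Z' ^+ k)^i *m P' = om *: P'.
  by rewrite (restricts_exp ZY') (nil_shift_exp zN') ?leq_addl // mul_mx_scalar.
have [Q [QP PQ _]] := res_projector cardK firr fmon fsz rom rP s1.
have [Q' [QP' PQ' _]] := res_projector cardK firr fmon fsz rom rP' s2.
have ePhi : epr (op Z ^+ k)^i fK om *m phi^i = phi^i *m epr (op Z' ^+ k)^i fK om.
  rewrite /epr -scalemxAl -scalemxAr; congr (_ *: _); apply: pmx_intertwine.
  rewrite -!map_mxM; congr (_^i); apply: exp_intertwine; exact: hom_op.
have e : phi^i *m P' = P *m (Q *m phi^i *m P').
  by rewrite !mulmxA PQ ePhi -mulmxA -PQ' -mulmxA QP' mulmx1.
move: (Q *m phi^i *m P') e => psi e; exists psi => //; apply/hom_shift => x.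
apply: (res_cancel rP); rewrite mulmxA -ZY -mulmxA -e mulmxA -map_mxM hphi map_mxM.
by rewrite -mulmxA ZY' mulmxA e -mulmxA.
Qed.

Lemma restricts_hom psi : hom Y Y' psi -> exists2 phi, hom Z Z' phi & phi^i *m P' = P *m psi.
Proof.
move=> /hom_shift hpsi; have [phi e] := isres_surj cardK (P *m psi) rP'.
exists phi => // x; apply: (isres_inj rP'); rewrite !map_mxM -!mulmxA e ZY' !mulmxA ZY e.
by rewrite -!mulmxA hpsi.
Qed.
End Homs.

Lemma restricts_iso x x' y y' : restricts x y -> restricts x' y' ->
  (exists N, pmx (op (projT2 y)) ('X ^+ N) = 0) ->
  (exists N, pmx (op (projT2 y')) ('X ^+ N) = 0) -> oiso x x' <-> oiso y y'.
Proof.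
move=> [P rP ZY] [P' rP' ZY'] nY nY'; split=> -[g [h [hg gh hgi]]]; have hh := hom_inv hg gh hgi.
  have [g' hg' eg] := hom_restricts rP ZY rP' ZY' nY nY' hg.
  have [h' hh' eh] := hom_restricts rP' ZY' rP ZY nY' nY hh.
  exists g', h'; split=> //; [apply: (res_cancel rP) | apply: (res_cancel rP')].
    by rewrite mulmxA -eg -mulmxA -eh mulmxA -map_mxM gh map_mx1 mul1mx mulmx1.
  by rewrite mulmxA -eh -mulmxA -eg mulmxA -map_mxM hgi map_mx1 mul1mx mulmx1.
have [g' hg' eg] := restricts_hom ZY rP' ZY' hg.
have [h' hh' eh] := restricts_hom ZY' rP ZY hh.
exists g', h'; split=> //; [apply: (isres_inj rP) | apply: (isres_inj rP')].
  by rewrite map_mxM -mulmxA eh mulmxA eg -mulmxA gh map_mx1 mul1mx mulmx1.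
by rewrite map_mxM -mulmxA eg mulmxA eh -mulmxA hgi map_mx1 mul1mx mulmx1.
Qed.

Lemma restricts_naut x y : restricts x y ->
  (exists N, pmx (op (projT2 y)) ('X ^+ N) = 0) -> naut x = naut y.
Proof.
move=> [P rP ZY] nY; have [Q QP] := row_fullP (isres_full cardK rP).
pose h (phi : 'M[F]_(projT1 x)) := Q *m phi^i *m P.
have hE phi psi : phi^i *m P = P *m psi -> h phi = psi.
  by move=> e; rewrite /h -mulmxA e mulmxA QP mul1mx.
have down phi : hom (projT2 x) (projT2 x) phi ->
    hom (projT2 y) (projT2 y) (h phi) /\ phi^i *m P = P *m h phi.
  by move=> /(hom_restricts rP ZY rP ZY nY nY)[psi hpsi e]; rewrite (hE _ _ e).
rewrite /naut; have inj : {in auts (projT2 x) &, injective h}.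
  move=> u v; rewrite !inE => /andP[_ /asboolP/down[_ eu]] /andP[_ /asboolP/down[_ ev]] e.
  by apply: (isres_inj rP); rewrite eu ev e.
rewrite -(card_in_imset inj); congr #|pred_of_set _|; apply/setP => psi; apply/imsetP/idP.
  case=> u; rewrite inE => /andP[uu /asboolP hu] ->; have [hhu eu] := down _ hu.
  rewrite inE; apply/andP; split; last exact/asboolP.
  have [_ ev] := down _ (hom_invmx hu uu).
  suff /mulmx1_unit[] : h u *m h (invmx u) = 1%:M by [].
  apply: (res_cancel rP); rewrite mulmxA -eu -mulmxA -ev mulmxA -map_mxM mulmxV //.
  by rewrite map_mx1 mul1mx mulmx1.
rewrite inE => /andP[up /asboolP hp]; have [u hu eu] := restricts_hom ZY rP ZY hp.
have [v hv ev] := restricts_hom ZY rP ZY (hom_invmx hp up).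
exists u; last by rewrite (hE _ _ eu).
rewrite inE; apply/andP; split; last exact/asboolP.
suff /mulmx1_unit[] : u *m v = 1%:M by [].
apply: (isres_inj rP); rewrite map_mxM -mulmxA ev mulmxA eu -mulmxA mulmxV //.
by rewrite map_mx1 mul1mx mulmx1.
Qed.

(** Restriction is a bijection on isomorphism classes that preserves the number of automorphisms and
    multiplies dimension vectors by [r]; other dimension vectors carry no [f]-primary pair. *)
Lemma mass_series_res : @mass_series n A sr tg w F f = mps_subst_exp r (@mass_series n A sr tg w K 'X).
Proof.
have r0 : (0 < r)%N by have := firr.1; rewrite fsz ltnS.
apply/funext => beta; rewrite /mps_subst_exp; have [s ts] := primary_transv sr tg w f beta.
rewrite (mass_series_transv ts); case: forallP => [dv|ndv]; last first.
  case: s ts => [|x s] [_ Ps _ _]; first by rewrite big_nil.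
  case: ndv => i; have px := Ps x (mem_head _ _).
  have [a [Y [[P rP ZY] nY]]] := restricts_from px.
  have [[_ _ fx] _ _] := px.
  have := resf_fdim cardK firr fmon fsz rom rP (restricts_base ZY) i; rewrite fx => ->.
  exact: dvdn_mulr.
have bg i : (beta i = r * ddiv beta r i)%N by rewrite ffunE mulnC divnK.
have [t tK] := primary_transv sr tg w ('X : {poly K}) (ddiv beta r).
rewrite (mass_series_transv tK).
refine (transv_sum (R := restricts) ts tK _ _ _ _).
- move=> x px; have [a [Y [R nY]]] := restricts_from px; exists (obj_of Y); last by case: x {px} R.
  have [gx hx _] := px; case: R => P rP ZY; split=> //.
    exact/(restricts_good rP ZY bg).
  exact/(restricts_endo rP ZY).
- move=> [a Y] py; have [m [Z R]] := restricts_to Y; exists (obj_of Z) => //.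
  have [gy hy ny] := py; case: R => P rP ZY; split.
  + exact/(restricts_good rP ZY bg).
  + exact/(restricts_endo rP ZY).
  exact: (restricts_nil rP ZY).
- by move=> x x' y y' R R' _ _ [_ _ ny] [_ _ ny']; apply: restricts_iso.
by move=> x y R _ [_ _ ny]; apply: restricts_naut.
Qed.

End RestrictionOfPairs.

(** * Commuting with a nilpotent matrix *)

Section JordanForm.
Variable k : fieldType.

(* In jmx ms the i-th entry of ms (from 0) counts the blocks of size i + 1. The
   space of jmx (m :: ms) is the image, on which the matrix is jmx ms, followed
   by m vectors in the kernel and by sumn ms vectors mapped to the generators
   jtop ms of the image; jquo ms is the projection onto the cokernel. *)
Fixpoint jsize (ms : seq nat) : nat :=
  if ms is m :: ms' then (jsize ms' + (m + sumn ms'))%N else 0%N.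

Definition jtop (ms : seq nat) : 'M[k]_(sumn ms, jsize ms) :=
  match ms with
  | [::] => 0
  | m :: ms' => row_mx 0 1%:M : 'M_(m + sumn ms', jsize ms' + (m + sumn ms'))
  end.

Definition jquo (ms : seq nat) : 'M[k]_(jsize ms, sumn ms) :=
  match ms with
  | [::] => 0
  | m :: ms' => col_mx 0 1%:M : 'M_(jsize ms' + (m + sumn ms'), m + sumn ms')
  end.

Fixpoint jmx (ms : seq nat) : 'M[k]_(jsize ms) :=
  match ms with
  | [::] => 0
  | m :: ms' =>
    block_mx (jmx ms') 0 (col_mx 0 (jtop ms')) 0 : 'M_(jsize ms' + (m + sumn ms'))
  end.

Lemma jtop_quo ms : jtop ms *m jquo ms = 1%:M.
Proof.
case: ms => [|m ms]; first by apply/matrixP => -[].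
by rewrite /= mul_row_col mul0mx add0r mulmx1.
Qed.

Lemma jmx_quo ms : jmx ms *m jquo ms = 0.
Proof.
case: ms => [|m ms]; first by apply/matrixP => -[].
by rewrite /= mul_block_col !mulmx0 !mul0mx !addr0 col_mx0.
Qed.

Lemma jquo_ker ms p (v : 'M_(p, jsize ms)) : v *m jquo ms = 0 -> exists u, v = u *m jmx ms.
Proof.
elim: ms p v => [|m ms IH] p v; first by exists 0; rewrite mul0mx thinmx0.
rewrite /= -[v]hsubmxK mul_row_col mulmx0 mulmx1 add0r => r0.
have [|u eu] := IH _ (lsubmx v - lsubmx v *m jquo ms *m jtop ms).
  by rewrite mulmxBl -!mulmxA jtop_quo mulmx1 subrr.
exists (row_mx u (row_mx 0 (lsubmx v *m jquo ms))).
by rewrite mul_row_block !mulmx0 addr0 mul_row_col mul0mx add0r -eu subrK r0.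
Qed.

Lemma jtop_decomp ms : exists u, 1%:M = jquo ms *m jtop ms + u *m jmx ms.
Proof.
have [|u e] := @jquo_ker ms _ (1%:M - jquo ms *m jtop ms).
  by rewrite mulmxBl mul1mx -mulmxA jtop_quo mulmx1 subrr.
by exists u; rewrite -e addrC subrK.
Qed.

Lemma jmx_inj ms p (v : 'M_(jsize ms, p)) : jmx ms *m v = 0 -> jtop ms *m v = 0 -> v = 0.
Proof.
move=> h1 h2; have [u e] := jtop_decomp ms.
by rewrite -[v]mul1mx e mulmxDl -!mulmxA h1 h2 !mulmx0 addr0.
Qed.

Lemma jquo_full ms : row_full (jquo ms).
Proof. by apply/row_fullP; exists (jtop ms); exact: jtop_quo. Qed.

Lemma jmx_kermx ms : (kermx (jquo ms) :=: jmx ms)%MS.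
Proof.
apply/eqmxP/andP; split; last by apply/sub_kermxP; exact: jmx_quo.
by have [u ->] := jquo_ker (mulmx_ker (jquo ms)); exact: submxMl.
Qed.

Lemma rank_jmx ms : (\rank (jmx ms) + sumn ms = jsize ms)%N.
Proof.
rewrite -(jmx_kermx ms) mxrank_ker (eqP (jquo_full ms)) subnK //.
by rewrite -{1}(eqP (jquo_full ms)) rank_leq_row.
Qed.

Definition jcomm (s t : seq nat) (v : 'M[k]_(jsize s, jsize t)) : Prop :=
  jmx s *m v = v *m jmx t.

(** For [v] commuting with the Jordan matrices, the map induced on their cokernels, by
    [jind_quo]. *)
Definition jind (s t : seq nat) (v : 'M[k]_(jsize s, jsize t)) : 'M_(sumn s, sumn t) :=
  jtop s *m v *m jquo t.

Lemma jind_quo s t (v : 'M[k]_(jsize s, jsize t)) : jcomm v ->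
  v *m jquo t = jquo s *m jind v.
Proof.
move=> cv; have [u e] := jtop_decomp s.
rewrite -[X in X *m jquo t]mul1mx e !mulmxDl -!mulmxA (mulmxA (jmx s)) cv -(mulmxA v).
by rewrite jmx_quo !mulmx0 addr0 /jind -!mulmxA.
Qed.

Section Blocks.
Variables (a : nat) (s : seq nat) (b : nat) (t : seq nat).
Implicit Type v : 'M[k]_(jsize s + (a + sumn s), jsize t + (b + sumn t)).

(** The blocks below the image are not all free: [T] is forced to be the map that [x] induces on
    cokernels, and [y1], [y2] solve linear equations, while [Y] and [S] are arbitrary. *)
Lemma jcomm_cons (x : 'M[k]_(jsize s, jsize t)) (e : 'M_(jsize s, b + sumn t))
    (y1 : 'M_(a, jsize t)) (y2 : 'M_(sumn s, jsize t))
    (Y : 'M_(a, b)) (f : 'M_(a, sumn t)) (S : 'M_(sumn s, b)) (T : 'M_(sumn s, sumn t)) :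
  @jcomm (a :: s) (b :: t) (block_mx x e (col_mx y1 y2) (block_mx Y f S T)) <->
  [/\ jcomm x, e = 0, f = 0, T = jind x & y1 *m jmx t = 0 /\
      y2 *m jmx t = jtop s *m x - jind x *m jtop t].
Proof.
rewrite /jcomm /= !mulmx_block !mulmx0 !mul0mx !addr0.
rewrite mul_block_col !mulmx0 !add0r mul_col_mx mul0mx mul_col_mx mul0mx.
rewrite mul_col_mx add_col_mx; split=> [/eq_block_mx[]|[cx -> -> -> [h1 ->]]].
  move=> h1 h2 /eq_col_mx[h3 h4] h5.
  have e0 : e = 0.
    apply: jmx_inj => //; move: h5; rewrite -[X in _ = X]col_mx0 => /eq_col_mx[_ //].
  have h1' : jmx s *m x = x *m jmx t.
    by rewrite h1 e0 mul0mx addr0.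
  (* Multiplication by [jquo t] kills [jmx t] and turns [jtop t] into 1, which isolates [f] and then
     [T]. *)
  have := congr1 (mulmx^~ (jquo t)) h3; rewrite mulmxDl mul0mx -!mulmxA jmx_quo jtop_quo.
  rewrite mulmx0 mulmx1 add0r => f0; have := congr1 (mulmx^~ (jquo t)) h4.
  rewrite mulmxDl -!mulmxA jmx_quo jtop_quo mulmx0 mulmx1 add0r mulmxA -/(jind x) => T0.
  split=> //; split; first by rewrite h3 -f0 mul0mx addr0.
  by rewrite (_ : _ *m (x *m _) = T *m jtop t) ?h4 ?addrK // -T0 /jind !mulmxA.
by rewrite !mul0mx !mulmx0 col_mx0 !addr0 cx h1 subrK.
Qed.

Lemma jcomm_consP v : @jcomm (a :: s) (b :: t) v -> let q := drsubmx v in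
  [/\ jcomm (ulsubmx v), ursubmx v = 0, ursubmx q = 0 & drsubmx q = jind (ulsubmx v)].
Proof.
rewrite -{1}[v]submxK -{1}[drsubmx v]submxK -{1}[dlsubmx v]vsubmxK.
by case/jcomm_cons => h1 h2 h3 h4 _; split.
Qed.

Definition jblock (x : 'M[k]_(jsize s, jsize t)) (y1 : 'M_(a, jsize t)) (y2 : 'M_(sumn s, jsize t))
    (Y : 'M_(a, b)) (S : 'M_(sumn s, b)) :
    'M[k]_(jsize s + (a + sumn s), jsize t + (b + sumn t)) :=
  block_mx x 0 (col_mx y1 y2) (block_mx Y 0 S (jind x)).

Lemma jcomm_jblock x y1 y2 Y S : jcomm x ->
  y1 *m jmx t = 0 -> y2 *m jmx t = jtop s *m x - jind x *m jtop t ->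
  @jcomm (a :: s) (b :: t) (jblock x y1 y2 Y S).
Proof. by move=> cx h1 h2; apply/jcomm_cons. Qed.

Lemma jblock_ul x y1 y2 Y S : ulsubmx (jblock x y1 y2 Y S) = x.
Proof. exact: block_mxKul. Qed.

Lemma jblock_dr x y1 y2 Y S : ulsubmx (drsubmx (jblock x y1 y2 Y S)) = Y.
Proof. by rewrite block_mxKdr block_mxKul. Qed.

Lemma jblock_inj x y1 y2 Y S y1' y2' S' :
  jblock x y1 y2 Y S = jblock x y1' y2' Y S' -> [/\ y1 = y1', y2 = y2' & S = S'].
Proof. by case/eq_block_mx => _ _ /eq_col_mx[-> ->] /eq_block_mx[_ _ -> _]. Qed.

Lemma jcomm_jblockP v : @jcomm (a :: s) (b :: t) v ->
  let y1 := usubmx (dlsubmx v) in let y2 := dsubmx (dlsubmx v) in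
  let x := ulsubmx v in
  [/\ v = jblock x y1 y2 (ulsubmx (drsubmx v)) (dlsubmx (drsubmx v)),
    jcomm x, y1 *m jmx t = 0 & y2 *m jmx t = jtop s *m x - jind x *m jtop t].
Proof.
rewrite -{1}[v]submxK -{1}[drsubmx v]submxK -{1}[dlsubmx v]vsubmxK.
case/jcomm_cons => cx u0 u1 u2 [h1 h2]; split=> //.
by rewrite /jblock vsubmxK -u2 -[X in block_mx _ X]u0 -[X in block_mx (ulsubmx (drsubmx v)) X]u1 !submxK.
Qed.
End Blocks.
End JordanForm.

Section CommutingCount.
Variable k : finFieldType.

Lemma card_left_kernel p m r (M : 'M[k]_(m, r)) :
  #|finset (fun y : 'M[k]_(p, m) => y *m M == 0)| = (#|k| ^ (p * (m - \rank M)))%N.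
Proof.
rewrite -mxrank_ker; pose B := row_base (kermx M).
have inj : injective (fun z : 'M[k]_(p, \rank (kermx M)) => z *m B).
  by apply: row_free_inj; rewrite /B row_base_free.
rewrite -(card_mx k) -cardsT -(card_imset _ inj); congr #|pred_of_set _|; apply/setP => y.
rewrite inE; apply/eqP/imsetP => [yM|[z _ ->]].
  have /submxP[z ->] : (y <= B)%MS by rewrite /B eq_row_base; apply/sub_kermxP.
  by exists z.
by apply/sub_kermxP; rewrite (submx_trans (submxMl _ _)) // /B eq_row_base.
Qed.

(** Given [x] and [Y], the free data are [y1] in a kernel, [y2] in a translate of a kernel and [S]:
    exponents [a * sumn t], [sumn s * sumn t] and [sumn s * b], the whole product less [a * b]. *)
Lemma card_jcomm a s b t (x : 'M[k]_(jsize s, jsize t)) (Y : 'M[k]_(a, b)) : jcomm x ->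
  #|finset (fun v : 'M[k]_(jsize s + (a + sumn s), jsize t + (b + sumn t)) =>
      [&& `[< @jcomm k (a :: s) (b :: t) v >], ulsubmx v == x & ulsubmx (drsubmx v) == Y])|
  = (#|k| ^ ((a + sumn s) * (b + sumn t) - a * b))%N.
Proof.
move=> cx; have [y0 ey0] : exists y0, jtop k s *m x - jind x *m jtop k t = y0 *m jmx k t.
  apply: jquo_ker; rewrite mulmxBl -!mulmxA jtop_quo mulmx1 mulmxA -/(jind x). by rewrite subrr.
pose Ker p := finset (fun y : 'M[k]_(p, jsize t) => y *m jmx k t == 0).
have cK p : #|Ker p| = (#|k| ^ (p * sumn t))%N.
  by rewrite card_left_kernel -{1}(rank_jmx k t) addKn.
pose h (z : 'M[k]_(a, jsize t) * 'M[k]_(sumn s, jsize t) * 'M[k]_(sumn s, b)) :=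
  jblock x z.1.1 (z.1.2 + y0) Y z.2.
have inj : injective h by move=> [[? ?] ?] [[? ?] ?] /jblock_inj[/= -> /addIr -> ->].
transitivity #|finset.setX (finset.setX (Ker a) (Ker (sumn s))) [set: 'M[k]_(sumn s, b)]%SET|.
  rewrite -(card_imset _ inj); congr #|pred_of_set _|; apply/setP => v; rewrite inE.
  apply/and3P/imsetP => [[/asboolP cv /eqP vx /eqP vY]|[[[z1 z2] S]]].
    have /= [ev _ h1 h2] := jcomm_jblockP cv; rewrite vx vY in ev h2.
    exists (usubmx (dlsubmx v), dsubmx (dlsubmx v) - y0, dlsubmx (drsubmx v)); last first.
      by rewrite /h /= subrK.
    by rewrite !inE /= h1 eqxx mulmxBl h2 ey0 subrr eqxx.
  rewrite !inE /= andbT => /andP[/eqP h1 /eqP h2] ->; rewrite /h /=.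
  split; [ | by rewrite jblock_ul | by rewrite jblock_dr].
  have e2 : (z2 + y0) *m jmx k t = jtop k s *m x - jind x *m jtop k t by rewrite mulmxDl h2 add0r ey0.
  exact (jcomm_jblock Y S cx h1 e2).
rewrite !cardsX !cK cardsT card_mx -!expnD; congr expn; nia.
Qed.

End CommutingCount.

(** * Images and cokernels of endomorphisms of semistable representations *)

Section SemistableQuotients.
Variables (n : nat) (A : finType) (sr tg : A -> 'I_n) (w : 'I_n -> rat) (k : fieldType).
Local Notation fam := (@fam ('I_n + A)%type k).
Local Notation quiv := (quiv sr tg).

(** Image and kernel are both stable subspaces, of weight at most 0, and their weights add up to
    0. *)
Lemma SS_endo_image m (Z : fam m) N : quiv Z -> SS w Z -> hom Z Z N -> wt w Z N = 0.
Proof.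
move=> qZ sZ hN; have := wt_hom w qZ hN (stable1 Z).
have [-> _] := sZ; rewrite mul1mx => e.
have le1 : wt w Z N <= 0.
  apply: SS_le0 sZ _ => x; rewrite -hN; exact: submxMl.
have le2 : wt w Z (1%:M :&: kermx N)%MS <= 0.
  by apply: SS_le0 sZ _; apply: stable_cap; [exact: stable1 | exact: stable_kermx hN].
by apply/eqP; rewrite eq_le le1 /=; lra.
Qed.

Lemma SS_image m p (Z : fam m) (W : fam p) N B : quiv Z -> SS w Z -> hom Z Z N ->
  hom W Z B -> row_free B -> (B :=: N)%MS -> SS w W.
Proof.
move=> qZ sZ hN hB fB BN; apply: (SS_sub hB fB _ sZ).
by rewrite -(wt_free w _ hB fB) mul1mx (eqmx_wt w Z BN) (SS_endo_image qZ sZ hN).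
Qed.

(** A stable subspace of the quotient has the weight of its preimage, since the kernel, being the
    image of [N], has weight 0. *)
Lemma SS_cokernel m p (Z : fam m) (Q : fam p) N C : quiv Z -> SS w Z -> hom Z Z N ->
  hom Z Q C -> row_full C -> (kermx C :=: N)%MS -> SS w Q.
Proof.
move=> qZ sZ hN hC fC CN; have wN := SS_endo_image qZ sZ hN.
have wk : wt w Z (kermx C) = 0 by rewrite (eqmx_wt w Z CN).
have pre r (U : 'M_(r, p)) : stable Q U -> wt w Q U = wt w Z (kermx (C *m cokermx U)).
  move=> sU; set U' := kermx _.
  have inU b (v : 'M_(b, m)) : (v <= U')%MS = (v *m C <= U)%MS.
    by rewrite [RHS]submxE -mulmxA; apply/sub_kermxP/eqP.
  have sU' : stable Z U'.
    by move=> x; rewrite inU -mulmxA hC mulmxA (submx_trans (submxMr _ _) (sU x)) // -inU.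
  rewrite (wt_hom w qZ hC sU').
  have -> : wt w Z (U' :&: kermx C)%MS = 0.
    rewrite -wk; apply: eqmx_wt; apply/eqmxP/andP; split; first exact: capmxSr.
    by rewrite sub_capmx submx_refl andbT inU mulmx_ker sub0mx.
  rewrite addr0; apply: eqmx_wt; apply/eqmxP/andP; split; last by rewrite -inU.
  have [D DC] := row_fullP fC.
  by rewrite -[X in (X <= _)%MS]mulmx1 -DC mulmxA submxMr // inU -mulmxA DC mulmx1 submx_refl.
split=> [|U sU].
  have := wt_hom w qZ hC (stable1 Z); have [-> _] := sZ; rewrite mul1mx => e.
  have e1 : wt w Q C = wt w Q 1%:M.
    by apply: eqmx_wt; apply/eqmxP; rewrite submx1 sub1mx fC.
  have e2 : wt w Z (1%:M :&: kermx C)%MS = wt w Z (kermx C).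
    by apply: eqmx_wt; apply/eqmxP; rewrite capmxSr sub_capmx submx1 submx_refl.
  by rewrite -e1; move: e; rewrite e2 wk addr0.
rewrite pre //; apply: SS_le0 sZ _ => x; apply/sub_kermxP.
apply/eqP; rewrite mulmxA -submxE -mulmxA hC mulmxA.
have : (kermx (C *m cokermx U) *m C <= U)%MS by rewrite submxE -mulmxA mulmx_ker.
by move=> /(submxMr (Q x)) h; exact: submx_trans h (sU x).
Qed.

End SemistableQuotients.

Section GradedSums.
Variables (n : nat) (k : fieldType).
Implicit Types f : 'I_n -> nat.

Lemma gsum_free f f' (g : forall i, 'M[k]_(f i, f' i)) : (forall i, row_free (g i)) -> row_free (gsum g).
Proof.
move=> fg; have /dep_choice[h gh] : forall i, exists h, g i *m h = 1%:M by move=> i; apply/row_freeP.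
by apply/row_freeP; exists (gsum h); rewrite gsumM -(gsum1 k f); apply: eq_bigr => i _; rewrite gh.
Qed.

Lemma gsum_full f f' (g : forall i, 'M[k]_(f i, f' i)) : (forall i, row_full (g i)) -> row_full (gsum g).
Proof.
move=> fg; have /dep_choice[h gh] : forall i, exists h, h *m g i = 1%:M by move=> i; apply/row_fullP.
by apply/row_fullP; exists (gsum h); rewrite gsumM -(gsum1 k f'); apply: eq_bigr => i _; rewrite gh.
Qed.

Lemma gsum_ker f f' f'' (g : forall i, 'M[k]_(f i, f' i)) (h : forall i, 'M[k]_(f'' i, f i)) :
  (forall i, h i *m g i = 0) ->
  (forall i p (v : 'M_(p, f i)), v *m g i = 0 -> (v <= h i)%MS) -> (kermx (gsum g) :=: gsum h)%MS.
Proof.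
move=> hg0 ker; apply/eqmxP/andP; split; last first.
  by apply/sub_kermxP; rewrite gsumM; apply: big1 => i _; rewrite hg0 mulmx0 mul0mx.
set M := kermx _; have Mg : M *m gsum g = 0 by exact: mulmx_ker.
rewrite -[X in (X <= _)%MS]mulmx1 -(sum_prj_inc k f) mulmx_sumr; apply: summx_sub => i _.
rewrite mulmxA; have /submxP[u ->] : (M *m prj k f i <= h i)%MS.
  by apply: ker; rewrite -mulmxA -gsum_prj mulmxA Mg mul0mx.
by rewrite -mulmxA -inc_gsum mulmxA submxMl.
Qed.

End GradedSums.

(** * Representations commuting with a graded Jordan matrix *)

Section GradedJordan.
Variables (n : nat) (A : finType) (sr tg : A -> 'I_n).
Implicit Types (d : dvec n) (D : seq (dvec n)).

(** The entries of [D] are dimension vectors, one for each block size from 1 on; [parts_at D i] is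
    the resulting Jordan type at the vertex [i]. *)
Definition parts_at D i : seq nat := [seq fun_of_fin d i | d <- D].
Definition jdim D (i : 'I_n) : nat := jsize (parts_at D i).

Section AnyField.
Variable k : fieldType.
Local Notation rep := (grep sr tg k).

Definition gcomm D (V : rep (jdim D)) : Prop :=
  forall e, @jcomm k (parts_at D (sr e)) (parts_at D (tg e)) (V e).

Section Cons.
Variables (d : dvec n) (D : seq (dvec n)).
Local Notation c i := (sumn (parts_at D i)).
Variable V : rep (jdim (d :: D)).
Local Notation "V [ e ]" := (V e : 'M[k]_(jdim D (sr e) + (d (sr e) + c (sr e)),
  jdim D (tg e) + (d (tg e) + c (tg e)))) (at level 2).

(** With [W] the image of the nilpotent matrix: [gul] is the subrepresentation on [W], [gq] the
    quotient by [W], [gdr] the image of the kernel in [gq], and [gtop] the quotient of [gq] by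
    [gdr]. *)
Definition gul : rep (jdim D) := [ffun e => ulsubmx V[e]].
Definition gq : rep (fun i => d i + c i)%N := [ffun e => drsubmx V[e]].
Definition gdr : rep d := [ffun e => ulsubmx (drsubmx V[e])].
Definition gtop : rep (fun i => c i) := [ffun e => drsubmx (drsubmx V[e])].

Hypothesis cV : gcomm V.

Lemma gcomm_gul : gcomm gul.
Proof. by move=> e; rewrite ffunE; have [] := jcomm_consP (cV e). Qed.

Variable w : 'I_n -> rat.

(** Two exact sequences are combined: [gul] into [V] onto [gq], and [gdr] into [gq] onto [gtop]. The
    link is that [gtop] is also the cokernel of the nilpotent matrix on [gul], by the forced block
    [jind], so it is semistable as soon as [gul] is. *)
Lemma SS_jordan : SS w (assemble V) <-> SS w (assemble gul) /\ SS w (assemble gdr).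
Proof.
have cons e := jcomm_consP (cV e).
pose N := gsum (fun i => jmx k (parts_at (d :: D) i)).
pose NW := gsum (fun i => jmx k (parts_at D i)).
pose B := gsum (fun i => row_mx 1%:M 0 : 'M[k]_(jdim D i, jdim D i + (d i + c i))).
pose C := gsum (fun i => col_mx 0 1%:M : 'M[k]_(jdim D i + (d i + c i), d i + c i)).
pose J := gsum (fun i => row_mx 1%:M 0 : 'M[k]_(d i, d i + c i)).
pose R := gsum (fun i => col_mx 0 1%:M : 'M[k]_(d i + c i, c i)).
pose S := gsum (fun i => jquo k (parts_at D i)).
have hN : hom (assemble V) (assemble V) N by apply: gsum_hom => e; symmetry; apply: cV.
have hNW : hom (assemble gul) (assemble gul) NW by apply: gsum_hom => e; symmetry; apply: gcomm_gul.
have hB : hom (assemble gul) (assemble V) B.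
  apply: gsum_hom => e; rewrite ffunE; have [_ u0 _ _] := cons e.
  by rewrite -[X in _ = _ *m X](submxK V[e]) mul_row_block u0 mul_mx_row !mulmx1 !mul1mx !mulmx0 !mul0mx !addr0.
have hC : hom (assemble V) (assemble gq) C.
  apply: gsum_hom => e; rewrite ffunE; have [_ u0 _ _] := cons e.
  by rewrite -[X in X *m _ = _](submxK V[e]) mul_block_col u0 mul_col_mx !mulmx1 !mul1mx !mulmx0 !mul0mx !add0r.
have hJ : hom (assemble gdr) (assemble gq) J.
  apply: gsum_hom => e; rewrite !ffunE; have [_ _ u0 _] := cons e.
  by rewrite -[X in _ = _ *m X](submxK (drsubmx V[e])) mul_row_block u0 mul_mx_row !mulmx1 !mul1mx !mulmx0 !mul0mx !addr0.
have hR : hom (assemble gq) (assemble gtop) R.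
  apply: gsum_hom => e; rewrite !ffunE; have [_ _ u0 _] := cons e.
  by rewrite -[X in X *m _ = _](submxK (drsubmx V[e])) mul_block_col u0 mul_col_mx !mulmx1 !mul1mx !mulmx0 !mul0mx !add0r.
have hS : hom (assemble gul) (assemble gtop) S.
  apply: gsum_hom => e; rewrite !ffunE; have [cx _ _ ->] := cons e; exact: jind_quo cx.
have rowfree1 a b : row_free (row_mx 1%:M 0 : 'M[k]_(a, a + b)).
  by apply/row_freeP; exists (col_mx 1%:M 0); rewrite mul_row_col mulmx1 mul0mx addr0.
have colfull1 a b : row_full (col_mx 0 1%:M : 'M[k]_(a + b, b)).
  by apply/row_fullP; exists (row_mx 0 1%:M); rewrite mul_row_col mulmx1 mul0mx add0r.
have ker1 a b p (v : 'M[k]_(p, a + b)) : v *m (col_mx 0 1%:M : 'M[k]_(a + b, b)) = 0 ->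
    (v <= (row_mx 1%:M 0 : 'M[k]_(a, a + b)))%MS.
  rewrite -[v]hsubmxK mul_row_col mulmx0 mulmx1 add0r => ->.
  by apply/submxP; exists (lsubmx v); rewrite mul_mx_row mulmx1 mulmx0.
have fB : row_free B by apply: gsum_free => i; exact: rowfree1.
have fC : row_full C by apply: gsum_full => i; exact: colfull1.
have fJ : row_free J by apply: gsum_free => i; exact: rowfree1.
have fR : row_full R by apply: gsum_full => i; exact: colfull1.
have fS : row_full S by apply: gsum_full => i; exact: jquo_full.
have CB : (kermx C :=: B)%MS.
  apply: gsum_ker => [i|i p v]; last exact: ker1.
  by rewrite mul_row_col mulmx0 mul0mx addr0.
have RJ : (kermx R :=: J)%MS.
  apply: gsum_ker => [i|i p v]; last exact: ker1.
  by rewrite mul_row_col mulmx0 mul0mx addr0.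
have jker s p (v : 'M[k]_(p, jsize s)) : v *m jquo k s = 0 -> (v <= jmx k s)%MS.
  by case/jquo_ker => u ->; exact: submxMl.
have SN : (kermx S :=: NW)%MS.
  by apply: gsum_ker => [i|i p v]; [exact: jmx_quo | exact: jker].
have CN : (kermx C :=: N)%MS.
  apply: gsum_ker => [i|i p v]; first exact: (jmx_quo k (parts_at (d :: D) i)).
  exact: (@jker (parts_at (d :: D) i)).
have BN : (B :=: N)%MS by apply: eqmx_trans CN; apply: eqmx_sym.
have qV := assemble_quiv V; have qU := assemble_quiv gul; have qQ := assemble_quiv gq.
split=> [sV|[sU sY]].
  have sU := SS_image qV sV hN hB fB BN.
  have sQ := SS_cokernel qV sV hN hC fC CN.
  have sT := SS_cokernel qU sU hNW hS fS SN.
  split=> //; apply: (SS_sub hJ fJ _ sQ).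
  have := wt_hom w qQ hR (stable1 _); have [-> _] := sQ.
  have -> : wt w (assemble gtop) (1%:M *m R) = 0.
    by have [<- _] := sT; apply: eqmx_wt; apply/eqmxP; rewrite mul1mx submx1 sub1mx.
  rewrite add0r => e; rewrite -(wt_free w _ hJ fJ) mul1mx.
  transitivity (wt w (assemble gq) (1%:M :&: kermx R)%MS); last exact: esym e.
  apply: eqmx_wt.
  apply: (eqmx_trans (eqmx_sym RJ)); apply/eqmxP.
  by rewrite sub_capmx submx1 submx_refl capmxSr.
have sT := SS_cokernel qU sU hNW hS fS SN.
have sQ := SS_extension qQ hJ hR fJ fR RJ sY sT.
exact: SS_extension qV hB hC fB fC CB sU sQ.
Qed.

End Cons.
End AnyField.
End GradedJordan.

Lemma card_dffun_forall (A : finType) (T : A -> finType) (S : forall e, {set T e}) :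
  #|finset (fun V : {dffun forall e : A, T e} => [forall e, V e \in S e])| = (\prod_e #|S e|)%N.
Proof.
transitivity #|(family (fun e => mem (S e)) : simpl_pred {dffun forall e : A, T e})|; last by rewrite card_family foldrE big_image.
by apply: eq_card => V; rewrite inE; apply/forallP/familyP.
Qed.

Section GradedCount.
Variables (n : nat) (A : finType) (sr tg : A -> 'I_n) (k : finFieldType).
Implicit Types (d : dvec n) (D : seq (dvec n)).
Local Notation rep := (grep sr tg k).
Variable P : forall f : 'I_n -> nat, rep f -> Prop.
Hypothesis P_nil : forall V : rep (jdim [::]), P V.
Hypothesis P_cons : forall d D (V : rep (jdim (d :: D))), gcomm V ->
  P V <-> P (gul V) /\ P (gdr V).

Definition dtot D (i : 'I_n) : nat := sumn (parts_at D i).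

(** The exponents of [card_jcomm], summed over the arrows and over the layers. *)
Fixpoint cexp D : nat :=
  if D is d :: D' then
    (\sum_(e : A) (dtot (d :: D') (sr e) * dtot (d :: D') (tg e) - d (sr e) * d (tg e))
       + cexp D')%N
  else 0%N.

Definition nP (f : 'I_n -> nat) : nat := #|finset (fun Y : rep f => `[< P Y >])|.

(** The property [P] is left abstract to serve twice. For semistability the formula gives the
    numerators of [Pmu]; for invertibility, with one arrow at each vertex, it gives the order of the
    centralizer of the Jordan matrix, hence the denominators. *)
Lemma card_gcomm D :
  #|finset (fun V : rep (jdim D) => `[< gcomm V /\ P V >])| =
  (#|k| ^ cexp D * \prod_(d <- D) nP d)%N.
Proof.
elim: D => [|d D IH].
  rewrite big_nil /= expn0 muln1; have -> : finset (fun V : rep (jdim [::]) => `[< gcomm V /\ P V >]) = [set: _]%SET.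
    apply/setP => V; rewrite !inE; apply/asboolP; split=> // e.
    by apply/matrixP => -[].
  rewrite cardsT; apply/eqP/card1P; exists (finfun (fun e => 0)) => V; rewrite !inE.
  by apply/esym/eqP/ffunP => e; apply/matrixP => -[].
pose h (V : rep (jdim (d :: D))) := (gul V, gdr V).
rewrite (card_fibers _ h).
pose good (XY : rep (jdim D) * rep d) := `[< gcomm XY.1 /\ P XY.1 >] && `[< P XY.2 >].
pose c e := ((dtot (d :: D) (sr e) * dtot (d :: D) (tg e) - d (sr e) * d (tg e)))%N.
transitivity (\sum_(XY | good XY) \prod_e #|k| ^ c e)%N.
  rewrite [RHS]big_mkcond; apply: eq_bigr => -[X Y] _; rewrite /good /=.
  case: asboolP => [[cX PX]|nX] /=; last first.
    apply/eqP; rewrite cards_eq0; apply/eqP/setP => V; rewrite !inE; apply/negP.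
    case/andP => /asboolP[cV PV] /eqP[eX _]; apply: nX; rewrite -eX; split; first exact: gcomm_gul.
    by case/P_cons: PV.
  case: asboolP => [PY|nY]; last first.
    apply/eqP; rewrite cards_eq0; apply/eqP/setP => V; rewrite !inE; apply/negP.
    case/andP => /asboolP[cV PV] /eqP[_ eY]; apply: nY; rewrite -eY.
    by case/P_cons: PV.
  rewrite (eq_bigr _ (fun e _ => esym (card_jcomm (Y e) (cX e)))) -card_dffun_forall.
  apply: eq_card => V; rewrite !inE; apply/andP/forallP.
    case=> /asboolP[cV PV] /eqP[eX eY] e; rewrite inE; apply/and3P; split.
    - by apply/asboolP; exact: cV.
    - by rewrite -eX ffunE.
    by rewrite -eY ffunE.
  move=> hV; have cV : gcomm V by move=> e; have := hV e; rewrite inE => /and3P[/asboolP].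
  have eX : gul V = X.
    by apply/ffunP => e; rewrite ffunE; have := hV e; rewrite inE => /and3P[_ /eqP].
  have eY : gdr V = Y.
    by apply/ffunP => e; rewrite ffunE; have := hV e; rewrite inE => /and3P[_ _ /eqP].
  split; last by rewrite /h eX eY.
  by apply/asboolP; split=> //; apply/P_cons => //; rewrite eX eY.
rewrite sum_nat_const.
have -> : #|good| = (#|finset (fun V : rep (jdim D) => `[< gcomm V /\ P V >])| * nP d)%N.
  by rewrite /nP -cardsX; apply: eq_card => -[X Y]; rewrite !inE /good /in_mem /=.
rewrite IH big_cons -expn_sum /= expnD mulnC -!mulnA; congr (_ * (_ * _))%N; exact: mulnC.
Qed.

End GradedCount.

Section UnitCount.
Variables (n : nat) (k : finFieldType).
Local Notation rep := (@grep n 'I_n id id k).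

Definition gunit (f : 'I_n -> nat) (V : rep f) : Prop := forall i, V i \in unitmx.

Lemma gunit_nil (V : rep (jdim [::])) : gunit V.
Proof. by move=> i; rewrite unitmxE; move: (V i) => /= M; rewrite det_mx00 unitr1. Qed.

Lemma jind_unit s (x : 'M[k]_(jsize s)) : jcomm x -> x \in unitmx -> jind x \in unitmx.
Proof.
move=> cx ux; have cx' : jcomm (invmx x).
  rewrite /jcomm -[X in X *m invmx x]mul1mx -(mulVmx ux) -!mulmxA (mulmxA x) -cx.
  by rewrite -(mulmxA _ x) mulmxV // mulmx1.
suff /mulmx1_unit[] : jind x *m jind (invmx x) = 1%:M by [].
rewrite {1}/jind -!mulmxA -(jind_quo cx') (mulmxA x) mulmxV // mul1mx; exact: jtop_quo.
Qed.

Lemma gunit_cons (d : dvec n) D (V : rep (jdim (d :: D))) : gcomm V ->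
  gunit V <-> gunit (gul V) /\ gunit (gdr V).
Proof.
move=> cV; have key i : V i \in unitmx <-> gul V i \in unitmx /\ gdr V i \in unitmx.
  rewrite !ffunE; have := jcomm_consP (cV i).
  move: (V i : 'M[k]_(jdim D i + (d i + sumn (parts_at D i)))) => v [cx u0 u1 u2].
  have uv : v \in unitmx = (ulsubmx v \in unitmx) && (drsubmx v \in unitmx).
    by rewrite -{1}[v]submxK u0 !unitmxE det_lblock unitrM.
  have uq : drsubmx v \in unitmx = (ulsubmx (drsubmx v) \in unitmx) && (drsubmx (drsubmx v) \in unitmx).
    by rewrite -{1}[drsubmx v]submxK u1 !unitmxE det_lblock unitrM.
  rewrite [X in is_true X <-> _]uv uq u2; split=> [/and3P[] //|[h1 h2]].
  by rewrite h1 h2 (jind_unit cx).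
split=> [uV|[u1 u2] i]; last exact/key.
by split=> i; have /key[] := uV i.
Qed.

Lemma card_gunit (f : 'I_n -> nat) : nP (@gunit) f = (\prod_i nunits k (f i))%N.
Proof.
rewrite /nP /nunits -card_dffun_forall; apply: eq_card => V; rewrite !inE.
by apply/asboolP/forallP => h i; have := h i; rewrite ?inE.
Qed.

End UnitCount.

(** * Existence and uniqueness of the nilpotent normal form *)

Section NilpotentNormalForm.
Variable k : fieldType.

Definition simil m p (N : 'M[k]_m) (M : 'M[k]_p) : Prop :=
  exists g h, [/\ N *m g = g *m M, g *m h = 1%:M & h *m g = 1%:M].

Lemma similE m p (N : 'M[k]_m) (M : 'M[k]_p) :
  simil N M <-> isof ([ffun=> N] : fam unit k m) ([ffun=> M] : fam unit k p).
Proof.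
split=> -[g [h [e gh hg]]]; exists g, h; split=> //; first by move=> u; rewrite !ffunE.
by have := e tt; rewrite !ffunE.
Qed.

Lemma simil_sym m p (N : 'M[k]_m) (M : 'M[k]_p) : simil N M -> simil M N.
Proof. by rewrite !similE; apply: isof_sym. Qed.

Lemma simil_trans m p r (M : 'M[k]_p) (N : 'M[k]_m) (Q : 'M[k]_r) :
  simil N M -> simil M Q -> simil N Q.
Proof. by rewrite !similE; apply: isof_trans. Qed.

Lemma simil_size m p (N : 'M[k]_m) (M : 'M[k]_p) : simil N M -> m = p.
Proof. by rewrite similE; apply: isof_size. Qed.

Lemma simil_rank m p (N : 'M[k]_m) (M : 'M[k]_p) : simil N M -> \rank N = \rank M.
Proof.
case=> g [h [e gh hg]].
have fg : row_free g by apply/row_freeP; exists h.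
have fh : row_free h by apply/row_freeP; exists g.
have -> : M = h *m N *m g by rewrite -mulmxA e mulmxA hg mul1mx.
have uh : row_full h by apply/row_fullP; exists g.
by rewrite mxrankMfree // (eqmxMfull N uh).
Qed.

Lemma simil_exp0 m p (N : 'M[k]_m) (M : 'M[k]_p) L : simil N M -> M ^+ L = 0 -> N ^+ L = 0.
Proof.
case=> g [h [e gh hg]] M0; rewrite -[LHS]mulmx1 -gh mulmxA (exp_intertwine L e) M0.
by rewrite mulmx0 mul0mx.
Qed.

Lemma exp_factor m b (C : 'M[k]_(m, b)) (R : 'M[k]_(b, m)) L :
  (C *m R) ^+ L.+1 = C *m (R *m C) ^+ L *m R.
Proof.
elim: L => [|L IH]; first by rewrite expr0 expr1 -[1]/(1%:M) mulmx1.
by rewrite exprSr IH exprSr -!mulmxE !mulmxA.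
Qed.

(** For a full rank factorization [N = C R], the matrix [R C] is [N] on its image and its nilpotency
    exponent is one less, so it has a normal form by induction. The type is padded with zeros to
    length [L], which keeps the types at different vertices equally long. *)
Lemma nilpotent_jordan L m (N : 'M[k]_m) : N ^+ L = 0 ->
  exists2 ms, size ms = L & simil N (jmx k ms).
Proof.
elim: L m N => [|L IH] m N NL.
  exists [::] => //; case: m N NL => [|m] N.
    by move=> _; exists 0, 0; split; apply/matrixP => -[].
  by rewrite expr0 => /eqP; rewrite oner_eq0.
pose C := col_base N; pose R := row_base N.
have CR : C *m R = N by exact: mulmx_base.
have cf : row_full C by exact: col_base_full.
have rf : row_free R by exact: row_base_free.
move: (\rank N) C R CR cf rf => b C R CR cf rf.
have [s ss [g0 [h0 [e0 gh hg]]]] : exists2 s, size s = L & simil (R *m C) (jmx k s).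
  apply: IH; have := NL; rewrite -CR exp_factor => e.
  have [R' RR] := row_freeP rf; have [C' CC] := row_fullP cf.
  have := congr1 (fun X => C' *m X *m R') e; rewrite mulmx0 mul0mx !mulmxA CC mul1mx.
  by rewrite -mulmxA RR mulmx1.
pose a := C *m g0; pose bb := h0 *m R.
have abb : a *m bb = N by rewrite /a /bb mulmxA -(mulmxA C) gh mulmx1.
have bba : bb *m a = jmx k s by rewrite /a /bb -!mulmxA (mulmxA R) e0 mulmxA hg mul1mx.
have [a' aa] : exists a', a' *m a = 1%:M.
  by have [C' CC] := row_fullP cf; exists (h0 *m C'); rewrite /a mulmxA -(mulmxA h0) CC mulmx1.
have [b' bb'] : exists b', bb *m b' = 1%:M.
  by have [R' RR] := row_freeP rf; exists (R' *m g0); rewrite /bb mulmxA -(mulmxA h0) RR mulmx1.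
(* The new basis vectors: [Z] lifts the generators of the image along [a], and [Y] will span a
   complement, within the kernel of [N], of its intersection with the image. *)
clearbody a bb; pose Z := jtop k s *m a'.
have Za : Z *m a = jtop k s by rewrite /Z -mulmxA aa mulmx1.
pose D := (kermx a :\: bb)%MS.
have [r [Y [Yfree YD]]] : exists r (Y : 'M[k]_(r, m)), row_free Y /\ (Y :=: D)%MS.
  by exists (\rank D), (row_base D); split; [exact: row_base_free | exact: eq_row_base].
have Ya : Y *m a = 0 by apply/sub_kermxP; rewrite YD; exact: diffmxSl.
have Ybb p (u : 'M[k]_(p, r)) (v : 'M_(p, _)) : u *m Y = v *m bb -> u = 0.
  move=> e; have : (u *m Y <= D :&: bb)%MS.
    by rewrite sub_capmx {2}e submxMl andbT -YD submxMl.
  rewrite capmx_diff submx0 => /eqP e1; have [Y' YY] := row_freeP Yfree.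
  by rewrite -[u]mulmx1 -YY mulmxA e1 mul0mx.
clearbody Z; exists (r :: s); first by rewrite /= ss.
pose f : 'M[k]_(jsize s + (r + sumn s), m) := col_mx bb (col_mx Y Z).
have fN : jmx k (r :: s) *m f = f *m N.
  rewrite /f /= mul_block_col !mul0mx !addr0 !mul_col_mx mul0mx.
  by rewrite -abb !mulmxA bba Ya Za mul0mx.
have ff : row_free f.
  apply: inj_row_free => v; rewrite -[v]hsubmxK -[rsubmx v]hsubmxK.
  move: (lsubmx v) (lsubmx (rsubmx v)) (rsubmx (rsubmx v)) => u y z.
  rewrite /f !mul_row_col => e0'.
  have ea : u *m jmx k s + z *m jtop k s = 0.
    by have := congr1 (mulmx^~ a) e0'; rewrite !mulmxDl -!mulmxA bba Ya Za mulmx0 add0r mul0mx.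
  have z0 : z = 0.
    have := congr1 (mulmx^~ (jquo k s)) ea.
    by rewrite mulmxDl -!mulmxA jmx_quo jtop_quo mulmx0 add0r mulmx1 mul0mx.
  move: e0'; rewrite z0 mul0mx addr0 => e1.
  have y0 : y = 0.
    by apply: (Ybb _ y (- u)); rewrite mulNmx; apply/eqP; rewrite -subr_eq0 opprK addrC e1.
  move: e1; rewrite y0 mul0mx addr0 => e2.
  have -> : u = 0 by rewrite -[u]mulmx1 -bb' mulmxA e2 mul0mx.
  by rewrite !row_mx0.
have fu : row_full f.
  rewrite -sub1mx; have [u eu] := jtop_decomp k s.
  have fE : (f :=: bb + (Y + Z))%MS.
    apply: (eqmx_trans (eqmx_sym (addsmxE bb (col_mx Y Z)))).
    exact: adds_eqmx (eqmx_refl _) (eqmx_sym (addsmxE _ _)).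
  pose v' := 1%:M - a *m u *m bb - a *m jquo k s *m Z.
  have v'a : v' *m a = 0.
    rewrite /v' !mulmxBl mul1mx -!mulmxA bba Za -addrA -opprD -mulmxDr.
    by rewrite [X in a *m X]addrC -eu mulmx1 subrr.
  have -> : 1%:M = v' + a *m u *m bb + a *m jquo k s *m Z by rewrite /v' addrAC !subrK.
  have fbb : (bb <= f)%MS by rewrite fE addsmxSl.
  have fY : (Y <= f)%MS by rewrite fE (submx_trans (addsmxSl Y Z)) ?addsmxSr.
  have fZ : (Z <= f)%MS by rewrite fE (submx_trans (addsmxSr Y Z)) ?addsmxSr.
  apply: addmx_sub; last exact: submx_trans (submxMl _ _) fZ.
  apply: addmx_sub; last exact: submx_trans (submxMl _ _) fbb.
  have vk : (v' <= kermx a)%MS by apply/sub_kermxP.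
  apply: submx_trans vk _; rewrite -(addsmx_diff_cap_eq (kermx a) bb) addsmx_sub -/D -YD fY.
  exact: submx_trans (capmxSr _ _) fbb.
have [B Bf] := row_fullP fu; have [D' fD] := row_freeP ff.
have eBD : B = D' by rewrite -[B]mulmx1 -fD mulmxA Bf mul1mx.
exists B, f; split; [ | exact: Bf | by rewrite eBD].
by rewrite -[N]mul1mx -Bf -(mulmxA B) -fN -!mulmxA eBD fD mulmx1.
Qed.

(** A similarity restricts to the images, where induction gives equal tails; equal ranks and sizes
    then give equal heads. Lengths are compared because trailing zeros do not change the matrix up
    to similarity. *)
Lemma jmx_simil_eq s s' : size s = size s' -> simil (jmx k s) (jmx k s') -> s = s'.
Proof.
elim: s s' => [|m s IH] [|m' s'] // sz sim; have ss : size s = size s' by case: sz.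
have esum : (m + sumn s = m' + sumn s')%N.
  have r1 := rank_jmx k (m :: s); have r2 := rank_jmx k (m' :: s').
  have e1 := simil_rank sim; have e2 := simil_size sim.
  apply: (@addnI (\rank (jmx k (m' :: s')))).
  by transitivity (jsize (m :: s)); [rewrite -e1; exact: r1 | rewrite e2; exact: esym r2].
pose B a t : 'M[k]_(jsize t, jsize (a :: t)) :=
  row_mx 1%:M 0 : 'M[k]_(jsize t, jsize t + (a + sumn t)).
pose B' a t : 'M[k]_(jsize (a :: t), jsize t) :=
  col_mx 1%:M 0 : 'M[k]_(jsize t + (a + sumn t), jsize t).
have BJ a t : B a t *m jmx k (a :: t) = jmx k t *m B a t.
  by rewrite /B /= mul_row_block mul_mx_row !mulmx0 !mul1mx !mul0mx !addr0 mulmx1.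
have [u eu] : exists u, B m s = u *m jmx k (m :: s).
  by apply: jquo_ker; rewrite /B /= mul_row_col mulmx0 mul0mx addr0.
have [u' eu'] : exists u, B m' s' = u *m jmx k (m' :: s').
  by apply: jquo_ker; rewrite /B /= mul_row_col mulmx0 mul0mx addr0.
have JB a t : exists v, jmx k (a :: t) = v *m B a t.
  exists (col_mx (jmx k t) (col_mx 0 (jtop k t))).
  by rewrite /B /= mul_col_mx mul_mx_row mulmx0 mulmx1 mul_mx_row mulmx0 mulmx1.
have [v ev] := JB m s; have [v' ev'] := JB m' s'.
have Bfree a t : B a t *m B' a t = 1%:M by rewrite /B /B' /= mul_row_col mulmx0 addr0 mulmx1.
clearbody B B'.
case: sim => g [h [e gh hg]].
have e' : jmx k (m' :: s') *m h = h *m jmx k (m :: s).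
  by rewrite -[LHS]mul1mx -hg -!mulmxA (mulmxA g) -e -(mulmxA _ g) gh mulmx1.
have Bg : B m s *m g = (u *m g *m v') *m B m' s' by rewrite eu -mulmxA e ev' !mulmxA.
have Bh : B m' s' *m h = (u' *m h *m v) *m B m s by rewrite eu' -mulmxA e' ev !mulmxA.
move: (u *m g *m v') (u' *m h *m v) Bg Bh => phi psi Bg Bh.
have cancel a t p (x y : 'M_(p, _)) : x *m B a t = y *m B a t -> x = y.
  by move=> /(congr1 (mulmx^~ (B' a t))); rewrite -!mulmxA Bfree !mulmx1.
have es : s = s'.
  apply: IH => //; exists phi, psi; split.
  - apply: (cancel m' s'); transitivity (B m s *m (g *m jmx k (m' :: s'))).
      by rewrite -mulmxA -Bg mulmxA -BJ -mulmxA e.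
    by rewrite mulmxA Bg -!mulmxA BJ.
  - by apply: (cancel m s); rewrite -mulmxA -Bh mulmxA -Bg -mulmxA gh mulmx1 mul1mx.
  by apply: (cancel m' s'); rewrite -mulmxA -Bg mulmxA -Bh -mulmxA hg mulmx1 mul1mx.
by rewrite -es in esum *; congr (_ :: _); apply: (addIn esum).
Qed.

Lemma jmx_nil s : jmx k s ^+ size s = 0.
Proof.
elim: s => [|m s IH]; first by apply/matrixP => -[].
pose B : 'M[k]_(jsize s, jsize s + (m + sumn s)) := row_mx 1%:M 0.
pose v := col_mx (jmx k s) (col_mx 0 (jtop k s)) : 'M[k]_(jsize s + (m + sumn s), jsize s).
have -> : jmx k (m :: s) = v *m B.
  by rewrite /B /v /= mul_col_mx mul_mx_row mulmx0 mulmx1 mul_mx_row mulmx0 mulmx1.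
rewrite exp_factor (_ : B *m v = jmx k s) ?IH ?mulmx0 ?mul0mx //.
by rewrite /B /v mul_row_col mul1mx mul0mx addr0.
Qed.

End NilpotentNormalForm.

(** The ranks of the powers drop strictly until they stabilize, and for a nilpotent matrix they can
    only stabilize at 0. *)
Lemma nilpotent_index (k : fieldType) m (u : 'M[k]_m) N : u ^+ N = 0 -> u ^+ m = 0.
Proof.
move=> uN; suff rk j : (\rank (u ^+ j) <= m - j)%N.
  by apply/eqP; rewrite -mxrank_eq0 -leqn0; apply: leq_trans (rk m) _; rewrite subnn.
elim: j => [|j IH]; first by rewrite subn0 rank_leq_row.
have sub : (u ^+ j.+1 <= u ^+ j)%MS by rewrite exprS submxMl.
have [le|gt] := leqP (\rank (u ^+ j)) (\rank (u ^+ j.+1)); last first.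
  by rewrite subnS -ltnS; apply: leq_trans gt _; apply: leq_trans IH _; exact: leqSpred.
have st i : (u ^+ j <= u ^+ (j + i))%MS.
  elim: i => [|i IHi]; first by rewrite addn0.
  have eq1 : (u ^+ j <= u ^+ j.+1)%MS by rewrite -(geq_leqif (mxrank_leqif_sup sub)).
  apply: submx_trans eq1 _; rewrite exprSr addnS [in X in (_ <= X)%MS]exprSr; exact: submxMr.
have : (u ^+ j <= (0 : 'M_m))%MS.
  by apply: submx_trans (st N) _; rewrite addnC exprD uN mul0r.
by rewrite submx0 => /eqP u0; rewrite exprSr u0 mul0r mxrank0.
Qed.

(** * Masses normalized by the product of the linear groups at the vertices *)

Section GradedOrbits.
Variables (n : nat) (A : finType) (sr tg : A -> 'I_n) (k : finFieldType).
Local Notation rep := (grep sr tg k).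
Local Notation gl f := ({dffun forall i : 'I_n, 'M[k]_(fun_of_fin f i)}).

Lemma gsum_unit (f : 'I_n -> nat) (g : forall i, 'M[k]_(f i)) :
  gsum g \in unitmx <-> forall i, g i \in unitmx.
Proof.
split=> [ug i|ug].
  have : g i *m (inc k f i *m invmx (gsum g) *m prj k f i) = 1%:M.
    by rewrite !mulmxA -inc_gsum -(mulmxA (inc k f i)) mulmxV // mulmx1 inc_prj.
  by case/mulmx1_unit.
have : gsum g *m gsum (fun i => invmx (g i)) = 1%:M.
  by rewrite gsumM -(gsum1 k f); apply: eq_bigr => i _; rewrite mulmxV.
by case/mulmx1_unit.
Qed.

Lemma gsum_inj (f f' : 'I_n -> nat) (g h : forall i, 'M[k]_(f i, f' i)) :
  gsum g = gsum h -> forall i, g i = h i.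
Proof.
move=> e i; have := congr1 (fun M => inc k f i *m M *m prj k f' i) e.
by rewrite !inc_gsum -!mulmxA inc_prj !mulmx1.
Qed.

Lemma eq_gsum (f f' : 'I_n -> nat) (g h : forall i, 'M[k]_(f i, f' i)) :
  (forall i, g i = h i) -> gsum g = gsum h.
Proof. by move=> e; apply: eq_bigr => i _; rewrite e. Qed.

Lemma gsum_exp (f : 'I_n -> nat) (g : forall i, 'M[k]_(f i)) N :
  gsum g ^+ N = gsum (fun i => g i ^+ N).
Proof.
elim: N => [|N IH]; first by rewrite expr0 -[1]/(1%:M) -(gsum1 k f); exact: eq_gsum.
by rewrite exprS IH -mulmxE gsumM; apply: eq_gsum => i; rewrite exprS.
Qed.

Variable beta : dvec n.

(** Orbit counting for the product of the groups at the vertices: isomorphisms between assembled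
    representations are block diagonal, so the stabilizer is the full automorphism group. *)
Lemma graded_orbit (V0 : rep beta) :
  (#|finset (fun V : rep beta => `[< isof (assemble V0) (assemble V) >])|
    * naut (obj_of (assemble V0)) = \prod_i nunits k (beta i))%N.
Proof.
pose G := finset (fun g : gl beta => [forall i, g i \in [set x | x \in unitmx]%SET]).
have cG : #|G| = (\prod_i nunits k (beta i))%N by rewrite card_dffun_forall.
have GP (g : gl beta) : reflect (forall i, g i \in unitmx) (g \in G).
  by rewrite inE; apply: (iffP forallP) => h i; have := h i; rewrite inE.
pose cc (g : gl beta) : rep beta := [ffun e => invmx (g (sr e)) *m V0 e *m g (tg e)].
have hcc g : g \in G -> forall e, V0 e *m g (tg e) = g (sr e) *m cc g e.
  by move=> /GP ug e; rewrite ffunE !mulmxA mulmxV // mul1mx.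
rewrite -cG (card_fibers _ cc) (bigID (fun V => `[< isof (assemble V0) (assemble V) >])) /= addnC.
rewrite [X in _ = (X + _)%N]big1 ?add0n => [|V /asboolPn no]; last first.
  apply/eqP; rewrite cards_eq0; apply/eqP/setP => g; rewrite [LHS]inE [RHS]inE.
  apply/negP => /andP[gG /eqP cg]; apply: no; apply/isof_unit; exists (gsum g).
    exact/gsum_unit/GP.
  by apply: gsum_hom; rewrite -cg; exact: hcc.
rewrite -sum1dep_card big_distrl /=; apply: eq_bigr => V /asboolP/isof_unit[phi uphi hphi].
rewrite mul1n; pose t (g : gl beta) := gsum g *m invmx phi.
have inj : injective t.
  move=> g h /(congr1 (mulmx^~ phi)); rewrite !mulmxKV // => /gsum_inj e; exact/ffunP.
rewrite -(card_imset _ inj); congr #|pred_of_set _|; apply/setP => h; apply/idP/imsetP.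
  rewrite inE => /andP[uh /asboolP hh]; have hf := homM hh hphi.
  have [psiE rel] := hom_gsum hf.
  pose g : gl beta := [ffun i => inc k beta i *m (h *m phi) *m prj k beta i].
  have gE : gsum g = h *m phi by rewrite [RHS]psiE; apply: eq_gsum => i; rewrite ffunE.
  have gG : g \in G by apply/GP/gsum_unit; rewrite gE unitmx_mul uh.
  exists g; last by rewrite /t gE mulmxK.
  rewrite inE gG; apply/eqP/ffunP => e; have ug := GP _ gG.
  by apply: (can_inj (mulKmx (ug (sr e)))); rewrite -(hcc _ gG) !ffunE rel.
case=> g; rewrite inE => /andP[gG /eqP cg] ->; rewrite inE unitmx_mul unitmx_inv uphi andbT.
apply/andP; split; first exact/gsum_unit/GP.
apply/asboolP; apply: (homM (Y := assemble V)).
  by apply: gsum_hom; rewrite -cg; exact: hcc.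
by apply: hom_inv hphi _ _; rewrite ?mulmxV ?mulVmx.
Qed.

Variable w : 'I_n -> rat.
Local Notation good := (@good n A sr tg w k).
Local Notation nGL := (\prod_i nunits k (beta i))%N.

Lemma good_assembleE (V : rep beta) : good beta (assemble V) <-> SS w (assemble V).
Proof.
split=> [[] //|sV]; split=> //; first exact: assemble_quiv.
by apply/ffunP => i; rewrite assemble_fdim.
Qed.

Lemma graded_sum_transv L (phi : obj ('I_n + A)%type k -> rat) :
  (forall x y, oiso x y -> phi x = phi y) ->
  transv (@oiso _ k) (fun x => good beta (projT2 x)) L id ->
  \sum_(V : rep beta | `[< SS w (assemble V) >]) phi (obj_of (assemble V)) =
    \sum_(x <- L) phi x * (nGL%:R / (naut x)%:R).
Proof.
move=> phii [uL PL iL sL].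
have e x : x \in L -> phi x * (nGL%:R / (naut x)%:R) =
    \sum_(V : rep beta | `[< SS w (assemble V) >])
      if `[< isof (projT2 x) (assemble V) >] then phi (obj_of (assemble V)) else 0.
  move=> xL; have [qx _ fx] := PL x xL; have [V0 xV] := assemble_ex qx fx.
  rewrite -(graded_orbit V0) natrM (naut_iso (y := obj_of (assemble V0)) xV) mulfK; last first.
    by rewrite pnatr_eq0 -lt0n naut_gt0.
  rewrite -big_mkcondr /= -sum1dep_card natr_sum mulr_sumr.
  apply: eq_big => V; last first.
    by move=> /asboolP V0V; rewrite mulr1; apply: phii; exact: isof_trans xV V0V.
  apply/asboolP/andP => [V0V|[_ /asboolP xV']]; last exact: isof_trans (isof_sym xV) xV'.
  have xV' := isof_trans xV V0V; split; apply/asboolP => //.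
  by apply/good_assembleE; apply: good_iso xV' _; exact: PL.
rewrite [RHS](eq_big_seq _ e) exchange_big /=; apply: eq_bigr => V /asboolP/good_assembleE PV.
have [x xL xX] := sL (obj_of (assemble V)) PV; rewrite (bigD1_seq x) //= asboolT; last exact: isof_sym xX.
rewrite [X in _ = _ + X]big_seq_cond [X in _ = _ + X]big1 ?addr0 // => y /andP[yL yx]; rewrite asboolF // => yX.
by case/eqP: yx; apply: iL => //; apply: isof_trans yX xX.
Qed.

Definition nilends (x : obj ('I_n + A)%type k) : {set 'M[k]_(projT1 x)} :=
  finset (fun N => `[< hom (projT2 x) (projT2 x) N >] && (N ^+ ht beta == 0)).

Lemma nilends_iso x y : oiso x y -> #|nilends x| = #|nilends y|.
Proof.
suff le x' y' : oiso x' y' -> (#|nilends x'| <= #|nilends y'|)%N.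
  by move=> xy; apply/eqP; rewrite eqn_leq !le //; exact: oiso_sym.
case=> f [g [hf fg gf]]; have hg := hom_inv hf fg gf.
have inj : injective (fun N => g *m N *m f).
  move=> M N /(congr1 (fun X => f *m X *m g)).
  by rewrite !mulmxA fg !mul1mx -!mulmxA fg !mulmx1.
rewrite -(card_imset _ inj); apply/subset_leq_card/fintype.subsetP => _ /imsetP[N + ->].
rewrite !inE => /andP[/asboolP hN /eqP N0]; apply/andP; split.
  by apply/asboolP; apply: homM (homM hg hN) hf.
apply/eqP; apply: (@simil_exp0 _ _ _ _ N (ht beta)) N0.
by exists g, f; split=> //; rewrite -!mulmxA fg mulmx1.
Qed.

(** For either group, of the total space or graded, a class contributes its number of nilpotent
    endomorphisms divided by [naut]. In the graded form the order of summation can be exchanged, the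
    nilpotent [N] coming first; by [nilpotent_index] the exponent [ht beta] detects nilpotency. *)
Lemma mass_series_nil : @mass_series n A sr tg w k 'X beta * nGL%:R =
  \sum_(N : gl beta | [forall i, N i ^+ ht beta == 0])
    #|finset (fun V : rep beta => `[< (forall e, N (sr e) *m V e = V e *m N (tg e)) /\
      SS w (assemble V) >])|%:R.
Proof.
have [L tL] : exists L, transv (@oiso _ k) (fun x => good beta (projT2 x)) L id.
  by apply: (@obj_transv_exists _ _ (ht beta)) => x [qx _ <-]; rewrite (ht_fdim qx).
have phii x y : oiso x y -> #|nilends x|%:R = #|nilends y|%:R :> rat by move=> /nilends_iso ->.
have nu0 : (nunits k (ht beta))%:R != 0 :> rat by rewrite pnatr_eq0 -lt0n nunits_gt0.
have -> : @mass_series n A sr tg w k 'X beta * nGL%:R = \sum_(x <- L) #|nilends x|%:R * (nGL%:R / (naut x)%:R).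
  rewrite /mass_series /mass mulrAC; apply: (mulIf nu0); rewrite divfK //.
  rewrite mulr_suml; transitivity ((\sum_(x <- L) #|nilends x|%:R *
      ((nunits k (ht beta))%:R / (naut x)%:R)) * nGL%:R : rat); last first.
    by rewrite mulr_suml; apply: eq_bigr => x _; move: (_^-1) => y; ring.
  congr (_ * _); rewrite -(@sum_transv _ _ (fun x => good beta (projT2 x)) (ht beta) L (fun x => #|nilends x|%:R)) //.
  - rewrite (card_fibers _ (@base n A k _)) natr_sum [RHS]big_mkcond /=; apply: eq_bigr => X _.
    case: asboolP => [gX|nX]; last first.
      apply/eqP; rewrite pnatr_eq0 cards_eq0; apply/eqP/setP => Z; rewrite !inE.
      by apply/negP => /andP[/asboolP[+ _ _] /eqP e]; rewrite /= e.
    congr (_%:R); have inj : injective (@extend n A k _ X).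
      by move=> g h /(congr1 (@op n A k _)); rewrite !op_extend.
    rewrite -(card_imset _ inj); congr #|pred_of_set _|; apply/setP => Z; rewrite inE.
    apply/andP/imsetP => [[]|[g]].
      rewrite inE => /asboolP[_ /= hZ [N zN]] /eqP e.
      exists (op Z); last by rewrite -e extend_base.
      rewrite inE /= -e; apply/andP; split; first exact/asboolP.
      by apply/eqP; apply: (@nilpotent_index _ _ _ N); rewrite -zN pmxXn pmxX.
    rewrite inE /= => /andP[/asboolP hg /eqP g0] ->; rewrite base_extend; split=> //.
    rewrite inE; apply/asboolP; split=> /=.
    + by rewrite base_extend.
    + by rewrite base_extend op_extend.
    by exists (ht beta); rewrite op_extend pmxXn pmxX.
  - by move=> x [qx _ <-]; rewrite (ht_fdim qx).
  by move=> x y xy; apply: good_iso.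
rewrite -(graded_sum_transv phii tL).
transitivity (\sum_(V : rep beta | `[< SS w (assemble V) >])
    \sum_(N : gl beta | [forall i, N i ^+ ht beta == 0] &&
      `[< forall e, N (sr e) *m V e = V e *m N (tg e) >]) (1%:R : rat)).
  apply: eq_bigr => V _; rewrite -natr_sum; congr (_%:R); rewrite sum1dep_card.
  have inj : injective (fun N : gl beta => gsum N).
    by move=> M N /gsum_inj e; apply/ffunP.
  rewrite -(card_imset _ inj); congr #|pred_of_set _|; apply/setP => M; apply/idP/imsetP.
    rewrite inE => /andP[/asboolP hM /eqP M0]; have [ME rel] := hom_gsum hM.
    pose N : gl beta := [ffun i => inc k beta i *m M *m prj k beta i].
    have NE : gsum N = M by rewrite [RHS]ME; apply: eq_gsum => i; rewrite ffunE.
    exists N; last by rewrite NE.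
    rewrite inE; apply/andP; split.
      apply/forallP => i; apply/eqP; move: M0; rewrite /= -NE gsum_exp => M0.
      apply: (@gsum_inj _ _ (fun i => N i ^+ ht beta) (fun i => 0) _ i); rewrite M0; symmetry; apply: big1 => j _.
      by rewrite mulmx0 mul0mx.
    by apply/asboolP => e; rewrite !ffunE; exact: esym (rel e).
  case=> N; rewrite inE => /andP[/forallP N0 /asboolP hN] ->; rewrite inE; apply/andP; split.
    by apply/asboolP; apply: gsum_hom => e; rewrite hN.
  rewrite /= gsum_exp; apply/eqP; apply: big1 => i _.
  by rewrite (eqP (N0 i)) mulmx0 mul0mx.
rewrite (exchange_big_dep (fun N : gl beta => [forall i, N i ^+ ht beta == 0])) /=; last first.
  by move=> V N _ /andP[].
apply: eq_bigr => N N0; rewrite -natr_sum sum1dep_card; congr (_%:R); apply: eq_card => V.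
by rewrite !inE N0 /=; apply/andP/asboolP => [[/asboolP h1 /asboolP h2]|[h1 h2]]; split=> //; apply/asboolP.
Qed.

End GradedOrbits.

(** * Partitions *)

Section Partitions.
Implicit Types (lam nu : Defs.partition) (ms : seq nat).

Lemma jsizeE ms : jsize ms = (\sum_(0 <= i < size ms) i.+1 * nth 0 ms i)%N.
Proof.
elim: ms => [|m ms IH] /=; first by rewrite big_geq.
rewrite big_nat_recl // mul1n IH; have -> : sumn ms = (\sum_(0 <= i < size ms) nth 0 ms i)%N.
  by rewrite sumnE (big_nth 0%N).
rewrite addnCA -big_split /=; congr (_ + _)%N; apply: eq_bigr => i _; lia.
Qed.

Lemma big_nat_widen0 (R : Type) (idx : R) (op : Monoid.com_law idx) a b c (f : nat -> R) :
  (b <= c)%N -> (forall i, (b <= i)%N -> f i = idx) ->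
  \big[op/idx]_(a <= i < b) f i = \big[op/idx]_(a <= i < c) f i.
Proof.
move=> bc f0; have [ab|ba] := leqP a b.
  rewrite [RHS](big_cat_nat (n := b)) //= [X in op _ X]big_nat_cond [X in op _ X]big1 ?Monoid.mulm1 //.
  by move=> i /andP[/andP[bi _] _]; exact: f0.
rewrite big_geq ?(ltnW ba) // big_nat_cond big1 // => i /andP[/andP[ai _] _].
by apply: f0; apply: ltnW; apply: leq_trans ba ai.
Qed.

Lemma part_leq lam k : k \in parts lam -> (k <= psize lam)%N.
Proof.
rewrite /psize; elim: (parts lam) => //= x s IH; rewrite inE => /orP[/eqP->|/IH]; first exact: leq_addr.
by move=> h; apply: leq_trans h (leq_addl _ _).
Qed.

Lemma pmult_eq0 lam k : (psize lam < k)%N -> pmult lam k = 0%N.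
Proof.
by move=> lt; apply/count_memPn; apply: contraL lt => /part_leq; rewrite -leqNgt.
Qed.

Lemma sum_count_mem (s : seq nat) L : (forall k, k \in s -> (k <= L)%N) ->
  sumn s = (\sum_(0 <= k < L.+1) k * count_mem k s)%N.
Proof.
elim: s => [_|x s IH h] /=; first by rewrite big1 // => i _; rewrite muln0.
rewrite IH => [|k ks]; last by apply: h; rewrite inE ks orbT.
under [RHS]eq_bigr do rewrite mulnDr.
rewrite big_split /=; congr (_ + _)%N.
rewrite (bigD1_seq x) ?iota_uniq ?mem_index_iota ?ltnS ?h ?mem_head //= eqxx muln1.
by rewrite big1 ?addn0 // => i /negPf; rewrite eq_sym => ->; rewrite muln0.
Qed.

Definition mults L lam : seq nat := [seq pmult lam s | s <- iota 1 L].

Lemma size_mults L lam : size (mults L lam) = L.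
Proof. by rewrite size_map size_iota. Qed.

Lemma nth_mults L lam i : (i < L)%N -> nth 0%N (mults L lam) i = pmult lam i.+1.
Proof. by move=> iL; rewrite (nth_map 0%N) ?size_iota // nth_iota // add1n. Qed.

Lemma jsize_mults L lam : (psize lam <= L)%N -> jsize (mults L lam) = psize lam.
Proof.
move=> le; rewrite jsizeE size_mults /psize (@sum_count_mem _ L) => [|k /part_leq kl]; last first.
  exact: leq_trans kl le.
rewrite big_nat_recl // mul0n add0n big_nat [RHS]big_nat; apply: eq_bigr => i /andP[_ iL].
by rewrite nth_mults.
Qed.

Lemma partition_of_mults ms : exists2 lam, mults (size ms) lam = ms & psize lam = jsize ms.
Proof.
pose l := flatten [seq nseq (nth 0%N ms s) s.+1 | s <- iota 0 (size ms)].
have cl k : count_mem k.+1 l = if (k < size ms)%N then nth 0%N ms k else 0%N.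
  rewrite /l count_flatten -!map_comp sumnE big_map.
  transitivity (\sum_(s <- iota 0 (size ms)) (s == k) * nth 0%N ms s)%N.
    by apply: eq_bigr => s _; rewrite /= count_nseq /= eqSS.
  case: ifP => [lt|ge].
    rewrite (bigD1_seq k) ?iota_uniq ?mem_iota //= eqxx mul1n big1 ?addn0 // => s /negPf->.
    by rewrite mul0n.
  rewrite big1_seq // => s; rewrite mem_iota add0n => /andP[_ lt].
  by case: eqP => [e|_]; rewrite ?mul0n //; move: lt; rewrite e ge.
have l0 : 0%N \notin l.
  by apply/flattenP => -[_ /mapP[s _ ->]]; rewrite mem_nseq andbF.
have srt : sorted geq (sort geq l) && (0%N \notin sort geq l).
  by rewrite mem_sort l0 andbT; apply: sort_sorted => x y; exact: leq_total.
pose lam := Partition srt.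
have pm k : pmult lam k.+1 = if (k < size ms)%N then nth 0%N ms k else 0%N.
  by rewrite -cl /pmult /=; apply/permP; rewrite perm_sort.
have ml : mults (size ms) lam = ms.
  apply: (@eq_from_nth _ 0%N); rewrite size_mults // => i lt.
  by rewrite nth_mults // pm lt.
exists lam => //.
rewrite jsizeE /psize (@sum_count_mem _ (size ms)) => [|k].
  rewrite big_nat_recl // mul0n add0n big_nat [RHS]big_nat; apply: eq_bigr => i /andP[_ iL].
  by have := pm i; rewrite iL /pmult => ->.
rewrite mem_sort => /flattenP[_ /mapP[s + ->]]; rewrite mem_iota mem_nseq => lt /andP[_ /eqP->].
by move: lt; rewrite add0n.
Qed.

Lemma mults_inj L lam nu : (psize lam <= L)%N -> (psize nu <= L)%N ->
  mults L lam = mults L nu -> lam = nu.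
Proof.
move=> l1 l2 e; have p0 (l : Defs.partition) : 0%N \notin parts l by case: l => ? /= /andP[].
have cm k : count_mem k (parts lam) = count_mem k (parts nu).
  case: k => [|k]; first by rewrite !(count_memPn _).
  have [kL|kL] := ltnP k L.
    by have := congr1 (nth 0%N ^~ k) e; rewrite !nth_mults.
  have e0 l : (psize l <= L)%N -> pmult l k.+1 = 0%N.
    by move=> le; apply: pmult_eq0; rewrite ltnS (leq_trans le kL).
  exact: etrans (e0 _ l1) (esym (e0 _ l2)).
apply: val_inj => /=; apply: (@sorted_eq _ geq).
- by move=> x y z /= xy yz; apply: leq_trans yz xy.
- by move=> x y /= /andP[xy yx]; apply/eqP; rewrite eqn_leq yx xy.
- by case: lam {l1 e cm} => ? /= /andP[].
- by case: nu {l2 e cm} => ? /= /andP[].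
by apply/allP => x _ /=; rewrite cm.
Qed.

Lemma pconj_mults L lam i : (psize lam <= L)%N ->
  pconj lam i.+1 = sumn (drop i (mults L lam)).
Proof.
move=> le; rewrite /pconj /mults -map_drop drop_iota sumnE big_map addnC.
rewrite (@big_nat_widen0 _ _ _ _ _ L.+1) //; last by move=> k; exact: pmult_eq0.
by rewrite /index_iota subSS addn1.
Qed.

Lemma pconj_eq0 lam i : (psize lam < i)%N -> pconj lam i = 0%N.
Proof. by move=> lt; rewrite /pconj big_geq. Qed.

Lemma pform_cut L lam nu : (psize lam <= L)%N ->
  pform lam nu = (\sum_(1 <= i < L.+1) pconj lam i * pconj nu i)%N.
Proof. by move=> le; apply: big_nat_widen0 => // i /pconj_eq0 ->. Qed.

Lemma pform'_cut L lam nu : (psize lam <= L)%N ->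
  pform' lam nu = \sum_(1 <= i < L.+1)
    ((pconj lam i * pconj nu i)%:Z - (pmult lam i * pmult nu i)%:Z).
Proof.
move=> le; rewrite sumrB /pform' (pform_cut nu le) -!natz !natr_sum; congr (_ - _).
  by apply: eq_bigr => i _; rewrite natz.
rewrite (@big_nat_widen0 _ _ _ _ _ L.+1) //; first by apply: eq_bigr => i _; rewrite natz.
by move=> i /pmult_eq0 ->.
Qed.

Lemma pb_cut L lam q : (psize lam <= L)%N ->
  pb lam q = \prod_(1 <= i < L.+1) \prod_(1 <= k < (pmult lam i).+1) (1 - q ^+ k).
Proof.
by move=> le; apply: big_nat_widen0 => // i /pmult_eq0 ->; rewrite big_geq.
Qed.

Lemma pmult_leq_pconj lam i : (pmult lam i <= pconj lam i)%N.
Proof.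
have [lt|ge] := ltnP (psize lam) i; first by rewrite pmult_eq0.
by rewrite /pconj big_ltn ?leq_addr.
Qed.

End Partitions.

(** The order of the general linear group in the form that produces the factors of [pb lam q^-1]. *)
Lemma nunitsE (F : finFieldType) m :
  (nunits F m)%:R = #|F|%:R ^+ (m * m) * \prod_(1 <= k < m.+1) (1 - (#|F|%:R : rat)^-1 ^+ k).
Proof.
have q0 : (#|F|%:R : rat) != 0 by rewrite pnatr_eq0 -lt0n; apply/card_gt0P; exists 0.
case: m => [|m].
  rewrite /nunits big_geq // mulr1 expr0 (_ : finset _ = [set: _]%SET) ?cardsT ?card_mx ?expn0 //.
  by apply/setP => g; rewrite !inE unitmxE det_mx00 unitr1.
have -> : nunits F m.+1 = #|'GL_m.+1[F]%g|.
  by rewrite /nunits cardsT /= card_sub; apply: eq_card => g; rewrite !inE.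
rewrite card_GL // natrM natrX natr_prod.
have -> : (m.+1 * m.+1 = 'C(m.+1, 2) + (\sum_(1 <= i < m.+2) i))%N.
  elim: m => [|m IH]; first by rewrite big_nat1.
  by rewrite big_nat_recr //= binS bin1; move: IH; lia.
rewrite exprD -mulrA; congr (_ * _).
rewrite -prodrXr -big_split /=; apply: eq_bigr => k _.
have p0 : (0 < #|F| ^ k)%N by rewrite expn_gt0; apply/orP; left; apply/card_gt0P; exists 0.
rewrite natrB // natrX.
by rewrite mulrBr mulr1 exprVn divff // expf_neq0.
Qed.

(** * The series of nilpotent pairs *)

Section NilpotentPairs.
Variables (n : nat) (A : finType) (sr tg : A -> 'I_n) (k : finFieldType) (w : 'I_n -> rat).
Implicit Types (D : seq (dvec n)).
Local Notation rep := (grep sr tg k).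
Local Notation SSrep := (fun (f : 'I_n -> nat) (V : rep f) => SS w (assemble V)).

Lemma card_commuting_simil D (f : 'I_n -> nat) (N : forall i, 'M[k]_(f i)) :
  (forall i, simil (N i) (jmx k (parts_at D i))) ->
  #|finset (fun V : rep f => `[< (forall e, N (sr e) *m V e = V e *m N (tg e)) /\ SS w (assemble V) >])|
  = (#|k| ^ cexp sr tg D * \prod_(d <- D) nP SSrep d)%N.
Proof.
move=> /dep_choice[g /dep_choice[h gh]].
rewrite -(@card_gcomm n A sr tg k SSrep); last 2 first.
- move=> V; have rk p (M : 'M[k]_(p, \sum_(i < n) jdim [::] i)) : \rank M = 0%N.
    by apply/eqP; rewrite -leqn0; apply: leq_trans (rank_leq_col M) _; rewrite big1.
  by split=> [|U _]; rewrite /wt big1 // => i _; rewrite rk mulr0.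
- by move=> d D' V cV; exact: SS_jordan.
pose t (V : rep f) : rep (jdim D) := [ffun e => h (sr e) *m V e *m g (tg e)].
have inj : injective t.
  move=> V W /ffunP e; apply/ffunP => x; have := e x; rewrite !ffunE.
  have [_ gs _] := gh (sr x); have [_ gt _] := gh (tg x).
  move=> /(congr1 (fun M => g (sr x) *m M *m h (tg x))).
  by rewrite !mulmxA gs !mul1mx -!mulmxA gt !mulmx1.
have tiso V : isof (assemble V) (assemble (t V)).
  exists (gsum g), (gsum h); split.
  - by apply: gsum_hom => e; rewrite ffunE !mulmxA; have [_ -> _] := gh (sr e); rewrite mul1mx.
  - by rewrite gsumM -(gsum1 k f); apply: eq_gsum => i; have [] := gh i.
  by rewrite gsumM -(gsum1 k (jdim D)); apply: eq_gsum => i; have [] := gh i.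
rewrite -(card_imset _ inj); congr #|pred_of_set _|; apply/setP => W; rewrite [RHS]inE.
have hJ i : jmx k (parts_at D i) *m h i = h i *m N i.
  have [Ng gi hi] := gh i; rewrite -[LHS]mul1mx -hi -!mulmxA (mulmxA (g i)) -Ng.
  by rewrite -(mulmxA _ (g i)) gi mulmx1.
apply/imsetP/asboolP => [[V + ->]|[cW sW]].
  rewrite inE => /asboolP[cV sV]; split; last by apply: SS_iso (isof_sym (tiso V)) (assemble_quiv _) sV.
  move=> e; rewrite /jcomm ffunE !mulmxA hJ -(mulmxA _ (N _)) cV -!mulmxA.
  by have [-> _ _] := gh (tg e).
pose V : rep f := [ffun e => g (sr e) *m W e *m h (tg e)].
have tV : t V = W.
  apply/ffunP => e; rewrite !ffunE !mulmxA; have [_ _ ->] := gh (sr e).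
  by rewrite mul1mx -mulmxA; have [_ _ ->] := gh (tg e); rewrite mulmx1.
exists V => //; rewrite inE; apply/asboolP; split; last first.
  by apply: SS_iso (tiso V) (assemble_quiv _) _; rewrite tV.
move=> e; rewrite ffunE !mulmxA; have [-> _ _] := gh (sr e).
have := congr1 (fun M => g (sr e) *m M *m h (tg e)) (cW e).
by rewrite -!mulmxA hJ.
Qed.

(** Orbit counting at each vertex, the centralizer of the Jordan matrix being counted by
    [card_gcomm] for invertible families. *)
Lemma card_simil_orbit D (beta : dvec n) : (forall i, jdim D i = beta i) ->
  (#|finset (fun N : {dffun forall i : 'I_n, 'M[k]_(beta i)} =>
      [forall i, N i \in finset (fun M => `[< simil M (jmx k (parts_at D i)) >])])|
   * (#|k| ^ cexp (@id 'I_n) id D * \prod_(d <- D) \prod_i nunits k (fun_of_fin d i))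
   = \prod_i nunits k (beta i))%N.
Proof.
move=> jb; rewrite card_dffun_forall.
have -> : (\prod_(d <- D) \prod_i nunits k (fun_of_fin d i) =
    \prod_(d <- D) nP (@gunit n k) (fun_of_fin d))%N.
  by apply: eq_bigr => d _; rewrite card_gunit.
rewrite -(card_gcomm (@gunit_nil n k) (@gunit_cons n k)).
pose x i : obj unit k := obj_of ([ffun=> jmx k (parts_at D i)] : fam unit k (jdim D i)).
have -> : #|finset (fun V : @grep n 'I_n id id k (jdim D) => `[< gcomm V /\ gunit V >])| =
    (\prod_i naut (x i))%N.
  rewrite /naut -card_dffun_forall; apply: eq_card => V; rewrite !inE.
  apply/asboolP/forallP => [[cV uV] i|h].
    rewrite inE uV; apply/asboolP => u; rewrite !ffunE; exact: cV.
  split=> i; have := h i; rewrite inE => /andP[ui /asboolP hi] //.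
  by have := hi tt; rewrite !ffunE.
rewrite -big_split /=; apply: eq_bigr => i _.
rewrite -(orbit_count (jb i : projT1 (x i) = beta i)); congr (_ * _)%N.
have inj : injective (fun M : 'M[k]_(beta i) => [ffun=> M] : fam unit k (beta i)).
  by move=> M M' /ffunP/(_ tt); rewrite !ffunE.
rewrite -(card_imset _ inj); congr #|pred_of_set _|; apply/setP => Y; rewrite [RHS]inE.
apply/imsetP/asboolP => [[M + ->]|xY].
  by rewrite inE => /asboolP sM; apply/isof_sym/similE.
exists (Y tt); last by apply/ffunP => -[]; rewrite ffunE.
rewrite inE; apply/asboolP/similE; apply: isof_sym.
by rewrite (_ : [ffun=> Y tt] = Y) //; apply/ffunP => -[]; rewrite ffunE.
Qed.

Lemma cexpE (B : finType) (s t : B -> 'I_n) D : cexp s t D =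
  (\sum_e \sum_(0 <= j < size D)
    (sumn (drop j (parts_at D (s e))) * sumn (drop j (parts_at D (t e)))
     - nth 0 (parts_at D (s e)) j * nth 0 (parts_at D (t e)) j))%N.
Proof.
elim: D => [|d D IH] /=; first by rewrite big1 // => e _; rewrite big_geq.
rewrite IH -big_split /=; apply: eq_bigr => e _; rewrite big_nat_recl //.
Qed.

End NilpotentPairs.

(** * Identification of [Pmu] with the series of nilpotent pairs *)

Section PmuIsMass.
Variables (n : nat) (a : 'M[nat]_n).
Variables (theta : {additive {ffun 'I_n -> int} -> int}) (mu : rat) (F : finFieldType).
Local Notation sr := (@src n a).
Local Notation tg := (@tgt n a).
Local Notation w := (weight theta mu).
Local Notation q := (#|F|%:R : rat).
Local Notation SSrep := (fun (f : 'I_n -> nat) (V : grep sr tg F f) => SS w (assemble V)).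
Implicit Types (lam : {ffun 'I_n -> Defs.partition}) (beta d : dvec n).

Definition layers L lam : seq (dvec n) := [seq tuple_mult lam s | s <- iota 1 L].

Lemma parts_at_layers L lam i : parts_at (layers L lam) i = mults L (lam i).
Proof. by rewrite /parts_at /layers -map_comp; apply: eq_map => s /=; rewrite ffunE. Qed.

Lemma size_layers L lam : size (layers L lam) = L.
Proof. by rewrite size_map size_iota. Qed.

Lemma q_neq0 : q != 0.
Proof. by rewrite pnatr_eq0 -lt0n; apply/card_gt0P; exists 0. Qed.

(** The sum of the multiplicities from position [j] on is the conjugate part of index [j + 1], and
    the truncated subtraction in [cexp] is exact because a multiplicity is at most the conjugate
    part of the same index. *)
Lemma cexp_layers (B : finType) (s t : B -> 'I_n) L lam : (forall i, psize (lam i) <= L)%N ->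
  (cexp s t (layers L lam))%:Z = \sum_e pform' (lam (s e)) (lam (t e)).
Proof.
move=> le; rewrite cexpE -natz natr_sum; apply: eq_bigr => e _.
rewrite (pform'_cut _ (le (s e))) natr_sum size_layers [RHS]big_add1 /= big_nat [RHS]big_nat.
apply: eq_bigr => j /andP[_ jL]; rewrite !parts_at_layers -!pconj_mults // !nth_mults //.
by rewrite natz -subzn // leq_mul // pmult_leq_pconj.
Qed.

Lemma sum_arrow (G : 'I_n -> 'I_n -> int) :
  \sum_(e : arrow a) G (src e) (tgt e) = \sum_i \sum_j (a i j)%:Z * G i j.
Proof.
rewrite pair_bigA /=.
transitivity (\sum_(ij : 'I_n * 'I_n) \sum_(c : 'I_(a ij.1 ij.2)) G ij.1 ij.2).
  by rewrite sig_big_dep.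
by apply: eq_bigr => ij _; rewrite sumr_const card_ord -mulr_natl natz.
Qed.

Lemma nP_Rss d : nP SSrep d = #|Rss a theta mu F d|.
Proof.
rewrite /nP /Rss; case: ifP => D; last first.
  rewrite cards0; apply/eqP; rewrite cards_eq0; apply/eqP/setP => V; rewrite !inE.
  by apply/asboolP => /semistable_SS[]; rewrite D.
apply: eq_card => V; rewrite !inE; apply/asboolP/asboolP => [/semistable_SS[] //|sV].
exact/semistable_SS.
Qed.

(** The numerator counts the semistable representations commuting with a nilpotent of type [lam],
    the denominator is the order of the centralizer of that nilpotent. The squares of the
    multiplicities subtracted in [pform'] come back from the orders of the linear groups. *)
Lemma Pterm_layers beta lam : tuple_size lam = beta ->
  let D := layers (ht beta) lam in
  (#|F| ^ cexp sr tg D * \prod_(d <- D) nP SSrep d)%:R /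
    (#|F| ^ cexp (@id 'I_n) id D * \prod_(d <- D) \prod_i nunits F (fun_of_fin d i))%:R
  = Pterm a theta mu F lam.
Proof.
move=> tb D; pose L := ht beta.
have le i : (psize (lam i) <= L)%N by have := leq_ht beta i; rewrite -{1}tb ffunE.
have hL : (\sum_(i < n) psize (lam i))%N = L.
  by rewrite /L -tb /ht; apply: eq_bigr => i _; rewrite ffunE.
rewrite /Pterm hL; congr (_ / _).
  rewrite natrM natrX natr_prod /D /layers big_map; congr (_ * _).
    by rewrite exprnP (cexp_layers _ _ le) (sum_arrow (fun i j => pform' (lam i) (lam j))).
  by rewrite /index_iota subn1; apply: eq_bigr => s _; rewrite nP_Rss.
rewrite natrM natrX exprnP (cexp_layers _ _ le).
rewrite natr_prod /D /layers big_map; under eq_bigr do rewrite natr_prod.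
rewrite exchange_big /=.
have -> : q ^ (\sum_(e < n) pform' (lam (id e)) (lam (id e))) = \prod_(e < n) q ^ pform' (lam e) (lam e).
  elim/big_rec2: _ => [|i y x _ <-]; first by rewrite expr0z.
  by rewrite expfzDr ?q_neq0.
rewrite -big_split /=; apply: eq_bigr => i _.
rewrite (pb_cut _ (le i)) /pform'.
transitivity (q ^ pform' (lam i) (lam i) * \prod_(1 <= s < L.+1)
    (q ^+ (pmult (lam i) s * pmult (lam i) s)
      * \prod_(1 <= k < (pmult (lam i) s).+1) (1 - q^-1 ^+ k))).
  congr (_ * _); rewrite /index_iota subn1; apply: eq_bigr => s _.
  by rewrite ffunE nunitsE.
rewrite big_split /= mulrA; congr (_ * _).
rewrite prodrXr exprnP exprnP -expfzDr ?q_neq0 // /pform'.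
congr (_ ^ _); rewrite -[RHS]addr0 -addrA; congr (_ + _).
rewrite (@big_nat_widen0 _ _ _ 1 _ L.+1) ?addNr //; last by move=> j /pmult_eq0 ->.
exact: le.
Qed.

(** The nilpotents [N] are sorted by Jordan type at each vertex. Those of type [lam] form one orbit,
    of size the group order over that of the centralizer, and each commutes with equally many
    semistable representations. *)
Theorem Pmu_mass_series : Pmu a theta mu F = @mass_series n (arrow a) sr tg w F 'X.
Proof.
apply/funext => beta; pose L := ht beta; pose nGL := (\prod_i nunits F (beta i))%N.
have nGL0 : nGL%:R != 0 :> rat.
  by rewrite pnatr_eq0 -lt0n; apply: prodn_gt0 => i; exact: nunits_gt0.
pose gl := {dffun forall i : 'I_n, 'M[F]_(beta i)}.
pose typ (N : gl) lam := tuple_size lam = beta /\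
  forall i, simil (N i) (jmx F (parts_at (layers L lam) i)).
have ps lam i : tuple_size lam = beta -> psize (lam i) = beta i by move=> <-; rewrite ffunE.
have psL lam i : tuple_size lam = beta -> (psize (lam i) <= L)%N by move=> /ps ->; exact: leq_ht.
have typ_ex (N : gl) : [forall i, N i ^+ L == 0] -> exists lam, typ N lam.
  move=> /forallP N0.
  have /dep_choice[l lP] i : exists l, simil (N i) (jmx F (mults L l)) /\ psize l = beta i.
    have [ms sms sim] := nilpotent_jordan (eqP (N0 i)).
    have [l ml pl] := partition_of_mults ms; exists l; rewrite -sms ml; split=> //.
    by rewrite pl (simil_size sim).
  exists (finfun l); split; first by apply/ffunP => i; rewrite !ffunE; have [] := lP i.
  by move=> i; rewrite parts_at_layers ffunE; have [] := lP i.
have typ_nil (N : gl) lam : typ N lam -> [forall i, N i ^+ L == 0].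
  move=> [_ sim]; apply/forallP => i; apply/eqP; apply: (simil_exp0 (sim i)).
  have sz : size (parts_at (layers L lam) i) = L by rewrite parts_at_layers size_mults.
  by have := jmx_nil F (parts_at (layers L lam) i); rewrite sz.
have typ_uniq (N : gl) lam lam' : typ N lam -> typ N lam' -> lam = lam'.
  move=> [tl sim] [tl' sim']; apply/ffunP => i.
  apply: (@mults_inj L); rewrite ?psL //; rewrite -!parts_at_layers.
  apply: (jmx_simil_eq (k := F)); first by rewrite !parts_at_layers !size_mults.
  exact: simil_trans (simil_sym (sim i)) (sim' i).
have jd lam i : tuple_size lam = beta -> jdim (layers L lam) i = beta i.
  by move=> tl; rewrite /jdim parts_at_layers jsize_mults ?psL // ps.
have typ_sur lam : tuple_size lam = beta -> exists N, typ N lam.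
  move=> tl; have /dep_choice[N NP] i : exists M : 'M[F]_(beta i), simil M (jmx F (parts_at (layers L lam) i)).
    rewrite -(jd lam i tl); exists (jmx F (parts_at (layers L lam) i)).
    by exists 1%:M, 1%:M; rewrite !mulmx1 mul1mx.
  by exists (finfun N); split=> // i; rewrite ffunE.
have /dep_choice[ty tyP] (N : gl) : exists lam, [forall i, N i ^+ L == 0] -> typ N lam.
  have [/typ_ex[lam h]|] := boolP [forall i, N i ^+ L == 0]; first by exists lam.
  have [l0 _ _] := partition_of_mults [::]; by exists [ffun=> l0].
(* Every tuple of size [beta] is the type of some nilpotent, so this finite list is the whole index
   set of the coefficient of [Pmu] at [beta]. *)
pose s := undup [seq ty N | N <- [seq N : gl <- enum gl | [forall i, (N : gl) i ^+ L == 0]]].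
have sP lam : lam \in s <-> tuple_size lam = beta.
  rewrite mem_undup; split=> [/mapP[N + ->]|tl].
    by rewrite mem_filter => /andP[/tyP[]].
  have [N tN] := typ_sur lam tl; have N0 := typ_nil N lam tN.
  apply/mapP; exists N; first by rewrite mem_filter N0 mem_enum.
  exact: typ_uniq tN (tyP N N0).
have -> : Pmu a theta mu F beta = \sum_(lam <- s) Pterm a theta mu F lam.
  rewrite fsbig_seq ?undup_uniq // /Pmu.
  suff -> : [set lam | tuple_size lam = beta]%classic = [set` s]%classic by [].
  by apply/seteqP; split=> lam /= /sP.
apply: (mulIf nGL0); rewrite mass_series_nil.
pose C lam := (#|F| ^ cexp sr tg (layers L lam) * \prod_(d <- layers L lam) nP SSrep d)%N.
transitivity (\sum_(N : gl | [forall i, N i ^+ L == 0]) (C (ty N))%:R : rat); last first.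
  apply: eq_bigr => N N0; rewrite (@card_commuting_simil _ _ _ _ _ _ (layers L (ty N)) beta (fun i => N i)) //.
  by have [] := tyP N N0.
transitivity (\sum_(N : gl | [forall i, N i ^+ L == 0]) \sum_(lam <- s)
    if ty N == lam then (C lam)%:R else 0 : rat); last first.
  apply: eq_bigr => N N0; rewrite (bigD1_seq (ty N)) ?undup_uniq //=; last first.
    by rewrite mem_undup; apply: map_f; rewrite mem_filter N0 mem_enum.
  by rewrite eqxx big1 ?addr0 // => lam /negPf; rewrite eq_sym => ->.
rewrite exchange_big mulr_suml; apply: eq_big_seq => lam /sP tl.
rewrite -(Pterm_layers tl) -big_mkcondr /= sumr_const.
have orb := @card_simil_orbit n F (layers L lam) beta (fun i => jd lam i tl).
move: orb; set oc := #|_|; set den := (#|F| ^ cexp id id _ * _)%N => orb.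
have nE : nGL%:R = oc%:R * den%:R :> rat by rewrite -natrM orb.
have den0 : den%:R != 0 :> rat by apply: contraNneq nGL0 => d0; rewrite nE d0 mulr0.
rewrite nE -/(C lam) [oc%:R * _]mulrC mulrA divfK // mulr_natr; congr (_ *+ _).
apply: eq_card => N; rewrite !inE; apply/forallP/andP => [h|[N0 /eqP <-] i].
  have tN : typ N lam by split=> // i; have := h i; rewrite inE => /asboolP.
  by have N0 := typ_nil N lam tN; split=> //; apply/eqP; apply: typ_uniq (tyP N N0) tN.
by have [_ sim] := tyP N N0; rewrite inE; apply/asboolP; exact: sim.
Qed.

End PmuIsMass.

(** * The product over monic irreducible polynomials *)

Section FirstIdentity.
Variables (n : nat) (a : 'M[nat]_n).
Variables (theta : {additive {ffun 'I_n -> int} -> int}) (mu : rat).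
Variables (q : nat) (GF : nat -> finFieldType).
Hypothesis cardGF : forall r, (0 < r)%N -> #|GF r| = (q ^ r)%N.
Local Notation A := (arrow a).
Local Notation w := (weight theta mu).
Local Notation ms F := (@mass_series n A (@src n a) (@tgt n a) w F).

Lemma irr_root0 (F : fieldType) (f : {poly F}) :
  irreducible_poly f -> f \is monic -> f != 'X -> ~~ root f 0.
Proof.
move=> fi fm; apply: contraNN => r0.
have Xf : 'X %| f by rewrite -['X]subr0 -polyC0 dvdp_XsubCl.
have := fi.2 'X; rewrite size_polyX => /(_ isT Xf).
by rewrite eqp_monic ?monicX // eq_sym.
Qed.

Lemma mass_series_irr d f : (0 < d)%N -> f \in irrs (GF 1%N) d ->
  ms (GF 1%N) f = mps_subst_exp d (Pmu a theta mu (GF d)).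
Proof.
move=> d0 /mem_irrs[fi fm sf fX].
have cK : #|GF d| = (#|GF 1%N| ^ d)%N by rewrite !cardGF // expn1.
have [iota] := finfield_embed cK d0.
have [om rom] := irr_root_exists iota cK fi fm sf (dvdnn d).
have om0 : om != 0.
  apply: contraTneq rom => ->; rewrite -(rmorph0 iota) fmorph_root; exact: irr_root0.
rewrite (mass_series_res cK fi fm sf rom om0 (@src n a) (@tgt n a) w); congr (mps_subst_exp d _).
by rewrite Pmu_mass_series.
Qed.

Theorem Mseries_prod_Pmu :
  has_prod (fun d : nat => (0 < d)%N)
    (fun d : nat => mps_subst_exp d (Pmu a theta mu (GF d)) ^+ phi (GF 1%N) d)
    (Mseries a theta mu (GF 1%N)).
Proof.
(* The irreducible factors of the characteristic polynomial of a matrix of size [ht beta] have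
   degree at most [ht beta]; further degrees in [J'] leave the count of pairs at [beta]
   unchanged. *)
move=> beta; exists [fset d | d in iota 1 (ht beta)]%fset => J' /fsubsetP sJ.
pose R := flatten [seq irrs (GF 1%N) d | d <- [seq d <- J' | (0 < d)%N]].
have RP f : f \in R -> exists2 d, f \in irrs (GF 1%N) d & d \in J' /\ (0 < d)%N.
  by case/flattenP => _ /mapP[d + ->] fd; rewrite mem_filter => /andP[d0 dJ]; exists d.
have uR : uniq R.
  apply: (@uniq_flatten_map _ _ _ _ (fun f : {poly GF 1%N} => (size f).-1)).
  - by rewrite filter_uniq ?fset_uniq.
  - by move=> d _; exact: uniq_irrs.
  by move=> d f _ /mem_irrs[_ _ -> _].
have irrR f : f \in R -> irreducible_poly f /\ f \is monic.
  by move=> /RP[d /mem_irrs[fi fm _ _] _].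
transitivity (ms (GF 1%N) (\prod_(f <- R) f) beta).
  congr (_ beta); rewrite mass_series_prod // /R big_flatten big_map big_filter /=.
  apply: eq_bigr => d d0; rewrite -(size_irrs (GF 1%N) d) (eq_big_seq _ (fun f => @mass_series_irr d f d0)).
  by rewrite big_const_seq count_predT iter_mulr_1.
have [M tM] := good_transv a theta mu (GF 1%N) beta.
rewrite (Mseries_transv tM); apply: mass_series_units tM.
  have rX f : f \in R -> coprimep f 'X.
    move=> /RP[d /mem_irrs[fi fm _ fX] _].
    by rewrite -['X]subr0 -polyC0 coprimep_XsubC irr_root0.
  elim: (R) rX => [_|f R' IH rX]; first by rewrite big_nil coprime1p.
  rewrite big_cons coprimepMl rX ?mem_head //=; apply: IH => g gR.
  by apply: rX; rewrite inE gR orbT.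
move=> g ug; apply: unit_primary ug _ => f fi fm fX sf.
have s0 : (0 < (size f).-1)%N by have := fi.1; case: (size f) => [|[|]].
have fR : f \in R.
  apply/flattenP; exists (irrs (GF 1%N) (size f).-1).
    apply: map_f; rewrite mem_filter s0; apply: sJ; apply/imfsetP; exists (size f).-1 => //=.
    by rewrite mem_iota s0 add1n ltnS; move: sf; case: (size f).
  by apply/mem_irrs; split=> //; case: (size f) s0.
by rewrite (bigD1_seq f) //= dvdp_mulr.
Qed.

End FirstIdentity.

Theorem theorem3p1 (n : nat) (a : 'M[nat]_n)
    (theta : {additive {ffun 'I_n -> int} -> int}) (mu : rat)
    (q : nat) (hq : exists p m : nat, [/\ prime p, (0 < m)%N & q = (p ^ m)%N])
    (GF : nat -> finFieldType)
    (hGF : forall r : nat, (0 < r)%N -> #|GF r| = (q ^ r)%N) :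
  [/\ has_prod (fun d : nat => (0 < d)%N)
        (fun d : nat => mps_subst_exp d (Pmu a theta mu (GF d)) ^+ phi (GF 1%N) d)
        (Mseries a theta mu (GF 1%N)),
      has_prod (fun alpha : {ffun 'I_n -> nat} => Delta theta mu alpha && (alpha != 0))
        (fun alpha : {ffun 'I_n -> nat} =>
           (1 - mps_mon rat alpha) ^- Iss a theta (GF 1%N) alpha)
        (Mseries a theta mu (GF 1%N)),
      forall alpha : {ffun 'I_n -> nat}, Delta theta mu alpha -> alpha != 0 ->
        (Iss a theta (GF 1%N) alpha)%:R =
        \sum_(d <- divisors (dgcd alpha)) (d%:R : rat)^-1 *
          \sum_(r <- divisors d)
            moeb (d %/ r) * (Ass a theta (GF r) (ddiv alpha d))%:R
    & forall alpha : {ffun 'I_n -> nat}, Delta theta mu alpha -> alpha != 0 ->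
        (Ass a theta (GF 1%N) alpha)%:R =
        \sum_(d <- divisors (dgcd alpha)) (d%:R : rat)^-1 *
          \sum_(r <- divisors d)
            moeb r * (Iss a theta (GF r) (ddiv alpha d))%:R].
Proof.
split.
- exact: Mseries_prod_Pmu hGF.
- exact: Mseries_prod_Iss.
- move=> alpha D nz; rewrite (Iss_of_Ass a hGF (ltn0Sn 0) D nz).
  by under eq_bigr do under eq_bigr do rewrite mul1n.
by move=> alpha D nz; exact: (Ass_of_Iss a hGF D nz).
Qed.
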